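(* Let $(A,\Gamma^{+},\alpha)$ be a dynamical system such that every $\alpha_{x}\in\operatorname{End}(A)$ is extendible. Let $p=\overline{\pi}_{\alpha}(1_{M(A)})$, and let $k_{A}:A\to p\mathcal{T}_{\alpha}p$ and $w:\Gamma^{+}\to M(p\mathcal{T}_{\alpha}p)$ be the maps defined by $$k_{A}(a)=\pi_{\alpha}(a)\quad\text{and}\quad w_{x}=pS_{x}^{*}p.$$ Then the triple $(p\mathcal{T}_{\alpha}p,k_{A},w)$ is a partial-isometric crossed product of $(A,\Gamma^{+},\alpha)$, and therefore $\psi:=k_{A}\times w:(A\times_{\alpha}^{\mathrm{piso}}\Gamma^{+},i_{A},v)\to p\mathcal{T}_{\alpha}p$ is an isomorphism which satisfies $\psi(i_{A}(a))=k_{A}(a)$ and $\psi(v_{x})=w_{x}$ for all $a\in A$, $x\in\Gamma^+$ (the latter for the extension of $\psi$ to multiplier algebras). Moreover, the crossed product $A\times_{\alpha}^{\mathrm{piso}}\Gamma^{+}$ is Morita equivalent to the algebra $\mathcal{T}_{\alpha}$.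
   Context: $\Gamma$ is a totally ordered abelian group (discrete) and $\Gamma^{+}=\{x\in\Gamma:x\ge 0\}$ its positive cone. A dynamical system $(A,\Gamma^{+},\alpha)$ consists of a (not necessarily unital) $C^*$-algebra $A$ and an action (semigroup homomorphism) $\alpha:\Gamma^{+}\to\operatorname{End}(A)$ with $\alpha_0=\mathrm{id}_A$. An endomorphism $\alpha_x$ is extendible if it extends to a strictly continuous endomorphism $\overline{\alpha}_x$ of the multiplier algebra $M(A)$ (possibly $\overline{\alpha}_x(1_{M(A)})\ne 1_{M(A)}$). A partial-isometric representation of $\Gamma^{+}$ (on a Hilbert space, or in a multiplier algebra) is a map $V$ such that each $V_s$ is a partial isometry and $V_sV_t=V_{s+t}$ for all $s,t\in\Gamma^+$. A covariant partial-isometric representation of $(A,\Gamma^{+},\alpha)$ on a Hilbert space $H$ (or, similarly, in a $C^*$-algebra $B$, with $V$ taking values in $M(B)$) is a pair $(\pi,V)$ with $\pi$ a non-degenerate representation (homomorphism) of $A$ and $V$ a partial-isometric representation of $\Gamma^+$ such that $\pi(\alpha_s(a))=V_s\pi(a)V_s^*$ and $V_s^*V_s\pi(a)=\pi(a)V_s^*V_s$ for all $a\in A$, $s\in\Gamma^+$. A partial-isometric crossed product of $(A,\Gamma^+,\alpha)$ is a triple $(B,i_A,v)$ consisting of a $C^*$-algebra $B$, a non-degenerate homomorphism $i_A:A\to B$ and a partial-isometric representation $v:\Gamma^+\to M(B)$ such that: (i) $(i_A,v)$ is a covariant partial-isometric representation in $B$; (ii) for every covariant partial-isometric representation $(\pi,V)$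 on a Hilbert space $H$ there is a non-degenerate representation $\pi\times V$ of $B$ on $H$ with $(\pi\times V)\circ i_A=\pi$ and $\overline{(\pi\times V)}\circ v=V$; (iii) $B=\overline{\operatorname{span}}\{v_s^*i_A(a)v_t:a\in A,\ s,t\in\Gamma^+\}$. (The bar denotes the extension to the multiplier algebra.) It is known that such a triple exists and is unique up to isomorphism; it is denoted $(A\times_{\alpha}^{\mathrm{piso}}\Gamma^{+},i_A,v)$. For a covariant partial-isometric representation $(k_A,w)$ in a $C^*$-algebra, $k_A\times w$ denotes the corresponding non-degenerate homomorphism of $A\times_{\alpha}^{\mathrm{piso}}\Gamma^{+}$. $\ell^2(\Gamma^+,A)$ is the Hilbert $A$-module of functions $f:\Gamma^+\to A$ such that $\sum_{x\in\Gamma^+}f(x)^*f(x)$ converges in norm in $A$, with $(f\cdot a)(x)=f(x)a$ and $\langle f,g\rangle=\sum_{x}f(x)^*g(x)$; $\mathcal{L}(\ell^2(\Gamma^+,A))$ is the $C^*$-algebra of its adjointable operators. Define $\pi_\alpha:A\to\mathcal{L}(\ell^2(\Gamma^+,A))$ by $(\pi_\alpha(a)f)(t)=\alpha_t(a)f(t)$, and for $t\in\Gamma^+$ the isometry $S_t$ by $S_t(f)(i)=f(i-t)$ if $i\ge t$ and $S_t(f)(i)=0$ if $i<t$. Then $\mathcal{T}_\alpha:=\overline{\operatorname{span}}\{S_x\pi_\alpha(a)S_y^*:a\in A,\ x,y\in\Gamma^+\}$ is a $C^*$-subalgebra of $\mathcal{L}(\ell^2(\Gamma^+,A))$ containing $\pi_\alpha(A)$,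 with $S_x\in M(\mathcal{T}_\alpha)$. The homomorphism $\pi_\alpha$ extends to a strictly continuous homomorphism $\overline{\pi}_\alpha:M(A)\to M(\mathcal{T}_\alpha)$, and $p=\overline{\pi}_\alpha(1_{M(A)})$ is the projection given by $(pf)(t)=\overline{\alpha}_t(1_{M(A)})f(t)$. *)

(* Defs.v *)
From HB Require Import structures.
From mathcomp Require Import all_boot all_order all_algebra.
From mathcomp Require Import finmap complex.
From mathcomp Require Import boolp classical_sets functions filter reals.
From mathcomp Require Import topology normedtype.
From mathcomp Require Import summability.

Set Implicit Arguments.
Unset Strict Implicit.
Unset Printing Implicit Defensive.

Import Order.TTheory GRing.Theory Num.Theory.
Import numFieldNormedType.Exports.

Local Open Scope classical_set_scope.
Local Open Scope ring_scope.
Local Open Scope complex_scope.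

Reserved Notation "x ** y" (at level 40, left associativity).

HB.mixin Record isTotallyOrderedGroup G of Num.POrderedZmodule G := {
  le_total_group : total (fun x y : G => x <= y);
  leD2l_group : forall x y z : G, x <= y -> z + x <= z + y
}.

#[short(type="ordGroupType")]
HB.structure Definition TotallyOrderedGroup :=
  {G of Num.POrderedZmodule G & isTotallyOrderedGroup G}.

Definition pos_cone (G : ordGroupType) : Type := {x : G | 0 <= x}.
HB.instance Definition _ (G : ordGroupType) := Choice.on (pos_cone G).

Section PosCone.
Variable G : ordGroupType.

Lemma pos_cone_add_subproof (s t : pos_cone G) : 0 <= val s + val t.
Proof.
apply: (le_trans (valP s)).
by have := leD2l_group _ _ (val s) (valP t); rewrite addr0.
Qed.

Lemma pos_cone_sub_subproof (t i : pos_cone G) :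
  val t <= val i -> 0 <= val i - val t.
Proof.
by move=> /(leD2l_group _ _ (- val t)); rewrite addNr addrC.
Qed.

Definition pc0 : pos_cone G := exist _ 0 (lexx 0).
Definition pc_add (s t : pos_cone G) : pos_cone G :=
  exist _ (val s + val t) (pos_cone_add_subproof s t).
Definition pc_sub (t i : pos_cone G) (h : val t <= val i) : pos_cone G :=
  exist _ (val i - val t) (pos_cone_sub_subproof h).

End PosCone.

HB.mixin Record isStarAlgebra (R : realType) A of GRing.Lmodule R[i] A := {
  amul : A -> A -> A;
  star : A -> A;
  amulA : forall x y z, amul x (amul y z) = amul (amul x y) z;
  amulDl : forall x y z, amul (x + y) z = amul x z + amul y z;
  amulDr : forall x y z, amul x (y + z) = amul x y + amul x z;
  amulZl : forall (c : R[i]) x y, amul (c *: x) y = c *: amul x y;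
  amulZr : forall (c : R[i]) x y, amul x (c *: y) = c *: amul x y;
  starK : forall x, star (star x) = x;
  starD : forall x y, star (x + y) = star x + star y;
  starZ : forall (c : R[i]) x, star (c *: x) = (Num.conj c) *: star x;
  starM : forall x y, star (amul x y) = amul (star y) (star x)
}.

#[short(type="starAlgType")]
HB.structure Definition StarAlgebra (R : realType) :=
  {A of GRing.Lmodule R[i] A & isStarAlgebra R A}.

Notation "x ** y" := (amul x y) : ring_scope.

HB.mixin Record isCStar (R : realType) A
    of StarAlgebra R A & CompleteNormedModule R[i] A := {
  ler_norm_amul : forall x y : A, `|x ** y| <= `|x| * `|y|;
  cstar_identity : forall x : A, `|star x ** x| = `|x| ^+ 2
}.

#[short(type="cstarType")]
HB.structure Definition CStarAlgebra (R : realType) :=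
  {A of StarAlgebra R A & CompleteNormedModule R[i] A & isCStar R A}.

Record star_hom (R : realType) (A B : starAlgType R) (f : A -> B) : Prop :=
  StarHom {
    star_homD : forall x y, f (x + y) = f x + f y;
    star_homZ : forall (c : R[i]) x, f (c *: x) = c *: f x;
    star_homM : forall x y, f (x ** y) = f x ** f y;
    star_hom_star : forall x, f (star x) = star (f x)
  }.

Definition lin_span (K : numDomainType) (V : lmodType K) (S : set V) : set V :=
  [set x | exists (n : nat) (c : 'I_n -> K) (s : 'I_n -> V),
     (forall i, S (s i)) /\ x = \sum_(i < n) c i *: s i].

Definition total_set (K : numFieldType) (V : normedModType K) (S : set V) :=
  closure (lin_span S) = setT.

Section CStarTheory.
Variables (R : realType) (A : cstarType R).
Implicit Types x y a : A.

Lemma amulBr a x y : a ** (x - y) = a ** x - a ** y.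
Proof. by rewrite -scaleN1r amulDr amulZr scaleN1r. Qed.

Lemma star_amul_eq0 x : star x ** x = 0 -> x = 0.
Proof.
move=> h; apply/eqP; rewrite -normr_eq0 -sqrf_eq0.
by rewrite -cstar_identity h normr0.
Qed.

Lemma amul_injr x y : (forall a, a ** x = a ** y) -> x = y.
Proof.
move=> h; apply/eqP; rewrite -subr_eq0; apply/eqP/star_amul_eq0.
by rewrite amulBr h subrr.
Qed.

Lemma amul_injl x y : (forall a, x ** a = y ** a) -> x = y.
Proof.
move=> h; rewrite -[x]starK -[y]starK; congr star.
by apply: amul_injr => a; rewrite -[a]starK -!starM h.
Qed.

Lemma norm_star x : `|star x| = `|x|.
Proof.
have H y : `|y| <= `|star y|.
  have [->|y0] := eqVneq y 0; first by rewrite normr0.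
  rewrite -(ler_pM2r (x := `|y|)) ?normr_gt0// -expr2 -cstar_identity.
  exact: ler_norm_amul.
by apply/eqP; rewrite eq_le H -{2}[x]starK H.
Qed.

End CStarTheory.

HB.mixin Record isHilbert (R : realType) H of CompleteNormedModule R[i] H := {
  hdot : H -> H -> R[i];
  hdotDl : forall x y z, hdot (x + y) z = hdot x z + hdot y z;
  hdotZl : forall (c : R[i]) x y, hdot (c *: x) y = c * hdot x y;
  hdotC : forall x y, hdot y x = Num.conj (hdot x y);
  hdotxx : forall x, hdot x x = `|x| ^+ 2
}.

#[short(type="hilbertType")]
HB.structure Definition Hilbert (R : realType) :=
  {H of CompleteNormedModule R[i] H & isHilbert R H}.

(* Linearity of [bop_fun] and [bop_adj] follows from [bop_adjP]; the adjoint,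
   which exists and is unique by Riesz, is carried along to make the
   involution a total operation. *)
Record bop (R : realType) (H : hilbertType R) := Bop {
  bop_fun :> H -> H;
  bop_adj : H -> H;
  bop_adjP : forall x y, hdot (bop_fun x) y = hdot x (bop_adj y);
  bop_bounded : exists M : R[i], forall x,
    `|bop_fun x| <= M * `|x| /\ `|bop_adj x| <= M * `|x|
}.

Section BoundedOperators.
Variables (R : realType) (H : hilbertType R).
Implicit Types (x y z : H) (S T U : bop H).

Lemma hdotDr x y z : hdot x (y + z) = hdot x y + hdot x z.
Proof. by rewrite hdotC hdotDl rmorphD/= -!hdotC. Qed.

Lemma hdotZr (c : R[i]) x y : hdot x (c *: y) = Num.conj c * hdot x y.
Proof. by rewrite hdotC hdotZl rmorphM/= -hdotC. Qed.

Lemma hdotr0 x : hdot x 0 = 0.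
Proof. by rewrite -(scale0r (0 : H)) hdotZr rmorph0 mul0r. Qed.

Lemma hdot_injr x y : (forall z, hdot z x = hdot z y) -> x = y.
Proof.
move=> h; apply/eqP; rewrite -subr_eq0 -normr_eq0 -sqrf_eq0 -hdotxx.
by rewrite -[X in hdot _ (_ + X)]scaleN1r hdotDr hdotZr h -hdotZr -hdotDr
  scaleN1r subrr hdotr0.
Qed.

Lemma hdot_injl x y : (forall z, hdot x z = hdot y z) -> x = y.
Proof. by move=> h; apply: hdot_injr => z; rewrite hdotC h -hdotC. Qed.

Lemma bop_adjP' T x y : hdot (bop_adj T x) y = hdot x (T y).
Proof. by rewrite hdotC -bop_adjP -hdotC. Qed.

Lemma bop_eq S T : (forall x, S x = T x) -> S = T.
Proof.
move=> h; have h' x : bop_adj S x = bop_adj T x.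
  by apply: hdot_injr => z; rewrite -!bop_adjP h.
case: S T h h' => f f' p q [g g' p' q'] /= /funext h /funext h'; subst g g'.
by congr Bop.
Qed.

Lemma bopD T x y : T (x + y) = T x + T y.
Proof. by apply: hdot_injl => z; rewrite hdotDl !bop_adjP hdotDl. Qed.

Lemma bopZ T (c : R[i]) x : T (c *: x) = c *: T x.
Proof. by apply: hdot_injl => z; rewrite hdotZl !bop_adjP hdotZl. Qed.

Lemma bop_bound_ge0 (f g : H -> H) :
  (exists M : R[i], forall x, `|f x| <= M * `|x| /\ `|g x| <= M * `|x|) ->
  exists2 M : R[i], 0 <= M &
    forall x, `|f x| <= M * `|x| /\ `|g x| <= M * `|x|.
Proof.
move=> [M hM]; have [h|] := pselect (exists x : H, x != 0).
  case: h => x x0; exists M => //.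
  have x_gt0 : 0 < `|x| by rewrite normr_gt0.
  rewrite -(pmulr_lge0 _ x_gt0); apply: le_trans (hM x).1; exact: normr_ge0.
move=> h; exists 0 => // x; have -> : x = 0.
  by apply/eqP; apply: contrapT => /negP x0; apply: h; exists x.
by have := hM 0; rewrite normr0 !mulr0.
Qed.

Program Definition bop_zero : bop H := @Bop R H (fun=> 0) (fun=> 0) _ _.
Next Obligation.
by move=> x y /=; rewrite hdotr0 -[0 in LHS](scale0r (0 : H)) hdotZl mul0r.
Qed.
Next Obligation. by exists 0 => x /=; rewrite normr0 mul0r. Qed.

Program Definition bop_add S T : bop H :=
  @Bop R H (fun x => S x + T x) (fun x => bop_adj S x + bop_adj T x) _ _.
Next Obligation. by move=> S T x y; rewrite hdotDl hdotDr !bop_adjP. Qed.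
Next Obligation.
move=> S T; have [M hM] := bop_bounded S; have [N hN] := bop_bounded T.
exists (M + N) => x; rewrite mulrDl; split;
  by rewrite (le_trans (ler_normD _ _))// lerD ?(hM _).1 ?(hM _).2 ?(hN _).1 ?(hN _).2.
Qed.

Program Definition bop_scale (c : R[i]) T : bop H :=
  @Bop R H (fun x => c *: T x) (fun x => Num.conj c *: bop_adj T x) _ _.
Next Obligation.
by move=> c T x y; rewrite hdotZl hdotZr bop_adjP conjCK.
Qed.
Next Obligation.
move=> c T; have [M hM] := bop_bounded T; exists (`|c| * M) => x.
by rewrite !normrZ norm_conjC -!mulrA; split; rewrite ler_wpM2l ?(hM _).1 ?(hM _).2.
Qed.

Program Definition bop_mul S T : bop H :=
  @Bop R H (fun x => S (T x)) (fun x => bop_adj T (bop_adj S x)) _ _.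
Next Obligation. by move=> S T x y; rewrite !bop_adjP. Qed.
Next Obligation.
move=> S T.
have [M M0 hM] := bop_bound_ge0 (bop_bounded S).
have [N N0 hN] := bop_bound_ge0 (bop_bounded T).
exists (M * N) => x; split.
  by rewrite (le_trans (hM _).1)// -mulrA ler_wpM2l// (hN _).1.
by rewrite (le_trans (hN _).2)// [M * N]mulrC -mulrA ler_wpM2l// (hM _).2.
Qed.

Program Definition bop_star T : bop H := @Bop R H (bop_adj T) T _ _.
Next Obligation. by move=> T x y; rewrite bop_adjP'. Qed.
Next Obligation.
by move=> T; have [M hM] := bop_bounded T; exists M => x; split; case: (hM x).
Qed.

HB.instance Definition _ := gen_eqMixin (bop H).
HB.instance Definition _ := gen_choiceMixin (bop H).

Fact bop_addA : associative bop_add.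
Proof. by move=> S T U; apply: bop_eq => x /=; rewrite addrA. Qed.
Fact bop_addC : commutative bop_add.
Proof. by move=> S T; apply: bop_eq => x /=; rewrite addrC. Qed.
Fact bop_add0 : left_id bop_zero bop_add.
Proof. by move=> S; apply: bop_eq => x /=; rewrite add0r. Qed.
Fact bop_addN : left_inverse bop_zero (bop_scale (-1)) bop_add.
Proof. by move=> S; apply: bop_eq => x /=; rewrite scaleN1r addNr. Qed.

HB.instance Definition _ :=
  GRing.isZmodule.Build (bop H) bop_addA bop_addC bop_add0 bop_addN.

Fact bop_scaleA (a b : R[i]) T :
  bop_scale a (bop_scale b T) = bop_scale (a * b) T.
Proof. by apply: bop_eq => x /=; rewrite scalerA. Qed.
Fact bop_scale1 : left_id 1 bop_scale.
Proof. by move=> T; apply: bop_eq => x /=; rewrite scale1r. Qed.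
Fact bop_scaleDr : right_distributive bop_scale +%R.
Proof. by move=> c S T; apply: bop_eq => x /=; rewrite scalerDr. Qed.
Fact bop_scaleDl T : {morph bop_scale^~ T : a b / a + b}.
Proof. by move=> a b; apply: bop_eq => x /=; rewrite scalerDl. Qed.

HB.instance Definition _ := GRing.Zmodule_isLmodule.Build R[i] (bop H)
  bop_scaleA bop_scale1 bop_scaleDr bop_scaleDl.

Fact bop_mulA S T U : bop_mul S (bop_mul T U) = bop_mul (bop_mul S T) U.
Proof. exact: bop_eq. Qed.
Fact bop_mulDl S T U : bop_mul (S + T) U = bop_mul S U + bop_mul T U.
Proof. exact: bop_eq. Qed.
Fact bop_mulDr S T U : bop_mul S (T + U) = bop_mul S T + bop_mul S U.
Proof. by apply: bop_eq => x /=; rewrite bopD. Qed.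
Fact bop_mulZl (c : R[i]) S T : bop_mul (c *: S) T = c *: bop_mul S T.
Proof. exact: bop_eq. Qed.
Fact bop_mulZr (c : R[i]) S T : bop_mul S (c *: T) = c *: bop_mul S T.
Proof. by apply: bop_eq => x /=; rewrite bopZ. Qed.
Fact bop_starK T : bop_star (bop_star T) = T.
Proof. exact: bop_eq. Qed.
Fact bop_starD S T : bop_star (S + T) = bop_star S + bop_star T.
Proof. exact: bop_eq. Qed.
Fact bop_starZ (c : R[i]) T : bop_star (c *: T) = Num.conj c *: bop_star T.
Proof. exact: bop_eq. Qed.
Fact bop_starM S T : bop_star (bop_mul S T) = bop_mul (bop_star T) (bop_star S).
Proof. exact: bop_eq. Qed.

HB.instance Definition _ := isStarAlgebra.Build R (bop H)
  bop_mulA bop_mulDl bop_mulDr bop_mulZl bop_mulZr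
  bop_starK bop_starD bop_starZ bop_starM.

End BoundedOperators.

(* M(A) as the algebra of double centralizers (Busby): [ml m a] is m a and
   [mr m a] is a m. Linearity, boundedness, and the module properties of both
   maps follow from [ml_mr]. *)
Record multiplier (R : realType) (A : cstarType R) := Multiplier {
  ml : A -> A;
  mr : A -> A;
  ml_mr : forall a b, a ** ml b = mr a ** b
}.

Section Multipliers.
Variables (R : realType) (A : cstarType R).
Implicit Types (a b : A) (m n k : multiplier A).

Lemma multiplier_eq m n : (forall a, ml m a = ml n a) -> m = n.
Proof.
move=> h; have h' a : mr m a = mr n a.
  by apply: amul_injl => b; rewrite -!ml_mr h.
case: m n h h' => f f' p [g g' p'] /= /funext h /funext h'; subst g g'.
by congr Multiplier.
Qed.

Lemma mlM m a b : ml m (a ** b) = ml m a ** b.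
Proof. by apply: amul_injr => c; rewrite ml_mr !amulA ml_mr. Qed.
Lemma mrM m a b : mr m (a ** b) = a ** mr m b.
Proof. by apply: amul_injl => c; rewrite -ml_mr -!amulA ml_mr. Qed.
Lemma mlD m a b : ml m (a + b) = ml m a + ml m b.
Proof. by apply: amul_injr => c; rewrite amulDr !ml_mr amulDr. Qed.
Lemma mrD m a b : mr m (a + b) = mr m a + mr m b.
Proof. by apply: amul_injl => c; rewrite amulDl -!ml_mr amulDl. Qed.
Lemma mlZ m (c : R[i]) a : ml m (c *: a) = c *: ml m a.
Proof. by apply: amul_injr => b; rewrite amulZr !ml_mr amulZr. Qed.
Lemma mrZ m (c : R[i]) a : mr m (c *: a) = c *: mr m a.
Proof. by apply: amul_injl => b; rewrite amulZl -!ml_mr amulZl. Qed.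
Lemma mlmrC m n a : ml m (mr n a) = mr n (ml m a).
Proof. by apply: amul_injr => c; rewrite ml_mr -!mrM ml_mr. Qed.

Program Definition mult_of a : multiplier A :=
  @Multiplier R A (fun b => a ** b) (fun b => b ** a) _.
Next Obligation. by move=> a b c /=; rewrite amulA. Qed.

Definition mult_one : multiplier A :=
  @Multiplier R A id id (fun _ _ => erefl).

Program Definition mult_zero : multiplier A :=
  @Multiplier R A (fun=> 0) (fun=> 0) _.
Next Obligation.
by move=> a b /=; rewrite -(scale0r 0) amulZl amulZr !scale0r.
Qed.

Program Definition mult_add m n : multiplier A :=
  @Multiplier R A (fun a => ml m a + ml n a) (fun a => mr m a + mr n a) _.
Next Obligation. by move=> m n a b /=; rewrite amulDr amulDl !ml_mr. Qed.

Program Definition mult_scale (c : R[i]) m : multiplier A :=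
  @Multiplier R A (fun a => c *: ml m a) (fun a => c *: mr m a) _.
Next Obligation. by move=> c m a b /=; rewrite amulZr amulZl ml_mr. Qed.

Program Definition mult_mul m n : multiplier A :=
  @Multiplier R A (fun a => ml m (ml n a)) (fun a => mr n (mr m a)) _.
Next Obligation. by move=> m n a b /=; rewrite !ml_mr. Qed.

Program Definition mult_star m : multiplier A :=
  @Multiplier R A (fun a => star (mr m (star a))) (fun a => star (ml m (star a))) _.
Next Obligation.
move=> m a b /=; rewrite -[a in LHS]starK -[b in RHS]starK -!starM.
by rewrite ml_mr.
Qed.

HB.instance Definition _ := gen_eqMixin (multiplier A).
HB.instance Definition _ := gen_choiceMixin (multiplier A).

Fact mult_addA : associative mult_add.
Proof. by move=> m n k; apply: multiplier_eq => a /=; rewrite addrA. Qed.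
Fact mult_addC : commutative mult_add.
Proof. by move=> m n; apply: multiplier_eq => a /=; rewrite addrC. Qed.
Fact mult_add0 : left_id mult_zero mult_add.
Proof. by move=> m; apply: multiplier_eq => a /=; rewrite add0r. Qed.
Fact mult_addN : left_inverse mult_zero (mult_scale (-1)) mult_add.
Proof. by move=> m; apply: multiplier_eq => a /=; rewrite scaleN1r addNr. Qed.

HB.instance Definition _ := GRing.isZmodule.Build (multiplier A)
  mult_addA mult_addC mult_add0 mult_addN.

Fact mult_scaleA (c d : R[i]) m :
  mult_scale c (mult_scale d m) = mult_scale (c * d) m.
Proof. by apply: multiplier_eq => a /=; rewrite scalerA. Qed.
Fact mult_scale1 : left_id 1 mult_scale.
Proof. by move=> m; apply: multiplier_eq => a /=; rewrite scale1r. Qed.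
Fact mult_scaleDr : right_distributive mult_scale +%R.
Proof. by move=> c m n; apply: multiplier_eq => a /=; rewrite scalerDr. Qed.
Fact mult_scaleDl m : {morph mult_scale^~ m : c d / c + d}.
Proof. by move=> c d; apply: multiplier_eq => a /=; rewrite scalerDl. Qed.

HB.instance Definition _ := GRing.Zmodule_isLmodule.Build R[i] (multiplier A)
  mult_scaleA mult_scale1 mult_scaleDr mult_scaleDl.

Fact mult_mulA m n k : mult_mul m (mult_mul n k) = mult_mul (mult_mul m n) k.
Proof. exact: multiplier_eq. Qed.
Fact mult_mulDl m n k : mult_mul (m + n) k = mult_mul m k + mult_mul n k.
Proof. exact: multiplier_eq. Qed.
Fact mult_mulDr m n k : mult_mul m (n + k) = mult_mul m n + mult_mul m k.
Proof. by apply: multiplier_eq => a /=; rewrite mlD. Qed.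
Fact mult_mulZl (c : R[i]) m n : mult_mul (c *: m) n = c *: mult_mul m n.
Proof. exact: multiplier_eq. Qed.
Fact mult_mulZr (c : R[i]) m n : mult_mul m (c *: n) = c *: mult_mul m n.
Proof. by apply: multiplier_eq => a /=; rewrite mlZ. Qed.
Fact mult_starK m : mult_star (mult_star m) = m.
Proof. by apply: multiplier_eq => a /=; rewrite !starK. Qed.
Fact mult_starD m n : mult_star (m + n) = mult_star m + mult_star n.
Proof. by apply: multiplier_eq => a /=; rewrite starD. Qed.
Fact mult_starZ (c : R[i]) m : mult_star (c *: m) = Num.conj c *: mult_star m.
Proof. by apply: multiplier_eq => a /=; rewrite starZ. Qed.
Fact mult_starM m n :
  mult_star (mult_mul m n) = mult_mul (mult_star n) (mult_star m).
Proof. by apply: multiplier_eq => a /=; rewrite starK. Qed.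

HB.instance Definition _ := isStarAlgebra.Build R (multiplier A)
  mult_mulA mult_mulDl mult_mulDr mult_mulZl mult_mulZr
  mult_starK mult_starD mult_starZ mult_starM.

Definition strict_cvg (F : set_system (multiplier A)) (m : multiplier A) :=
  forall a, (fun n => ml n a) @ F --> ml m a /\
            (fun n => mr n a) @ F --> mr m a.

End Multipliers.

Record projection (R : realType) (A : cstarType R) := Projection {
  proj_val :> multiplier A;
  proj_idem : proj_val ** proj_val = proj_val;
  proj_star : star proj_val = proj_val
}.

(* pAp, as the set of a with p a p = a. *)
Definition corner_pred (R : realType) (A : cstarType R) (p : projection A) :
  {pred A} := fun a => ml p (mr p a) == a.

Record corner (R : realType) (A : cstarType R) (p : projection A) := Corner {
  corner_val : A;
  corner_valP : corner_val \in corner_pred p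
}.

Section Corner.
Variables (R : realType) (A : cstarType R) (p : projection A).
Implicit Types (a b : A) (x y z : corner p).

HB.instance Definition _ := [isSub of corner p for @corner_val R A p].
HB.instance Definition _ := [Choice of corner p by <:].

Lemma corner_predP a : reflect (ml p (mr p a) = a) (a \in corner_pred p).
Proof. exact: eqP. Qed.

Lemma mlpp a : ml p (ml p a) = ml p a.
Proof. by rewrite -[RHS](congr1 (@ml R A ^~ a) (proj_idem p)). Qed.

Lemma mrpp a : mr p (mr p a) = mr p a.
Proof. by rewrite -[RHS](congr1 (@mr R A ^~ a) (proj_idem p)). Qed.

Lemma star_mlp a : star (ml p a) = mr p (star a).
Proof. by rewrite -{2}(proj_star p) /= starK. Qed.

Lemma star_mrp a : star (mr p a) = ml p (star a).
Proof. by rewrite -{2}(proj_star p) /= starK. Qed.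

Lemma corner_mem a : ml p (mr p a) \in corner_pred p.
Proof. by apply/corner_predP; rewrite -mlmrC mlpp mrpp. Qed.

Lemma corner_ml x : ml p (val x) = val x.
Proof. by rewrite -{1}(corner_predP _ (valP x)) mlpp; exact/corner_predP/valP. Qed.

Lemma corner_mr x : mr p (val x) = val x.
Proof.
by rewrite -{1}(corner_predP _ (valP x)) -mlmrC mrpp; exact/corner_predP/valP.
Qed.

Lemma corner_memP a : ml p a = a -> mr p a = a -> a \in corner_pred p.
Proof. by move=> la ra; apply/corner_predP; rewrite ra. Qed.

Fact corner_submod_closed : submod_closed (corner_pred p).
Proof.
split; first by apply/corner_predP; rewrite -(scale0r (0 : A)) mrZ mlZ !scale0r.
move=> c a b /corner_predP pa /corner_predP pb; apply/corner_predP.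
by rewrite mrD mrZ mlD mlZ pa pb.
Qed.

HB.instance Definition _ :=
  GRing.isSubmodClosed.Build R[i] A (corner_pred p) corner_submod_closed.
HB.instance Definition _ := [SubChoice_isSubLmodule of corner p by <:].

Fact corner_norm_triangle x y : `|val (x + y)| <= `|val x| + `|val y|.
Proof. exact: ler_normD. Qed.
Fact corner_normZ (c : R[i]) x : `|val (c *: x)| = `|c| * `|val x|.
Proof. exact: normrZ. Qed.
Fact corner_norm_eq0 x : `|val x| = 0 -> x = 0.
Proof. by move=> /normr0_eq0 h; apply: val_inj. Qed.

HB.instance Definition _ := Lmodule_isNormed.Build R[i] (corner p)
  corner_norm_triangle corner_normZ corner_norm_eq0.

Lemma norm_mlp a : `|ml p a| <= `|a|.
Proof.
have [->|a0] := eqVneq (ml p a) 0; first by rewrite normr0.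
rewrite -(ler_pM2r (x := `|ml p a|)) ?normr_gt0// -expr2 -cstar_identity.
rewrite star_mlp -ml_mr mlpp -(norm_star a); exact: ler_norm_amul.
Qed.

Lemma norm_mrp a : `|mr p a| <= `|a|.
Proof. by rewrite -norm_star star_mrp -[leRHS]norm_star norm_mlp. Qed.

Lemma corner_norm_val x : `|x| = `|val x|. Proof. by []. Qed.

Fact corner_complete (F : set_system (corner p)) :
  ProperFilter F -> cauchy F -> cvg F.
Proof.
move=> FF cF.
have cvF : cvg ((fun x : corner p => val x) @ F).
  apply/cauchy_cvgP/cauchy_ballP => e e0.
  move/cauchy_ballP : cF => /(_ e e0) [[P Q] /= [FP FQ] PQ].
  exists (val @` P, val @` Q) => /=.
    by split; [apply: filterS FP|apply: filterS FQ] => x Px; exists x.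
  move=> [_ _] [/= [x Px <-] [y Qy <-]].
  have := PQ (x, y) (conj Px Qy).
  by rewrite -!ball_normE /=.
set l := lim ((fun x : corner p => val x) @ F).
have lp : l \in corner_pred p.
  apply/corner_predP/eqP; rewrite -subr_eq0 -normr_le0.
  apply/ler_addgt0Pr => e e0; rewrite add0r.
  have e20 : 0 < e / 2 by rewrite divr_gt0.
  have /cvgrPdist_lt /(_ _ e20) H := cvF.
  have [x /ltW hx] := filter_ex H.
  rewrite -(subrKA (val x)) (le_trans (ler_normD _ _))// (splitr e) lerD//.
    rewrite -{1}(corner_predP _ (valP x)).
    rewrite -(scaleN1r (ml p _)) -mlZ -mrZ -mlD -mrD scaleN1r.
    by rewrite (le_trans (norm_mlp _))// (le_trans (norm_mrp _)).
  by rewrite distrC.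
apply/cvg_ex; exists (Corner lp); apply/cvgrPdist_lt => e e0.
by have /cvgrPdist_lt /(_ _ e0) := cvF.
Qed.

HB.instance Definition _ := Uniform_isComplete.Build (corner p) corner_complete.

Fact corner_amul_mem x y : val x ** val y \in corner_pred p.
Proof. by apply: corner_memP; rewrite ?mlM ?mrM ?corner_ml ?corner_mr. Qed.
Fact corner_star_mem x : star (val x) \in corner_pred p.
Proof.
by apply: corner_memP; rewrite -?star_mrp -?star_mlp ?corner_ml ?corner_mr.
Qed.

Definition corner_amul x y : corner p := Corner (corner_amul_mem x y).
Definition corner_star x : corner p := Corner (corner_star_mem x).

Fact corner_amulA x y z :
  corner_amul x (corner_amul y z) = corner_amul (corner_amul x y) z.
Proof. by apply: val_inj; exact: amulA. Qed.
Fact corner_amulDl x y z :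
  corner_amul (x + y) z = corner_amul x z + corner_amul y z.
Proof. by apply: val_inj; exact: amulDl. Qed.
Fact corner_amulDr x y z :
  corner_amul x (y + z) = corner_amul x y + corner_amul x z.
Proof. by apply: val_inj; exact: amulDr. Qed.
Fact corner_amulZl (c : R[i]) x y :
  corner_amul (c *: x) y = c *: corner_amul x y.
Proof. by apply: val_inj; exact: amulZl. Qed.
Fact corner_amulZr (c : R[i]) x y :
  corner_amul x (c *: y) = c *: corner_amul x y.
Proof. by apply: val_inj; exact: amulZr. Qed.
Fact corner_starK x : corner_star (corner_star x) = x.
Proof. by apply: val_inj; exact: starK. Qed.
Fact corner_starD x y : corner_star (x + y) = corner_star x + corner_star y.
Proof. by apply: val_inj; exact: starD. Qed.
Fact corner_starZ (c : R[i]) x :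
  corner_star (c *: x) = Num.conj c *: corner_star x.
Proof. by apply: val_inj; exact: starZ. Qed.
Fact corner_starM x y :
  corner_star (corner_amul x y) = corner_amul (corner_star y) (corner_star x).
Proof. by apply: val_inj; exact: starM. Qed.

HB.instance Definition _ := isStarAlgebra.Build R (corner p)
  corner_amulA corner_amulDl corner_amulDr corner_amulZl corner_amulZr
  corner_starK corner_starD corner_starZ corner_starM.

Fact corner_norm_amul x y : `|x ** y| <= `|x| * `|y|.
Proof. exact: ler_norm_amul. Qed.
Fact corner_cstar_identity x : `|star x ** x| = `|x| ^+ 2.
Proof. exact: cstar_identity. Qed.

HB.instance Definition _ :=
  isCStar.Build R (corner p) corner_norm_amul corner_cstar_identity.

Fact compress_ml_mem (m : multiplier A) x :
  ml ((p : multiplier A) ** m ** p) (val x) \in corner_pred p.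
Proof.
by apply: corner_memP; rewrite /= ?mlpp// -!mlmrC corner_mr.
Qed.

Fact compress_mr_mem (m : multiplier A) x :
  mr ((p : multiplier A) ** m ** p) (val x) \in corner_pred p.
Proof.
by apply: corner_memP; rewrite /= ?mrpp// !mlmrC corner_ml.
Qed.

Fact compress_ml_mr (m : multiplier A) x y :
  x ** Corner (compress_ml_mem m y) = Corner (compress_mr_mem m x) ** y.
Proof. by apply: val_inj; exact: ml_mr. Qed.

(* The multiplier p m p of pAp, for m in M(A). *)
Definition compress (m : multiplier A) : multiplier (corner p) :=
  Multiplier (compress_ml_mr m).

End Corner.

Definition mult_extension (R : realType) (B : cstarType R) (W : starAlgType R)
    (rho : B -> W) (rhobar : multiplier B -> W) : Prop :=
  star_hom rhobar /\ forall b, rhobar (mult_of b) = rho b.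

Definition strictly_continuous (R : realType) (A B : cstarType R)
    (f : multiplier A -> multiplier B) : Prop :=
  forall (F : set_system (multiplier A)) (m : multiplier A),
    Filter F -> strict_cvg F m -> strict_cvg (f @ F) (f m).

Definition strict_extension (R : realType) (A B : cstarType R)
    (phi : A -> B) (phibar : multiplier A -> multiplier B) : Prop :=
  mult_extension (fun a => mult_of (phi a)) phibar /\
  strictly_continuous phibar.

Definition extendible (R : realType) (A : cstarType R) (phi : A -> A) : Prop :=
  exists phibar, strict_extension phi phibar.

Section UnitImage.
Variables (R : realType) (A B : cstarType R) (phi : A -> B).
Variables (phibar : multiplier A -> multiplier B).
Hypothesis hphi : strict_extension phi phibar.

Fact unit_image_idem :
  phibar (mult_one A) ** phibar (mult_one A) = phibar (mult_one A).
Proof.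
by rewrite -(star_homM hphi.1.1); congr phibar; exact: multiplier_eq.
Qed.

Fact unit_image_star : star (phibar (mult_one A)) = phibar (mult_one A).
Proof.
rewrite -(star_hom_star hphi.1.1); congr phibar.
by apply: multiplier_eq => a /=; rewrite starK.
Qed.

Definition unit_image : projection B :=
  Projection unit_image_idem unit_image_star.

Fact unit_image_mem a : phi a \in corner_pred unit_image.
Proof.
have H1 : mult_of (phi a) = phibar (mult_one A) ** mult_of (phi a).
  rewrite -(hphi.1.2 a) -(star_homM hphi.1.1); congr phibar.
  exact: multiplier_eq.
have H2 : mult_of (phi a) = mult_of (phi a) ** phibar (mult_one A).
  rewrite -(hphi.1.2 a) -(star_homM hphi.1.1); congr phibar.
  exact: multiplier_eq.
apply: corner_memP => /=.
  apply: amul_injl => b; rewrite -mlM.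
  by have := congr1 (@ml R B ^~ b) H1.
apply: amul_injl => b; rewrite -ml_mr.
by have := congr1 (@ml R B ^~ b) H2.
Qed.

Definition corner_map (a : A) : corner unit_image := Corner (unit_image_mem a).

End UnitImage.

Section Systems.
Variables (R : realType) (G : ordGroupType) (A : cstarType R).
Variable alpha : pos_cone G -> A -> A.
Local Notation GP := (pos_cone G).

Record dynamical_system : Prop := DynamicalSystem {
  ds_hom : forall x, star_hom (alpha x);
  ds_add : forall s t a, alpha (pc_add s t) a = alpha s (alpha t a);
  ds_id : forall a, alpha (pc0 G) a = a
}.

(* Partial isometries are the V with V V* V = V; [W] is either [bop H] or a
   multiplier algebra. *)
Record piso_representation (W : starAlgType R) (V : GP -> W) : Prop :=
  PisoRepresentation {
    piso_isom : forall s, V s ** star (V s) ** V s = V s;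
    piso_add : forall s t, V s ** V t = V (pc_add s t)
  }.

Record covariant (W : starAlgType R) (pi : A -> W) (V : GP -> W) : Prop :=
  Covariant {
    cov_hom : star_hom pi;
    cov_piso : piso_representation V;
    cov_act : forall s a, pi (alpha s a) = V s ** pi a ** star (V s);
    cov_comm : forall s a,
      star (V s) ** V s ** pi a = pi a ** (star (V s) ** V s)
  }.

Definition nondegenerate_hom (B C : cstarType R) (f : B -> C) : Prop :=
  total_set [set z | exists b c, z = f b ** c].

Definition nondegenerate_rep (B : cstarType R) (H : hilbertType R)
    (pi : B -> bop H) : Prop :=
  total_set [set z | exists b h, z = pi b h].

Definition covariant_in (B : cstarType R) (k : A -> B)
    (w : GP -> multiplier B) : Prop :=
  star_hom k /\ nondegenerate_hom k /\ covariant (fun a => mult_of (k a)) w.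

Record piso_crossed_product (B : cstarType R) (iA : A -> B)
    (v : GP -> multiplier B) : Prop := PisoCrossedProduct {
  pcp_covariant : covariant_in iA v;
  pcp_universal : forall (H : hilbertType R) (pi : A -> bop H) (V : GP -> bop H),
    nondegenerate_rep pi -> covariant pi V ->
    exists rho : B -> bop H,
      [/\ star_hom rho, nondegenerate_rep rho,
          forall a, rho (iA a) = pi a &
          exists2 rhobar, mult_extension rho rhobar &
            forall s, rhobar (v s) = V s];
  pcp_span : total_set
    [set b | exists s a t, b = ml (star (v s)) (mr (v t) (iA a))]
}.

(* [psi] is the homomorphism [kA x w] of the crossed product [(B, iA, v)]. *)
Record integrated_form (B : cstarType R) (iA : A -> B)
    (v : GP -> multiplier B) (D : cstarType R) (kA : A -> D)
    (w : GP -> multiplier D) (psi : B -> D) : Prop := IntegratedForm {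
  if_hom : star_hom psi;
  if_nondegenerate : nondegenerate_hom psi;
  if_algebra : forall a, psi (iA a) = kA a;
  if_semigroup : exists2 psibar, mult_extension (fun b => mult_of (psi b)) psibar &
    forall x, psibar (v x) = w x
}.

End Systems.

Section Toeplitz.
Variables (R : realType) (G : ordGroupType) (A : cstarType R).
Local Notation GP := (pos_cone G).
Implicit Types (f g : GP -> A).

Definition l2_mem f : Prop :=
  cvg (partial_sum (fun x : GP => star (f x) ** f x) @ totally).

Definition l2_dot f g : A := sum (fun x : GP => star (f x) ** g x).

Definition l2_norm f : R[i] := sqrtC `|l2_dot f f|.

(* Operators on l2(G+, A) are represented by maps on all functions, of which
   only the restriction to [l2_mem] matters. *)
Definition l2_adjoint (T T' : (GP -> A) -> (GP -> A)) : Prop :=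
  [/\ forall f, l2_mem f -> l2_mem (T f),
      forall f, l2_mem f -> l2_mem (T' f) &
      forall f g, l2_mem f -> l2_mem g -> l2_dot (T f) g = l2_dot f (T' g)].

Definition shift (t : GP) f : GP -> A := fun i =>
  match @idP (val t <= val i) with
  | ReflectT h => f (pc_sub h)
  | ReflectF _ => 0
  end.

Variable alpha : GP -> A -> A.

Definition pi_alpha (a : A) f : GP -> A := fun t => alpha t a ** f t.

(* S_x pi_alpha(a) S_y^* *)
Definition toeplitz_generator (T : (GP -> A) -> (GP -> A)) : Prop :=
  exists x a y Sy', l2_adjoint (shift y) Sy' /\
    forall f, l2_mem f -> T f = shift x (pi_alpha a (Sy' f)).

(* T_alpha as an abstract C*-algebra together with its isometric *-isomorphism
   [ta_op] onto the closed span of the S_x pi_alpha(a) S_y^* in the adjointable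
   operators on l2(G+, A) (so it is unique up to a unique isomorphism); the
   norm is the operator norm. [ta_pi] and [ta_shift] are pi_alpha and S seen
   in T_alpha and M(T_alpha). *)
Record toeplitz_algebra := ToeplitzAlgebra {
  ta_alg :> cstarType R;
  ta_op : ta_alg -> (GP -> A) -> (GP -> A);
  ta_pi : A -> ta_alg;
  ta_shift : GP -> multiplier ta_alg;
  ta_opD : forall s t f, l2_mem f -> ta_op (s + t) f = ta_op s f + ta_op t f;
  ta_opZ : forall (c : R[i]) t f, l2_mem f -> ta_op (c *: t) f = c *: ta_op t f;
  ta_opM : forall s t f, l2_mem f -> ta_op (s ** t) f = ta_op s (ta_op t f);
  ta_op_star : forall t, l2_adjoint (ta_op t) (ta_op (star t));
  ta_op_norm : forall t (M : R[i]), 0 <= M ->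
    (`|t| <= M) <->
    (forall f, l2_mem f -> l2_norm (ta_op t f) <= M * l2_norm f);
  ta_generators : forall T, toeplitz_generator T ->
    exists t, forall f, l2_mem f -> ta_op t f = T f;
  ta_span : total_set [set t | toeplitz_generator (ta_op t)];
  ta_op_pi : forall a f, l2_mem f -> ta_op (ta_pi a) f = pi_alpha a f;
  ta_op_shiftl : forall x t f, l2_mem f ->
    ta_op (ml (ta_shift x) t) f = shift x (ta_op t f);
  ta_op_shiftr : forall x t f, l2_mem f ->
    ta_op (mr (ta_shift x) t) f = ta_op t (shift x f)
}.

End Toeplitz.

Record right_hilbert_module (R : realType) (A : cstarType R)
    (X : completeNormedModType R[i]) (act : X -> A -> X) (ip : X -> X -> A) :
    Prop := RightHilbertModule {
  rhm_actDl : forall x y a, act (x + y) a = act x a + act y a;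
  rhm_actDr : forall x a b, act x (a + b) = act x a + act x b;
  rhm_actZl : forall (c : R[i]) x a, act (c *: x) a = c *: act x a;
  rhm_actZr : forall (c : R[i]) x a, act x (c *: a) = c *: act x a;
  rhm_actM : forall x a b, act x (a ** b) = act (act x a) b;
  rhm_ipD : forall x y z, ip x (y + z) = ip x y + ip x z;
  rhm_ipZ : forall (c : R[i]) x y, ip x (c *: y) = c *: ip x y;
  rhm_ipM : forall x y a, ip x (act y a) = ip x y ** a;
  rhm_ip_star : forall x y, star (ip x y) = ip y x;
  rhm_ip_ge0 : forall x, exists a, ip x x = star a ** a;
  rhm_norm : forall x, `|ip x x| = `|x| ^+ 2
}.

Record left_hilbert_module (R : realType) (A : cstarType R)
    (X : completeNormedModType R[i]) (act : A -> X -> X) (ip : X -> X -> A) :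
    Prop := LeftHilbertModule {
  lhm_actDl : forall a b x, act (a + b) x = act a x + act b x;
  lhm_actDr : forall a x y, act a (x + y) = act a x + act a y;
  lhm_actZl : forall (c : R[i]) a x, act (c *: a) x = c *: act a x;
  lhm_actZr : forall (c : R[i]) a x, act a (c *: x) = c *: act a x;
  lhm_actM : forall a b x, act (a ** b) x = act a (act b x);
  lhm_ipD : forall x y z, ip (x + y) z = ip x z + ip y z;
  lhm_ipZ : forall (c : R[i]) x y, ip (c *: x) y = c *: ip x y;
  lhm_ipM : forall a x y, ip (act a x) y = a ** ip x y;
  lhm_ip_star : forall x y, star (ip x y) = ip y x;
  lhm_ip_ge0 : forall x, exists a, ip x x = star a ** a;
  lhm_norm : forall x, `|ip x x| = `|x| ^+ 2
}.

(* The norms defined by the two inner products of an imprimitivity bimodule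
   always coincide, so [X] carries just one norm. *)
Record imprimitivity_bimodule (R : realType) (A B : cstarType R) :=
  ImprimitivityBimodule {
    ib_car : completeNormedModType R[i];
    ib_lact : A -> ib_car -> ib_car;
    ib_ract : ib_car -> B -> ib_car;
    ib_lip : ib_car -> ib_car -> A;
    ib_rip : ib_car -> ib_car -> B;
    ib_left : left_hilbert_module ib_lact ib_lip;
    ib_right : right_hilbert_module ib_ract ib_rip;
    ib_assoc : forall a x b,
      ib_lact a (ib_ract x b) = ib_ract (ib_lact a x) b;
    ib_left_full : total_set [set a | exists x y, a = ib_lip x y];
    ib_right_full : total_set [set b | exists x y, b = ib_rip x y];
    ib_lact_adj : forall a x y,
      ib_rip (ib_lact a x) y = ib_rip x (ib_lact (star a) y);
    ib_ract_adj : forall b x y,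
      ib_lip (ib_ract x b) y = ib_lip x (ib_ract y (star b));
    ib_imprimitivity : forall x y z,
      ib_lact (ib_lip x y) z = ib_ract x (ib_rip y z)
  }.

Definition morita_equivalent (R : realType) (A B : cstarType R) : Prop :=
  inhabited (imprimitivity_bimodule A B).

(* Main.v *)
(** A finite formal sum [l] of generators [v_s^* i_A(a) v_t] is evaluated in any
    covariant pair, and these sums form a *-algebra under a product that only
    uses the covariance relations. On l2 the compressed sum has matrix
    coefficients [coef l r t], bounded by its norm in the corner. Conversely, in
    any representation on a Hilbert space, the homogeneous part of [l] of a given
    degree [s - t] is bounded by the largest coefficient: the initial projection
    of [V_u], for the largest [u] that occurs, splits off one block at a time. A
    sum with [N] degrees is therefore bounded by [N] times its norm in the corner;
    applied to the powers [(l^* l)^(2^n)], whose number of degrees is polynomial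
    in [2^n], this gives the constant 1. So every covariant pair factors through
    the corner. Two crossed products have isometric dense *-subalgebras by the
    universal property and a faithful representation, which yields the
    isomorphism; [pT] is the imprimitivity bimodule.

    Multiplier extensions come from Cohen's factorization theorem and, on Hilbert
    spaces, from the Hellinger-Toeplitz theorem. Positivity is developed without
    spectral theory: [1 - (1 - x)^(1/2)] is the limit of the iteration
    [e -> (x + e^2) / 2]. *)

Require Import Defs.
From HB Require Import structures.
From mathcomp Require Import all_boot all_order all_algebra finmap.
From mathcomp Require Import complex ring lra.
From mathcomp Require Import boolp classical_sets functions filter reals.
From mathcomp Require Import topology normedtype sequences.
From mathcomp Require Import summability.

Set Implicit Arguments.
Unset Strict Implicit.
Unset Printing Implicit Defensive.

Import Order.TTheory GRing.Theory Num.Theory.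
Import numFieldNormedType.Exports.

Local Open Scope classical_set_scope.
Local Open Scope ring_scope.
Local Open Scope complex_scope.

(** * Identities in modules and star-algebras by reflection *)

(** The corner and an arbitrary covariant representation share only their matrix coefficients, and
    these control a sum one degree at a time, whereas the universal property needs a bound with
    constant 1. The usual bridge is a faithful expectation, obtained by averaging over the dual of
    the group. Here commutativity of the group enters by counting: the degrees in a 2^n-th power are
    sums of 2^n elements of one finite set, hence polynomially many in 2^n, while the C*-identity
    makes the norm of the power exactly a power of the norm. Taking roots removes the count.

    The other obstacle is the absence of units. The projection V_s V_s^* is tied to A only through
    the limit of alpha_s(u) along an approximate unit, so products of generators involve the
    projections [one_at]. Elements c + a of the unitization are handled through their action on A.
    Relations that are accessible on Hilbert spaces only are carried back to a C*-algebra by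
    representations that compute the norm of one given element. *)

Section LmodReflection.
Variables (K : comNzRingType) (V : lmodType K).

Inductive lterm :=
  | LVar of nat | LZero | LAdd of lterm & lterm | LOpp of lterm
  | LScale of K & lterm.

Fixpoint leval (e : nat -> V) t : V :=
  match t with
  | LVar i => e i
  | LZero => 0
  | LAdd a b => leval e a + leval e b
  | LOpp a => - leval e a
  | LScale c a => c *: leval e a
  end.

Fixpoint lcoef t (i : nat) : K :=
  match t with
  | LVar j => if Nat.eqb i j then 1 else 0
  | LZero => 0
  | LAdd a b => lcoef a i + lcoef b i
  | LOpp a => - lcoef a i
  | LScale c a => c * lcoef a i
  end.

Fixpoint lterm_bound t : nat :=
  match t with
  | LVar j => j.+1
  | LZero => 0
  | LAdd a b => Nat.max (lterm_bound a) (lterm_bound b)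
  | LOpp a => lterm_bound a
  | LScale c a => lterm_bound a
  end.

Lemma levalE e n t : (lterm_bound t <= n)%N ->
  leval e t = \sum_(i < n) lcoef t i *: e i.
Proof.
elim: t => [j|_|a IHa b IHb|a IHa|c a IHa] /=.
- move=> jn; rewrite (bigD1 (Ordinal jn))//= PeanoNat.Nat.eqb_refl scale1r.
  rewrite big1 ?addr0// => i ij.
  case: (PeanoNat.Nat.eqb_spec i j) => [h|]; last by rewrite scale0r.
  by move/eqP: ij; case; apply: val_inj.
- by rewrite big1 // => i _; rewrite scale0r.
- move=> /ssrnat.leP/PeanoNat.Nat.max_lub_iff[/ssrnat.leP/IHa -> /ssrnat.leP/IHb ->]; rewrite -big_split/=.
  by apply: eq_bigr => i _; rewrite scalerDl.
- move=> /IHa ->; rewrite -sumrN; by apply: eq_bigr => i _; rewrite scaleNr.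
- move=> /IHa ->; rewrite scaler_sumr; by apply: eq_bigr => i _; rewrite scalerA.
Qed.

(** A proposition rather than a boolean test: the coefficients lie in an arbitrary ring, and each
    comparison is left as a ring goal. *)
Fixpoint lchecks n t1 t2 : Prop :=
  match n with
  | 0%N => True
  | m.+1 => lcoef t1 m = lcoef t2 m /\ lchecks m t1 t2
  end.

Definition lenv (l : seq V) i := nth 0 l i.

Lemma leval_eq (l : seq V) t1 t2 :
  lchecks (Nat.max (lterm_bound t1) (lterm_bound t2)) t1 t2 ->
  leval (lenv l) t1 = leval (lenv l) t2.
Proof.
set n := Nat.max _ _ => h.
rewrite (@levalE _ n t1); last exact/ssrnat.leP/PeanoNat.Nat.le_max_l.
rewrite (@levalE _ n t2); last exact/ssrnat.leP/PeanoNat.Nat.le_max_r.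
apply: eq_bigr => i _; congr (_ *: _).
elim: {+}n i h => [[]//|m IH] [i /= im] [h1 h2].
by move: im; rewrite ltnS leq_eqVlt => /orP[/eqP ->//|im]; apply: (IH (Ordinal im)).
Qed.

End LmodReflection.

Section StarReflection.
Variables (R : realType) (A : starAlgType R).
Local Notation K := (R[i]).

Inductive sterm :=
  | SVar of nat | SZero | SAdd of sterm & sterm | SOpp of sterm
  | SScale of K & sterm | SMul of sterm & sterm | SStar of sterm.

Fixpoint seval (e : nat -> A) t : A :=
  match t with
  | SVar i => e i
  | SZero => 0
  | SAdd a b => seval e a + seval e b
  | SOpp a => - seval e a
  | SScale c a => c *: seval e a
  | SMul a b => seval e a ** seval e b
  | SStar a => star (seval e a)
  end.

Definition letter := (nat * bool)%type.
(** Words are nonempty by construction, since the algebra has no unit to be the value of an empty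
    word. *)
Definition word := (letter * seq letter)%type.

Definition leteval (e : nat -> A) (l : letter) : A :=
  if l.2 then star (e l.1) else e l.1.

Fixpoint wevals e (l : letter) (s : seq letter) : A :=
  match s with
  | [::] => leteval e l
  | l' :: s' => leteval e l ** wevals e l' s'
  end.

Definition weval e (w : word) := wevals e w.1 w.2.

Definition wmul (w1 w2 : word) : word := (w1.1, w1.2 ++ w2.1 :: w2.2).

Definition lflip (l : letter) : letter := (l.1, if l.2 then false else true).

Fixpoint wstars (l : letter) (s : seq letter) : word :=
  match s with
  | [::] => (lflip l, [::])
  | l' :: s' => wmul (wstars l' s') (lflip l, [::])
  end.

Definition wstar (w : word) := wstars w.1 w.2.

Definition nform := seq (K * word).

Fixpoint nmul1 (c : K) (w : word) (b : nform) : nform :=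
  match b with
  | [::] => [::]
  | q :: b' => (c * q.1, wmul w q.2) :: nmul1 c w b'
  end.

Fixpoint nmul (a b : nform) : nform :=
  match a with
  | [::] => [::]
  | p :: a' => nmul1 p.1 p.2 b ++ nmul a' b
  end.

Fixpoint nscale (c : K) (a : nform) : nform :=
  match a with
  | [::] => [::]
  | p :: a' => (c * p.1, p.2) :: nscale c a'
  end.

Fixpoint nstar (a : nform) : nform :=
  match a with
  | [::] => [::]
  | p :: a' => (Num.conj p.1, wstar p.2) :: nstar a'
  end.

Fixpoint snorm t : nform :=
  match t with
  | SVar i => [:: (1, ((i, false), [::]))]
  | SZero => [::]
  | SAdd a b => snorm a ++ snorm b
  | SOpp a => nscale (-1) (snorm a)
  | SScale c a => nscale c (snorm a)
  | SMul a b => nmul (snorm a) (snorm b)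
  | SStar a => nstar (snorm a)
  end.

Fixpoint neval e (a : nform) : A :=
  match a with
  | [::] => 0
  | p :: a' => p.1 *: weval e p.2 + neval e a'
  end.

Lemma neval_cat e a b : neval e (a ++ b) = neval e a + neval e b.
Proof. by elim: a => [|p a IH] /=; rewrite ?add0r// IH addrA. Qed.

Lemma amul0l (x : A) : 0 ** x = 0.
Proof. by have := amulZl 0 (0 : A) x; rewrite !scale0r. Qed.

Lemma amul0r (x : A) : x ** 0 = 0.
Proof. by have := amulZr 0 x (0 : A); rewrite !scale0r. Qed.

Lemma star0 : star (0 : A) = 0.
Proof. by have := starZ 0 (0 : A); rewrite rmorph0 !scale0r. Qed.

Lemma weval_mul e w1 w2 : weval e (wmul w1 w2) = weval e w1 ** weval e w2.
Proof.
case: w1 => l s; rewrite /weval /=.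
by elim: s l => [//|l' s IH] l /=; rewrite IH amulA.
Qed.

Lemma leteval_flip e l : leteval e (lflip l) = star (leteval e l).
Proof. by case: l => i [] /=; rewrite /leteval/= ?starK. Qed.

Lemma weval_star e w : weval e (wstar w) = star (weval e w).
Proof.
case: w => l s; rewrite /wstar /weval/=.
elim: s l => [|l' s IH] l /=; first exact: leteval_flip.
have /= := weval_mul e (wstars l' s) (lflip l, [::]).
by rewrite /weval/= => ->; rewrite IH starM -leteval_flip.
Qed.

Lemma neval_scale e c a : neval e (nscale c a) = c *: neval e a.
Proof. by elim: a => [|p a IH] /=; rewrite ?scaler0// IH scalerDr scalerA. Qed.

Lemma neval_mul e a b : neval e (nmul a b) = neval e a ** neval e b.
Proof.
elim: a => [|p a IH] /=; first by rewrite amul0l.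
rewrite neval_cat IH amulDl; congr (_ + _).
elim: b {IH} => [|q b IH] /=; first by rewrite amul0r.
by rewrite IH amulDr amulZr weval_mul !amulZl scalerA mulrC.
Qed.

Lemma neval_star e a : neval e (nstar a) = star (neval e a).
Proof.
elim: a => [|p a IH] /=; first by rewrite star0.
by rewrite IH starD starZ weval_star.
Qed.

Lemma snormE e t : seval e t = neval e (snorm t).
Proof.
elim: t => [i||a IHa b IHb|a IHa|c a IHa|a IHa b IHb|a IHa] //=.
- by rewrite scale1r addr0.
- by rewrite neval_cat IHa IHb.
- by rewrite neval_scale IHa scaleN1r.
- by rewrite neval_scale IHa.
- by rewrite neval_mul IHa IHb.
- by rewrite neval_star IHa.
Qed.

(** Comparison through [if] and [Nat.eqb] lets [lazy], with a fixed list of constants, decide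
    equality of words while leaving the coefficients untouched. *)
Definition leteqb (l1 l2 : letter) : bool :=
  if Nat.eqb l1.1 l2.1 then Bool.eqb l1.2 l2.2 else false.

Fixpoint seqeqb (s1 s2 : seq letter) : bool :=
  match s1, s2 with
  | [::], [::] => true
  | l1 :: s1', l2 :: s2' => if leteqb l1 l2 then seqeqb s1' s2' else false
  | _, _ => false
  end.

Definition weqb (w1 w2 : word) : bool :=
  if leteqb w1.1 w2.1 then seqeqb w1.2 w2.2 else false.

Lemma leteqbP l1 l2 : leteqb l1 l2 -> l1 = l2.
Proof.
case: l1 l2 => i b [j c]; rewrite /leteqb/=.
by case: PeanoNat.Nat.eqb_spec => // -> /Bool.eqb_prop ->.
Qed.

Lemma weqbP w1 w2 : weqb w1 w2 -> w1 = w2.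
Proof.
case: w1 w2 => l1 s1 [l2 s2]; rewrite /weqb/=.
case: ifP => // /leteqbP -> h; congr pair.
elim: s1 s2 h => [[]//|l s IH] [//|l' s']/=.
by case: ifP => // /leteqbP -> /IH ->.
Qed.

Fixpoint ncoef (w : word) (a : nform) : K :=
  match a with
  | [::] => 0
  | p :: a' => if weqb w p.2 then p.1 + ncoef w a' else ncoef w a'
  end.

Fixpoint nrest (w : word) (a : nform) : nform :=
  match a with
  | [::] => [::]
  | p :: a' => if weqb w p.2 then nrest w a' else p :: nrest w a'
  end.

Lemma neval_split e w a :
  neval e a = ncoef w a *: weval e w + neval e (nrest w a).
Proof.
elim: a => [|p a IH] /=; first by rewrite scale0r addr0.
case: ifP => [/weqbP <- | _] /=; rewrite {1}IH; last by rewrite addrCA.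
by rewrite scalerDl addrA.
Qed.

(** The coefficients of the leading word are collected and must sum to zero; then the remaining
    words are treated. [n] is fuel, since [nrest] does not return a structural subterm. *)
Fixpoint nchecks (n : nat) (a : nform) : Prop :=
  match n, a with
  | m.+1, p :: a' => p.1 + ncoef p.2 a' = 0 /\ nchecks m (nrest p.2 a')
  | _, [::] => True
  | _, _ => False
  end.

Lemma nchecksP e n a : nchecks n a -> neval e a = 0.
Proof.
elim: n a => [[]//|n IH] [//|p a] /= [h1 h2].
by rewrite (neval_split e p.2 a) addrA -scalerDl h1 scale0r (IH _ h2) addr0.
Qed.

Definition senv (l : seq A) i := nth 0 l i.

Lemma seval_eq (l : seq A) n t1 t2 :
  nchecks n (snorm (SAdd t1 (SOpp t2))) ->
  seval (senv l) t1 = seval (senv l) t2.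
Proof.
move=> /(nchecksP (senv l)); rewrite -snormE /= => /eqP.
by rewrite subr_eq0 => /eqP.
Qed.

End StarReflection.

Lemma conj_realC (R : realType) (r : R) : Num.conj (r%:C) = r%:C.
Proof. exact: conjc_real. Qed.

Lemma conj_iC (R : realType) : Num.conj ('i : R[i]) = - 'i.
Proof. by apply/eqP; rewrite eq_complex /= oppr0 !eqxx. Qed.

Lemma realC_eq0 (R : realType) (r : R) : (r%:C == 0) = (r == 0).
Proof. exact: fmorph_eq0. Qed.

Lemma realCD (R : realType) (r s : R) : (r + s)%:C = r%:C + s%:C.
Proof. exact: rmorphD. Qed.
Lemma realCB (R : realType) (r s : R) : (r - s)%:C = r%:C - s%:C.
Proof. exact: rmorphB. Qed.
Lemma realCN (R : realType) (r : R) : (- r)%:C = - r%:C.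
Proof. exact: rmorphN. Qed.
Lemma realCM (R : realType) (r s : R) : (r * s)%:C = r%:C * s%:C.
Proof. exact: rmorphM. Qed.
Lemma realCX (R : realType) (r : R) n : (r ^+ n)%:C = r%:C ^+ n.
Proof. exact: rmorphXn. Qed.
Lemma realCV (R : realType) (r : R) : (r^-1)%:C = (r%:C)^-1.
Proof. exact: fmorphV. Qed.
Lemma realC1 (R : realType) : (1 : R)%:C = 1. Proof. by []. Qed.
Lemma realC0 (R : realType) : (0 : R)%:C = 0. Proof. by []. Qed.
Lemma realCn (R : realType) n : (n%:R : R)%:C = n%:R.
Proof. exact: rmorph_nat. Qed.

Definition realCE := (realCD, realCB, realCN, realCM, realCX, realCV, realC1,
  realC0, realCn).

Ltac atom_find x l :=
  lazymatch l with
  | x :: _ => constr:(0%N)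
  | _ :: ?l' => let n := atom_find x l' in constr:(S n)
  end.

Ltac atom_mem x l :=
  lazymatch l with
  | [::] => constr:(false)
  | x :: _ => constr:(true)
  | _ :: ?l' => atom_mem x l'
  end.

Ltac atom_add x l :=
  lazymatch atom_mem x l with
  | true => l
  | false => constr:(x :: l)
  end.

Ltac lmod_atoms t l :=
  lazymatch t with
  | (?a + ?b)%R => let l := lmod_atoms a l in lmod_atoms b l
  | (- ?a)%R => lmod_atoms a l
  | (_ *: ?a)%R => lmod_atoms a l
  | (?a *+ _)%R => lmod_atoms a l
  | 0%R => l
  | _ => atom_add t l
  end.

Ltac lmod_reify K l t :=
  lazymatch t with
  | (?a + ?b)%R =>
      let a := lmod_reify K l a in
      let b := lmod_reify K l b in constr:(@LAdd K a b)
  | (- ?a)%R => let a := lmod_reify K l a in constr:(@LOpp K a)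
  | (?c *: ?a)%R => let a := lmod_reify K l a in constr:(@LScale K c a)
  | (?a *+ ?n)%R => let a := lmod_reify K l a in constr:(@LScale K n%:R a)
  | 0%R => constr:(@LZero K)
  | _ => let n := atom_find t l in constr:(@LVar K n)
  end.

Ltac lmod_setup K V :=
  lazymatch goal with
  | |- ?x = ?y =>
    let l := lmod_atoms x constr:(@nil V) in
    let l := lmod_atoms y l in
    let t1 := lmod_reify K l x in
    let t2 := lmod_reify K l y in
    have : leval (lenv l) t1 = leval (lenv l) t2;
    [ apply: leval_eq;
      lazy beta iota zeta delta [lchecks lcoef lterm_bound Nat.max Nat.eqb]
    | rewrite /leval /lenv /nth ?scaler_nat; apply ]
  end.

Ltac sterm_atoms t l :=
  lazymatch t with
  | (?a + ?b)%R => let l := sterm_atoms a l in sterm_atoms b l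
  | (- ?a)%R => sterm_atoms a l
  | (_ *: ?a)%R => sterm_atoms a l
  | (?a *+ _)%R => sterm_atoms a l
  | (?a ** ?b)%R => let l := sterm_atoms a l in sterm_atoms b l
  | star ?a => sterm_atoms a l
  | 0%R => l
  | _ => atom_add t l
  end.

Ltac sterm_reify R l t :=
  lazymatch t with
  | (?a + ?b)%R =>
      let a := sterm_reify R l a in
      let b := sterm_reify R l b in constr:(@SAdd R a b)
  | (- ?a)%R => let a := sterm_reify R l a in constr:(@SOpp R a)
  | (?c *: ?a)%R => let a := sterm_reify R l a in constr:(@SScale R c a)
  | (?a *+ ?n)%R => let a := sterm_reify R l a in constr:(@SScale R n%:R a)
  | (?a ** ?b)%R =>
      let a := sterm_reify R l a in
      let b := sterm_reify R l b in constr:(@SMul R a b)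
  | star ?a => let a := sterm_reify R l a in constr:(@SStar R a)
  | 0%R => constr:(@SZero R)
  | _ => let n := atom_find t l in constr:(@SVar R n)
  end.

Ltac star_setup R A :=
  lazymatch goal with
  | |- ?x = ?y =>
    let l := sterm_atoms x constr:(@nil A) in
    let l := sterm_atoms y l in
    let t1 := sterm_reify R l x in
    let t2 := sterm_reify R l y in
    have : seval (senv l) t1 = seval (senv l) t2;
    (* [200] is the fuel, an upper bound for the number of distinct words. *)
    [ apply: (@seval_eq _ _ _ 200);
      lazy beta iota zeta delta [nchecks ncoef nrest snorm weqb seqeqb leteqb
        Nat.eqb Bool.eqb nscale nmul nmul1 nstar wmul wstar wstars lflip cat
        fst snd]
    | rewrite /seval /senv /nth ?scaler_nat; apply ]
  end.

Ltac coef_ring :=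
  repeat match goal with |- _ /\ _ => split end;
  try exact: Logic.I;
  rewrite ?(rmorphD, rmorphN, rmorphM, rmorph1, rmorph0, rmorphXn, rmorph_nat)/=;
  rewrite ?(conj_realC, conj_iC, realCE);
  try by field; rewrite ?realC_eq0.

Tactic Notation "lmod" constr(K) constr(V) := lmod_setup K V; coef_ring.
Tactic Notation "staralg" constr(R) constr(A) := star_setup R A; coef_ring.

(** * Real-valued norms and limits *)

Lemma lim_uniq (K : numFieldType) (V : pseudoMetricNormedZmodType K) (T : Type)
    (F : set_system T) {FF : ProperFilter F} (f : T -> V) (a b : V) :
  f t @[t --> F] --> a -> f t @[t --> F] --> b -> a = b.
Proof. by move=> fa fb; exact: (cvg_unique (@norm_hausdorff _ _) fa fb). Qed.

Section RealNorm.
Variables (R : realType) (V : normedModType R[i]).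
Implicit Types (x y z : V) (r : R).

(** The norm over [R[i]] takes complex values; [nr] is the real number behind it, so that estimates
    are open to [lra] and [nra]. *)
Definition nr x : R := complex.Re `|x|.

Lemma nrE x : `|x| = (nr x)%:C.
Proof. by rewrite RRe_real// normr_real. Qed.

Lemma nr_ge0 x : 0 <= nr x.
Proof. by rewrite -ler0c -nrE. Qed.

Lemma nr0 : nr (0 : V) = 0. Proof. by rewrite /nr normr0. Qed.

Lemma nrN x : nr (- x) = nr x. Proof. by rewrite /nr normrN. Qed.

Lemma nr_distC x y : nr (x - y) = nr (y - x). Proof. by rewrite /nr distrC. Qed.

Lemma nrD x y : nr (x + y) <= nr x + nr y.
Proof. by rewrite -lecR realCD -!nrE ler_normD. Qed.

Lemma nrB x y : nr (x - y) <= nr x + nr y.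
Proof. by rewrite -[nr y]nrN nrD. Qed.

Lemma nr_dist_trans y x z : nr (x - z) <= nr (x - y) + nr (y - z).
Proof. by rewrite -[x - z](subrKA y) nrD. Qed.

Lemma nrZC (c : R[i]) x : nr (c *: x) = complex.Re `|c| * nr x.
Proof.
by apply: complexI; rewrite -nrE normrZ nrE realCM RRe_real// normr_real.
Qed.

Lemma nrZ r x : nr (r%:C *: x) = `|r| * nr x.
Proof. by rewrite nrZC normc_def /= expr0n addr0 sqrtr_sqr. Qed.

Lemma nrZp r x : 0 <= r -> nr (r%:C *: x) = r * nr x.
Proof. by move=> r0; rewrite nrZ ger0_norm. Qed.

Lemma nr_eq0 x : nr x = 0 -> x = 0.
Proof. by move=> h; apply/eqP; rewrite -normr_eq0 nrE h. Qed.

Lemma nr_le0 x : nr x <= 0 -> x = 0.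
Proof. by move=> h; apply: nr_eq0; apply/eqP; rewrite eq_le h nr_ge0. Qed.

Lemma nr_small x : (forall e, 0 < e -> nr x <= e) -> x = 0.
Proof. by move=> h; apply: nr_le0; apply/ler_addgt0Pl => e e0; rewrite addr0 h. Qed.

Lemma nr_small_eq x y : (forall e, 0 < e -> nr (x - y) <= e) -> x = y.
Proof. by move=> h; apply/eqP; rewrite -subr_eq0; apply/eqP/nr_small. Qed.

Lemma nr_sum (I : Type) (s : seq I) (P : pred I) (F : I -> V) :
  nr (\sum_(i <- s | P i) F i) <= \sum_(i <- s | P i) nr (F i).
Proof.
elim/big_ind2: _ => [|x a y b xa yb|//]; first by rewrite nr0.
by rewrite (le_trans (nrD _ _))// lerD.
Qed.

Lemma cvg_nrP (T : Type) (F : set_system T) {FF : Filter F} (f : T -> V) l :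
  (f t @[t --> F] --> l) <-> forall e : R, 0 < e -> \forall t \near F, nr (f t - l) <= e.
Proof.
split=> [/cvgrPdist_le h e e0|h].
  have /h : 0 < e%:C by rewrite ltcR.
  by apply: filterS => t; rewrite distrC nrE lecR.
apply/cvgrPdist_le => e e0.
have -> : e = (complex.Re e)%:C by rewrite RRe_real// gtr0_real.
have /h : 0 < complex.Re e by rewrite -ltcR RRe_real// gtr0_real.
by apply: filterS => t; rewrite distrC nrE lecR.
Qed.

Lemma cvg_ext (T : Type) (F : set_system T) (f g : T -> V) (l : V) :
  f =1 g -> f t @[t --> F] --> l -> g t @[t --> F] --> l.
Proof. by move=> /funext ->. Qed.

Lemma closure_nrP (S : set V) x :
  closure S x <-> forall e : R, 0 < e -> exists2 y, S y & nr (x - y) <= e.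
Proof.
split=> [h e e0|h B].
  have /h [y [Sy]] : nbhs x (ball x e%:C) by apply: nbhsx_ballx; rewrite ltcR.
  by rewrite -ball_normE /= nrE ltcR => /ltW; exists y.
move=> /nbhs_ballP[e /= e0 xB].
have e20 : 0 < complex.Re e / 2.
  by rewrite divr_gt0// -ltcR RRe_real// gtr0_real.
have [y Sy xy] := h _ e20; exists y; split=> //; apply: xB.
rewrite -ball_normE /= nrE; apply: (@le_lt_trans _ _ (complex.Re e / 2)%:C).
  by rewrite lecR.
rewrite -[ltRHS]RRe_real ?gtr0_real// ltcR; lra.
Qed.

Lemma total_setP (S : set V) :
  total_set S <-> forall x (e : R), 0 < e ->
    exists2 y, lin_span S y & nr (x - y) <= e.
Proof.
split=> [h x|h].
  by apply/closure_nrP; rewrite [closure _]h.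
by apply/seteqP; split=> // x _; apply/closure_nrP/h.
Qed.

Lemma lin_span_ind (S P : set V) : P 0 -> (forall x y, P x -> P y -> P (x + y)) ->
  (forall (c : R[i]) x, P x -> P (c *: x)) -> S `<=` P -> lin_span S `<=` P.
Proof.
move=> P0 PD PZ SP x [n [c [s [Ss ->]]]].
by elim/big_ind: _ => // i _; apply/PZ/SP.
Qed.

Lemma lin_span_incl (S : set V) : S `<=` lin_span S.
Proof.
move=> x Sx; exists 1%N, (fun=> 1), (fun=> x); split=> //.
by rewrite big_ord1 scale1r.
Qed.

Lemma lin_spanD (S : set V) x y : lin_span S x -> lin_span S y -> lin_span S (x + y).
Proof.
move=> [n [c [s [Ss ->]]]] [m [d [t [St ->]]]].
exists (n + m)%N,
  (fun i => match fintype.split i with inl j => c j | inr j => d j end),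
  (fun i => match fintype.split i with inl j => s j | inr j => t j end).
split; first by move=> i; case: (fintype.split i).
rewrite big_split_ord /=; congr (_ + _); apply: eq_bigr => i _.
  by rewrite -[lshift _ _]/(unsplit (inl i)) unsplitK.
by rewrite -[rshift _ _]/(unsplit (inr i)) unsplitK.
Qed.

Lemma lin_spanZ (S : set V) (c : R[i]) x : lin_span S x -> lin_span S (c *: x).
Proof.
move=> [n [d [s [Ss ->]]]]; exists n, (fun i => c * d i), s; split=> //.
by rewrite scaler_sumr; apply: eq_bigr => i _; rewrite scalerA.
Qed.

Lemma lin_span0 (S : set V) : lin_span S 0.
Proof. by exists 0%N, (fun=> 0), (fun=> 0); split=> [[]//|]; rewrite big_ord0. Qed.

(** Density as an induction principle: a predicate that defines a closed subspace and holds on the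
    generators holds everywhere. *)
Lemma total_ind (S P : set V) : total_set S ->
  P 0 -> (forall x y, P x -> P y -> P (x + y)) ->
  (forall (c : R[i]) x, P x -> P (c *: x)) ->
  (forall x, (forall e : R, 0 < e -> exists2 y, P y & nr (x - y) <= e) -> P x) ->
  S `<=` P -> forall x, P x.
Proof.
move=> /total_setP tS P0 PD PZ Pc SP x; apply: Pc => e e0.
by have [y Sy xy] := tS x e e0; exists y => //; apply: (lin_span_ind P0 PD PZ SP).
Qed.

Lemma total_set_trans (S T : set V) : total_set S ->
  (forall x (e : R), S x -> 0 < e -> exists2 y, lin_span T y & nr (x - y) <= e) ->
  total_set T.
Proof.
move=> tS ST; apply/total_setP => x.
apply: (total_ind tS (P := fun x => forall e, 0 < e ->
  exists2 y, lin_span T y & nr (x - y) <= e)) => {x}.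
- by move=> e e0; exists 0; [exact: lin_span0|rewrite subrr nr0 ltW].
- move=> x y hx hy e e0; have e20 : 0 < e / 2 by rewrite divr_gt0.
  have [x' Tx xx] := hx _ e20; have [y' Ty yy] := hy _ e20.
  exists (x' + y'); first exact: lin_spanD.
  have -> : x + y - (x' + y') = (x - x') + (y - y') by rewrite opprD addrACA.
  by rewrite (le_trans (nrD _ _))// (splitr e) lerD.
- move=> c x hx e e0; set k := complex.Re `|c| + 1.
  have k0 : 0 < k.
    by rewrite ltr_wpDl// -ler0c RRe_real ?normr_real.
  have [x' Tx xx] := hx (e / k) (divr_gt0 e0 k0).
  exists (c *: x'); first exact: lin_spanZ.
  rewrite -scalerBr nrZC (@le_trans _ _ (k * (e / k)))//; last first.
    by rewrite mulrCA divff ?mulr1 ?gt_eqF.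
  rewrite ler_pM ?nr_ge0//; last by rewrite lerDl.
  by rewrite -ler0c RRe_real ?normr_real.
- move=> x hx e e0; have e20 : 0 < e / 2 by rewrite divr_gt0.
  have [y hy xy] := hx _ e20; have [z Tz yz] := hy _ e20.
  exists z => //; rewrite (le_trans (nr_dist_trans y _ _))// (splitr e).
  exact: lerD.
- by move=> x Sx e e0; apply: ST.
Qed.

End RealNorm.

Section Completeness.
Variables (R : realType) (V : completeNormedModType R[i]).

Lemma nr_complete (T : Type) (F : set_system T) {FF : ProperFilter F} (f : T -> V) :
  (forall e : R, 0 < e -> exists2 P : set T, F P &
    forall s t, P s -> P t -> nr (f s - f t) <= e) ->
  exists l : V, f t @[t --> F] --> l.
Proof.
move=> h; suff /cvg_ex : cvg (f @ F :> set_system V) by [].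
apply/cauchy_cvgP/cauchy_ballP => e e0.
have e20 : 0 < complex.Re e / 2.
  by rewrite divr_gt0// -ltcR RRe_real// gtr0_real.
have [P FP hP] := h _ e20.
exists (f @` P, f @` P) => /=.
  by split; apply: (@filterS _ F _ P) FP => t Pt; exists t.
move=> [_ _] [/= [s Ps <-] [t Pt <-]]; rewrite -ball_normE /= nrE.
apply: (@le_lt_trans _ _ (complex.Re e / 2)%:C); first by rewrite lecR hP.
rewrite -[ltRHS]RRe_real ?gtr0_real// ltcR; lra.
Qed.

Lemma nr_cauchy_seq (f : nat -> V) :
  (forall e : R, 0 < e -> exists N, forall m n, (N <= m)%N -> (m <= n)%N ->
     nr (f n - f m) <= e) -> exists l : V, f n @[n --> \oo] --> l.
Proof.
move=> h; apply: nr_complete => e e0.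
have [N hN] := h e e0; exists [set n | (N <= n)%N]; first by exists N.
move=> m n Nm Nn; have [mn|/ltnW nm] := leqP m n; last exact: hN.
by rewrite nr_distC hN.
Qed.

(** The sequence [d] is nondecreasing by the first hypothesis and bounded by the second, hence
    Cauchy, and its differences dominate those of [f]. *)
Lemma nr_telescope (f : nat -> V) (d : nat -> R) (M : R) :
  (forall n, nr (f n.+1 - f n) <= d n.+1 - d n) -> (forall n, d n <= M) ->
  exists l : V, f n @[n --> \oo] --> l.
Proof.
move=> fd dM.
have dn m n : (m <= n)%N -> nr (f n - f m) <= d n - d m.
  elim: n => [|n IH]; first by rewrite leqn0 => /eqP ->; rewrite !subrr nr0.
  rewrite leq_eqVlt => /orP[/eqP ->|/IH h]; first by rewrite !subrr nr0.
  rewrite (le_trans (nr_dist_trans (f n) _ _))//.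
  by rewrite -[leRHS](subrKA (d n)) lerD.
have dc : cvgn d.
  apply: nondecreasing_is_cvgn.
    by move=> m n /dn h; rewrite -subr_ge0 (le_trans _ h)// nr_ge0.
  by exists M => _ [n _ <-].
apply: nr_cauchy_seq => e e0.
have /cvgrPdist_le /(_ (e / 2)) := dc.
have e20 : 0 < e / 2 by rewrite divr_gt0.
move=> /(_ e20)[N _ hN]; exists N => m n Nm mn.
rewrite (le_trans (dn _ _ mn))// (le_trans (ler_norm _))//.
have h1 := hN n (leq_trans Nm mn); have h2 := hN m Nm.
rewrite distrC in h1; rewrite (le_trans (ler_distD (lim (d @ \oo)) _ _))//.
by rewrite (splitr e) lerD.
Qed.

End Completeness.

Section CStarNorm.
Variables (R : realType) (A : cstarType R).
Implicit Types x y : A.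

Lemma nrM x y : nr (x ** y) <= nr x * nr y.
Proof. by rewrite -lecR realCM -!nrE ler_norm_amul. Qed.

Lemma nr_cstar x : nr (star x ** x) = nr x ^+ 2.
Proof. by apply: complexI; rewrite realCX -!nrE cstar_identity. Qed.

Lemma nr_star x : nr (star x) = nr x.
Proof. by rewrite /nr norm_star. Qed.

Lemma nr_cstar' x : nr (x ** star x) = nr x ^+ 2.
Proof. by rewrite -[nr x]nr_star -nr_cstar starK. Qed.

Lemma starB x y : star (x - y) = star x - star y.
Proof. by staralg R A. Qed.

Lemma starN x : star (- x) = - star x.
Proof. by staralg R A. Qed.

Lemma amulBl x y z : (x - y) ** z = x ** z - y ** z.
Proof. by staralg R A. Qed.

Lemma amulNl x y : (- x) ** y = - (x ** y).
Proof. by staralg R A. Qed.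

Lemma amulNr x y : x ** (- y) = - (x ** y).
Proof. by staralg R A. Qed.

Lemma cvg_amull (T : Type) (F : set_system T) {FF : Filter F} (f : T -> A) l a :
  f t @[t --> F] --> l -> (a ** f t) @[t --> F] --> a ** l.
Proof.
move=> /cvg_nrP h; apply/cvg_nrP => e e0.
have k0 : 0 < nr a + 1 by rewrite ltr_wpDl ?nr_ge0.
apply: filterS (h _ (divr_gt0 e0 k0)) => t ft.
rewrite -amulBr (le_trans (nrM _ _))//.
rewrite (@le_trans _ _ ((nr a + 1) * (e / (nr a + 1))))//; last first.
  by rewrite mulrCA divff ?mulr1 ?gt_eqF.
by rewrite ler_pM ?nr_ge0// lerDl.
Qed.

Lemma cvg_star (T : Type) (F : set_system T) {FF : Filter F} (f : T -> A) l :
  f t @[t --> F] --> l -> star (f t) @[t --> F] --> star l.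
Proof.
move=> /cvg_nrP h; apply/cvg_nrP => e e0.
by apply: filterS (h _ e0) => t; rewrite -starB nr_star.
Qed.

Lemma cvg_amulr (T : Type) (F : set_system T) {FF : Filter F} (f : T -> A) l a :
  f t @[t --> F] --> l -> (f t ** a) @[t --> F] --> l ** a.
Proof.
move=> /cvg_star /(cvg_amull (a := star a)) /cvg_star; rewrite starM !starK.
by under eq_fun do rewrite starM !starK.
Qed.

Lemma cvg_amul (T : Type) (F : set_system T) {FF : ProperFilter F} (f g : T -> A) l k :
  f t @[t --> F] --> l -> g t @[t --> F] --> k -> (f t ** g t) @[t --> F] --> l ** k.
Proof.
move=> fl gk; have /cvgrPdist_le/(_ 1) : f t @[t --> F] --> l := fl.
move=> /(_ ltr01) fb; move/cvg_nrP: gk => gk.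
have h0 : (f t ** (g t - k)) @[t --> F] --> (0 : A).
  apply/cvg_nrP => e e0; have k0 : 0 < nr l + 1 by rewrite ltr_wpDl ?nr_ge0.
  near=> t; rewrite subr0 (le_trans (nrM _ _))//.
  rewrite (@le_trans _ _ ((nr l + 1) * (e / (nr l + 1))))//; last first.
    by rewrite mulrCA divff ?mulr1 ?gt_eqF.
  rewrite ler_pM ?nr_ge0//; last by near: t; apply: gk; exact: divr_gt0.
  have : nr (f t - l) <= 1 by rewrite nr_distC -lecR -nrE; near: t.
  have := nrD l (f t - l); rewrite addrC subrK; lra.
rewrite -[l ** k]add0r; apply: cvg_ext (cvgD h0 (cvg_amulr (a := k) fl)) => t.
by rewrite amulBr -[LHS]/(_ - _ + _) subrK.
Unshelve. all: by end_near. Qed.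

End CStarNorm.

(** * Positivity in C*-algebras *)

Lemma cvg_realC (R : realType) (T : Type) (F : set_system T) {FF : Filter F}
    (f : T -> R) (l : R) :
  f t @[t --> F] --> l -> ((f t)%:C : R[i]^o) @[t --> F] --> (l%:C : R[i]^o).
Proof.
move=> /cvgrPdist_le h; apply/cvgrPdist_le => e e0.
have /h : 0 < complex.Re e by rewrite -ltcR RRe_real// gtr0_real.
apply: filterS => t; rewrite -realCB normc_def /= expr0n addr0 sqrtr_sqr => ht.
by rewrite -[leRHS]RRe_real ?gtr0_real// lecR.
Qed.

Section Positivity.
Variables (R : realType) (A : cstarType R).
Implicit Types (a b h x y z : A) (c d g r s t K L : R).

(* The element [c + a] of the unitization acts on [A] with norm at most [K]. *)
Definition mb c K a := forall x, nr (c%:C *: x + a ** x) <= K * nr x.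

(** Testing at [star a] produces a a^*, whose norm is the square of that of a; there is no unit to
    test at. *)
Lemma mb_nr c K a : 0 <= K -> mb c K a -> nr a <= K + `|c|.
Proof.
move=> K0 /(_ (star a)); rewrite nr_star => h.
have [->|a0] := eqVneq (nr a) 0; first by rewrite addr_ge0.
have {}a0 : 0 < nr a by rewrite lt_neqAle eq_sym a0 nr_ge0.
rewrite -(ler_pM2r a0) -expr2 -nr_cstar' mulrDl.
have -> : a ** star a = (c%:C *: star a + a ** star a) - c%:C *: star a.
  by rewrite addrC addKr.
by rewrite (le_trans (nrB _ _))// lerD// nrZ nr_star.
Qed.

Lemma nr_mb a K : 0 <= K -> nr a <= K -> mb 0 K a.
Proof.
by move=> K0 aK x; rewrite scale0r add0r (le_trans (nrM _ _))// ler_wpM2r// nr_ge0.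
Qed.

Lemma mbD c K a d L b : mb c K a -> mb d L b -> mb (c + d) (K + L) (a + b).
Proof.
move=> ha hb x; rewrite mulrDl.
have -> : (c + d)%:C *: x + (a + b) ** x =
  (c%:C *: x + a ** x) + (d%:C *: x + b ** x) by staralg R A.
by rewrite (le_trans (nrD _ _))// lerD.
Qed.

(** The element in the conclusion is the part in A of the product (c + a)(d + b). *)
Lemma mbM c K a d L b : 0 <= K -> mb c K a -> mb d L b ->
  mb (c * d) (K * L) (c%:C *: b + d%:C *: a + a ** b).
Proof.
move=> K0 ha hb x.
have -> : (c * d)%:C *: x + (c%:C *: b + d%:C *: a + a ** b) ** x =
  c%:C *: (d%:C *: x + b ** x) + a ** (d%:C *: x + b ** x) by staralg R A.
by rewrite (le_trans (ha _))// -mulrA ler_wpM2l.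
Qed.

Lemma mbZ r c K a : 0 <= r -> mb c K a -> mb (r * c) (r * K) (r%:C *: a).
Proof.
move=> r0 ha x.
have -> : (r * c)%:C *: x + (r%:C *: a) ** x = r%:C *: (c%:C *: x + a ** x).
  by staralg R A.
by rewrite nrZp// -mulrA ler_wpM2l.
Qed.

Lemma mb_le c K L a : K <= L -> mb c K a -> mb c L a.
Proof. by move=> KL ha x; rewrite (le_trans (ha x))// ler_wpM2r// nr_ge0. Qed.

Lemma mb_cvg (c : nat -> R) (a : nat -> A) c' a' K :
  c n @[n --> \oo] --> c' -> a n @[n --> \oo] --> a' ->
  (forall n, mb (c n) K (a n)) -> mb c' K a'.
Proof.
move=> cc aa h x; have cx : ((c n)%:C *: x + a n ** x) @[n --> \oo] -->
    (c'%:C *: x + a' ** x).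
  by apply: cvgD; [apply: cvgZr_tmp; exact: cvg_realC|exact: cvg_amulr].
apply/ler_addgt0Pl => e e0; move/cvg_nrP: cx => /(_ _ e0)[n _ /(_ n (leqnn n)) /= hn].
have := h n x; have := nr_dist_trans ((c n)%:C *: x + a n ** x) (c'%:C *: x + a' ** x) 0.
by rewrite !subr0; rewrite nr_distC in hn; lra.
Qed.

Section AffineSqrt.
Variables (g : R) (h : A).
Hypotheses (g0 : 0 <= g) (g1 : g <= 1) (hh : star h = h) (hb : mb g 1 h).

(* [1 - e] with [e] the limit of [e_0 = 0], [e_(n+1) = (g + h + e_n^2) / 2] is a
   square root of [1 - g - h]; increments are dominated by those of the same
   scheme for [g + h := 1]. *)
Fixpoint sqrt_iter n : R * A * R :=
  match n with
  | 0 => (0, 0, 0)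
  | m.+1 => let: (s, a, e) := sqrt_iter m in
     ((g + s ^+ 2) / 2,
      (2^-1)%:C *: (h + (2 * s)%:C *: a + a ** a),
      (1 + e ^+ 2) / 2)
  end.

Let sg n := (sqrt_iter n).1.1.
Let an n := (sqrt_iter n).1.2.
Let ep n := (sqrt_iter n).2.

Let sgS n : sg n.+1 = (g + sg n ^+ 2) / 2.
Proof. by rewrite /sg /=; case: (sqrt_iter n) => [[]]. Qed.
Let anS n : an n.+1 = (2^-1)%:C *: (h + (2 * sg n)%:C *: an n + an n ** an n).
Proof. by rewrite /an /sg /=; case: (sqrt_iter n) => [[]]. Qed.
Let epS n : ep n.+1 = (1 + ep n ^+ 2) / 2.
Proof. by rewrite /ep /=; case: (sqrt_iter n) => [[]]. Qed.

Let ep01 n : 0 <= ep n <= 1.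
Proof.
elim: n => [|n /andP[e0 e1]]; first by rewrite /ep/= lexx ler01.
by rewrite epS; apply/andP; split; nra.
Qed.

Let sg0 n : 0 <= sg n.
Proof.
elim: n => [|n IH]; first by rewrite /sg/= lexx.
by rewrite sgS divr_ge0// addr_ge0// sqr_ge0.
Qed.

Let sgep n : sg n <= ep n.
Proof.
elim: n => [|n IH]; first by rewrite /sg/ep/= lexx.
have := sg0 n; have /andP[] := ep01 n; have := g1; rewrite sgS epS; nra.
Qed.

Let step_factor (k x y z : R) : x = (k + y ^+ 2) / 2 -> z = (k + x ^+ 2) / 2 ->
  z - x = (x - y) * ((x + y) / 2).
Proof.
move=> hx ->; have -> : k = 2 * x - y ^+ 2 by rewrite hx; field.
by field.
Qed.

Let sg_step n : 0 <= sg n.+1 - sg n <= ep n.+1 - ep n.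
Proof.
elim: n => [|n /andP[IH1 IH2]].
  by have := g0; have := g1; rewrite sgS epS /sg /ep/= => *; apply/andP; split; lra.
have := sg0 n; have := sg0 n.+1; have := sgep n; have := sgep n.+1.
move=> h1 h2 h3 h4.
rewrite (step_factor (sgS n) (sgS n.+1)) (step_factor (epS n) (epS n.+1)).
apply/andP; split; first by rewrite mulr_ge0//; lra.
by rewrite ler_pM//; lra.
Qed.

Let an_star n : star (an n) = an n.
Proof.
elim: n => [|n IH]; first by rewrite /an /= star0.
by rewrite anS !(starZ, starD, starM) hh IH !conj_realC.
Qed.

Let an_comm n y : h ** y = y ** h -> an n ** y = y ** an n.
Proof.
move=> hy; elim: n => [|n IH]; first by rewrite /an /= amul0l amul0r.
rewrite anS amulZl amulZr; congr (_ *: _).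
rewrite !amulDl !amulDr amulZl amulZr hy IH; congr (_ + _).
by rewrite -amulA IH amulA IH amulA.
Qed.

Let an_comm2 m n : an m ** an n = an n ** an m.
Proof. by apply: an_comm; rewrite an_comm. Qed.

Let an_mb n : mb (sg n) (ep n) (an n).
Proof.
elim: n => [|n IH].
  by move=> x; rewrite /sg/an/ep/= scale0r amul0l addr0 nr0 mul0r.
have /andP[e0 e1] := ep01 n.
have := mbZ (r := 2^-1) _ (mbD hb (mbM e0 IH IH)); rewrite invr_ge0 ler0n => /(_ isT).
rewrite sgS epS anS -!expr2 !(mulrC 2^-1).
suff -> : (2^-1)%:C *: (h + ((sg n)%:C *: an n + (sg n)%:C *: an n + an n ** an n))
  = (2^-1)%:C *: (h + (2 * sg n)%:C *: an n + an n ** an n) by [].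
by staralg R A.
Qed.

(** For commuting terms e_(n+2) - e_(n+1) equals (e_(n+1) - e_n)(e_(n+1) + e_n) / 2, and [mbM]
    reproduces the scalar recursion of [ep] as the bound. *)
Let an_step n : mb (sg n.+1 - sg n) (ep n.+1 - ep n) (an n.+1 - an n).
Proof.
elim: n => [|n IH].
  have s0 : sg 0 = 0 by []; have e0 : ep 0 = 0 by []; have a0 : an 0 = 0 by [].
  rewrite sgS epS anS s0 e0 a0 expr0n /= amul0l scaler0 !addr0 !subr0.
  have := mbZ (r := 2^-1) _ hb; rewrite invr_ge0 ler0n => /(_ isT).
  by rewrite !(mulrC 2^-1).
have /andP[e0 _] := ep01 n; have /andP[s0 s1] := sg_step n.
have e1 : 0 <= ep n.+1 - ep n by lra.
have := mbZ (r := 2^-1) _ (mbM e1 IH (mbD (an_mb n.+1) (an_mb n))).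
rewrite invr_ge0 ler0n => /(_ isT).
rewrite (step_factor (sgS n) (sgS n.+1)) (step_factor (epS n) (epS n.+1)).
rewrite ![2^-1 * _]mulrC -!mulrA.
set w := _ *: _ => hm; suff -> : an n.+2 - an n.+1 = w by [].
have -> : an n.+2 - an n.+1 = (2^-1)%:C *: ((2 * sg n.+1)%:C *: an n.+1 -
    (2 * sg n)%:C *: an n + (an n.+1 ** an n.+1 - an n ** an n)).
  rewrite (anS n.+1) [X in _ - X]anS.
  by staralg R A.
rewrite /w; have hc := an_comm2 n n.+1.
have -> : (an n.+1 - an n) ** (an n.+1 + an n) = an n.+1 ** an n.+1 - an n ** an n.
  by rewrite amulDr !amulBl hc addrA subrK.
by staralg R A.
Qed.

(** The limit s + a solves 2 e = (g + h) + e^2 in the unitization; the equation is stated as its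
    scalar part and its part in A. Each iterate commutes with whatever commutes with h, and so does
    the limit. *)
Lemma affine_sqrt : exists s a, [/\ star a = a, 0 <= s <= 1 /\ 2 * s = g + s ^+ 2,
  2%:C *: a = h + (2 * s)%:C *: a + a ** a, mb s 1 a &
  forall y, h ** y = y ** h -> a ** y = y ** a].
Proof.
have sg_nd : nondecreasing_seq sg.
  apply/nondecreasing_seqP => n; have /andP[] := sg_step n; lra.
have sg1 n : sg n <= 1 by have := sgep n; have /andP[] := ep01 n; lra.
have sc : cvgn sg.
  by apply: nondecreasing_is_cvgn => //; exists 1 => _ [n _ <-].
move: sc => /cvg_ex[s hs].
have [a ha] : exists a : A, an n @[n --> \oo] --> a.
  (* [mb_nr] adds the scalar increment to the bound; it is at most the increment of [ep], hence the
     factor 2. *)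
  apply: (@nr_telescope R A an (fun n => 2 * ep n) 2) => n.
    have /andP[h1 h2] := sg_step n.
    have := mb_nr (le_trans h1 h2) (an_step n); rewrite ger0_norm//; lra.
  by have /andP[] := ep01 n; lra.
exists s, a; have sn : sg n.+1 @[n --> \oo] --> s by rewrite cvg_shiftS.
have hn : an n.+1 @[n --> \oo] --> a by rewrite cvg_shiftS.
have s0 : 0 <= s by apply: (cvgr_to_ge hs); near=> n.
have s1 : s <= 1 by apply: (cvgr_to_le hs); near=> n.
split.
- apply: (lim_uniq (cvg_star ha)).
  by apply: cvg_ext ha => n; rewrite an_star.
- split; first by rewrite s0.
  suff e : s = (g + s ^+ 2) / 2 by rewrite {1}e; field.
  apply: (lim_uniq sn); under eq_fun do rewrite sgS.
  apply: cvgM; last exact: cvg_cst.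
  by apply: cvgD; [exact: cvg_cst|apply: cvgM].
- suff e : a = (2^-1)%:C *: (h + (2 * s)%:C *: a + a ** a).
    by rewrite {1}e; staralg R A.
  apply: (lim_uniq hn); under eq_fun do rewrite anS.
  apply: cvgZl_tmp; apply: cvgD; last exact: cvg_amul.
  apply: cvgD; first exact: cvg_cst.
  by apply: cvgZ => //; apply: cvg_realC; apply: cvgM => //; exact: cvg_cst.
- apply: mb_cvg hs ha _ => n; apply: mb_le (an_mb n).
  by have /andP[] := ep01 n.
- move=> y hy; apply: (lim_uniq (cvg_amulr (a := y) ha)).
  by under eq_fun do rewrite an_comm//; exact: cvg_amull.
Unshelve. all: by end_near. Qed.

End AffineSqrt.
End Positivity.

(** * Positive elements and their square roots *)

Section PositiveElements.
Variables (R : realType) (A : cstarType R).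
Implicit Types (a b h x y z p q : A) (c d g r s t K L : R).

Lemma nr_polar p q : star p ** q = star q ** p ->
  nr (p + 'i *: q) ^+ 2 = nr (star p ** p + star q ** q).
Proof.
move=> h; rewrite -nr_cstar; congr nr.
rewrite starD starZ conj_iC amulDl !amulDr !amulZl !amulZr h scalerA mulNr.
by rewrite -expr2 sqr_i opprK; staralg R A.
Qed.

(** p is the mean of p + iq and p - iq; the cross terms cancel in both squares, so both elements
    have the norm on the right. *)
Lemma nr_polar_le p q : star p ** q = star q ** p ->
  nr p ^+ 2 <= nr (star p ** p + star q ** q).
Proof.
move=> h; have e1 := nr_polar h.
have h' : star p ** (- q) = star (- q) ** p by rewrite amulNr starN amulNl h.
have := nr_polar h'; rewrite starN amulNr amulNl opprK => e2.
set u := p + 'i *: q in e1 *; set v := p + 'i *: - q in e2 *.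
have uv : nr u = nr v by apply/eqP; rewrite -(eqrXn2 (ltn0Sn 1)) ?nr_ge0// e1 e2.
have pE : p = (2^-1)%:C *: (u + v).
  by rewrite /u /v scalerN addrACA subrr addr0; lmod R[i] A.
have : nr p <= nr u.
  by rewrite pE nrZp ?invr_ge0//; have := nrD u v; rewrite -uv; lra.
by move=> pu; rewrite -e1 lerXn2r// nnegrE nr_ge0.
Qed.

(** In the unitization, c + a and d + b are commuting self-adjoint elements whose squares add up to
    t^2, so (c + a) + i (d + b) behaves as t times a unitary and its real part has norm at most t.
    The last two hypotheses are the scalar part and the part in A of that equation. *)
Lemma affine_unitary c d t a b : 0 <= t -> star a = a -> star b = b ->
  a ** b = b ** a -> c ^+ 2 + d ^+ 2 = t ^+ 2 ->
  (2 * c)%:C *: a + a ** a + ((2 * d)%:C *: b + b ** b) = 0 -> mb c t a.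
Proof.
move=> t0 ha hb ab ht h0 x.
set p := c%:C *: x + a ** x; set q := d%:C *: x + b ** x.
have pq : star p ** q = star q ** p.
  have e : star p ** q - star q ** p = star x ** (a ** b - b ** a) ** x.
    by rewrite /p /q !(starD, starM, starZ) ha hb !conj_realC; staralg R A.
  by apply/eqP; rewrite -subr_eq0 e ab subrr amul0r amul0l.
have := nr_polar_le pq.
have -> : star p ** p + star q ** q = (t ^+ 2)%:C *: (star x ** x) + star x **
    ((2 * c)%:C *: a + a ** a + ((2 * d)%:C *: b + b ** b)) ** x.
  by rewrite -ht /p /q !(starD, starM, starZ) ha hb !conj_realC; staralg R A.
rewrite h0 amul0r amul0l addr0 nrZp ?sqr_ge0// nr_cstar -exprMn.
by rewrite ler_pXn2r ?nnegrE ?mulr_ge0 ?nr_ge0.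
Qed.

(** By [affine_sqrt] the element t^2 - (c + a)^2 has a self-adjoint root t (1 - s - e). Paired with
    c + a it satisfies [affine_unitary], so it has norm at most t, and squaring gives the bound. *)
Lemma mb_sqr_compl c t a : 0 <= c -> c <= t -> star a = a -> mb c t a ->
  mb (t ^+ 2 - c ^+ 2) (t ^+ 2) (- ((2 * c)%:C *: a + a ** a)).
Proof.
move=> c0 ct ha hm; have [t0|t0] := leP t 0.
  have {}t0 : t = 0 by apply/eqP; rewrite eq_le t0 (le_trans c0).
  have {}c0 : c = 0 by apply/eqP; rewrite eq_le c0 -t0 ct.
  have {}ha : a = 0.
    by apply: nr_le0; move: hm; rewrite t0 => /(mb_nr (lexx 0)); rewrite c0 normr0 addr0.
  move=> x; rewrite t0 c0 ha subrr scale0r amul0l mulr0 scaler0 !addr0 oppr0.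
  by rewrite amul0l addr0 nr0 expr0n mul0r.
(* Here g + h is the square of (c + a) / t. *)
pose g := (c / t) ^+ 2; pose h := (t^-1 ^+ 2)%:C *: ((2 * c)%:C *: a + a ** a).
have tn : t != 0 by rewrite gt_eqF.
have k0 : 0 <= c / t by rewrite divr_ge0// ltW.
have k1 : c / t <= 1 by rewrite ler_pdivrMr ?mul1r.
have g0 : 0 <= g by rewrite sqr_ge0.
have g1 : g <= 1 by rewrite expr_le1.
have hh : star h = h by rewrite /h !(starZ, starD, starM) !conj_realC ha.
have hb : mb g 1 h.
  have ti : 0 <= t^-1 by rewrite invr_ge0 ltW.
  have := mbM (mulr_ge0 ti (ltW t0)) (mbZ ti hm) (mbZ ti hm).
  rewrite mulVf// mulr1 -expr2 [t^-1 * c]mulrC.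
  suff -> : (c / t)%:C *: ((t^-1)%:C *: a) + (c / t)%:C *: ((t^-1)%:C *: a) +
   ((t^-1)%:C *: a) ** ((t^-1)%:C *: a) = h by [].
  by rewrite /h; staralg R A.
have [s [e [he [/andP[s0 s1] hs] e2 em ec]]] := affine_sqrt g0 g1 hh hb.
have ae : a ** e = e ** a.
  by apply/esym/ec; rewrite /h; staralg R A.
have ht2 : 2%:C *: e = (2 * s)%:C *: e + e ** e + h by rewrite e2; staralg R A.
have hk : (t ^+ 2)%:C *: h = (2 * c)%:C *: a + a ** a.
  by rewrite /h; staralg R A.
have eq0 : (2 * (t * (1 - s)))%:C *: (- t%:C *: e) + (- t%:C *: e) ** (- t%:C *: e)
   = - ((2 * c)%:C *: a + a ** a).
  rewrite -hk; have -> : h = 2%:C *: e - ((2 * s)%:C *: e + e ** e).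
    by rewrite ht2 addrAC subrr add0r.
  by staralg R A.
have eqc : (t * (1 - s)) ^+ 2 = t ^+ 2 - c ^+ 2.
  have -> : c ^+ 2 = t ^+ 2 * g by rewrite /g; field.
  have -> : g = 2 * s - s ^+ 2 by rewrite hs; ring.
  by ring.
have hu : mb (t * (1 - s)) t (- t%:C *: e).
  apply: (@affine_unitary _ c t _ a) => //; first exact: ltW.
  - by rewrite starZ he rmorphN /= conj_realC.
  - by rewrite amulZl amulZr ae.
  - by rewrite eqc subrK.
  - by rewrite eq0 addNr.
have := mbM (ltW t0) hu hu; rewrite -!expr2 eqc.
suff -> : (t * (1 - s))%:C *: (- t%:C *: e) + (t * (1 - s))%:C *: (- t%:C *: e) +
  (- t%:C *: e) ** (- t%:C *: e) = - ((2 * c)%:C *: a + a ** a) by [].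
by rewrite -eq0; staralg R A.
Qed.

(** Positivity as a norm inequality in the unitization: t - b has norm at most t. Sums and
    nonnegative multiples are then immediate, and positivity of x^* x becomes the substantial point
    ([Pos_star_mul]). *)
Definition Pos b := star b = b /\ exists2 t, 0 <= t & mb t t (- b).

Lemma mb_shift t s b : 0 <= s -> mb t t (- b) -> mb (t + s) (t + s) (- b).
Proof.
move=> s0 h; rewrite -[- b]addr0; apply: mbD => // x.
by rewrite amul0l addr0 nrZp.
Qed.

(** [affine_sqrt] with g = 1 and h = - b / t yields a root of 1 - g - h = b / t. *)
Lemma Pos_sqrt b : Pos b -> exists c : A, [/\ star c = c, Pos c, c ** c = b &
  forall y, b ** y = y ** b -> c ** y = y ** c].
Proof.
move=> [hb [t0 t00 /(mb_shift ler01) ht0]].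
have [t t1 ht] : exists2 t, 0 < t & mb t t (- b) by exists (t0 + 1) => //; lra.
have tn : t != 0 by rewrite gt_eqF.
have hm : mb 1 1 ((t^-1)%:C *: - b).
  by have := mbZ (r := t^-1) _ ht; rewrite invr_ge0 (ltW t1) mulVf// => /(_ isT).
have hh : star ((t^-1)%:C *: - b) = (t^-1)%:C *: - b.
  by rewrite starZ starN hb conj_realC.
have [s [e [he [/andP[s0 s1] hs] e2 em ec]]] := affine_sqrt ler01 (lexx 1) hh hm.
(* For g = 1 the scalar equation reads (s - 1)^2 = 0, so the root 1 - s - e has no scalar part and
   lies in A. *)
have {}hs : s = 1.
  by apply/eqP; rewrite -subr_eq0 -sqrf_eq0; apply/eqP; have := hs; nra.
subst s; pose k := Num.sqrt t.
have k0 : 0 <= k by rewrite sqrtr_ge0.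
have kk : k ^+ 2 = t by rewrite sqr_sqrtr// ltW.
have hc : star (- k%:C *: e) = - k%:C *: e by rewrite starZ he rmorphN /= conj_realC.
exists (- k%:C *: e); split=> //.
- split=> //; exists k => //; have := mbZ k0 em; rewrite mulr1.
  by rewrite scaleNr opprK.
- have -> : (- k%:C *: e) ** (- k%:C *: e) = (k ^+ 2)%:C *: (e ** e) by staralg R A.
  have -> : e ** e = (t^-1)%:C *: b.
    have -> : e ** e = 2%:C *: e - (2 * 1)%:C *: e - (t^-1)%:C *: - b.
      by rewrite e2; staralg R A.
    by staralg R A.
  by rewrite kk; staralg R A.
- move=> y hy; rewrite amulZl amulZr ec//.
  by rewrite amulZl amulZr amulNl amulNr hy.
Qed.

Lemma mb_sqr (c : A) t : star c = c -> nr c ^+ 2 <= t -> mb t t (- (c ** c)).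
Proof.
move=> hc ct; have h := nr_mb (nr_ge0 c) (lexx (nr c)).
have := mb_sqr_compl (lexx 0) (nr_ge0 c) hc h.
rewrite mulr0 expr0n subr0 scale0r add0r -(subrK (nr c ^+ 2) t) [t - _ + _]addrC.
by apply: mb_shift; rewrite subr_ge0.
Qed.

Lemma Pos_sqr (c : A) : star c = c -> Pos (c ** c).
Proof.
move=> hc; split; first by rewrite starM hc.
by exists (nr c ^+ 2); [exact: sqr_ge0|exact: mb_sqr].
Qed.

(** The t in [Pos] may be large; writing b as a square shows that every t above the norm of b will
    do. *)
Lemma Pos_mb b t : Pos b -> nr b <= t -> mb t t (- b).
Proof.
move=> /Pos_sqrt[c [hc _ <- _]] bt; apply: mb_sqr => //.
by rewrite -nr_cstar hc.
Qed.

Lemma Pos0 : Pos (0 : A).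
Proof. by rewrite -(amul0l (0 : A)); apply: Pos_sqr; rewrite star0. Qed.

Lemma PosD b1 b2 : Pos b1 -> Pos b2 -> Pos (b1 + b2).
Proof.
move=> [h1 [t1 t10 m1]] [h2 [t2 t20 m2]]; split; first by rewrite starD h1 h2.
by exists (t1 + t2); [exact: addr_ge0|rewrite opprD; exact: mbD].
Qed.

Lemma PosZ r b : 0 <= r -> Pos b -> Pos (r%:C *: b).
Proof.
move=> r0 [h [t t0 m]]; split; first by rewrite starZ h conj_realC.
by exists (r * t); [exact: mulr_ge0|rewrite -scalerN; exact: mbZ].
Qed.

Lemma Pos_sum (I : Type) (s : seq I) (P : pred I) (F : I -> A) :
  (forall i, P i -> Pos (F i)) -> Pos (\sum_(i <- s | P i) F i).
Proof. by move=> h; elim/big_ind: _ => //; [exact: Pos0|exact: PosD]. Qed.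

(** The sum of r + b and t - b is r + t, and the second summand takes away at most t. *)
Lemma Pos_lower b r x : Pos b -> 0 <= r -> r * nr x <= nr (r%:C *: x + b ** x).
Proof.
move=> [_ [t t0 /(_ x) m]] r0.
have := nrD (r%:C *: x + b ** x) (t%:C *: x + (- b) ** x).
have -> : r%:C *: x + b ** x + (t%:C *: x + (- b) ** x) = (r + t)%:C *: x.
  by staralg R A.
by rewrite nrZp ?addr_ge0//; lra.
Qed.

End PositiveElements.

(** Used to solve linear equations where no unit, hence no inverse, is at hand. *)
Lemma contraction_fix (R : realType) (X : completeNormedModType R[i]) (f : X -> X)
    (q : R) : 0 <= q -> q < 1 -> (forall x y, nr (f x - f y) <= q * nr (x - y)) ->
  exists x, f x = x.
Proof.
move=> q0 q1 fq; pose y := fix y n := if n is m.+1 then f (y m) else 0 : X.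
pose C := nr (y 1%N) / (1 - q).
have q10 : 0 < 1 - q by rewrite subr_gt0.
have C0 : 0 <= C by rewrite divr_ge0 ?nr_ge0// ltW.
have step n : nr (y n.+1 - y n) <= C * (1 - q) * q ^+ n.
  elim: n => [|n IH]; first by rewrite subr0 expr0 mulr1 divfK ?gt_eqF.
  by rewrite (le_trans (fq _ _))// exprS mulrCA ler_wpM2l.
have [l hl] : exists l : X, y n @[n --> \oo] --> l.
  apply: (@nr_telescope R X y (fun n => - (C * q ^+ n)) 0) => n.
    by rewrite (le_trans (step n))// exprS; lra.
  by rewrite oppr_le0 mulr_ge0// exprn_ge0.
exists l; have hl' : y n.+1 @[n --> \oo] --> l by rewrite cvg_shiftS.
apply: lim_uniq hl'; apply/cvg_nrP => e e0.
move/cvg_nrP: hl => /(_ _ e0); apply: filterS => n hn /=.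
by rewrite (le_trans (fq _ _))// (le_trans _ hn)// ler_piMl ?nr_ge0// ltW.
Qed.

(** * Positivity of x^* x and monotonicity of the norm *)

Section Order.
Variables (R : realType) (A : cstarType R).
Implicit Types (a b h x y z p q u : A) (c d g r s t K L : R).

(** 1 - a^* a is the square of 1 - e. The identity survives every homomorphism, which makes
    homomorphisms contractive without a spectral radius. *)
Lemma ball_sqrt a : nr a <= 1 ->
  exists e : A, [/\ star e = e, 2%:C *: e = star a ** a + e ** e &
    forall y, star a ** a ** y = y ** (star a ** a) -> e ** y = y ** e].
Proof.
move=> a1; have hb : mb 0 1 (star a ** a).
  by apply: nr_mb => //; rewrite nr_cstar expr_le1 ?nr_ge0.
have hh : star (star a ** a) = star a ** a by rewrite starM starK.
have [s [e [he [/andP[s0 s1] hs] e2 _ hc]]] := affine_sqrt (lexx 0) ler01 hh hb.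
exists e; split=> //; have {}hs : s = 0.
  have : s * (2 - s) = 0 by rewrite mulrBr -expr2 mulrC hs; ring.
  by move=> /eqP; rewrite mulf_eq0 => /orP[/eqP//|]; rewrite subr_eq0 => /eqP; lra.
by rewrite e2 hs; staralg R A.
Qed.

(* The function [t (s - t)] is at most [s^2 / 4] on the spectrum of [z^2]. *)
Let quarter_bound z s : star z = z -> s = nr (z ** z) ->
  nr (s%:C *: (z ** z) - z ** z ** (z ** z)) <= s ^+ 2 / 4.
Proof.
move=> hz sD; have sE : s = nr z ^+ 2 by rewrite sD -nr_cstar hz.
have s0 : 0 <= s by rewrite sE sqr_ge0.
pose k := nr z; have k0 : 0 <= k by rewrite nr_ge0.
have kk : k ^+ 2 = s by rewrite sE.
have [kz|kn] := eqVneq k 0.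
  have -> : z = 0 by apply: nr_eq0.
  by rewrite !amul0l scaler0 subrr nr0 divr_ge0 ?sqr_ge0.
have sn : s != 0 by rewrite -kk sqrf_eq0.
have [|e [he e2 hc]] := @ball_sqrt ((k^-1)%:C *: z).
  by rewrite nrZp ?invr_ge0// mulVf.
move: e2 hc; rewrite starZ hz conj_realC amulZl amulZr scalerA -realCM -expr2.
rewrite exprVn kk => e2 hc.
have ze : e ** z = z ** e.
  by apply: hc; rewrite amulZl amulZr amulA.
(* b = k z (1 - e) is a root of s u - u^2, since (1 - e)^2 = 1 - u / s. *)
pose b := k%:C *: (z - z ** e); pose u := z ** z.
have zzs : star u = u by rewrite /u starM hz.
have bE : b ** b = s%:C *: u - u ** u.
  have e3 : e ** e = 2%:C *: e - (s^-1)%:C *: u by rewrite e2 addrC addKr.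
  have -> : b ** b = (k ^+ 2)%:C *: (z ** z - (2%:C *: (z ** z ** e)) + z ** z ** (e ** e)).
    have h1 : z ** e ** z = z ** z ** e by rewrite -amulA ze amulA.
    have h2 : z ** e ** (z ** e) = z ** z ** (e ** e).
      by rewrite amulA h1 -amulA.
    have -> : b ** b = (k ^+ 2)%:C *: (z ** z - z ** (z ** e) - z ** e ** z + z ** e ** (z ** e)).
      by rewrite /b; staralg R A.
    by rewrite h1 h2; staralg R A.
  by rewrite kk e3 /u; staralg R A.
have bu : b ** u = u ** b.
  have zue : e ** u = u ** e by rewrite /u amulA ze -amulA ze amulA.
  have -> : u ** b = k%:C *: (z ** z ** z - z ** (u ** e)) by rewrite /b /u; staralg R A.
  by rewrite -zue /b /u; staralg R A.
have hb : star b = b by rewrite /b starZ conj_realC starB starM hz he ze.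
(* The equation used is b^2 + (u - s / 2)^2 = (s / 2)^2. *)
have hm : mb 0 (s / 2) b.
  apply: (@affine_unitary _ _ 0 (- (s / 2)) _ b u) => //; first by rewrite divr_ge0.
    by ring.
  by rewrite bE; staralg R A.
have := mb_nr _ hm; rewrite normr0 addr0 divr_ge0// => /(_ isT) nb.
rewrite -/u -bE (le_trans (nrM _ _))//.
have -> : s ^+ 2 / 4 = (s / 2) * (s / 2) by field.
by rewrite ler_pM ?nr_ge0.
Qed.

(** Since y^* y = - z^2, the elements y k and z k have equal norms for all k. With s the norm of
    z^2, the lower bound s for s + y y^*, applied to y z, gives that s^2 is at most the norm of s
    z^2 - z^4, hence at most s^2 / 4. So s = 0. *)
Let neg_star_mul_eq0 y z : star z = z -> star y ** y = - (z ** z) ->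
  Pos (y ** star y) -> y = 0.
Proof.
move=> hz yy PW; pose s := nr (z ** z).
have nyk k : nr (y ** k) = nr (z ** k).
  apply/eqP; rewrite -(eqrXn2 (ltn0Sn 1)) ?nr_ge0// -!nr_cstar.
  rewrite !starM hz -!amulA [star y ** (y ** k)]amulA yy amulNl amulNr nrN.
  by rewrite -[z ** z ** k]amulA.
have := Pos_lower (y ** z) PW (nr_ge0 (z ** z)).
have -> : (nr (z ** z))%:C *: (y ** z) + y ** star y ** (y ** z) =
    y ** ((nr (z ** z))%:C *: z - z ** z ** z).
  rewrite amulBr amulZr; congr (_ + _).
  by rewrite -!amulA [star y ** _]amulA yy amulNl amulNr -!amulA.
rewrite !nyk; have -> : z ** ((nr (z ** z))%:C *: z - z ** z ** z) =
  (nr (z ** z))%:C *: (z ** z) - z ** z ** (z ** z) by staralg R A.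
rewrite -/s => h1; have := quarter_bound hz (erefl s); rewrite -/s => h2.
have s0 : s = 0.
  have := le_trans h1 h2; have : 0 <= s by rewrite nr_ge0.
  move: (s) => s'; nra.
by apply: star_amul_eq0; rewrite yy (nr_eq0 s0) oppr0.
Qed.

(** Let m be the root of b^2 and n = m - b. For y = x n one finds y^* y = n b n = - m n^2 = - z^2
    with z = r n, where r is the root of m. On the other hand y y^* + y^* y is half of p^2 + q^2, so
    y y^* is a sum of squares of self-adjoint elements. Hence y = 0, which forces n = 0 and b =
    m. *)
Lemma Pos_star_mul x : Pos (star x ** x).
Proof.
pose b := star x ** x; have hb : star b = b by rewrite /b starM starK.
have [m [hm Pm mm mc]] := Pos_sqrt (Pos_sqr hb).
have mb : m ** b = b ** m by apply: mc; rewrite amulA.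
pose n := m - b; have hn : star n = n by rewrite /n starB hm hb.
have bn : b ** n = - (m ** n) by rewrite /n !amulBr mm mb opprB.
have [r [hr _ rr rc]] := Pos_sqrt Pm.
have rn : r ** n = n ** r by apply: rc; rewrite /n amulBr amulBl mb.
pose z := r ** n; have hz : star z = z by rewrite /z starM hr hn -rn.
have zz : z ** z = m ** n ** n.
  by rewrite /z -amulA [n ** (r ** n)]amulA -rn !amulA rr.
pose y := x ** n.
have yy : star y ** y = - (z ** z).
  have -> : star y ** y = n ** (b ** n) by rewrite /y /b starM hn !amulA.
  have nm : n ** m = m ** n by rewrite /n amulBl amulBr mb.
  by rewrite bn amulNr amulA nm zz.
have PW : Pos (y ** star y).
  pose p := y + star y; pose q := 'i *: (y - star y).
  have hp : star p = p by rewrite /p starD starK addrC.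
  have hq : star q = q by rewrite /q starZ conj_iC starB starK scaleNr -scalerN opprB.
  have -> : y ** star y = (2^-1)%:C *: (p ** p + q ** q) + z ** z.
    have -> : q ** q = - ((y - star y) ** (y - star y)).
      by rewrite /q amulZl amulZr scalerA -expr2 sqr_i scaleN1r.
    have -> : z ** z = - (star y ** y) by rewrite yy opprK.
    by rewrite /p; staralg R A.
  apply: PosD; last exact: Pos_sqr.
  by apply: PosZ; [rewrite invr_ge0|apply: PosD; exact: Pos_sqr].
have y0 : y = 0 by apply: (neg_star_mul_eq0 hz yy PW).
have bn0 : b ** n = 0 by rewrite /b -amulA -/y y0 amul0r.
have n0 : n = 0.
  apply: star_amul_eq0; rewrite hn {1}/n amulBl bn0 subr0.
  by rewrite -[m ** n]opprK -bn bn0 oppr0.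
have mE : m = b by apply/eqP; rewrite -subr_eq0; apply/eqP.
by rewrite -/b -mE.
Qed.

Lemma Pos_mul_star x : Pos (x ** star x).
Proof. by rewrite -{1}[x]starK; exact: Pos_star_mul. Qed.

(** With M the norm of b + c, the element t + b = (t - c) + (b + c) has norm at most t + M, so (M -
    b) / (t + M) has a root by [affine_sqrt]. Suitably scaled, this root and the root [beta] of b
    have squares adding up to M, and [affine_unitary] bounds [beta] by the square root of M. *)
Lemma Pos_norm_le b (c : A) : Pos b -> Pos c -> nr b <= nr (b + c).
Proof.
move=> Pb Pc; pose M := nr (b + c); pose t := nr c + 1.
have M0 : 0 <= M by rewrite nr_ge0.
have t1 : 1 <= t by rewrite /t lerDr nr_ge0.
have hc : mb t t (- c) by apply: (Pos_mb Pc); rewrite lerDl.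
have hbc : mb 0 M (b + c) by apply: nr_mb.
have hb : mb t (t + M) b.
  by have := mbD hc hbc; rewrite addr0 [b + c]addrC addKr.
have [beta [hbeta _ bb bcomm]] := Pos_sqrt Pb.
clearbody t.
have tM : 0 < t + M by rewrite ltr_wpDr// (lt_le_trans ltr01).
have tMn : t + M != 0 by rewrite gt_eqF.
have hs : star (((t + M)^-1)%:C *: b) = ((t + M)^-1)%:C *: b.
  by rewrite starZ conj_realC; case: Pb => ->.
have hm : mb (t / (t + M)) 1 (((t + M)^-1)%:C *: b).
  have := mbZ (r := (t + M)^-1) _ hb; rewrite invr_ge0 (ltW tM) => /(_ isT).
  by rewrite (mulVf tMn) mulrC.
have g0 : 0 <= t / (t + M) by rewrite divr_ge0 ?(le_trans ler01 t1) ?ltW.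
have g1 : t / (t + M) <= 1 by rewrite ler_pdivrMr// mul1r lerDl.
have [s [e [he [/andP[s0 s1] sE] e2 _ ec]]] := affine_sqrt g0 g1 hs hm.
pose k := Num.sqrt (t + M).
have kk : k ^+ 2 = t + M by rewrite sqr_sqrtr// ltW.
pose L := Num.sqrt M; have LL : L ^+ 2 = M by rewrite sqr_sqrtr.
have eb : e ** beta = beta ** e.
  by apply: ec; rewrite amulZl amulZr -bb amulA.
have hbL : mb 0 L beta.
  apply: (@affine_unitary _ _ 0 (k * (1 - s)) _ beta (- k%:C *: e)) => //.
  - exact: sqrtr_ge0.
  - by rewrite starZ he rmorphN /= conj_realC.
  - by rewrite amulZl amulZr eb.
  - rewrite expr0n add0r LL exprMn kk.
    have -> : (1 - s) ^+ 2 = 1 - t / (t + M).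
      have -> : t / (t + M) = 2 * s - s ^+ 2 by rewrite sE; ring.
      by ring.
    by field.
  - have -> : (2 * 0)%:C *: beta + beta ** beta + ((2 * (k * (1 - s)))%:C *:
      (- k%:C *: e) + (- k%:C *: e) ** (- k%:C *: e)) =
      b - (k ^+ 2)%:C *: (2%:C *: e - (2 * s)%:C *: e - e ** e).
      by rewrite bb; staralg R A.
    by move: tMn; rewrite e2 kk; move: (t + M) => T Tn; staralg R A.
have := mb_nr (sqrtr_ge0 M) hbL; rewrite normr0 addr0 => bL.
rewrite -/M -LL expr2 -bb (le_trans (nrM _ _))// ler_pM ?nr_ge0//.
Qed.

Lemma nr_le_star x y : nr x ^+ 2 <= nr (star x ** x + star y ** y).
Proof. by rewrite -nr_cstar; apply: Pos_norm_le; exact: Pos_star_mul. Qed.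

End Order.

(** * Approximate units *)

Section ApproximateUnits.
Variables (R : realType) (A : cstarType R).
Implicit Types (a b x y u : A) (r s t e : R).

Definition unitlike u :=
  [/\ star u = u, nr u <= 1 & forall x, nr (x - u ** x) <= nr x].

(** 2 u - u^2 is u plus the conjugate of 1 - u by the root d of u, and 1 - d^2 is again a square by
    [ball_sqrt]. As a sum of squares the identity passes through homomorphisms and bounds the action
    of 1 - u there by 1. *)
Lemma unitlike_decomp u : unitlike u ->
  exists d f : A, 2%:C *: u - u ** u = star d ** d + star f ** f.
Proof.
move=> [hu u1 um]; have Pu : Pos u.
  split=> //; exists 1 => // x; rewrite scale1r amulNl mul1r; exact: um.
have [d [hd _ dd _]] := Pos_sqrt Pu.
have d1 : nr d <= 1.
  by have := nr_ge0 d; rewrite -(expr_le1 (ltn0Sn 1)) -?nr_cstar ?hd ?dd ?nr_ge0.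
have [f [hf f2 fc]] := ball_sqrt d1.
rewrite hd dd in f2 fc; have fd : f ** d = d ** f.
  by apply: fc; rewrite -dd amulA.
exists d, (d - f ** d); rewrite starB starM hd hf -dd.
have -> : 2%:C *: (d ** d) - d ** d ** (d ** d) =
  d ** d + (d ** d - d ** (d ** d) ** d) by staralg R A.
have -> : (d - d ** f) ** (d - f ** d) = d ** d - d ** (2%:C *: f - f ** f) ** d.
  by staralg R A.
have -> // : d ** d = 2%:C *: f - f ** f by rewrite f2 dd addrK.
Qed.

(** With b the sum of the x x^* and y = b (d + b)^-1, the element u = 1 - (1 - y)^2 lies in A;
    squaring turns the bound 1 for 1 - y into the bound 1 for u. Moreover (1 - y) x x^* (1 - y) lies
    below (1 - y) b (1 - y) = d y (1 - y), which is small. *)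
Lemma approx_unit (s : seq A) e : 0 < e ->
  exists2 u, unitlike u & forall x, x \in s -> nr (x - u ** x) <= e.
Proof.
move=> e0; pose b := \sum_(x <- s) x ** star x.
have Pb : Pos b by apply: Pos_sum => x _; exact: Pos_mul_star.
have hb : star b = b by case: Pb.
(* The final estimate is d times the norm of y - y^2, which is at most that of y, hence at most
   2. *)
pose d := e ^+ 2 / 2; have d0 : 0 < d by rewrite divr_gt0// exprn_gt0.
have hm := Pos_mb Pb (lexx _); pose T := nr b.
have T0 : 0 <= T by rewrite nr_ge0.
have Td : 0 < d + T by rewrite ltr_wpDr.
have dn : d != 0 by rewrite gt_eqF.
(* The equation (d + b) y = b, turned into a fixed point problem by adding T y - b y to both sides;
   T - b has norm at most T. *)
have [y hy] : exists y : A, ((d + T)^-1)%:C *: (b + (T%:C *: y - b ** y)) = y.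
  apply: (contraction_fix (q := T / (d + T))).
  - by rewrite divr_ge0// ltW.
  - by rewrite ltr_pdivrMr// mul1r ltrDr.
  move=> x y; have -> : forall k : R, k%:C *: (b + (T%:C *: x - b ** x)) -
      k%:C *: (b + (T%:C *: y - b ** y)) = k%:C *: (T%:C *: (x - y) + (- b) ** (x - y)).
    by move=> k; staralg R A.
  rewrite nrZp ?invr_ge0 ?(ltW Td)// [T / _]mulrC -mulrA ler_wpM2l//.
  by rewrite invr_ge0 ltW.
have {}hy : d%:C *: y + b ** y = b.
  have : (d + T)%:C *: y = b + (T%:C *: y - b ** y).
    by rewrite -{1}hy scalerA -realCM divff ?gt_eqF// scale1r.
  move=> h; have -> : d%:C *: y = (d + T)%:C *: y - T%:C *: y by staralg R A.
  by rewrite h; staralg R A.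
have inj x : d%:C *: x + b ** x = 0 -> x = 0.
  move=> h; have := Pos_lower x Pb (ltW d0); rewrite h nr0 pmulr_rle0//.
  exact: nr_le0.
have by_ : b ** y = y ** b.
  apply/eqP; rewrite -subr_eq0; apply/eqP/inj.
  have -> : d%:C *: (b ** y - y ** b) + b ** (b ** y - y ** b) =
    b ** (d%:C *: y + b ** y) - (d%:C *: y + b ** y) ** b by staralg R A.
  by rewrite hy subrr.
have sy : star y = y.
  apply/eqP; rewrite -subr_eq0; apply/eqP/inj.
  have hy' : d%:C *: star y + b ** star y = b.
    have -> : b ** star y = star (b ** y) by rewrite by_ starM hb.
    by rewrite -[d%:C]conj_realC -starZ -starD hy.
  have -> : d%:C *: (star y - y) + b ** (star y - y) =
    (d%:C *: star y + b ** star y) - (d%:C *: y + b ** y) by staralg R A.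
  by rewrite hy hy' subrr.
have my x : nr (x - y ** x) <= nr x.
  have := Pos_lower (x - y ** x) Pb (ltW d0).
  have -> : d%:C *: (x - y ** x) + b ** (x - y ** x) = d%:C *: x +
    (b ** x - (d%:C *: y + b ** y) ** x) by staralg R A.
  by rewrite hy subrr addr0 nrZp ?(ltW d0)// ler_pM2l.
have m1 : mb 1 1 (- y) by move=> x; rewrite scale1r amulNl mul1r.
pose u := 2%:C *: y - y ** y.
have su : star u = u by rewrite /u starB starZ starM sy conj_realC.
have xu x : x - u ** x = (x - y ** x) - y ** (x - y ** x) by rewrite /u; staralg R A.
exists u; first split=> //.
- have sny : star (- y) = - y by rewrite starN sy.
  have := mb_sqr_compl ler01 (lexx 1) sny m1.
  rewrite expr1n subrr => /(mb_nr ler01); rewrite normr0 addr0.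
  by have -> : - ((2 * 1)%:C *: - y + (- y) ** (- y)) = u by rewrite /u; staralg R A.
- by move=> x; rewrite xu (le_trans (my _)).
move=> x xs; rewrite xu (le_trans (my _))//.
rewrite -(@ler_pXn2r _ 2) ?nnegrE ?nr_ge0 ?(ltW e0)// -nr_cstar'.
have -> : (x - y ** x) ** star (x - y ** x) =
  x ** star x - y ** (x ** star x) - x ** star x ** y + y ** (x ** star x) ** y.
  by rewrite starB starM sy; staralg R A.
pose cj z := z - y ** z - z ** y + y ** z ** y.
have Pcj z : Pos z -> Pos (cj z).
  move=> /Pos_sqrt[c [hc _ <- _]].
  have -> : cj (c ** c) = star (c - c ** y) ** (c - c ** y).
    by rewrite /cj starB starM hc sy; staralg R A.
  exact: Pos_star_mul.
have cjb : cj b = d%:C *: (y - y ** y).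
  have e1 : b - y ** b = d%:C *: y by rewrite -by_ -{1}hy addrK.
  have -> : cj b = (b - y ** b) - (b - y ** b) ** y by rewrite /cj; staralg R A.
  by rewrite e1; staralg R A.
have Pbx : Pos (b - x ** star x).
  rewrite /b (big_rem x)//= addrAC subrr add0r.
  by apply: Pos_sum => z _; exact: Pos_mul_star.
have cjD : cj b = cj (x ** star x) + cj (b - x ** star x) by rewrite /cj; staralg R A.
rewrite -/(cj _); apply: (le_trans (Pos_norm_le (Pcj _ (Pos_mul_star x)) (Pcj _ Pbx))).
rewrite -cjD cjb nrZp ?(ltW d0)//.
have y2 : nr y <= 2 by have := mb_nr ler01 m1; rewrite nrN normr1.
have := my y; have -> : e ^+ 2 = d * 2 by rewrite /d; field.
by move=> h; rewrite ler_wpM2l ?(ltW d0)// (le_trans h).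
Qed.

(** The canonical approximate unit as a filter: no net is chosen, and every finite list is
    eventually approximated on both sides. *)
Definition au : set_system A := filter_from [set p : seq A * R | 0 < p.2]
  (fun p => [set u | unitlike u /\
     forall x, x \in p.1 -> nr (u ** x - x) <= p.2 /\ nr (x ** u - x) <= p.2]).

Global Instance au_filter : ProperFilter au.
Proof.
apply: filter_from_proper.
  apply: filter_from_filter; first by exists ([::], 1) => /=.
  move=> [s1 e1] [s2 e2] /= h1 h2; exists (s1 ++ s2, Num.min e1 e2) => /=.
    by rewrite lt_min h1.
  move=> u /= [hu h]; split; split=> // x xs.
    by have [] := h x; rewrite ?mem_cat ?xs// !le_min => /andP[? _] /andP[].
  by have [] := h x; rewrite ?mem_cat ?xs ?orbT// !le_min => /andP[_ ?] /andP[].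
move=> [s e] /= e0; have [u hu h] := approx_unit (s ++ map star s) e0.
exists u; split=> // x xs; split; first by rewrite nr_distC h// mem_cat xs.
rewrite -nr_star starB starM; case: (hu) => -> _ _; rewrite nr_distC h//.
by rewrite mem_cat map_f ?orbT.
Qed.

Lemma au_unitlike : \forall u \near au, unitlike u.
Proof. by exists ([::], 1) => [|u []] /=. Qed.

Lemma au_l x : u ** x @[u --> au] --> x.
Proof.
apply/cvg_nrP => e e0; exists ([:: x], e) => //= u [_ /(_ x)].
by rewrite mem_head => /(_ isT)[].
Qed.

Lemma au_r x : x ** u @[u --> au] --> x.
Proof.
apply/cvg_nrP => e e0; exists ([:: x], e) => //= u [_ /(_ x)].
by rewrite mem_head => /(_ isT)[].
Qed.

End ApproximateUnits.

(** * Homomorphisms and module actions *)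

Section Homomorphisms.
Variables (R : realType) (A : cstarType R).
Implicit Types (a b e : A).

Lemma star_hom0 (W : starAlgType R) (f : A -> W) : star_hom f -> f 0 = 0.
Proof. by move=> hf; have := star_homZ hf 0 0; rewrite !scale0r. Qed.

Lemma star_homN (W : starAlgType R) (f : A -> W) a : star_hom f -> f (- a) = - f a.
Proof. by move=> hf; rewrite -scaleN1r (star_homZ hf) scaleN1r. Qed.

Lemma star_homB (W : starAlgType R) (f : A -> W) a b :
  star_hom f -> f (a - b) = f a - f b.
Proof. by move=> hf; rewrite (star_homD hf) (star_homN _ hf). Qed.

Lemma star_hom_sum (W : starAlgType R) (f : A -> W) (I : Type) (s : seq I) (F : I -> A) :
  star_hom f -> f (\sum_(i <- s) F i) = \sum_(i <- s) f (F i).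
Proof. by move=> hf; apply: big_morph; [exact: star_homD hf|exact: star_hom0]. Qed.

(** Reduction to the unit ball, where [ball_sqrt] applies. *)
Lemma contr_scale (g : A -> R) : (forall (r : R) a, 0 <= r -> g (r%:C *: a) = r * g a) ->
  forall C, (forall a, nr a <= 1 -> g a <= C) -> forall a, g a <= nr a * C.
Proof.
move=> gZ C h a; have [a0|a0] := eqVneq (nr a) 0.
  have -> : a = (0 : R)%:C *: a by rewrite (nr_eq0 a0) scaler0.
  by rewrite gZ// mul0r scale0r nr0 mul0r.
have a1 : 0 < nr a by rewrite lt_neqAle eq_sym a0 nr_ge0.
have -> : g a = nr a * g (((nr a)^-1)%:C *: a).
  by rewrite gZ ?invr_ge0 ?nr_ge0// mulrA divff ?mul1r.
rewrite ler_wpM2l ?nr_ge0// h// nrZp ?invr_ge0 ?nr_ge0//.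
by rewrite mulVf.
Qed.

(** With e from [ball_sqrt], the difference between x^* x and the square of f(a) x is the square of
    x - f(e) x; multiplying by x stands in for a unit. *)
Lemma star_hom_mulC (B : cstarType R) (f : A -> B) a x : star_hom f ->
  nr (f a ** x) <= nr a * nr x.
Proof.
move=> hf; move: a; apply: contr_scale => [r a r0|a a1].
  by rewrite (star_homZ hf) amulZl nrZp.
have [e [he e2 _]] := ball_sqrt a1.
rewrite -(@ler_pXn2r _ 2) ?nnegrE ?nr_ge0//.
have hfe : star (f e) = f e by rewrite -(star_hom_star hf) he.
have h2 : f (star a ** a) = 2%:C *: f e - f e ** f e.
  by rewrite -(star_homZ hf) -(star_homM hf) -(star_homB _ _ hf) e2 addrK.
have := nr_le_star (f a ** x) (x - f e ** x).
suff -> : star (f a ** x) ** (f a ** x) + star (x - f e ** x) ** (x - f e ** x) =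
  star x ** x by rewrite nr_cstar.
have -> : star (f a ** x) ** (f a ** x) = star x ** f (star a ** a) ** x.
  by rewrite starM (star_homM hf) (star_hom_star hf) !amulA.
by rewrite h2 starB starM hfe; staralg R B.
Qed.

Lemma star_hom_contr (B : cstarType R) (f : A -> B) a : star_hom f -> nr (f a) <= nr a.
Proof.
move=> hf; have := star_hom_mulC a (star (f a)) hf.
rewrite nr_cstar' nr_star expr2; have [->|fa] := eqVneq (nr (f a)) 0.
  by rewrite nr_ge0.
by rewrite ler_pM2r// lt_neqAle eq_sym fa nr_ge0.
Qed.

Lemma star_hom_cvg (B : cstarType R) (f : A -> B) (T : Type) (F : set_system T)
    {FF : Filter F} (g : T -> A) (l : A) : star_hom f ->
  g t @[t --> F] --> l -> f (g t) @[t --> F] --> f l.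
Proof.
move=> hf /cvg_nrP h; apply/cvg_nrP => e e0; apply: filterS (h _ e0) => t ht.
by rewrite -star_homB// (le_trans (star_hom_contr _ hf)).
Qed.

End Homomorphisms.

Section HilbertHom.
Variables (R : realType) (H : hilbertType R).
Implicit Types (S T : bop H) (h k : H).

Lemma bop_mulE S T h : (S ** T) h = S (T h). Proof. by []. Qed.
Lemma bop_addE S T h : (S + T) h = S h + T h. Proof. by []. Qed.
Lemma bop_scaleE (c : R[i]) S h : (c *: S) h = c *: S h. Proof. by []. Qed.
Lemma bop_oppE S h : (- S) h = - S h. Proof. exact: scaleN1r. Qed.
Lemma bop0E h : (0 : bop H) h = 0. Proof. by []. Qed.
Lemma hdot_star T h k : hdot (T h) k = hdot h (star T k). Proof. exact: bop_adjP. Qed.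
Lemma hdot_star' T h k : hdot h (T k) = hdot (star T h) k.
Proof. by rewrite hdot_star starK. Qed.

Lemma bop_sumE (I : Type) (s : seq I) (F : I -> bop H) h :
  (\sum_(i <- s) F i) h = \sum_(i <- s) F i h.
Proof. by elim/big_ind2: _ => // ? ? ? ? <- <-. Qed.

Lemma bopB T h k : T (h - k) = T h - T k.
Proof. by rewrite bopD -scaleN1r bopZ scaleN1r. Qed.

Lemma bop0 T : T 0 = 0.
Proof. by have := bopZ T 0 0; rewrite !scale0r. Qed.

Lemma hdotBl h k l : hdot (h - k) l = hdot h l - hdot k l :> R[i].
Proof. by rewrite hdotDl -scaleN1r hdotZl mulN1r. Qed.

Lemma hdotBr h k l : hdot l (h - k) = hdot l h - hdot l k :> R[i].
Proof. by rewrite hdotDr -scaleN1r hdotZr rmorphN1 mulN1r. Qed.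

Lemma hdotxxE h : hdot h h = (nr h ^+ 2)%:C :> R[i].
Proof. by rewrite hdotxx realCX -nrE. Qed.

Lemma nr_hdot_le h k : hdot h h <= hdot k k :> R[i] -> nr h <= nr k.
Proof. by rewrite !hdotxxE lecR ler_pXn2r ?nnegrE ?nr_ge0. Qed.

Lemma nr_pythagoras h k : hdot h k = 0 :> R[i] -> nr (h + k) ^+ 2 = nr h ^+ 2 + nr k ^+ 2.
Proof.
move=> hk; apply: complexI; rewrite realCD -!hdotxxE hdotDl !hdotDr hk.
by rewrite [hdot k h]hdotC hk rmorph0 addr0 add0r.
Qed.

Lemma bop_bound T : exists2 M : R, 0 <= M & forall h, nr (T h) <= M * nr h.
Proof.
have [M M0 hM] := bop_bound_ge0 (bop_bounded T).
exists (complex.Re M); first by rewrite -ler0c RRe_real// ger0_real.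
move=> h; rewrite -lecR realCM -!nrE RRe_real ?ger0_real//.
by case: (hM h).
Qed.

Lemma bop_cvg (I : Type) (F : set_system I) {FF : Filter F} (f : I -> H) l T :
  f i @[i --> F] --> l -> T (f i) @[i --> F] --> T l.
Proof.
move=> /cvg_nrP hf; apply/cvg_nrP => e e0; have [M M0 hM] := bop_bound T.
have M1 : 0 < M + 1 by rewrite ltr_wpDl.
apply: filterS (hf _ (divr_gt0 e0 M1)) => i hi.
rewrite -bopB (le_trans (hM _))//.
rewrite (@le_trans _ _ ((M + 1) * (e / (M + 1))))//.
  by rewrite ler_pM ?nr_ge0// lerDl.
by rewrite mulrCA divff ?mulr1 ?gt_eqF.
Qed.

Lemma star_hom_hilbert (A : cstarType R) (f : A -> bop H) a h : star_hom f ->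
  nr (f a h) <= nr a * nr h.
Proof.
move=> hf; move: a; apply: contr_scale => [r a r0|a a1].
  by rewrite (star_homZ hf) bop_scaleE nrZp.
have [e [he e2 _]] := ball_sqrt a1.
have hfe : star (f e) = f e by rewrite -(star_hom_star hf) he.
have h2 : f (star a ** a) = 2%:C *: f e - f e ** f e.
  by rewrite -(star_homZ hf) -(star_homM hf) -(star_homB _ _ hf) e2 addrK.
apply: nr_hdot_le; rewrite -subr_ge0.
suff -> : hdot h h - hdot (f a h) (f a h) = hdot (h - f e h) (h - f e h) :> R[i].
  by rewrite hdotxxE ler0c sqr_ge0.
have -> : hdot (f a h) (f a h) = hdot (f (star a ** a) h) h :> R[i].
  by rewrite hdot_star' -(star_hom_star hf) -bop_mulE -(star_homM hf).
rewrite h2 bop_addE bop_oppE bop_scaleE bop_mulE !hdotBl !hdotBr hdotZl.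
rewrite [hdot h (f e h)]hdot_star' hfe [hdot (f e h) (f e h)]hdot_star' hfe.
by rewrite (realCn _ 2); ring.
Qed.

End HilbertHom.

(** A common frame for A acting on a C*-algebra through a homomorphism and on a Hilbert space
    through a representation. [bm_unit] is the bound 1 for 1 - u, where contractivity of the action
    alone would give 2. *)
Record banach_module (R : realType) (A : cstarType R) (X : completeNormedModType R[i])
    (act : A -> X -> X) : Prop := BanachModule {
  bm_Dl : forall a b x, act (a + b) x = act a x + act b x;
  bm_Dr : forall a x y, act a (x + y) = act a x + act a y;
  bm_Zl : forall (c : R[i]) a x, act (c *: a) x = c *: act a x;
  bm_Zr : forall (c : R[i]) a x, act a (c *: x) = c *: act a x;
  bm_M : forall a b x, act (a ** b) x = act a (act b x);
  bm_le : forall a x, nr (act a x) <= nr a * nr x;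
  bm_unit : forall u x, unitlike u -> nr (x - act u x) <= nr x
}.

(** * Cohen factorization and the action of multipliers *)

Section CohenFactorization.
Variables (R : realType) (A : cstarType R) (X : completeNormedModType R[i]).
Variable act : A -> X -> X.
Hypothesis hact : banach_module act.
Implicit Types (a b u : A) (x y : X).

Definition essential x : Prop := act u x @[u --> @au R A] --> x.

Lemma bm_Br a x y : act a (x - y) = act a x - act a y.
Proof. by rewrite (bm_Dr hact) -scaleN1r (bm_Zr hact) scaleN1r. Qed.

Lemma bm_Bl a b x : act (a - b) x = act a x - act b x.
Proof. by rewrite (bm_Dl hact) -scaleN1r (bm_Zl hact) scaleN1r. Qed.

Lemma bm_0l x : act 0 x = 0.
Proof. by have := bm_Zl hact 0 0 x; rewrite !scale0r. Qed.

Lemma bm_cvgl (T : Type) (F : set_system T) {FF : Filter F} (f : T -> A) l x :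
  f t @[t --> F] --> l -> act (f t) x @[t --> F] --> act l x.
Proof.
move=> /cvg_nrP h; apply/cvg_nrP => e e0.
have x0 : 0 < nr x + 1 by rewrite ltr_wpDl ?nr_ge0.
apply: filterS (h _ (divr_gt0 e0 x0)) => t ht.
rewrite -bm_Bl (le_trans (bm_le hact _ _))//.
rewrite (@le_trans _ _ (e / (nr x + 1) * (nr x + 1)))//; last by rewrite divfK ?gt_eqF.
by rewrite ler_pM ?nr_ge0// lerDl.
Qed.

Lemma essential_act a x : essential (act a x).
Proof.
rewrite /essential; under eq_fun do rewrite -(bm_M hact).
by apply: bm_cvgl; exact: au_l.
Qed.

Lemma essentialD x y : essential x -> essential y -> essential (x + y).
Proof.
move=> hx hy; rewrite /essential; under eq_fun do rewrite (bm_Dr hact).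
exact: cvgD.
Qed.

Lemma essentialZ (c : R[i]) x : essential x -> essential (c *: x).
Proof.
move=> hx; rewrite /essential; under eq_fun do rewrite (bm_Zr hact).
exact: cvgZl_tmp.
Qed.

Lemma essential_closed x :
  (forall e : R, 0 < e -> exists2 y, essential y & nr (x - y) <= e) -> essential x.
Proof.
move=> h; apply/cvg_nrP => e e0; have e3 : 0 < e / 3 by rewrite divr_gt0.
have [y /cvg_nrP/(_ _ e3) hy xy] := h _ e3.
apply: filterS2 hy (au_unitlike A) => u hu [_ u1 _].
have -> : act u x - x = act u (x - y) + (act u y - y) + (y - x).
  by rewrite bm_Br !addrA !subrK.
have hxy : nr (act u (x - y)) <= e / 3.
  rewrite (le_trans (bm_le hact _ _))// (le_trans _ xy)// ler_piMl ?nr_ge0//.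
have := nrD (act u (x - y) + (act u y - y)) (y - x).
have := nrD (act u (x - y)) (act u y - y); rewrite nr_distC in xy; lra.
Qed.

(* The stages [x = (2^-n + a_n) x_n] of Cohen's construction. *)
Let stage x n (p : A * X) := let r := 2^-1 ^+ n : R in
  [/\ essential p.2, x = r%:C *: p.2 + act p.1 p.2 &
      forall y, nr ((1 - r)%:C *: y - act p.1 y) <= (1 - r) * nr y].

(** One passes from a to b = a + r u with r = 2^-(n+1). The third clause of [stage], carried over to
    b, makes 1 - r - b a contraction with factor 1 - r, so x = (r + b) z is solvable. Then (r + b)(z
    - y) = r (y - u y), and since r + b is bounded below by r, the distance from z to y is at most
    the norm of y - u y. *)
Let stage_next x n p : stage x n p -> exists q, stage x n.+1 q /\
  nr (q.1 - p.1) <= 2^-1 ^+ n.+1 /\ nr (q.2 - p.2) <= 2^-1 ^+ n.+1.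
Proof.
case: p => a y [/= ey xE hm]; pose r : R := 2^-1 ^+ n.+1.
have r0 : 0 < r by rewrite exprn_gt0// invr_gt0.
have r2 : 2^-1 ^+ n = 2 * r by rewrite /r exprS mulrA divff ?mul1r ?pnatr_eq0.
rewrite r2 in xE hm.
have r1 : 2 * r <= 1 by rewrite -r2 exprn_ile1 ?invr_ge0// invf_le1// ler1n.
move/cvg_nrP: (ey) => /(_ _ r0) hy.
have [u [yu uu]] := filter_ex (filterI hy (au_unitlike A)).
have [_ u1 _] := uu; pose b := a + r%:C *: u.
have hb z : nr ((1 - r)%:C *: z - act b z) <= (1 - r) * nr z.
  have -> : (1 - r)%:C *: z - act b z =
     ((1 - 2 * r)%:C *: z - act a z) + r%:C *: (z - act u z).
    by rewrite /b (bm_Dl hact) (bm_Zl hact); lmod R[i] X.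
  have := nrD ((1 - 2 * r)%:C *: z - act a z) (r%:C *: (z - act u z)).
  rewrite (nrZp _ (ltW r0)); have := hm z; have := bm_unit hact z uu.
  by have := nr_ge0 z; nra.
have [z hz] : exists z, x + ((1 - r)%:C *: z - act b z) = z.
  apply: (contraction_fix (q := 1 - r)); [lra|lra|move=> z1 z2].
  have -> : x + ((1 - r)%:C *: z1 - act b z1) - (x + ((1 - r)%:C *: z2 - act b z2)) =
    (1 - r)%:C *: (z1 - z2) - act b (z1 - z2) by rewrite bm_Br; lmod R[i] X.
  exact: hb.
have xz : x = r%:C *: z + act b z.
  have -> : r%:C *: z = z - (1 - r)%:C *: z by lmod R[i] X.
  by rewrite -{1}hz; lmod R[i] X.
have ex : essential x.
  by rewrite xE; apply: essentialD; [exact: essentialZ|exact: essential_act].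
have ez : essential z.
  have -> : z = (r^-1)%:C *: (x + (-1 : R[i]) *: act b z).
    rewrite {1}xz scaleN1r addrK scalerA -realCM mulVf ?gt_eqF// scale1r//.
  by apply/essentialZ/essentialD => //; apply: essentialZ; exact: essential_act.
exists (b, z); split; [by split|split] => /=.
  rewrite /b addrAC subrr add0r (nrZp _ (ltW r0)) -/r ler_piMr// ltW//.
have e1 : r%:C *: (z - y) + act b (z - y) = r%:C *: (y - act u y).
  have -> : r%:C *: (z - y) + act b (z - y) =
    (r%:C *: z + act b z) - (r%:C *: y + act b y) by rewrite bm_Br; lmod R[i] X.
  rewrite -xz xE /b (bm_Dl hact) (bm_Zl hact); by lmod R[i] X.
have := nrD (r%:C *: (z - y) + act b (z - y)) ((1 - r)%:C *: (z - y) - act b (z - y)).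
have -> : r%:C *: (z - y) + act b (z - y) + ((1 - r)%:C *: (z - y) - act b (z - y))
  = z - y by lmod R[i] X.
rewrite e1 (nrZp _ (ltW r0)); have := hb (z - y); rewrite -/r.
have : nr (y - act u y) <= r by rewrite nr_distC.
by have := nr_ge0 (z - y); nra.
Qed.

Theorem cohen_factorization x : essential x ->
  exists a y, essential y /\ x = act a y.
Proof.
move=> ex; have s0 : stage x 0 (0, x).
  split=> //=; first by rewrite expr0 scale1r bm_0l addr0.
  by move=> y; rewrite subrr scale0r bm_0l subr0 mul0r nr0.
have /choice[f hf] : forall q : nat * (A * X), exists q' : A * X,
    stage x q.1 q.2 -> stage x q.1.+1 q' /\
    nr (q'.1 - q.2.1) <= 2^-1 ^+ q.1.+1 /\ nr (q'.2 - q.2.2) <= 2^-1 ^+ q.1.+1.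
  move=> [n p]; have [/stage_next[q hq]|ns] := pselect (stage x n p); first by exists q.
  by exists p.
pose p := fix p n := if n is m.+1 then f (m, p m) else (0, x).
have hp n : stage x n (p n) by elim: n => [//|n IH]; case: (hf (n, p n) IH).
have step n : nr ((p n.+1).1 - (p n).1) <= 2^-1 ^+ n.+1 /\
    nr ((p n.+1).2 - (p n).2) <= 2^-1 ^+ n.+1.
  by case: (hf (n, p n) (hp n)).
have half n : 2^-1 ^+ n.+1 = - (2^-1 ^+ n.+1) - - (2^-1 ^+ n) :> R.
  by rewrite exprS; field.
have half0 n : - (2^-1 ^+ n) <= 0 :> R by rewrite oppr_le0 exprn_ge0// invr_ge0.
have [a ha] : exists a : A, (p n).1 @[n --> \oo] --> a.
  apply: (@nr_telescope R A (fun n => (p n).1) (fun n => - (2^-1 ^+ n)) 0) => // n.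
  by rewrite -half; case: (step n).
have [y hy] : exists y : X, (p n).2 @[n --> \oo] --> y.
  apply: (@nr_telescope R X (fun n => (p n).2) (fun n => - (2^-1 ^+ n)) 0) => // n.
  by rewrite -half; case: (step n).
have r0 : (2^-1 ^+ n : R) @[n --> \oo] --> (0 : R).
  by apply: cvg_expr; rewrite ger0_norm ?invr_ge0// invf_lt1 ?ltr1n.
exists a, y; split.
  apply: essential_closed => e e0; move/cvg_nrP: hy => /(_ _ e0)[n _ /(_ n (leqnn n))/= hn].
  by exists (p n).2; [case: (hp n)|rewrite nr_distC].
have h1 : (2^-1 ^+ n)%:C *: (p n).2 @[n --> \oo] --> (0 : X).
  rewrite -(scale0r y); apply: cvgZ => //; exact: cvg_realC.
have h2 : act (p n).1 (p n).2 @[n --> \oo] --> act a y.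
  have -> : (fun n => act (p n).1 (p n).2) =
      (fun n => act (p n).1 y + act (p n).1 ((p n).2 - y)).
    by apply/funext => n; rewrite bm_Br addrC subrK.
  rewrite -[act a y]addr0; apply: cvgD; first exact: bm_cvgl.
  apply/cvg_nrP => e e0.
  have k0 : 0 < nr a + 1 by rewrite ltr_wpDl ?nr_ge0.
  move/cvg_nrP: ha => /(_ _ ltr01) ha; move/cvg_nrP: hy => /(_ _ (divr_gt0 e0 k0)) hy.
  apply: filterS2 ha hy => n an yn; rewrite subr0 (le_trans (bm_le hact _ _))//.
  rewrite (@le_trans _ _ ((nr a + 1) * (e / (nr a + 1))))//.
    rewrite ler_pM ?nr_ge0//; have := nrD ((p n).1 - a) a; rewrite subrK; lra.
  by rewrite mulrCA divff ?mulr1 ?gt_eqF.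
have h3 : ((2^-1 ^+ n)%:C *: (p n).2 + act (p n).1 (p n).2) @[n --> \oo] -->
    act a y by rewrite -[act a y]add0r; exact: cvgD.
symmetry.
apply: (lim_uniq h3); apply: cvg_ext (cvg_cst x) => n.
by case: (hp n).
Qed.

Lemma essential_inj x y : essential x -> essential y ->
  (forall a, act a x = act a y) -> x = y.
Proof.
move=> hx hy h; apply: (lim_uniq hx); rewrite /essential in hy.
by under eq_fun do rewrite h.
Qed.

(** The action is defined through a chosen factorization of x. The clause a (m x) = (a m) x removes
    the dependence on it, because A separates essential vectors ([essential_inj]). *)
Lemma multiplier_action : exists Mact : multiplier A -> X -> X,
  forall x, essential x ->
    [/\ forall m, essential (Mact m x),
        forall m a, act a (Mact m x) = act (mr m a) x &
        exists b y, x = act b y /\ forall m, Mact m x = act (ml m b) y].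
Proof.
have /choice[f hf] : forall x, exists q : A * X, essential x -> x = act q.1 q.2.
  move=> x; have [/cohen_factorization[a [y [_ ->]]]|nx] := pselect (essential x).
    by exists (a, y).
  by exists (0, x).
exists (fun m x => act (ml m (f x).1) (f x).2) => x /hf xE; split=> [m|m a|].
- exact: essential_act.
- by rewrite -(bm_M hact) ml_mr (bm_M hact) -xE.
- by exists (f x).1, (f x).2.
Qed.

End CohenFactorization.

(** * Extension to multiplier algebras *)

Section HomExtension.
Variables (R : realType) (A T : cstarType R) (phi : A -> T).
Hypothesis hphi : star_hom phi.
Implicit Types (a b u : A) (x y : T) (m n : multiplier A).

Lemma hom_module : banach_module (fun a x => phi a ** x).
Proof.
split.
- by move=> a b x; rewrite (star_homD hphi) amulDl.
- by move=> a x y; rewrite amulDr.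
- by move=> c a x; rewrite (star_homZ hphi) amulZl.
- by move=> c a x; rewrite amulZr.
- by move=> a b x; rewrite (star_homM hphi) amulA.
- by move=> a x; exact: star_hom_mulC.
move=> u x hu; have [d [f df]] := unitlike_decomp hu.
case: hu => su _ _; have sphi : star (phi u) = phi u by rewrite -(star_hom_star hphi) su.
rewrite -(@ler_pXn2r _ 2) ?nnegrE ?nr_ge0// -!nr_cstar.
have -> : star x ** x = star (x - phi u ** x) ** (x - phi u ** x) +
    (star (phi d ** x) ** (phi d ** x) + star (phi f ** x) ** (phi f ** x)).
  have -> : star (phi d ** x) ** (phi d ** x) + star (phi f ** x) ** (phi f ** x) =
      star x ** phi (star d ** d + star f ** f) ** x.
    rewrite (star_homD hphi) !(star_homM hphi) !(star_hom_star hphi).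
    by rewrite !starM; staralg R T.
  rewrite -df (star_homB _ _ hphi) (star_homZ hphi) (star_homM hphi).
  by rewrite starB starM sphi; staralg R T.
by apply: Pos_norm_le; [|apply: PosD]; exact: Pos_star_mul.
Qed.

Hypothesis hconv : forall x, exists y : T, phi u ** x @[u --> @au R A] --> y.

(* With [q := lim phi(u)], every [q x] factors as [phi(a) y], and the extension
   of [phi] is determined by [phibar(m) phi(a) y = phi(m a) y]. *)
Theorem hom_strict_extension : exists phibar, strict_extension phi phibar.
Proof.
have hM := hom_module.
have /choice[q hq] := hconv.
have qE a x : phi a ** q x = phi a ** x.
  apply: (lim_uniq (cvg_amull (a := phi a) (hq x))).
  have -> : (fun u => phi a ** (phi u ** x)) = (fun u => phi (a ** u) ** x).
    by apply/funext => u; rewrite (star_homM hphi) amulA.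
  by apply: cvg_amulr; exact: (star_hom_cvg hphi (@au_r R A a)).
have eq_ x : essential (fun a y => phi a ** y) (q x).
  by rewrite /essential; under eq_fun do rewrite qE; exact: hq.
have [M hMact] := multiplier_action hM.
pose L m x := M m (q x).
have Less m x : essential (fun a y => phi a ** y) (L m x).
  by have [+ _ _] := hMact _ (eq_ x); exact.
have Lact m a x : phi a ** L m x = phi (mr m a) ** x.
  by have [_ h _] := hMact _ (eq_ x); rewrite /L h qE.
have Lfac x : exists b y, q x = phi b ** y /\ forall m, L m x = phi (ml m b) ** y.
  by have [_ _ h] := hMact _ (eq_ x).
have Lu m x y : essential (fun a z => phi a ** z) y ->
    (forall a, phi a ** y = phi (mr m a) ** x) -> L m x = y.
  move=> ey h; apply: (essential_inj (Less m x) ey) => a.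
  by rewrite Lact h.
have Lml m x y : x ** L m y = star (L (star m) (star x)) ** y.
  have [b [y' [yE ->]]] := Lfac y; have [c [x' [xE ->]]] := Lfac (star x).
  have xc a : x ** phi a = star x' ** star (phi c) ** phi a.
    have := qE (star a) (star x); rewrite xE (star_hom_star hphi) => /(congr1 star).
    by rewrite !starM !starK.
  have yc a : phi a ** y = phi a ** phi b ** y'.
    by rewrite -amulA -yE qE.
  rewrite starM -!(star_hom_star hphi) amulA xc -[RHS]amulA yc.
  rewrite -(star_hom_star hphi) -!amulA; congr (_ ** _).
  by rewrite !amulA -!(star_homM hphi) ml_mr /= starK.
pose phibar m := @Multiplier R T (L m) (fun x => star (L (star m) (star x))) (Lml m).
exists phibar; split; last first.
  (* One factorization q x = phi(b) y serves all multipliers, so strict convergence at b gives norm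
     convergence at x. *)
  have Lc (F : set_system (multiplier A)) m x : Filter F -> strict_cvg F m ->
      L n x @[n --> F] --> L m x.
    move=> FF Fm; have [b [y [_ h]]] := Lfac x; rewrite h.
    under eq_fun do rewrite h.
    by apply: cvg_amulr; exact: (star_hom_cvg hphi (proj1 (Fm b))).
  move=> F m FF Fm x; split; first exact: Lc.
  apply: (@cvg_star _ _ _ F) => /=.
  have Fs : strict_cvg (star n @[n --> F]) (star m).
    by move=> a; have [h1 h2] := Fm (star a); split; exact: cvg_star.
  exact: (Lc _ _ _ _ Fs).
split; last first.
  move=> b; apply: multiplier_eq => x /=; apply: Lu.
    exact: (essential_act hM).
  by move=> a /=; rewrite (star_homM hphi) amulA.
split.
- move=> m n; apply: multiplier_eq => x /=; apply: Lu.
    exact: (essentialD hM).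
  by move=> a; rewrite amulDr !Lact /= (star_homD hphi) amulDl.
- move=> c m; apply: multiplier_eq => x /=; apply: Lu.
    exact: (essentialZ hM).
  by move=> a; rewrite amulZr !Lact /= (star_homZ hphi) amulZl.
- move=> m n; apply: multiplier_eq => x /=; apply: Lu; first exact: Less.
  by move=> a; rewrite !Lact.
- by move=> m; apply: multiplier_eq => x /=; rewrite !starK.
Qed.

End HomExtension.

Section MultExtension.
Variables (R : realType) (B : cstarType R) (W : starAlgType R).
Variables (rho : B -> W) (rhobar : multiplier B -> W).
Hypothesis h : mult_extension rho rhobar.

Lemma mult_extension_ml m b : rhobar m ** rho b = rho (ml m b).
Proof.
rewrite -!h.2 -(star_homM h.1); congr rhobar.
by apply: multiplier_eq => x /=; rewrite mlM.
Qed.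

Lemma mult_extension_mr m b : rho b ** rhobar m = rho (mr m b).
Proof.
rewrite -!h.2 -(star_homM h.1); congr rhobar.
by apply: multiplier_eq => x /=; rewrite ml_mr.
Qed.

End MultExtension.

(** * Everywhere defined operators with an adjoint are bounded *)

Section HellingerToeplitz.
Variables (R : realType) (H : hilbertType R).
Implicit Types (x y z : H).

Let re x y : R := complex.Re (hdot x y).

Let reDl x y z : re (x + y) z = re x z + re y z.
Proof. by rewrite /re hdotDl raddfD. Qed.
Let reZl (r : R) x y : re (r%:C *: x) y = r * re x y.
Proof. by rewrite /re hdotZl; case: (hdot x y) => a b /=; rewrite mul0r subr0. Qed.
Let reC x y : re x y = re y x.
Proof. by rewrite /re hdotC; case: (hdot y x). Qed.
Let rexx x : re x x = nr x ^+ 2. Proof. by rewrite /re hdotxxE. Qed.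

Lemma re_hdot_le x y : `|re x y| <= nr x * nr y.
Proof.
have key z w : re z w <= nr z * nr w.
  have [w0|w0] := eqVneq (nr w) 0.
    by rewrite (nr_eq0 w0) nr0 mulr0 /re hdotr0.
  have {}w0 : 0 < nr w by rewrite lt_neqAle eq_sym w0 nr_ge0.
  have [z0|z0] := eqVneq (nr z) 0.
    by rewrite (nr_eq0 z0) nr0 mul0r reC /re hdotr0.
  have {}z0 : 0 < nr z by rewrite lt_neqAle eq_sym z0 nr_ge0.
  have : 0 <= re ((nr w)%:C *: z + (- nr z)%:C *: w) ((nr w)%:C *: z + (- nr z)%:C *: w).
    by rewrite rexx sqr_ge0.
  rewrite reDl !reZl ![re _ (_ + _)]reC !reDl !reZl !rexx (reC w z).
  have zw0 := mulr_gt0 z0 w0; move=> h.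
  have {h} : 0 <= (nr z * nr w) * (nr z * nr w - re z w) by nra.
  by rewrite pmulr_rge0// subr_ge0.
rewrite ler_norml key andbT lerNl.
by have := key ((- 1)%:C *: x) y; rewrite reZl nrZ normrN1 mul1r mulN1r.
Qed.

(** A gliding hump: S stretches z_n by more than n 3^n, and l is a signed series of the normalized
    vectors S z_n with weights 3^-n. The signs keep the earlier terms from cancelling the n-th one
    against S z_n, and the later terms sum to half of it. Pairing l with S z_n then shows that T l
    has norm at least n / 2 for all n. *)
Theorem hellinger_toeplitz (S T : H -> H) :
  (forall x y, hdot (S x) y = hdot x (T y) :> R[i]) ->
  exists2 M : R, 0 <= M & forall x, nr (S x) <= M * nr x.
Proof.
move=> adj; apply: contrapT => nb.
have reST x y : re y (S x) = re (T y) x by rewrite reC /re adj -/(re _ _) reC.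
have /choice[z hz] : forall n, exists z, n%:R * 3 ^+ n * nr z < nr (S z).
  move=> n; apply: contrapT => h; apply: nb; exists (n%:R * 3 ^+ n) => [|x].
    by rewrite mulr_ge0 ?exprn_ge0.
  by rewrite leNgt; apply/negP => hx; apply: h; exists x.
have Sz n : 0 < nr (S (z n)).
  by apply: le_lt_trans (hz n); rewrite !mulr_ge0 ?nr_ge0 ?exprn_ge0.
pose w n := ((3^-1 ^+ n) / nr (S (z n)))%:C *: S (z n).
have w3 n : nr (w n) = 3^-1 ^+ n.
  rewrite nrZp ?divfK ?gt_eqF// divr_ge0 ?nr_ge0// exprn_ge0// invr_ge0//.
have rew n : re (w n) (S (z n)) = 3^-1 ^+ n * nr (S (z n)).
  by rewrite reZl rexx expr2 mulrA divfK ?gt_eqF.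
pose y := fix y n := if n is m.+1 then
  (if 0 <= re (y m) (S (z m)) then y m + w m else y m - w m) else 0.
have ystep n : nr (y n.+1 - y n) = 3^-1 ^+ n.
  by rewrite /=; case: ifP => _; rewrite [y n + _]addrC addrK ?nrN w3.
have ylow n : 3^-1 ^+ n * nr (S (z n)) <= `|re (y n.+1) (S (z n))|.
  rewrite /=; case: ifP => [y0|/negbT]; rewrite ?reDl.
    by rewrite rew (le_trans _ (ler_norm _))// lerDr.
  rewrite -ltNge => y0; have -> : re (- w n) (S (z n)) = - re (w n) (S (z n)).
    have -> : - w n = (- 1 : R)%:C *: w n by rewrite realCN scaleN1r.
    by rewrite reZl mulN1r.
  by rewrite rew -normrN opprD opprK (le_trans _ (ler_norm _))// lerDr oppr_ge0 ltW.
(* [- d n] is the sum of the 3^-k over k >= n, so the tail after the n-th term is half of that term;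
   with weights 2^-n it would be all of it. *)
pose d n : R := - (3 / 2 * 3^-1 ^+ n).
have dstep n : 3^-1 ^+ n = d n.+1 - d n by rewrite /d exprS; field.
have [l hl] : exists l : H, y n @[n --> \oo] --> l.
  apply: (@nr_telescope R H y d 0) => n; first by rewrite ystep dstep.
  by rewrite /d oppr_le0 mulr_ge0 ?exprn_ge0 ?invr_ge0 ?divr_ge0.
have ylim n : nr (l - y n.+1) <= 2^-1 * 3^-1 ^+ n.
  have hk k : nr (y (n.+1 + k)%N - y n.+1) <= d (n.+1 + k)%N - d n.+1.
    elim: k => [|k IH]; first by rewrite addn0 !subrr nr0.
    rewrite addnS (le_trans (nr_dist_trans (y (n.+1 + k)%N) _ _))//.
    by rewrite ystep dstep -[leRHS](subrKA (d (n.+1 + k)%N)) lerD.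
  apply/ler_addgt0Pl => e e0; move/cvg_nrP: hl => /(_ _ e0)[N _ hN].
  have := hN (n.+1 + N)%N (leq_addl _ _); rewrite /= nr_distC => h1.
  have h2 := hk N; have h3 := nr_dist_trans (y (n.+1 + N)%N) l (y n.+1).
  have h4 : d (n.+1 + N)%N <= 0.
    by rewrite /d oppr_le0 mulr_ge0 ?exprn_ge0 ?invr_ge0 ?divr_ge0.
  have h5 : - d n.+1 = 2^-1 * 3^-1 ^+ n by rewrite /d opprK exprS; field.
  lra.
have bound n : n%:R / 2 <= nr (T l).
  have z0 : 0 < nr (z n).
    rewrite lt_neqAle nr_ge0 andbT eq_sym; apply/eqP => /nr_eq0 z0.
    have : re (S (z n)) (S (z n)) = 0 by rewrite reST z0 /re hdotr0.
    by rewrite rexx => /eqP; rewrite sqrf_eq0 gt_eqF.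
  rewrite -(ler_pM2r z0) (le_trans _ (re_hdot_le _ _))// -reST.
  have -> : l = y n.+1 + (l - y n.+1) by rewrite addrC subrK.
  rewrite reDl; have h1 := re_hdot_le (l - y n.+1) (S (z n)); have h2 := ylow n.
  have h3 : nr (l - y n.+1) * nr (S (z n)) <= 2^-1 * 3^-1 ^+ n * nr (S (z n)).
    by rewrite ler_pM2r.
  have h4 : n%:R * nr (z n) <= 3^-1 ^+ n * nr (S (z n)).
    have := ltW (hz n); rewrite -(ler_pM2l (x := 3^-1 ^+ n)) ?exprn_gt0 ?invr_gt0//.
    apply: le_trans; rewrite le_eqVlt; apply/orP; left; apply/eqP.
    by rewrite exprVn; field; rewrite expf_neq0// pnatr_eq0.
  have := ler_normD (re (y n.+1) (S (z n)) + re (l - y n.+1) (S (z n)))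
    (- re (l - y n.+1) (S (z n))).
  rewrite addrK normrN; lra.
have [n hn] : exists n, 2 * nr (T l) < n%:R.
  by exists (Num.truncn (2 * nr (T l))).+1; exact: truncnS_gt.
by have := bound n; lra.
Qed.

End HellingerToeplitz.

Section RepExtension.
Variables (R : realType) (A : cstarType R) (H : hilbertType R) (pi : A -> bop H).
Hypotheses (hpi : star_hom pi) (ndpi : nondegenerate_rep pi).
Implicit Types (a b u : A) (h k : H) (m n : multiplier A).

Lemma rep_module : banach_module (fun a h => pi a h).
Proof.
split.
- by move=> a b x; rewrite (star_homD hpi).
- by move=> a x y; rewrite bopD.
- by move=> c a x; rewrite (star_homZ hpi).
- by move=> c a x; rewrite bopZ.
- by move=> a b x; rewrite (star_homM hpi).
- by move=> a x; exact: star_hom_hilbert.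
move=> u x hu; have [d [f df]] := unitlike_decomp hu.
case: hu => su _ _; have spi : star (pi u) = pi u by rewrite -(star_hom_star hpi) su.
apply: nr_hdot_le; rewrite -subr_ge0.
suff -> : hdot x x - hdot (x - pi u x) (x - pi u x) =
    hdot (pi d x) (pi d x) + hdot (pi f x) (pi f x) :> R[i].
  by rewrite !hdotxxE -realCD ler0c addr_ge0 ?sqr_ge0.
have -> : hdot (pi d x) (pi d x) + hdot (pi f x) (pi f x) =
    hdot (pi (star d ** d + star f ** f) x) x :> R[i].
  rewrite (star_homD hpi) !(star_homM hpi) !(star_hom_star hpi) hdotDl.
  by rewrite !bop_mulE -!hdot_star'.
rewrite -df (star_homB _ _ hpi) (star_homZ hpi) (star_homM hpi).
rewrite bop_addE bop_oppE bop_scaleE bop_mulE !hdotBl !hdotBr hdotZl.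
rewrite [hdot x (pi u x)]hdot_star' spi [hdot (pi u x) (pi u x)]hdot_star' spi.
by rewrite (realCn _ 2); ring.
Qed.

Lemma rep_essential h : essential (fun a h => pi a h) h.
Proof.
have hM := rep_module; move: h; apply: (total_ind ndpi).
- have : essential (fun a h => pi a h) (pi 0 0) by exact: (essential_act hM).
  by rewrite (bm_0l hM).
- exact: (essentialD hM).
- exact: (essentialZ hM).
- exact: (essential_closed hM).
- by move=> _ [b [h ->]]; exact: (essential_act hM).
Qed.

Lemma rep_inj h k : (forall a, pi a h = pi a k) -> h = k.
Proof.
by apply: (@essential_inj _ _ _ (fun a h => pi a h)); exact: rep_essential.
Qed.

Theorem rep_extension : exists pibar, mult_extension pi pibar.
Proof.
have [M hM] := multiplier_action rep_module.
have Mact m a h : pi a (M m h) = pi (mr m a) h by have [] := hM h (@rep_essential h).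
have Mfac h : exists b y, h = pi b y /\ forall m, M m h = pi (ml m b) y.
  by have [] := hM h (@rep_essential h).
have Madj m h k : hdot (M m h) k = hdot h (M (star m) k) :> R[i].
  have [b [y [hE ->]]] := Mfac h; have [c [z [kE ->]]] := Mfac k.
  rewrite kE [in RHS]hE !hdot_star -!(star_hom_star hpi) -!bop_mulE -!(star_homM hpi).
  congr (hdot y (pi _ z)) => /=.
  by rewrite -{1}[c]starK -starM ml_mr starM.
(* The chosen factorizations give no bound; boundedness comes from the formal adjoint. *)
have Mbd m : exists K : R[i], forall h, `|M m h| <= K * `|h| /\ `|M (star m) h| <= K * `|h|.
  have [K K0 hK] := hellinger_toeplitz (Madj m).
  have Madj' x y : hdot (M (star m) x) y = hdot x (M m y) :> R[i].
    by rewrite Madj starK.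
  have [L L0 hL] := hellinger_toeplitz Madj'.
  exists (Num.max K L)%:C => h; rewrite !nrE -realCM !lecR.
  by rewrite (le_trans (hK h)) ?(le_trans (hL h))// ler_wpM2r ?nr_ge0// le_max lexx ?orbT.
pose pibar m := Bop (Madj m) (Mbd m).
have Mu m h k : (forall a, pi a k = pi (mr m a) h) -> M m h = k.
  by move=> hk; apply: rep_inj => a; rewrite Mact hk.
exists pibar; split; last first.
  move=> b; apply: bop_eq => h /=; apply: Mu => a /=.
  by rewrite (star_homM hpi).
split.
- move=> m n; apply: bop_eq => h /=; apply: Mu => a /=.
  by rewrite bopD !Mact (star_homD hpi).
- move=> c m; apply: bop_eq => h /=; apply: Mu => a /=.
  by rewrite bopZ !Mact (star_homZ hpi).
- move=> m n; apply: bop_eq => h /=; apply: Mu => a /=.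
  by rewrite !Mact.
- by move=> m; apply: bop_eq.
Qed.

End RepExtension.

(** * Positive functionals *)

Section Sublinear.
Variables (R : realType) (V : lmodType R[i]).
Implicit Types (p q f : V -> R) (x y v : V) (r : R).

Definition sublinear q := (forall x y, q (x + y) <= q x + q y) /\
  (forall r x, 0 <= r -> q (r%:C *: x) <= r * q x).

Let sub0 q : sublinear q -> q 0 = 0.
Proof.
move=> [qD qZ]; have := qZ 0 0 (lexx 0); have := qD 0 0.
rewrite scale0r addr0 mul0r; lra.
Qed.

Let subN q x : sublinear q -> - q (- x) <= q x.
Proof. by move=> sq; have := sq.1 x (- x); rewrite subrr (sub0 sq); lra. Qed.

Let dir_set q v x := [set s | exists2 r, 0 <= r & s = q (x + r%:C *: v) - r * q v].

(** The new functional is the infimum over r >= 0 of q(x + r v) - r q(v). It satisfies q'(- v) <= -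
    q(v), so a functional that cannot be lowered in any direction is odd, hence linear. *)
Lemma sublinear_dir q v : sublinear q -> exists q', [/\ sublinear q',
  forall x, q' x <= q x & q' (- v) <= - q v].
Proof.
move=> sq; have [qD qZ] := sq; pose q' x := inf (dir_set q v x).
have lb x : lbound (dir_set q v x) (- q (- x)).
  move=> _ [r r0 ->]; have := qD (x + r%:C *: v) (- x).
  rewrite addrAC subrr add0r; have := qZ (r^-1) (r%:C *: v).
  have [->|rn] := eqVneq r 0.
    by rewrite scale0r addr0 mul0r subr0; have := subN x sq; lra.
  rewrite invr_ge0 r0 => /(_ isT); rewrite scalerA -realCM mulVf// scale1r.
  have rp : 0 < r by rewrite lt_neqAle eq_sym rn.
  by rewrite ler_pdivlMl// => h1 h2; lra.
have ne x : dir_set q v x !=set0 by exists (q (x + (0 : R)%:C *: v) - 0 * q v), 0.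
have qle x r : 0 <= r -> q' x <= q (x + r%:C *: v) - r * q v.
  by move=> r0; apply: ge_inf; [exists (- q (- x)); exact: lb|exists r].
have le_q x s : (forall r, 0 <= r -> s <= q (x + r%:C *: v) - r * q v) -> s <= q' x.
  by move=> h; apply: lb_le_inf => // _ [r r0 ->]; exact: h.
exists q'; split; [split|..].
- move=> x y; rewrite -lerBlDr; apply/le_q => r r0; rewrite lerBlDr -lerBlDl.
  apply/le_q => t t0; rewrite lerBlDl (le_trans (qle _ (r + t) (addr_ge0 r0 t0)))//.
  have := qD (x + r%:C *: v) (y + t%:C *: v).
  by have -> : x + r%:C *: v + (y + t%:C *: v) = x + y + (r + t)%:C *: v;
    [lmod R[i] V|lra].
- move=> r x r0; have [->|rn] := eqVneq r 0.
    rewrite scale0r mul0r (le_trans (qle _ 0 (lexx 0)))//.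
    by rewrite scale0r addr0 mul0r subr0 sub0.
  have rp : 0 < r by rewrite lt_neqAle eq_sym rn.
  rewrite -ler_pdivrMl//; apply/le_q => t t0; rewrite ler_pdivrMl//.
  rewrite (le_trans (qle _ (r * t) (mulr_ge0 r0 t0)))//.
  have := qZ r (x + t%:C *: v) r0.
  have -> : r%:C *: (x + t%:C *: v) = r%:C *: x + (r * t)%:C *: v by lmod R[i] V.
  lra.
- by move=> x; rewrite (le_trans (qle _ 0 (lexx 0)))// scale0r addr0 mul0r subr0.
- rewrite (le_trans (qle _ 1 ler01))// scale1r addNr (sub0 sq); lra.
Qed.

(** Zorn with the order reversed. Along a chain the pointwise infimum is bounded below by - p(- x),
    and it stays subadditive because two members of the chain are comparable. *)
Lemma sublinear_minimal p : sublinear p -> exists f, [/\ sublinear f,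
  forall x, f x <= p x & forall q, sublinear q -> (forall x, q x <= f x) -> q = f].
Proof.
move=> sp; pose T := {q : V -> R | sublinear q /\ forall x, q x <= p x}.
pose rel_ (s t : T) := `[< forall x, sval t x <= sval s x >].
have [| | | |f hf] := @Zorn T rel_.
- by move=> t; apply/asboolP.
- move=> s t u /asboolP st /asboolP tu; apply/asboolP => x.
  exact: le_trans (tu x) (st x).
- move=> [s ps] [t pt] /asboolP st /asboolP ts; apply: eq_exist => /=.
  by apply/funext => x; apply/eqP; rewrite eq_le st ts.
- move=> A totA; have [[t0 At0]|nA] := pselect (exists t, A t); last first.
    exists (exist _ p (conj sp (fun x => lexx (p x)))) => s As.
    by case: nA; exists s.
  pose E x := [set sval t x | t in A]; pose q x := inf (E x).
  have ne x : E x !=set0 by exists (sval t0 x), t0.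
  have lb x : lbound (E x) (- p (- x)).
    move=> _ [t At <-]; have [st tp] := svalP t.
    by have := subN x st; have := tp (- x); lra.
  have qle x t : A t -> q x <= sval t x.
    by move=> At; apply: ge_inf; [exists (- p (- x)); exact: lb|exists t].
  have le_q x s : (forall t, A t -> s <= sval t x) -> s <= q x.
    by move=> h; apply: lb_le_inf => // _ [t At <-]; exact: h.
  have sq : sublinear q.
    split=> [x y|r x r0].
      rewrite -lerBlDr; apply/le_q => s As; rewrite lerBlDr -lerBlDl.
      apply/le_q => t At; rewrite lerBlDr.
      have [/asboolP st|/asboolP ts] := totA _ _ As At.
        rewrite (le_trans (qle _ _ At))//; have [[tD _] _] := svalP t.
        by have := tD x y; have := st x; lra.
      rewrite (le_trans (qle _ _ As))//; have [[sD _] _] := svalP s.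
      by have := sD x y; have := ts y; lra.
    have [->|rn] := eqVneq r 0.
      rewrite scale0r mul0r (le_trans (qle _ _ At0))//.
      by have [st _] := svalP t0; rewrite sub0.
    have rp : 0 < r by rewrite lt_neqAle eq_sym rn.
    rewrite -ler_pdivrMl//; apply/le_q => t At; rewrite ler_pdivrMl//.
    by rewrite (le_trans (qle _ _ At))//; have [[_ tZ] _] := svalP t; exact: tZ.
  have qp x : q x <= p x.
    by rewrite (le_trans (qle _ _ At0))//; have [_] := svalP t0; exact.
  exists (exist _ q (conj sq qp)) => s As; apply/asboolP => x /=; exact: qle.
have [sf fp] := svalP f; exists (sval f); split=> // q sq qf.
have qp x : q x <= p x by exact: le_trans (qf x) (fp x).
have := hf (exist _ q (conj sq qp)).
by move=> /(_ _)/(congr1 sval) /= ->//; apply/asboolP.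
Qed.

(** Lowering p in the direction v before minimizing fixes the value at v: every functional below the
    result satisfies f(- v) <= - p(v). *)
Theorem hahn_banach_sublinear p v : sublinear p -> exists f, [/\
  forall x y, f (x + y) = f x + f y, forall r x, f (r%:C *: x) = r * f x,
  forall x, f x <= p x & f v = p v].
Proof.
move=> sp; have [pv [spv pvp pvv]] := sublinear_dir v sp.
have [f [sf fpv fmin]] := sublinear_minimal spv.
have fN x : f (- x) = - f x.
  have [q [sq qf qx]] := sublinear_dir x sf.
  rewrite (fmin q sq qf) in qx; have := subN x sf.
  by move=> h; apply/eqP; rewrite eq_le qx; lra.
have fD x y : f (x + y) = f x + f y.
  apply/eqP; rewrite eq_le sf.1/=.
  by have := sf.1 (x + y) (- y); rewrite addrK fN; lra.
have fZp r x : 0 <= r -> f (r%:C *: x) = r * f x.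
  move=> r0; apply/eqP; rewrite eq_le sf.2//=.
  by have := sf.2 r (- x) r0; rewrite scalerN !fN; lra.
exists f; split=> //.
- move=> r x; have [r0|/ltW r0] := leP 0 r; first exact: fZp.
  have -> : r%:C *: x = (- r)%:C *: (- x) by lmod R[i] V.
  by rewrite fZp ?oppr_ge0// fN mulrNN.
- by move=> x; rewrite (le_trans (fpv x)).
- apply/eqP; rewrite eq_le (le_trans (fpv v))//=.
  by have := le_trans (fpv (- v)) pvv; rewrite fN; lra.
Qed.

End Sublinear.

Record positive_functional (R : realType) (A : cstarType R) (F : A -> R[i]) : Prop :=
  PositiveFunctional {
    pf_D : forall x y, F (x + y) = F x + F y;
    pf_Z : forall (c : R[i]) x, F (c *: x) = c * F x;
    pf_star : forall x, F (star x) = Num.conj (F x);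
    pf_ge0 : forall x, 0 <= F (star x ** x);
    pf_le : forall x, F (star x ** x) <= (nr x ^+ 2)%:C
  }.

Section States.
Variables (R : realType) (A : cstarType R).
Implicit Types (x y z b : A).

(** The distance from x to the cone of negative elements. A linear functional below it is
    contractive and nonnegative on [Pos] at once. *)
Let dist_neg x := inf [set nr (x + z) | z in @Pos R A].

Let dist_neg_le x z : Pos z -> dist_neg x <= nr (x + z).
Proof.
move=> Pz; apply: ge_inf; last by exists z.
by exists 0 => _ [z' _ <-]; exact: nr_ge0.
Qed.

Let le_dist_neg x s : (forall z, Pos z -> s <= nr (x + z)) -> s <= dist_neg x.
Proof.
move=> h; apply: lb_le_inf; first by exists (nr (x + 0)), 0 => //; exact: Pos0.
by move=> _ [z Pz <-]; exact: h.
Qed.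

(** By monotonicity of the norm, the distance from b^* b to the negative cone is its full norm.
    Hahn-Banach gives a real functional attaining it, and F is its complexification through real and
    imaginary parts. *)
Theorem state_exists b : exists2 F : A -> R[i], positive_functional F &
  F (star b ** b) = (nr b ^+ 2)%:C.
Proof.
have sp : sublinear dist_neg.
  split=> [x y|r x r0].
    rewrite -lerBlDr; apply: le_dist_neg => z Pz; rewrite lerBlDr -lerBlDl.
    apply: le_dist_neg => w Pw; rewrite lerBlDl.
    rewrite (le_trans (dist_neg_le _ (PosD Pz Pw)))// addrACA; exact: nrD.
  have [->|rn] := eqVneq r 0.
    rewrite scale0r mul0r (le_trans (dist_neg_le _ (Pos0 A)))//.
    by rewrite addr0 nr0.
  have rp : 0 < r by rewrite lt_neqAle eq_sym rn.
  rewrite -ler_pdivrMl//; apply: le_dist_neg => z Pz; rewrite ler_pdivrMl//.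
  by rewrite (le_trans (dist_neg_le _ (PosZ r0 Pz)))// -scalerDr nrZp.
have [f [fD fZ fp fb]] := hahn_banach_sublinear (star b ** b) sp.
have fN x : f (- x) = - f x.
  have -> : - x = (- 1 : R)%:C *: x by rewrite realCN scaleN1r.
  by rewrite fZ mulN1r.
have fle x : f x <= nr x.
  by rewrite (le_trans (fp x))// (le_trans (dist_neg_le _ (Pos0 A)))// addr0.
have fpos x : 0 <= f (star x ** x).
  have := le_trans (fp (- (star x ** x))) (dist_neg_le _ (Pos_star_mul x)).
  by rewrite addNr nr0 fN oppr_le0.
have {}fb : f (star b ** b) = nr b ^+ 2.
  rewrite fb; apply/eqP; rewrite eq_le -fb (le_trans (fle _)) ?nr_cstar//= fb.
  apply: le_dist_neg => z Pz; rewrite -nr_cstar.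
  by apply: Pos_norm_le => //; exact: Pos_star_mul.
pose hre x := (2^-1 : R)%:C *: (x + star x).
pose him x := (2^-1 : R)%:C *: ((- 'i) *: (x - star x)).
pose F x : R[i] := (f (hre x))%:C + 'i * (f (him x))%:C.
have FD x y : F (x + y) = F x + F y.
  have h1 : hre (x + y) = hre x + hre y by rewrite /hre; staralg R A.
  have h2 : him (x + y) = him x + him y by rewrite /him; staralg R A.
  by rewrite /F h1 h2 !fD !realCD; ring.
have FZr (r : R) x : F (r%:C *: x) = r%:C * F x.
  have h1 : hre (r%:C *: x) = r%:C *: hre x by rewrite /hre; staralg R A.
  have h2 : him (r%:C *: x) = r%:C *: him x by rewrite /him; staralg R A.
  by rewrite /F h1 h2 !fZ !realCM; ring.
have ii : 'i * 'i = -1 :> R[i] by rewrite -expr2 sqr_i.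
have Fi x : F ('i *: x) = 'i * F x.
  have h1 : hre ('i *: x) = - him x by rewrite /hre /him; staralg R A.
  have h2 : him ('i *: x) = hre x.
    rewrite /hre /him; have -> : star ('i *: x) = - ('i *: star x).
      by rewrite starZ conj_iC scaleNr.
    by rewrite opprK -scalerDr [- 'i *: _]scalerA mulNr ii opprK scale1r.
  rewrite /F h1 h2 fN realCN mulrDr mulrA ii mulN1r; ring.
have Fpos x : F (star x ** x) = (f (star x ** x))%:C.
  have h1 : hre (star x ** x) = star x ** x.
    by rewrite /hre starM starK; staralg R A.
  have h2 : him (star x ** x) = 0 by rewrite /him starM starK subrr !scaler0.
  have f0 : f 0 = 0 by rewrite -(scale0r (0 : A)) -realC0 fZ mul0r.
  by rewrite /F h1 h2 f0 mulr0 addr0.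
exists F; last by rewrite Fpos fb.
split=> //.
- move=> c x; rewrite [c]complexE scalerDl FD FZr -scalerA Fi FZr mulrA mulrDl//.
- move=> x; have h1 : hre (star x) = hre x by rewrite /hre starK addrC.
  have h2 : him (star x) = - him x by rewrite /him starK; staralg R A.
  by rewrite /F h1 h2 fN rmorphD rmorphM /= conj_iC !conj_realC realCN mulrN mulNr.
- by move=> x; rewrite Fpos ler0c.
- by move=> x; rewrite Fpos lecR (le_trans (fle _))// nr_cstar.
Qed.

End States.

(** * Completion of a pre-Hilbert space and the GNS construction *)

Section ComplexLimits.
Variable R : realType.
Implicit Types z w : R[i].

Definition cn z : R := complex.Re `|z|.

Lemma cnE z : `|z| = (cn z)%:C.
Proof. by rewrite RRe_real// normr_real. Qed.

Lemma cn_ge0 z : 0 <= cn z.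
Proof. by rewrite -ler0c -cnE. Qed.

Lemma cnM z w : cn (z * w) = cn z * cn w.
Proof. by apply: complexI; rewrite realCM -!cnE normrM. Qed.

Lemma cnD z w : cn (z + w) <= cn z + cn w.
Proof. by rewrite -lecR realCD -!cnE ler_normD. Qed.

Lemma cnN z : cn (- z) = cn z. Proof. by rewrite /cn normrN. Qed.

Lemma cn_distC z w : cn (z - w) = cn (w - z). Proof. by rewrite /cn distrC. Qed.

Lemma cn0 : cn 0 = 0. Proof. by rewrite /cn normr0. Qed.

Lemma cn_real (r : R) : cn r%:C = `|r|.
Proof. by rewrite /cn normc_def /= expr0n addr0 sqrtr_sqr. Qed.

Lemma cn_conj z : cn (Num.conj z) = cn z.
Proof. by rewrite /cn norm_conjC. Qed.

Lemma cn_eq0 z : cn z = 0 -> z = 0.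
Proof. by move=> h; apply/eqP; rewrite -normr_eq0 cnE h. Qed.

Lemma Re_le_cn z : `|complex.Re z| <= cn z.
Proof. by have := normc_ge_Re z; rewrite cnE lecR. Qed.

Lemma Im_le_cn z : `|complex.Im z| <= cn z.
Proof.
rewrite -(@ler_pXn2r _ 2) ?nnegrE ?cn_ge0// real_normK ?num_real//.
have : (cn z ^+ 2)%:C = ((complex.Re z) ^+ 2 + (complex.Im z) ^+ 2)%:C.
  by rewrite add_Re2_Im2 realCX -cnE.
by move=> /complexI ->; rewrite lerDr sqr_ge0.
Qed.

Lemma cn_le_ReIm z : cn z <= `|complex.Re z| + `|complex.Im z|.
Proof.
rewrite {1}[z]complexE (le_trans (cnD _ _))// cnM !cn_real.
suff -> : cn 'i = 1 by rewrite mul1r.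
by rewrite /cn normc_def /= expr0n expr1n add0r sqrtr1.
Qed.

Definition ccvg (T : Type) (F : set_system T) (f : T -> R[i]) (l : R[i]) : Prop :=
  forall e : R, 0 < e -> \forall t \near F, cn (f t - l) <= e.

Lemma ccvg_uniq (T : Type) (F : set_system T) {FF : ProperFilter F} (f : T -> R[i]) l k :
  ccvg F f l -> ccvg F f k -> l = k.
Proof.
move=> fl fk; apply/eqP; rewrite -subr_eq0; apply/eqP/cn_eq0/eqP.
rewrite eq_le cn_ge0 andbT; apply/ler_addgt0Pl => e e0; rewrite addr0.
have e2 : 0 < e / 2 by rewrite divr_gt0.
have [t [h1 h2]] := filter_ex (filterI (fl _ e2) (fk _ e2)).
have -> : l - k = (f t - k) - (f t - l) by ring.
by rewrite (le_trans (cnD _ _))// cnN (splitr e) lerD.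
Qed.

Lemma ccvg_complete (T : Type) (F : set_system T) {FF : ProperFilter F} (f : T -> R[i]) :
  (forall e : R, 0 < e -> exists2 P : set T, F P &
    forall s t, P s -> P t -> cn (f s - f t) <= e) ->
  exists l, ccvg F f l.
Proof.
move=> h; have part (g : R[i] -> R) : (forall z w, `|g z - g w| <= cn (z - w)) ->
    exists l : R, g (f t) @[t --> F] --> l.
  move=> gl; suff /cvg_ex : cvg ((fun t => g (f t)) @ F :> set_system R) by [].
  apply/cauchy_cvgP/cauchy_ballP => e e0; have e2 : 0 < e / 2 by rewrite divr_gt0.
  have [P FP hP] := h _ e2.
  exists ((fun t => g (f t)) @` P, (fun t => g (f t)) @` P) => /=.
    by split; apply: (@filterS _ F _ P) FP => t Pt; exists t.
  move=> [_ _] [/= [s Ps <-] [t Pt <-]]; rewrite -ball_normE /=.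
  by rewrite (le_lt_trans (gl _ _))// (le_lt_trans (hP _ _ Ps Pt))//; lra.
have [a ha] : exists l : R, complex.Re (f t) @[t --> F] --> l.
  by apply: part => z w; rewrite -raddfB Re_le_cn.
have [b hb] : exists l : R, complex.Im (f t) @[t --> F] --> l.
  by apply: part => z w; rewrite -raddfB Im_le_cn.
exists (a +i* b) => e e0; have e2 : 0 < e / 2 by rewrite divr_gt0.
move/cvgrPdist_le: ha => /(_ _ e2) ha; move/cvgrPdist_le: hb => /(_ _ e2) hb.
apply: filterS2 ha hb => t ha hb; rewrite (le_trans (cn_le_ReIm _))// (splitr e).
by case: (f t) ha hb => c d /= ha hb; rewrite lerD// distrC.
Qed.

Lemma ccvgD (T : Type) (F : set_system T) {FF : Filter F} (f g : T -> R[i]) l k :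
  ccvg F f l -> ccvg F g k -> ccvg F (fun t => f t + g t) (l + k).
Proof.
move=> fl gk e e0; have e2 : 0 < e / 2 by rewrite divr_gt0.
apply: filterS2 (fl _ e2) (gk _ e2) => t h1 h2.
by rewrite opprD addrACA (le_trans (cnD _ _))// (splitr e) lerD.
Qed.

Lemma ccvgMl (T : Type) (F : set_system T) {FF : Filter F} (f : T -> R[i]) l c :
  ccvg F f l -> ccvg F (fun t => c * f t) (c * l).
Proof.
move=> fl e e0; have c0 : 0 < cn c + 1 by rewrite ltr_wpDl ?cn_ge0.
apply: filterS (fl _ (divr_gt0 e0 c0)) => t h.
rewrite -mulrBr cnM (@le_trans _ _ ((cn c + 1) * (e / (cn c + 1))))//.
  by rewrite ler_pM ?cn_ge0// lerDl.
by rewrite mulrCA divff ?mulr1 ?gt_eqF.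
Qed.

Lemma ccvg_conj (T : Type) (F : set_system T) {FF : Filter F} (f : T -> R[i]) l :
  ccvg F f l -> ccvg F (fun t => Num.conj (f t)) (Num.conj l).
Proof.
move=> fl e e0; apply: filterS (fl _ e0) => t.
by rewrite -rmorphB /= cn_conj.
Qed.

Lemma ccvg_ext (T : Type) (F : set_system T) (f g : T -> R[i]) l :
  f =1 g -> ccvg F f l -> ccvg F g l.
Proof. by move=> /funext ->. Qed.

Lemma ccvg_le (T : Type) (F : set_system T) {FF : ProperFilter F} (f : T -> R[i]) l M :
  ccvg F f l -> (\forall t \near F, cn (f t) <= M) -> cn l <= M.
Proof.
move=> fl fM; apply/ler_addgt0Pl => e e0.
have [t [h1 h2]] := filter_ex (filterI (fl _ e0) fM).
have := cnD (l - f t) (f t); rewrite subrK cn_distC; lra.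
Qed.

End ComplexLimits.

Record preinner (R : realType) (V : lmodType R[i]) := Preinner {
  pform :> V -> V -> R[i];
  pformDl : forall x y z, pform (x + y) z = pform x z + pform y z;
  pformZl : forall (c : R[i]) x y, pform (c *: x) y = c * pform x y;
  pformC : forall x y, pform y x = Num.conj (pform x y);
  pform_ge0 : forall x, 0 <= pform x x
}.

Section PreHilbert.
Variables (R : realType) (V : lmodType R[i]) (s : preinner V).
Implicit Types (x y z : V) (c : R[i]).

Definition pn x : R := Num.sqrt (complex.Re (s x x)).

Lemma pn_ge0 x : 0 <= pn x. Proof. exact: sqrtr_ge0. Qed.

Lemma pformxx x : s x x = (pn x ^+ 2)%:C.
Proof.
have h := pform_ge0 s x; rewrite sqr_sqrtr; first by rewrite RRe_real// ger0_real.
by rewrite -ler0c RRe_real// ger0_real.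
Qed.

Lemma pformDr x y z : s x (y + z) = s x y + s x z.
Proof. by rewrite pformC pformDl rmorphD /= -!pformC. Qed.

Lemma pformZr c x y : s x (c *: y) = Num.conj c * s x y.
Proof. by rewrite pformC pformZl rmorphM /= -pformC. Qed.

Lemma pformBl x y z : s (x - y) z = s x z - s y z.
Proof. by rewrite pformDl -scaleN1r pformZl mulN1r. Qed.

Lemma pformBr x y z : s x (y - z) = s x y - s x z.
Proof. by rewrite pformDr -scaleN1r pformZr rmorphN1 mulN1r. Qed.

Lemma pform_le x y : cn (s x y) <= pn x * pn y.
Proof.
set z := s x y; have key (t : R) : 0 <= pn x ^+ 2 - 2 * t * cn z ^+ 2 +
    t ^+ 2 * cn z ^+ 2 * pn y ^+ 2.
  rewrite -ler0c; have zz : z * Num.conj z = (cn z ^+ 2)%:C.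
    by rewrite realCX -cnE normCK.
  have := pform_ge0 s (x - (t%:C * z) *: y).
  rewrite pformBl !pformBr !pformZl !pformZr (pformC _ x y) -/z !pformxx.
  rewrite [Num.conj (_ * z)]rmorphM /= conj_realC.
  have -> : (pn x ^+ 2)%:C - t%:C * Num.conj z * z - (t%:C * z * Num.conj z -
     t%:C * z * (t%:C * Num.conj z * (pn y ^+ 2)%:C)) = (pn x ^+ 2)%:C -
     2 * t%:C * (z * Num.conj z) + t%:C ^+ 2 * (z * Num.conj z) * (pn y ^+ 2)%:C.
    by ring.
  by rewrite zz !realCE.
rewrite -(@ler_pXn2r _ 2) ?nnegrE ?cn_ge0 ?mulr_ge0 ?pn_ge0// exprMn.
have m0 : 0 <= cn z ^+ 2 by rewrite sqr_ge0.
have [y0|yn] := eqVneq (pn y ^+ 2) 0.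
  rewrite y0 mulr0; have [//|mn] := eqVneq (cn z ^+ 2) 0; first by rewrite le_eqVlt => ->; rewrite eqxx.
  (* For a null y the expression is affine in t; this t makes it - 1. *)
  have := key ((pn x ^+ 2 + 1) / (2 * cn z ^+ 2)); rewrite y0 mulr0 addr0.
  have -> : 2 * ((pn x ^+ 2 + 1) / (2 * cn z ^+ 2)) * cn z ^+ 2 = pn x ^+ 2 + 1.
    by move: mn; move: (cn z ^+ 2) => m mn; field.
  lra.
have yp : 0 < pn y ^+ 2 by rewrite lt_neqAle eq_sym yn sqr_ge0.
have := key ((pn y ^+ 2)^-1).
have -> : pn x ^+ 2 - 2 * (pn y ^+ 2)^-1 * cn z ^+ 2 + (pn y ^+ 2)^-1 ^+ 2 *
  cn z ^+ 2 * pn y ^+ 2 = pn x ^+ 2 - cn z ^+ 2 / pn y ^+ 2.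
  by move: yn; move: (pn y ^+ 2) => m mn; field.
by rewrite subr_ge0 ler_pdivrMr.
Qed.

Lemma pnD x y : pn (x + y) <= pn x + pn y.
Proof.
rewrite -(@ler_pXn2r _ 2) ?nnegrE ?addr_ge0 ?pn_ge0//.
have -> : pn (x + y) ^+ 2 = pn x ^+ 2 + 2 * complex.Re (s x y) + pn y ^+ 2.
  apply: complexI; rewrite -pformxx pformDl !pformDr !realCD realCM -!pformxx.
  rewrite (pformC _ x y); have := addcJ (s x y) => h.
  have -> : s x x + s x y + (Num.conj (s x y) + s y y) =
    s x x + (s x y + Num.conj (s x y)) + s y y by ring.
  by rewrite [_ + Num.conj _]h realCn.
have := pform_le x y; have := Re_le_cn (s x y).
have := ler_norm (complex.Re (s x y)); nra.
Qed.

Lemma pnZ c x : pn (c *: x) = cn c * pn x.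
Proof.
apply/eqP; rewrite -(@eqrXn2 _ 2) ?pn_ge0 ?mulr_ge0 ?cn_ge0 ?pn_ge0//; apply/eqP.
apply: complexI; rewrite -pformxx pformZl pformZr mulrA exprMn realCM pformxx.
by rewrite [in RHS]realCX -cnE normCK.
Qed.

(* The completion consists of the functionals [y |-> s x y] and their limits in
   the norm dual. *)
Definition approximates (phi : V -> R[i]) x (e : R) :=
  forall y, cn (phi y - s x y) <= e * pn y.

Definition hcompl_pred : {pred (V -> R[i]^o)} :=
  fun phi => `[< forall e : R, 0 < e -> exists x, approximates phi x e >].

Record hcompl := HCompl {
  hcompl_val : V -> R[i]^o;
  hcompl_valP : hcompl_val \in hcompl_pred
}.

End PreHilbert.

Section HilbertCompletion.
Variables (R : realType) (V : lmodType R[i]) (s : preinner V).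
Implicit Types (x y z : V) (c : R[i]).

HB.instance Definition _ := [isSub of hcompl s for @hcompl_val R V s].
HB.instance Definition _ := [Choice of hcompl s by <:].
Implicit Types (f g h : hcompl s).

Let approxD (p q : V -> R[i]) x y e d : approximates s p x e -> approximates s q y d ->
  approximates s (fun z => p z + q z) (x + y) (e + d).
Proof.
move=> px qy z; rewrite pformDl opprD addrACA mulrDl.
by rewrite (le_trans (cnD _ _))// lerD.
Qed.

Let approxZ (p : V -> R[i]) x c e : approximates s p x e ->
  approximates s (fun z => c * p z) (c *: x) (cn c * e).
Proof.
move=> px z; rewrite pformZl -mulrBr cnM -mulrA ler_wpM2l ?cn_ge0//.
Qed.

Fact hcompl_submod_closed : submod_closed (hcompl_pred s).
Proof.
split.
  apply/asboolP => e e0; exists 0 => y.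
  have -> : s 0 y = 0 by rewrite -(scale0r (0 : V)) pformZl mul0r.
  by rewrite subrr cn0 mulr_ge0 ?pn_ge0// ltW.
move=> c p q /asboolP hp /asboolP hq; apply/asboolP => e e0.
have c0 : 0 < cn c + 1 by rewrite ltr_wpDl ?cn_ge0.
have [x hx] := hp (e / 2 / (cn c + 1)) (divr_gt0 (divr_gt0 e0 (ltr0Sn _ 1)) c0).
have [y hy] := hq (e / 2) (divr_gt0 e0 (ltr0Sn _ 1)).
exists (c *: x + y) => z; have := approxD (approxZ c hx) hy z.
move=> /le_trans; apply; rewrite ler_wpM2r ?pn_ge0// [leRHS]splitr lerD2r.
rewrite mulrCA ler_piMr// ?divr_ge0 ?(ltW e0)//.
by rewrite ler_pdivrMr// mul1r lerDl.
Qed.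

HB.instance Definition _ :=
  GRing.isSubmodClosed.Build R[i] (V -> R[i]^o) (hcompl_pred s) hcompl_submod_closed.
HB.instance Definition _ := [SubChoice_isSubLmodule of hcompl s by <:].

Lemma hcompl_eq f g : (forall y, val f y = val g y) -> f = g.
Proof. by move=> h; apply: val_inj; apply/funext. Qed.

Lemma hcompl_addE f g y : val (f + g) y = val f y + val g y. Proof. by []. Qed.
Definition converges (x : nat -> V) f := forall e : R, 0 < e ->
  exists N, forall n, (N <= n)%N -> approximates s (val f) (x n) e.

Lemma converges_exists f : exists x : nat -> V, converges x f.
Proof.
have /asboolP hf := valP f.
have /choice[x hx] : forall n, exists x, approximates s (val f) x (n.+1%:R^-1).
  by move=> n; apply: hf; rewrite invr_gt0.
exists x => e e0; exists (Num.truncn e^-1) => n nN y.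
rewrite (le_trans (hx n y))// ler_wpM2r ?pn_ge0//.
rewrite invf_ple ?posrE// ltW// (lt_le_trans (truncnS_gt _))//.
by rewrite ler_nat ltnS.
Qed.

Lemma converges_uniq (x : nat -> V) f g : converges x f -> converges x g -> f = g.
Proof.
move=> xf xg; apply: hcompl_eq => y; apply/eqP; rewrite -subr_eq0; apply/eqP/cn_eq0.
apply/eqP; rewrite eq_le cn_ge0 andbT; apply/ler_addgt0Pl => e e0; rewrite addr0.
have y0 : 0 < pn s y + 1 by rewrite ltr_wpDl ?pn_ge0.
have d0 : 0 < e / 2 / (pn s y + 1) by rewrite !divr_gt0.
have [N hN] := xf _ d0; have [M hM] := xg _ d0.
have h1 := hN (maxn N M) (leq_maxl _ _) y; have h2 := hM (maxn N M) (leq_maxr _ _) y.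
have h3 : e / 2 / (pn s y + 1) * pn s y <= e / 2.
  by rewrite -mulrA ler_piMr ?divr_ge0 ?(ltW e0)// mulrC ler_pdivrMr// mul1r lerDl.
have -> : val f y - val g y = (val f y - s (x (maxn N M)) y) -
    (val g y - s (x (maxn N M)) y) by ring.
by rewrite (le_trans (cnD _ _))// cnN (splitr e) lerD// (le_trans _ h3).
Qed.

Lemma approximates_dist (p : V -> R[i]) x y e d : 0 <= e -> 0 <= d ->
  approximates s p x e -> approximates s p y d -> pn s (x - y) <= e + d.
Proof.
move=> e0 d0 hx hy; have [->|hn] := eqVneq (pn s (x - y)) 0; first exact: addr_ge0.
have hp : 0 < pn s (x - y) by rewrite lt_neqAle eq_sym hn pn_ge0.
rewrite -(ler_pM2r hp) mulrDl.
have -> : pn s (x - y) * pn s (x - y) = cn (s (x - y) (x - y)).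
  by rewrite pformxx cn_real ger0_norm ?sqr_ge0 ?expr2.
have -> : s (x - y) (x - y) = (p (x - y) - s y (x - y)) - (p (x - y) - s x (x - y)).
  by rewrite pformBl; ring.
by rewrite (le_trans (cnD _ _))// cnN addrC lerD.
Qed.

Lemma converges_cauchy (x : nat -> V) f : converges x f -> forall e : R, 0 < e ->
  exists N, forall m n, (N <= m)%N -> (N <= n)%N -> pn s (x m - x n) <= e.
Proof.
move=> xf e e0; have e2 : 0 < e / 2 by rewrite divr_gt0.
have [N hN] := xf _ e2; exists N => m n Nm Nn; rewrite (splitr e).
by apply: approximates_dist (hN _ Nm) (hN _ Nn); rewrite ltW.
Qed.

Lemma converges_bounded (x : nat -> V) f : converges x f ->
  exists2 M : R, 0 < M & \forall n \near \oo, pn s (x n) <= M.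
Proof.
move=> /converges_cauchy/(_ _ ltr01)[N hN].
exists (1 + pn s (x N)); first by rewrite ltr_wpDr ?pn_ge0.
exists N => // n /= Nn; have := pnD s (x n - x N) (x N); rewrite subrK.
by have := hN n N Nn (leqnn N); lra.
Qed.

Lemma converges_pn (x y : nat -> V) f : converges x f -> converges y f ->
  forall e : R, 0 < e -> \forall n \near \oo, pn s (x n - y n) <= e.
Proof.
move=> xf yf e e0; have e2 : 0 < e / 2 by rewrite divr_gt0.
have [N hN] := xf _ e2; have [M hM] := yf _ e2; exists (maxn N M) => // n /=.
rewrite geq_max => /andP[Nn Mn]; rewrite (splitr e).
by apply: approximates_dist (hN _ Nn) (hM _ Mn); rewrite ltW.
Qed.

Lemma pform_dist x y x' y' : cn (s x y - s x' y') <=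
  pn s (x - x') * pn s y + pn s x' * pn s (y - y').
Proof.
have -> : s x y - s x' y' = s (x - x') y + s x' (y - y').
  by rewrite pformBl pformBr; ring.
by rewrite (le_trans (cnD _ _))// lerD// pform_le.
Qed.

Lemma converges_pform (x y : nat -> V) f g : converges x f -> converges y g ->
  exists l, ccvg \oo (fun n => s (x n) (y n)) l.
Proof.
move=> xf yg; apply: ccvg_complete => e e0.
have [M M0 hM] := converges_bounded xf; have [L L0 hL] := converges_bounded yg.
have e1 : 0 < e / 2 / L by rewrite !divr_gt0.
have e2 : 0 < e / 2 / M by rewrite !divr_gt0.
have [N hN] := converges_cauchy xf e1; have [K hK] := converges_cauchy yg e2.
exists [set n | [/\ (N <= n)%N, (K <= n)%N, pn s (x n) <= M & pn s (y n) <= L]].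
  near=> n; split; [| |by near: n|by near: n]; near: n; exact: nbhs_infty_ge.
move=> m n [Nm Km xm ym] [Nn Kn xn yn]; rewrite (le_trans (pform_dist _ _ _ _))//.
rewrite (splitr e) lerD//.
  rewrite (@le_trans _ _ (e / 2 / L * L))//; last by rewrite divfK ?gt_eqF.
  by rewrite ler_pM ?pn_ge0// hN.
rewrite (@le_trans _ _ (M * (e / 2 / M)))//; last by rewrite mulrC divfK ?gt_eqF.
by rewrite ler_pM ?pn_ge0// hK.
Unshelve. all: by end_near. Qed.

Lemma converges_pform_uniq (x y x' y' : nat -> V) f g l : converges x f -> converges y g ->
  converges x' f -> converges y' g ->
  ccvg \oo (fun n => s (x n) (y n)) l -> ccvg \oo (fun n => s (x' n) (y' n)) l.
Proof.
move=> xf yg xf' yg' hl e e0.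
have [M M0 hM] := converges_bounded xf'; have [L L0 hL] := converges_bounded yg.
have e3 : 0 < e / 3 by rewrite divr_gt0.
have e1 : 0 < e / 3 / L by rewrite !divr_gt0.
have e2 : 0 < e / 3 / M by rewrite !divr_gt0.
have h1 := converges_pn xf xf' e1; have h2 := converges_pn yg yg' e2.
have h3 := hl _ e3; near=> n.
have -> : s (x' n) (y' n) - l = (s (x n) (y n) - l) - (s (x n) (y n) - s (x' n) (y' n)).
  by ring.
rewrite (le_trans (cnD _ _))// cnN.
have k3 : cn (s (x n) (y n) - l) <= e / 3 by near: n.
have := pform_dist (x n) (y n) (x' n) (y' n).
have kM : pn s (x' n) <= M by near: n.
have kL : pn s (y n) <= L by near: n.
have : pn s (x n - x' n) * pn s (y n) <= e / 3 / L * L.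
  by rewrite ler_pM ?pn_ge0//; near: n.
have : pn s (x' n) * pn s (y n - y' n) <= M * (e / 3 / M).
  by rewrite ler_pM ?pn_ge0//; near: n.
rewrite [M * _]mulrC !divfK ?gt_eqF//; lra.
Unshelve. all: by end_near. Qed.

Lemma hcompl_dot_exists f g : exists l, exists x y : nat -> V, [/\ converges x f, converges y g &
  ccvg \oo (fun n => s (x n) (y n)) l].
Proof.
have [x xf] := converges_exists f; have [y yg] := converges_exists g.
by have [l hl] := converges_pform xf yg; exists l, x, y.
Qed.

(** The limit along some pair of approximating sequences; [converges_pform_uniq] makes the choice
    immaterial. *)
Definition hcompl_dot f g : R[i] := sval (cid (hcompl_dot_exists f g)).

Lemma hcompl_dotP (x y : nat -> V) f g : converges x f -> converges y g ->
  ccvg \oo (fun n => s (x n) (y n)) (hcompl_dot f g).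
Proof.
rewrite /hcompl_dot; case: cid => l [x' [y' [xf' yg' hl]]] /= xf yg.
exact: (converges_pform_uniq xf' yg' xf yg hl).
Qed.

Lemma convergesD (x y : nat -> V) f g : converges x f -> converges y g ->
  converges (fun n => x n + y n) (f + g).
Proof.
move=> xf yg e e0; have e2 : 0 < e / 2 by rewrite divr_gt0.
have [N hN] := xf _ e2; have [M hM] := yg _ e2; exists (maxn N M) => n.
rewrite geq_max => /andP[Nn Mn]; rewrite [e]splitr.
exact: (approxD (hN _ Nn) (hM _ Mn)).
Qed.

Lemma convergesZ c (x : nat -> V) f : converges x f -> converges (fun n => c *: x n) (c *: f).
Proof.
move=> xf e e0; have c0 : 0 < cn c + 1 by rewrite ltr_wpDl ?cn_ge0.
have [N hN] := xf _ (divr_gt0 e0 c0); exists N => n Nn y.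
rewrite (le_trans (approxZ c (hN n Nn) y))// ler_wpM2r ?pn_ge0//.
by rewrite mulrCA ler_piMr ?(ltW e0)// ler_pdivrMr// mul1r lerDl.
Qed.

Lemma hcompl_dotDl f g h : hcompl_dot (f + g) h = hcompl_dot f h + hcompl_dot g h.
Proof.
have [x xf] := converges_exists f; have [y yg] := converges_exists g.
have [z zh] := converges_exists h.
apply: (ccvg_uniq (hcompl_dotP (convergesD xf yg) zh)).
apply: ccvg_ext (ccvgD (hcompl_dotP xf zh) (hcompl_dotP yg zh)) => n.
by rewrite pformDl.
Qed.

Lemma hcompl_dotZl c f g : hcompl_dot (c *: f) g = c * hcompl_dot f g.
Proof.
have [x xf] := converges_exists f; have [y yg] := converges_exists g.
apply: (ccvg_uniq (hcompl_dotP (convergesZ c xf) yg)).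
by apply: ccvg_ext (ccvgMl c (hcompl_dotP xf yg)) => n; rewrite pformZl.
Qed.

Lemma hcompl_dotC f g : hcompl_dot g f = Num.conj (hcompl_dot f g).
Proof.
have [x xf] := converges_exists f; have [y yg] := converges_exists g.
apply: (ccvg_uniq (hcompl_dotP yg xf)).
by apply: ccvg_ext (ccvg_conj (hcompl_dotP xf yg)) => n; rewrite -pformC.
Qed.

Definition hcompl_norm f : R := Num.sqrt (complex.Re (hcompl_dot f f)).

Lemma hcompl_dotxx f : hcompl_dot f f = (hcompl_norm f ^+ 2)%:C.
Proof.
have [x xf] := converges_exists f; have hl := hcompl_dotP xf xf.
set l := hcompl_dot f f in hl *.
have lim0 : 0 <= complex.Re l.
  apply/ler_addgt0Pl => e e0; have [n _ /(_ n (leqnn n)) /= hn] := hl _ e0.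
  have := le_trans (Re_le_cn _) hn; rewrite raddfB /= pformxx /=.
  rewrite ler_norml => /andP[_]; have := sqr_ge0 (pn s (x n)); lra.
have lI : complex.Im l = 0.
  apply/eqP; rewrite -normr_eq0 eq_le normr_ge0 andbT; apply/ler_addgt0Pl => e e0.
  have [n _ /(_ n (leqnn n)) /= hn] := hl _ e0.
  have := le_trans (Im_le_cn _) hn; rewrite raddfB /= pformxx /= sub0r normrN addr0.
  exact.
rewrite /hcompl_norm -/l sqr_sqrtr//.
by apply/eqP; rewrite eq_complex /= lI !eqxx.
Qed.

Lemma hcompl_normP (x : nat -> V) f : converges x f -> forall e : R, 0 < e ->
  \forall n \near \oo, `|pn s (x n) ^+ 2 - hcompl_norm f ^+ 2| <= e.
Proof.
move=> xf e e0; apply: filterS (hcompl_dotP xf xf e0) => n.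
by rewrite pformxx hcompl_dotxx -realCB cn_real.
Qed.

Lemma hcompl_norm_ge0 f : 0 <= hcompl_norm f. Proof. exact: sqrtr_ge0. Qed.

(** Together with [hcompl_eval_le] this identifies the norm of the inner product with the dual norm
    of the functional, from which the triangle inequality and completeness are read off. *)
Lemma hcompl_norm_le f K : 0 <= K -> (forall y, cn (val f y) <= K * pn s y) ->
  hcompl_norm f <= K.
Proof.
move=> K0 hf; have [x xf] := converges_exists f.
apply/ler_addgt0Pr => e e0; rewrite -(@ler_pXn2r _ 2) ?nnegrE ?hcompl_norm_ge0 ?addr_ge0 ?(ltW e0)//.
have e2 : 0 < e / 2 by rewrite divr_gt0.
apply/ler_addgt0Pl => d d0.
have [N hN] := xf _ e0; have [M _ hM] := hcompl_normP xf d0.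
have h1 := hN (maxn N M) (leq_maxl _ _); have := hM (maxn N M) (leq_maxr _ _).
move: (x _) h1 => z h1 /= h2.
have zK : pn s z <= K + e.
  have [->|zn] := eqVneq (pn s z) 0; first by rewrite addr_ge0// ltW.
  have zp : 0 < pn s z by rewrite lt_neqAle eq_sym zn pn_ge0.
  rewrite -(ler_pM2r zp) mulrDl.
  have -> : pn s z * pn s z = cn (s z z).
    by rewrite pformxx cn_real ger0_norm ?sqr_ge0 ?expr2.
  have -> : s z z = val f z - (val f z - s z z) by ring.
  by rewrite (le_trans (cnD _ _))// cnN lerD.
have : pn s z ^+ 2 <= (K + e) ^+ 2 by rewrite lerXn2r ?nnegrE ?pn_ge0 ?addr_ge0 ?(ltW e0).
by move: h2; rewrite ler_norml => /andP[]; lra.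
Qed.

Lemma hcompl_eval_le f y : cn (val f y) <= hcompl_norm f * pn s y.
Proof.
have [x xf] := converges_exists f.
suff h (e : R) : 0 < e -> cn (val f y) <= (hcompl_norm f + e) * pn s y.
  have [y0|yn] := eqVneq (pn s y) 0; first by have := h 1 ltr01; rewrite y0 !mulr0.
  have yp : 0 < pn s y by rewrite lt_neqAle eq_sym yn pn_ge0.
  rewrite -ler_pdivrMr//; apply/ler_addgt0Pr => e e0; rewrite ler_pdivrMr//.
  exact: h.
move=> e0; have e2 : 0 < e / 2 by rewrite divr_gt0.
have d0 : 0 < (e / 2) ^+ 2 by rewrite exprn_gt0.
have [N hN] := xf _ e2; have [M _ hM] := hcompl_normP xf d0.
have h1 := hN (maxn N M) (leq_maxl _ _); have := hM (maxn N M) (leq_maxr _ _).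
move: (x _) h1 => z h1 /= h2.
have zf : pn s z <= hcompl_norm f + e / 2.
  rewrite -(@ler_pXn2r _ 2) ?nnegrE ?pn_ge0 ?addr_ge0 ?hcompl_norm_ge0 ?(ltW e2)//.
  have f0 := hcompl_norm_ge0 f.
  move: h2; rewrite ler_norml sqrrD => /andP[_].
  by have := mulr_ge0 f0 (ltW e2); lra.
have -> : val f y = (val f y - s z y) + s z y by ring.
have := cnD (val f y - s z y) (s z y); have := pform_le s z y; have := h1 y.
have := pn_ge0 s y; nra.
Qed.

Fact hcompl_normD f g : (hcompl_norm (f + g))%:C <= (hcompl_norm f)%:C + (hcompl_norm g)%:C.
Proof.
rewrite -realCD lecR; apply: hcompl_norm_le.
  by rewrite addr_ge0 ?hcompl_norm_ge0.
move=> y; rewrite hcompl_addE mulrDl (le_trans (cnD _ _))//.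
by rewrite lerD// hcompl_eval_le.
Qed.

Fact hcompl_normZ c f : (hcompl_norm (c *: f))%:C = `|c| * (hcompl_norm f)%:C.
Proof.
rewrite cnE -realCM; congr (_%:C).
apply/eqP; rewrite -(@eqrXn2 _ 2) ?hcompl_norm_ge0 ?mulr_ge0 ?cn_ge0 ?hcompl_norm_ge0//.
apply/eqP; apply: complexI; rewrite -hcompl_dotxx hcompl_dotZl hcompl_dotC hcompl_dotZl.
rewrite [Num.conj _]rmorphM /= -hcompl_dotC hcompl_dotxx mulrA -normCK cnE. by rewrite !realCE; ring.
Qed.

Fact hcompl_norm_eq0 f : (hcompl_norm f)%:C = 0 -> f = 0.
Proof.
move=> /complexI f0; apply: hcompl_eq => y.
have := hcompl_eval_le f y; rewrite f0 mul0r => h.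
by apply: cn_eq0; apply/eqP; rewrite eq_le h cn_ge0.
Qed.

HB.instance Definition _ := Lmodule_isNormed.Build R[i] (hcompl s)
  hcompl_normD hcompl_normZ hcompl_norm_eq0.

Lemma hcompl_nr f : nr f = hcompl_norm f. Proof. by []. Qed.

Fact hcompl_complete (F : set_system (hcompl s)) : ProperFilter F -> cauchy F -> cvg F.
Proof.
move=> FF /cauchy_ballP cF.
have small (e : R) : 0 < e -> exists2 P : set (hcompl s), F P &
    forall f g, P f -> P g -> hcompl_norm (f - g) <= e.
  move=> e0; have /cF[[P Q] /= [FP FQ] PQ] : 0 < (e / 2)%:C :> R[i].
    by rewrite ltcR divr_gt0.
  have e2 f g : P f -> Q g -> hcompl_norm (f - g) <= e / 2.
    by move=> Pf Qg; have := PQ (f, g) (conj Pf Qg); rewrite /= -ball_normE /= nrE ltcR => /ltW.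
  have [h0 Qh] := filter_ex FQ; exists P => // f g Pf Pg; rewrite (splitr e).
  have -> : f - g = (f - h0) - (g - h0) by rewrite opprB addrA subrK.
  rewrite -hcompl_nr (le_trans (nrB (f - h0) (g - h0)))//.
  by rewrite !hcompl_nr lerD// e2.
have /choice[l hl] : forall y, exists l, ccvg F (fun f => val f y) l.
  move=> y; apply: ccvg_complete => e e0.
  have p0 : 0 < pn s y + 1 by rewrite ltr_wpDl ?pn_ge0.
  have [P FP hP] := small _ (divr_gt0 e0 p0); exists P => // f g Pf Pg.
  have -> : val f y - val g y = val (f - g) y by [].
  rewrite (le_trans (hcompl_eval_le _ _))//.
  rewrite (@le_trans _ _ (e / (pn s y + 1) * (pn s y + 1)))//; last by rewrite divfK ?gt_eqF.
  by rewrite ler_pM ?hcompl_norm_ge0 ?pn_ge0 ?hP ?lerDl.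
have lP (e : R) P g : (forall f g, P f -> P g -> hcompl_norm (f - g) <= e) -> F P -> P g ->
    forall y, cn (l y - val g y) <= e * pn s y.
  move=> hP FP Pg y; have h : ccvg F (fun f => val f y + - val g y) (l y - val g y).
    apply: ccvgD; first exact: hl.
    by move=> d d0; apply: nearW => f; rewrite subrr cn0 ltW.
  apply: (ccvg_le h); apply: filterS FP => f Pf.
  have -> : val f y - val g y = val (f - g) y by [].
  by rewrite (le_trans (hcompl_eval_le _ _))// ler_wpM2r ?pn_ge0 ?hP.
have lin : l \in hcompl_pred s.
  apply/asboolP => e e0; have e2 : 0 < e / 2 by rewrite divr_gt0.
  have [P FP hP] := small _ e2; have [g Pg] := filter_ex FP.
  have /asboolP/(_ _ e2)[x hx] := valP g; exists x => y.
  have -> : l y - s x y = (l y - val g y) + (val g y - s x y) by ring.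
  rewrite (le_trans (cnD _ _))// (splitr e) mulrDl lerD//.
  exact: lP hP FP Pg y.
apply/cvg_ex; exists (HCompl lin); apply/(cvg_nrP (F := F) id) => e e0.
have [P FP hP] := small _ e0; apply: (filterS _ FP) => g Pg.
rewrite nr_distC hcompl_nr; apply: hcompl_norm_le; first exact: ltW.
move=> y; exact: (lP e P g hP FP Pg y).
Qed.

HB.instance Definition _ := Uniform_isComplete.Build (hcompl s) hcompl_complete.

Fact hcompl_dot_norm f : hcompl_dot f f = `|f| ^+ 2.
Proof. by rewrite hcompl_dotxx nrE -realCX. Qed.

HB.instance Definition _ := isHilbert.Build R (hcompl s)
  hcompl_dotDl hcompl_dotZl hcompl_dotC hcompl_dot_norm.

Fact hcompl_eta_subproof x : (s x : V -> R[i]^o) \in hcompl_pred s.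
Proof.
apply/asboolP => e e0; exists x => y.
by rewrite subrr cn0 mulr_ge0 ?pn_ge0// ltW.
Qed.

Definition hcompl_eta x : hcompl s := HCompl (hcompl_eta_subproof x).

Lemma converges_eta x : converges (fun=> x) (hcompl_eta x).
Proof.
move=> e e0; exists 0%N => n _ y /=.
by rewrite subrr cn0 mulr_ge0 ?pn_ge0// ltW.
Qed.

Lemma nr_eta x : nr (hcompl_eta x) = pn s x.
Proof.
rewrite hcompl_nr; apply/eqP; rewrite -(@eqrXn2 _ 2) ?hcompl_norm_ge0 ?pn_ge0//.
rewrite -subr_eq0 -normr_eq0 eq_le normr_ge0 andbT; apply/ler_addgt0Pl => e e0.
have [n _ /(_ n (leqnn n))] := hcompl_normP (converges_eta x) e0.
by rewrite distrC addr0.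
Qed.

Lemma eta_dense f (e : R) : 0 < e -> exists x, nr (f - hcompl_eta x) <= e.
Proof.
move=> e0; have /asboolP/(_ _ e0)[x hx] := valP f; exists x.
by rewrite hcompl_nr; apply: hcompl_norm_le => //; exact: ltW.
Qed.

Lemma etaB x y : hcompl_eta (x - y) = hcompl_eta x - hcompl_eta y.
Proof. by apply: hcompl_eq => z /=; rewrite pformBl. Qed.

End HilbertCompletion.

(** * The representation attached to a positive functional *)

Section GNS.
Variables (R : realType) (A : cstarType R) (F : A -> R[i]).
Hypothesis hF : positive_functional F.
Implicit Types (a b x y : A).

Fact gns_Dl x y z : F (star z ** (x + y)) = F (star z ** x) + F (star z ** y).
Proof. by rewrite amulDr (pf_D hF). Qed.
Fact gns_Zl (c : R[i]) x y : F (star y ** (c *: x)) = c * F (star y ** x).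
Proof. by rewrite amulZr (pf_Z hF). Qed.
Fact gns_C x y : F (star x ** y) = Num.conj (F (star y ** x)).
Proof. by rewrite -(pf_star hF) starM starK. Qed.

Definition gns_form : preinner A :=
  @Preinner R A (fun x y => F (star y ** x)) gns_Dl gns_Zl gns_C (pf_ge0 hF).

Let s := gns_form.

Lemma gns_pn_le a x : pn s (a ** x) <= nr a * pn s x.
Proof.
move: a; apply: contr_scale => [r a r0|a a1].
  have -> : (r%:C *: a) ** x = r%:C *: (a ** x) by rewrite amulZl.
  by rewrite pnZ cn_real ger0_norm.
have [e [he e2 _]] := ball_sqrt a1.
rewrite -(@ler_pXn2r _ 2) ?nnegrE ?pn_ge0// -lecR -!pformxx /s /=.
rewrite -subr_ge0 -mulN1r -(pf_Z hF) -(pf_D hF) scaleN1r.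
suff -> : star x ** x - star (a ** x) ** (a ** x) =
  star (x - e ** x) ** (x - e ** x) by exact: pf_ge0.
have h2 : star a ** a = 2%:C *: e - e ** e by rewrite e2 addrK.
have -> : star (a ** x) ** (a ** x) = star x ** (star a ** a) ** x.
  by rewrite starM !amulA.
by rewrite h2 starB starM he; staralg R A.
Qed.

Lemma pn_le_nr x : pn s x <= nr x.
Proof.
rewrite -(@ler_pXn2r _ 2) ?nnegrE ?pn_ge0 ?nr_ge0// -lecR -pformxx.
exact: (pf_le hF).
Qed.

Fact gns_act_subproof a (f : hcompl s) :
  (fun y => val f (star a ** y)) \in hcompl_pred s.
Proof.
apply/asboolP => e e0; have a0 : 0 < nr a + 1 by rewrite ltr_wpDl ?nr_ge0.
have /asboolP/(_ _ (divr_gt0 e0 a0))[x hx] := valP f; exists (a ** x) => y.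
have -> : s (a ** x) y = s x (star a ** y) by rewrite /s /= starM starK amulA.
rewrite (le_trans (hx _))// -mulrA ler_wpM2l ?(ltW e0)// ler_pdivrMl//.
rewrite (le_trans (gns_pn_le _ _))// nr_star ler_wpM2r ?pn_ge0//.
by rewrite lerDl.
Qed.

(** On the functional y |-> F(y^* x), left multiplication of x by a amounts to replacing y by a^* y;
    this formula makes sense on the whole completion. *)
Definition gns_act a f : hcompl s := HCompl (gns_act_subproof a f).

Lemma gns_act_le a f : nr (gns_act a f) <= nr a * nr f.
Proof.
rewrite !hcompl_nr; apply: hcompl_norm_le.
  by rewrite mulr_ge0 ?nr_ge0 ?hcompl_norm_ge0.
move=> y /=; rewrite (le_trans (hcompl_eval_le _ _))//.
rewrite [nr a * _]mulrC -mulrA ler_wpM2l ?hcompl_norm_ge0//.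
by rewrite (le_trans (gns_pn_le _ _))// nr_star.
Qed.

Lemma converges_act a (x : nat -> A) (f : hcompl s) : converges x f ->
  converges (fun n => a ** x n) (gns_act a f).
Proof.
move=> xf e e0; have a0 : 0 < nr a + 1 by rewrite ltr_wpDl ?nr_ge0.
have [N hN] := xf _ (divr_gt0 e0 a0); exists N => n /hN hx y.
have -> : s (a ** x n) y = s (x n) (star a ** y) by rewrite /s /= starM starK amulA.
rewrite (le_trans (hx _))// -mulrA ler_wpM2l ?(ltW e0)// ler_pdivrMl//.
rewrite (le_trans (gns_pn_le _ _))// nr_star ler_wpM2r ?pn_ge0//.
by rewrite lerDl.
Qed.

Lemma gns_adj a (f g : hcompl s) :
  hdot (gns_act a f) g = hdot f (gns_act (star a) g) :> R[i].
Proof.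
have [x xf] := converges_exists f; have [y yg] := converges_exists g.
apply: (ccvg_uniq (hcompl_dotP (converges_act a xf) yg)).
apply: ccvg_ext (hcompl_dotP xf (converges_act (star a) yg)) => n.
by rewrite /s /= starM starK amulA.
Qed.

Lemma gns_bounded a : exists M : R[i], forall f : hcompl s,
  `|gns_act a f| <= M * `|f| /\ `|gns_act (star a) f| <= M * `|f|.
Proof.
exists (nr a)%:C => f; rewrite !nrE -realCM !lecR gns_act_le.
by rewrite -(nr_star a) gns_act_le.
Qed.

Definition gns_rep a : bop (hcompl s) := Bop (gns_adj a) (gns_bounded a).

Lemma gns_rep_hom : star_hom gns_rep.
Proof.
split.
- move=> a b; apply: bop_eq => f; have [x xf] := converges_exists f.
  apply: (converges_uniq (converges_act (a + b) xf)).
  have -> : (fun n => (a + b) ** x n) = (fun n => a ** x n + b ** x n).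
    by apply/funext => n; rewrite amulDl.
  exact: convergesD (converges_act a xf) (converges_act b xf).
- move=> c a; apply: bop_eq => f; have [x xf] := converges_exists f.
  apply: (converges_uniq (converges_act (c *: a) xf)).
  have -> : (fun n => (c *: a) ** x n) = (fun n => c *: (a ** x n)).
    by apply/funext => n; rewrite amulZl.
  exact: (convergesZ c (converges_act a xf)).
- move=> a b; apply: bop_eq => f; apply: hcompl_eq => y /=.
  by rewrite starM amulA.
- by move=> a; apply: bop_eq.
Qed.

Lemma gns_rep_eta a x : gns_rep a (hcompl_eta s x) = hcompl_eta s (a ** x).
Proof. by apply: hcompl_eq => y /=; rewrite starM starK amulA. Qed.

(** Without a unit there is no evident cyclic vector; the vectors of u along the approximate unit
    take its place. *)
Lemma gns_eta_au x : hcompl_eta s (x ** u) @[u --> @au R A] --> hcompl_eta s x.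
Proof.
apply/cvg_nrP => e e0; have := @au_r R A x => /cvg_nrP/(_ _ e0).
by apply: filterS => u hu; rewrite -etaB nr_eta (le_trans (pn_le_nr _)).
Qed.

Lemma gns_rep_nondegenerate : nondegenerate_rep gns_rep.
Proof.
apply/total_setP => f e e0; have e2 : 0 < e / 2 by rewrite divr_gt0.
have [x hx] := eta_dense f e2.
have /cvg_nrP/(_ _ e2) := @gns_eta_au x => /filter_ex[u hu].
exists (hcompl_eta s (x ** u)).
  by apply: lin_span_incl; exists x, (hcompl_eta s u); rewrite gns_rep_eta.
rewrite (le_trans (nr_dist_trans (hcompl_eta s x) _ _))// (splitr e) lerD//.
by rewrite nr_distC.
Qed.

End GNS.

(** The representation may depend on b, so no direct sum is formed. The vector of b has the norm of
    b, and it is the limit of sigma(b) applied to the vectors of u, which have norm at most 1. *)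
Theorem gelfand_naimark (R : realType) (A : cstarType R) (b : A) :
  exists (H : hilbertType R) (sigma : A -> bop H),
    [/\ star_hom sigma, nondegenerate_rep sigma &
      forall K : R, 0 <= K -> (forall h, nr (sigma b h) <= K * nr h) -> nr b <= K].
Proof.
have [F hF Fb] := state_exists b.
exists (hcompl (gns_form hF)), (gns_rep hF).
split=> [| |K K0 hK]; [exact: gns_rep_hom|exact: gns_rep_nondegenerate|].
have -> : nr b = nr (hcompl_eta (gns_form hF) b).
  rewrite nr_eta; apply/eqP; rewrite -(@eqrXn2 _ 2) ?nr_ge0 ?pn_ge0//; apply/eqP.
  by apply: complexI; rewrite -Fb -pformxx.
apply/ler_addgt0Pl => e e0.
have /cvg_nrP/(_ _ e0) := @gns_eta_au _ _ _ hF b => hu.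
have [u [bu [_ u1 _]]] := filter_ex (filterI hu (au_unitlike A)).
have := nrD (hcompl_eta (gns_form hF) b - hcompl_eta (gns_form hF) (b ** u))
  (hcompl_eta (gns_form hF) (b ** u)).
rewrite subrK nr_distC => /le_trans; apply; rewrite lerD//.
rewrite -gns_rep_eta (le_trans (hK _))// ler_piMr//.
by rewrite nr_eta (le_trans (pn_le_nr hF _)).
Qed.

(** * Covariant pairs and finite sums of generators *)

Section Cone.
Variable G : ordGroupType.
Implicit Types s t u r : pos_cone G.

Lemma pc_inj s t : val s = val t -> s = t.
Proof. by move=> h; apply: val_inj. Qed.

Lemma pc_addC s t : pc_add s t = pc_add t s.
Proof. by apply: pc_inj; rewrite /= addrC. Qed.

Lemma pc_addA s t u : pc_add s (pc_add t u) = pc_add (pc_add s t) u.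
Proof. by apply: pc_inj; rewrite /= addrA. Qed.

Lemma pc_leVge s t : val s <= val t \/ val t <= val s.
Proof. by apply/orP; exact: le_total_group. Qed.

(* Truncated: [0] unless [val t <= val s]. *)
Definition pc_diff s t : pos_cone G :=
  match @idP (val t <= val s) with
  | ReflectT h => pc_sub h
  | ReflectF _ => pc0 G
  end.

Lemma pc_diffE s t : val t <= val s -> val (pc_diff s t) = val s - val t.
Proof. by rewrite /pc_diff; case: {-}_ / idP. Qed.

Lemma pc_diffK s t : val t <= val s -> pc_add (pc_diff s t) t = s.
Proof. by move=> ts; apply: pc_inj; rewrite /= pc_diffE// subrK. Qed.

Lemma pc_add_diff s t : pc_diff (pc_add s t) t = s.
Proof.
apply: pc_inj; rewrite pc_diffE /= ?addrK//.
by have := leD2l_group _ _ (val t) (valP s); rewrite addr0 addrC.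
Qed.

Lemma pc_le_add s t : val s <= val (pc_add s t).
Proof. by have := leD2l_group _ _ (val s) (valP t); rewrite addr0. Qed.

End Cone.

Section StrictExtension.
Variables (R : realType) (A B : cstarType R) (phi : A -> B).
Variable phibar : multiplier A -> multiplier B.
Hypothesis hphi : strict_extension phi phibar.

Let strict_au : strict_cvg (mult_of u @[u --> @au R A]) (mult_one A).
Proof. by move=> a; split; [exact: au_l|exact: au_r]. Qed.

Lemma strict_extension_l b : phi u ** b @[u --> @au R A] --> ml (phibar (mult_one A)) b.
Proof.
have [h _] := hphi.2 _ _ _ strict_au b.
have {}h : ml (phibar (mult_of u)) b @[u --> @au R A] --> ml (phibar (mult_one A)) b.
  exact: h.
by apply: cvg_ext h => u; rewrite hphi.1.2.
Qed.

Lemma strict_extension_r b : b ** phi u @[u --> @au R A] --> mr (phibar (mult_one A)) b.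
Proof.
have [_ h] := hphi.2 _ _ _ strict_au b.
have {}h : mr (phibar (mult_of u)) b @[u --> @au R A] --> mr (phibar (mult_one A)) b.
  exact: h.
by apply: cvg_ext h => u; rewrite hphi.1.2.
Qed.

End StrictExtension.

Section System.
Variables (R : realType) (G : ordGroupType) (A : cstarType R).
Variable alpha : pos_cone G -> A -> A.
Hypotheses (halpha : dynamical_system alpha)
  (hext : forall x : pos_cone G, extendible (alpha x)).
Local Notation GP := (pos_cone G).
Implicit Types (s t u r x : GP) (a b c : A).

Definition alpha_bar x := sval (cid (hext x)).

Lemma alpha_barP x : strict_extension (alpha x) (alpha_bar x).
Proof. by rewrite /alpha_bar; case: cid. Qed.

(** The image of the unit under the extension of alpha_x. By [one_at_l] it is the limit of
    alpha_x(u), hence independent of the extension chosen in [alpha_bar]. *)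
Definition one_at x : projection A := unit_image (alpha_barP x).

Lemma one_at_l x b : alpha x u ** b @[u --> @au R A] --> ml (one_at x) b.
Proof. exact: (strict_extension_l (alpha_barP x)). Qed.

Lemma one_at_alpha x b : ml (one_at x) (alpha x b) = alpha x b.
Proof.
apply: (lim_uniq (@one_at_l x (alpha x b))).
have hx := ds_hom halpha x.
under eq_fun do rewrite -(star_homM hx).
exact: (star_hom_cvg hx (@au_l R A b)).
Qed.

Definition term := (GP * A * GP)%type.
Implicit Types (l m : seq term).

Definition ev (W : starAlgType R) (pi : A -> W) (V : GP -> W) l : W :=
  \sum_(q <- l) star (V q.1.1) ** pi q.1.2 ** V q.2.

(** The product of v_s^* a v_t and v_u^* b v_r. For u <= t one writes v_t = v_(t-u) v_u, replaces
    v_u v_u^* b by [one_at u] times b, and moves v_(t-u) to the right by covariance. The other case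
    is the adjoint computation. *)
Definition tmul (p q : term) : term :=
  let: (s, a, t) := p in let: (u, b, r) := q in
  if val u <= val t then
    (s, a ** alpha (pc_diff t u) (ml (one_at u) b), pc_add (pc_diff t u) r)
  else (pc_add (pc_diff u t) s, alpha (pc_diff u t) (mr (one_at t) a) ** b, r).

Definition fmul l m := [seq tmul p q | p <- l, q <- m].

Definition fstar l := [seq (q.2, star q.1.2, q.1.1) | q <- l : seq term].

Definition fscale (k : R[i]) l := [seq (q.1.1, k *: q.1.2, q.2) | q <- l : seq term].

Lemma amul_sumr (W : starAlgType R) (I : Type) (s : seq I) (F : I -> W) y :
  y ** (\sum_(i <- s) F i) = \sum_(i <- s) y ** F i.
Proof. by elim: s => [|i s IH]; rewrite ?big_nil ?amul0r// !big_cons amulDr IH. Qed.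

Lemma amul_suml (W : starAlgType R) (I : Type) (s : seq I) (F : I -> W) y :
  (\sum_(i <- s) F i) ** y = \sum_(i <- s) F i ** y.
Proof. by elim: s => [|i s IH]; rewrite ?big_nil ?amul0l// !big_cons amulDl IH. Qed.

Lemma star_sum (W : starAlgType R) (I : Type) (s : seq I) (F : I -> W) :
  star (\sum_(i <- s) F i) = \sum_(i <- s) star (F i).
Proof. by elim: s => [|i s IH]; rewrite ?big_nil ?star0// !big_cons starD IH. Qed.

Section CovariantPair.
Variables (W : starAlgType R) (pi : A -> W) (V : GP -> W).
Hypothesis cov : covariant alpha pi V.

Let hpi := cov_hom cov.

Lemma cov_VVV s : V s ** star (V s) ** V s = V s.
Proof. exact: piso_isom (cov_piso cov) s. Qed.

Lemma cov_add s t : V s ** V t = V (pc_add s t).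
Proof. exact: piso_add (cov_piso cov) s t. Qed.

(** V_s absorbs its initial projection, which commutes with pi(a). *)
Lemma cov_pi s a : V s ** pi a = pi (alpha s a) ** V s.
Proof. by rewrite (cov_act cov) -amulA -amulA [pi a ** _](esym (cov_comm cov s a)) !amulA cov_VVV. Qed.

Lemma cov_piS s a : pi a ** star (V s) = star (V s) ** pi (alpha s a).
Proof.
have := congr1 (@star R W) (cov_pi s (star a)).
rewrite !starM -!(star_hom_star hpi) starK => ->.
by rewrite -(star_hom_star (ds_hom halpha s)) starK.
Qed.

Lemma ev_cat l m : ev pi V (l ++ m) = ev pi V l + ev pi V m.
Proof. by rewrite /ev big_cat. Qed.

Lemma ev_scale k l : ev pi V (fscale k l) = k *: ev pi V l.
Proof.
rewrite /ev big_map scaler_sumr; apply: eq_bigr => q _ /=.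
by rewrite (star_homZ hpi) amulZr amulZl.
Qed.

Lemma ev_star l : ev pi V (fstar l) = star (ev pi V l).
Proof.
rewrite /ev big_map star_sum; apply: eq_bigr => q _ /=.
by rewrite !starM starK (star_hom_star hpi) amulA.
Qed.

(* Holds in every non-degenerate covariant representation, with
   [one_at s] the image of the unit under the extension of [alpha s]. *)
Hypothesis cov_range : forall s a, V s ** star (V s) ** pi a = pi (ml (one_at s) a).

Lemma cov_rangeS s a : pi a ** (V s ** star (V s)) = pi (mr (one_at s) a).
Proof.
rewrite -[pi a]starK -(star_hom_star hpi) -[V s ** _]starK starM starK -starM cov_range.
by rewrite -(star_hom_star hpi) star_mlp starK.
Qed.

Lemma ev_mul l m : ev pi V (fmul l m) = ev pi V l ** ev pi V m.
Proof.
rewrite /ev big_allpairs_dep amul_suml; apply: eq_bigr => -[[s a] t] _.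
rewrite amul_sumr; apply: eq_bigr => -[[u b] r] _ /=.
case: ifP => [ut|/negbT ut] /=.
  have e : V t = V (pc_diff t u) ** V u by rewrite cov_add pc_diffK.
  rewrite e -cov_add (star_homM hpi).
  move: (pc_diff t u) => d.
  have h : pi (alpha d (ml (one_at u) b)) ** V d = V d ** V u ** star (V u) ** pi b.
    by rewrite -cov_pi -cov_range !amulA.
  transitivity (star (V s) ** pi a ** (pi (alpha d (ml (one_at u) b)) ** V d) ** V r).
    by rewrite !amulA.
  by rewrite h !amulA.
have tu : val t <= val u by case: (pc_leVge t u) => // h; rewrite h in ut.
have e : V u = V (pc_diff u t) ** V t by rewrite cov_add pc_diffK.
rewrite e -cov_add !starM (star_homM hpi).
move: (pc_diff u t) => d.
have h : star (V d) ** pi (alpha d (mr (one_at t) a)) =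
    pi a ** V t ** star (V t) ** star (V d).
  by rewrite -cov_piS -cov_rangeS !amulA.
transitivity (star (V s) ** (star (V d) ** pi (alpha d (mr (one_at t) a))) **
  pi b ** V r); first by rewrite !amulA.
by rewrite h !amulA.
Qed.

End CovariantPair.
End System.

(** * Homogeneous sums on a Hilbert space *)

Section HilbertCovariant.
Variables (R : realType) (G : ordGroupType) (A : cstarType R).
Variable alpha : pos_cone G -> A -> A.
Hypotheses (halpha : dynamical_system alpha)
  (hext : forall x : pos_cone G, extendible (alpha x)).
Local Notation GP := (pos_cone G).
Local Notation one_at := (one_at hext).
Implicit Types (s t u r x : GP) (a b c : A) (l m : seq (term G A)).

(* The matrix coefficient [A -> A] at the points [r], [t] of the compression to
   the corner of the operator [sum S_s pi(a) S_u^*] on l2. *)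
Definition coef l r t : A := ml (one_at t) (mr (one_at r)
  (\sum_(q <- l | [&& val q.2 <= val r, val q.1.1 <= val t &
     val t - val q.1.1 == val r - val q.2]) alpha (pc_diff r q.2) q.1.2)).

Definition degree (q : term G A) : G := val q.1.1 - val q.2.

Definition homogeneous g l := [seq q <- l | degree q == g].

(** The coefficient at (r, t) sees only the terms of degree t - r, so bounds on the coefficients of
    a sum are inherited by its homogeneous parts. *)
Lemma coef_homogeneous l r t :
  coef (homogeneous (val t - val r) l) r t = coef l r t.
Proof.
rewrite /coef /homogeneous big_filter_cond; congr (ml _ (mr _ _)).
apply: eq_bigl => q; rewrite /degree.
case: (_ <= _) => //=; last by rewrite andbF.
case: (_ <= _) => //=; last by rewrite andbF.
rewrite andbC; apply: andb_idr; rewrite subr_eq => /eqP ->.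
by rewrite addrAC [val r - _]addrC addrK addrC.
Qed.

Lemma pc_max (I : eqType) (f : I -> GP) (s : seq I) : s != [::] ->
  exists2 i, i \in s & forall j, j \in s -> val (f j) <= val (f i).
Proof.
elim: s => [//|i s IH] _; have [->|/IH[j js hj]] := eqVneq s [::].
  by exists i; rewrite ?mem_head// => j; rewrite inE => /eqP ->.
have [ij|ji] := pc_leVge (f i) (f j).
  by exists j => [|k]; rewrite inE ?js ?orbT// => /orP[/eqP ->//|/hj].
exists i => [|k]; rewrite ?mem_head// inE => /orP[/eqP ->//|/hj kj].
exact: le_trans kj ji.
Qed.

Variables (H : hilbertType R) (pi : A -> bop H) (V : GP -> bop H).
Hypotheses (cov : covariant alpha pi V) (nd : nondegenerate_rep pi).

Let hpi := cov_hom cov.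

Lemma partial_isometry_le (T : bop H) h : T ** star T ** T = T -> nr (T h) <= nr h.
Proof.
move=> hT; apply: nr_hdot_le; rewrite -subr_ge0; pose Q := star T ** T.
have sQ : star Q = Q by rewrite /Q starM starK.
have QQ : Q ** Q = Q by rewrite /Q -amulA [T ** _]amulA hT.
suff -> : hdot h h - hdot (T h) (T h) = hdot (h - Q h) (h - Q h) :> R[i].
  by rewrite hdotxxE ler0c sqr_ge0.
have -> : hdot (T h) (T h) = hdot (Q h) h :> R[i] by rewrite hdot_star' -bop_mulE.
rewrite !hdotBl !hdotBr [hdot h (Q h)]hdot_star' sQ [hdot (Q h) (Q h)]hdot_star' sQ.
by rewrite -bop_mulE QQ; ring.
Qed.

Lemma hilbert_V_le s h : nr (V s h) <= nr h.
Proof. by apply: partial_isometry_le; exact: (cov_VVV cov). Qed.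

Lemma hilbert_VS_le s h : nr (star (V s) h) <= nr h.
Proof.
apply: partial_isometry_le; rewrite starK.
by have := congr1 (@star R (bop H)) (cov_VVV cov s); rewrite !starM starK amulA.
Qed.

(** By non-degeneracy pi(u) tends strongly to the identity, so V_s pi(u) V_s^* tends to V_s V_s^*;
    by covariance it is pi(alpha_s(u)). *)
Lemma hilbert_range s a : V s ** star (V s) ** pi a = pi (ml (one_at s) a).
Proof.
apply: bop_eq => h.
have e1 : pi u (star (V s) (pi a h)) @[u --> @au R A] --> star (V s) (pi a h).
  exact: (@rep_essential _ _ _ _ hpi nd).
have e2 : V s (pi u (star (V s) (pi a h))) @[u --> @au R A] -->
    V s (star (V s) (pi a h)) by exact: bop_cvg.
rewrite !bop_mulE; apply: (lim_uniq e2).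
have hM := rep_module hpi.
have e3 : pi (alpha s u ** a) h @[u --> @au R A] --> pi (ml (one_at s) a) h.
  exact: (bm_cvgl hM (@one_at_l _ _ _ _ hext s a)).
apply: cvg_ext e3 => u; rewrite (star_homM hpi) (cov_act cov).
by rewrite !bop_mulE.
Qed.

Let rangeS s a := cov_rangeS cov hilbert_range s a.

(** Range projections act on pi(A) as multipliers of A, and initial projections commute with pi(A).
    The identity is tested under pi(a), which separates vectors. *)
Lemma range_commute s d :
  V s ** star (V s) ** (star (V d) ** V d) = star (V d) ** V d ** (V s ** star (V s)).
Proof.
apply: bop_eq => h; apply: (rep_inj hpi nd) => a.
rewrite -!bop_mulE; congr (bop_fun _ h).
by rewrite amulA rangeS -(cov_comm cov) -rangeS amulA (cov_comm cov) -amulA.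
Qed.

(** Cutting a term down to the initial projection of V_(d+u) raises both of its indices by d. Terms
    of equal degree thereby collect into one block at the largest index. *)
Lemma initial_shift s a u d :
  star (V s) ** pi a ** V u ** (star (V (pc_add d u)) ** V (pc_add d u)) =
  star (V (pc_add d s)) ** pi (alpha d a) ** V (pc_add d u).
Proof.
have e : V u ** (star (V (pc_add d u)) ** V (pc_add d u)) = star (V d) ** V d ** V u.
  have -> : V u ** (star (V (pc_add d u)) ** V (pc_add d u)) =
      V u ** star (V u) ** (star (V d) ** V d) ** V u.
    by rewrite -(cov_add cov) starM !amulA.
  by rewrite range_commute -amulA (cov_VVV cov).
rewrite -[LHS]amulA e -(cov_add cov d s) starM.
have -> : star (V s) ** pi a ** (star (V d) ** V d ** V u) =
  star (V s) ** (pi a ** star (V d)) ** (V d ** V u) by rewrite !amulA.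
by rewrite (cov_piS halpha cov) (cov_add cov) !amulA.
Qed.

Let evH l := ev pi V l.

(** Induction on the number of distinct right indices. Let r be the largest one, t its left partner
    and Q the initial projection of V_r. On the range of Q the sum is V_t^* pi(X) V_r, with X the
    coefficient at (r, t); on the complement the terms of index r vanish and the induction
    hypothesis applies. The two images are orthogonal, so the bound remains K instead of adding
    up. *)
Lemma ev_homogeneous_le n l g K : (size (undup [seq q.2 | q <- l]) <= n)%N -> 0 <= K ->
  (forall q, q \in l -> degree q = g) ->
  (forall q, q \in l -> nr (coef l q.2 q.1.1) <= K) ->
  forall h, nr (evH l h) <= K * nr h.
Proof.
move=> + K0; elim: n l => [|n IH] l sl hg hK h.
  have -> : l = [::].
    case: l sl {hg hK} => // q l; rewrite leqn0 => /eqP/size0nil e.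
    by have : q.2 \in undup [seq q.2 | q <- q :: l]; [rewrite mem_undup mem_head|rewrite e].
  by rewrite /evH /ev big_nil bop0E nr0 mulr_ge0 ?nr_ge0.
have [->|l0] := eqVneq l [::].
  by rewrite /evH /ev big_nil bop0E nr0 mulr_ge0 ?nr_ge0.
have [q0 q0l hmax] := pc_max (fun q : term G A => q.2) l0.
pose r := q0.2; pose Q := star (V r) ** V r.
have sQ : star Q = Q by rewrite /Q starM starK.
have QQ : Q ** Q = Q by rewrite /Q -amulA [V r ** _]amulA (cov_VVV cov).
pose l' := [seq q <- l | q.2 != r].
have VQ : V r ** Q = V r by rewrite /Q amulA (cov_VVV cov).
have Vk k : V r (k - Q k) = 0 by rewrite bopB -bop_mulE VQ subrr.
have el' k : evH l (k - Q k) = evH l' (k - Q k).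
  rewrite /evH /ev !bop_sumE big_filter [RHS]big_mkcond.
  by apply: eq_bigr => q _; case: (eqVneq q.2 r) => [->|//]; rewrite bop_mulE Vk bop0.
have bound' : nr (evH l (h - Q h)) <= K * nr (h - Q h).
  rewrite el'; apply: IH.
  - rewrite -ltnS (leq_trans _ sl)//; apply: (@leq_ltn_trans (size (rem r (undup [seq q.2 | q <- l])))).
      apply: uniq_leq_size; first exact: undup_uniq.
      move=> u; rewrite mem_undup => /mapP[q]; rewrite mem_filter => /andP[qr ql] ->.
      rewrite mem_rem_uniq ?undup_uniq// inE qr mem_undup.
      by apply/mapP; exists q.
    rewrite size_rem ?mem_undup; last by apply/mapP; exists q0.
    by case: (undup _) (mem_undup [seq q.2 | q <- l] r) => // e;
      move: (map_f (fun q : term G A => q.2) q0l); rewrite -e.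
  - by move=> q; rewrite mem_filter => /andP[_]; exact: hg.
  - move=> q; rewrite mem_filter => /andP[qr ql].
    (* A term of right index r contributes only to coefficients at r or beyond, so removing such
       terms leaves those at smaller indices unchanged. *)
    suff -> : coef l' q.2 q.1.1 = coef l q.2 q.1.1 by exact: hK.
    rewrite /coef /l' big_filter_cond; congr (ml _ (mr _ _)).
    apply: eq_bigl => p; apply: andb_idl => /and3P[pq _ _].
    apply/negP => /eqP pr; move/eqP: qr; apply.
    by apply: pc_inj; apply/eqP; rewrite eq_le hmax//= -/r -pr.
pose t := q0.1.1; pose X := coef l r t.
have XK : nr X <= K by exact: hK.
pose S := \sum_(q <- l) alpha (pc_diff r q.2) q.1.2.
(* At the largest index every term meets the conditions in [coef]. *)
have XE : X = ml (one_at t) (mr (one_at r) S).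
  rewrite /X /coef /S; congr (ml _ (mr _ _)).
  rewrite big_seq_cond [RHS]big_seq; apply: eq_bigl => q; rewrite andbC.
  apply: andb_idl => ql; rewrite hmax//=.
  have e := hg q ql; have e0 := hg q0 q0l; rewrite /degree in e e0.
  have es : val q.1.1 = val q.2 + g by rewrite -e addrC subrK.
  have et : val t = val r + g by rewrite -e0 addrC subrK.
  rewrite es et; apply/andP; split.
    by rewrite ![_ + g]addrC; apply: leD2l_group; exact: hmax.
  by rewrite opprD addrACA subrr addr0.
have evQ k : evH l (Q k) = star (V t) (pi X (V r k)).
  have -> : evH l (Q k) = (evH l ** Q) k by [].
  have -> : evH l ** Q = star (V t) ** pi S ** V r.
    rewrite /evH /ev amul_suml /S (star_hom_sum _ _ hpi) amul_sumr amul_suml.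
    rewrite big_seq [RHS]big_seq; apply: eq_bigr => q ql.
    have ini := initial_shift q.1.1 q.1.2 q.2 (pc_diff r q.2).
    rewrite (pc_diffK (hmax q ql)) in ini; apply: (etrans ini).
    congr (star (V _) ** _ ** _); apply: pc_inj; rewrite /= pc_diffE ?hmax//.
    have e := hg q ql; have e0 := hg q0 q0l; rewrite /degree in e e0.
    have -> : val q.1.1 = g + val q.2 by rewrite -e subrK.
    by rewrite [g + _]addrC addrA subrK -e0 addrC subrK.
  have -> : star (V t) ** pi S ** V r = star (V t) ** pi X ** V r.
    rewrite XE -(hilbert_range t) -(rangeS r).
    have {1}<- : V r ** star (V r) ** V r = V r by exact: (cov_VVV cov).
    have {1}<- : star (V t) ** (V t ** star (V t)) = star (V t).
      by have := congr1 (@star R (bop H)) (cov_VVV cov t); rewrite !starM starK.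
    by rewrite !amulA.
  by rewrite !bop_mulE.
have boundQ : nr (evH l (Q h)) <= K * nr (Q h).
  have -> : evH l (Q h) = star (V t) (pi X (V r (Q h))).
    by rewrite evQ -[V r (Q h)]bop_mulE VQ.
  rewrite (le_trans (hilbert_VS_le _ _))// (le_trans (star_hom_hilbert _ _ hpi))//.
  by rewrite ler_pM ?nr_ge0// hilbert_V_le.
(* The first vector lies in the range of V_t^*, and V_t times the sum has V_r as its last factor,
   which kills h - Q h. *)
have orth : hdot (evH l (Q h)) (evH l (h - Q h)) = 0 :> R[i].
  rewrite evQ -hdot_star' -[V t (evH l _)]bop_mulE.
  suff -> : (V t ** evH l) (h - Q h) = 0 by rewrite hdotr0.
  rewrite /evH /ev amul_sumr bop_sumE big_seq big1// => q ql.
  have e := hg q ql; have e0 := hg q0 q0l; rewrite /degree in e e0.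
  have tE : t = pc_add (pc_diff r q.2) q.1.1.
    apply: pc_inj; rewrite /= pc_diffE ?hmax//.
    have -> : val q.1.1 = g + val q.2 by rewrite -e subrK.
    by rewrite [g + _]addrC addrA subrK -e0 addrC subrK.
  have -> : V t ** (star (V q.1.1) ** pi q.1.2 ** V q.2) =
      pi (alpha (pc_diff r q.2) (ml (one_at q.1.1) q.1.2)) ** V r.
    have -> : V r = V (pc_diff r q.2) ** V q.2 by rewrite (cov_add cov) (pc_diffK (hmax q ql)).
    rewrite tE -(cov_add cov) [RHS]amulA.
    by rewrite -(cov_pi cov) -hilbert_range !amulA.
  by rewrite bop_mulE Vk bop0.
have orthQ : hdot (Q h) (h - Q h) = 0 :> R[i].
  by rewrite -[X in hdot X _]/(Q h) -{1}sQ -hdot_star' bopB -[Q (Q h)]bop_mulE QQ subrr hdotr0.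
have hE : h = Q h + (h - Q h) by rewrite addrC subrK.
rewrite -(@ler_pXn2r _ 2) ?nnegrE ?mulr_ge0 ?nr_ge0// exprMn.
rewrite {1}hE bopD (nr_pythagoras orth) [in leRHS]hE (nr_pythagoras orthQ) mulrDr.
by rewrite -!exprMn lerD// lerXn2r ?nnegrE ?mulr_ge0 ?nr_ge0.
Qed.

End HilbertCovariant.

Lemma gelfand_naimark_eq (R : realType) (A : cstarType R) (x y : A) :
  (forall (H : hilbertType R) (sigma : A -> bop H), star_hom sigma ->
     nondegenerate_rep sigma -> sigma x = sigma y) -> x = y.
Proof.
move=> h; have [H [sigma [hs nd hn]]] := gelfand_naimark (x - y).
apply/eqP; rewrite -subr_eq0; apply/eqP/nr_le0/hn => // k.
by rewrite (star_homB _ _ hs) (h _ _ hs nd) subrr bop0E nr0 mul0r.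
Qed.

Section CovariantIn.
Variables (R : realType) (G : ordGroupType) (A : cstarType R).
Variable alpha : pos_cone G -> A -> A.
Hypotheses (halpha : dynamical_system alpha)
  (hext : forall x : pos_cone G, extendible (alpha x)).
Local Notation GP := (pos_cone G).
Variables (C : cstarType R) (k : A -> C) (w : GP -> multiplier C).
Hypothesis cov : covariant_in alpha k w.
Implicit Types (l m : seq (term G A)).

(** The counterpart of [ev] with values in C itself: a generator lies in C although each v_s is only
    a multiplier. *)
Definition evm l : C :=
  \sum_(q <- l) ml (star (w q.1.1)) (mr (w q.2) (k q.1.2)).

Lemma evm_cat l m : evm (l ++ m) = evm l + evm m.
Proof. by rewrite /evm big_cat. Qed.

Lemma evm_scale (c : R[i]) l : evm (fscale c l) = c *: evm l.
Proof.
rewrite /evm big_map scaler_sumr; apply: eq_bigr => q _.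
by rewrite (star_homZ cov.1) mrZ; exact: (mlZ (star (w _))).
Qed.

Section Rep.
Variables (H : hilbertType R) (sigma : C -> bop H) (sigmabar : multiplier C -> bop H).
Hypotheses (hs : star_hom sigma) (nd : nondegenerate_rep sigma).
Hypothesis hbar : mult_extension sigma sigmabar.

Lemma covariant_comp : covariant alpha (sigma \o k) (sigmabar \o w).
Proof.
have [hk [_ hc]] := cov; have hb := hbar.1.
have kE a : sigma (k a) = sigmabar (mult_of (k a)) by rewrite hbar.2.
split.
- split=> [x y|c x|x y|x] /=.
  + by rewrite (star_homD hk) (star_homD hs).
  + by rewrite (star_homZ hk) (star_homZ hs).
  + by rewrite (star_homM hk) (star_homM hs).
  + by rewrite (star_hom_star hk) (star_hom_star hs).
- split=> [s|s t] /=.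
    by rewrite -(star_hom_star hb) -!(star_homM hb) (piso_isom (cov_piso hc)).
  by rewrite -(star_homM hb) (piso_add (cov_piso hc)).
- move=> s a /=; rewrite !kE (cov_act hc) !(star_homM hb).
  by rewrite (star_hom_star hb).
- move=> s a /=; rewrite !kE -(star_hom_star hb) -!(star_homM hb).
  by rewrite (cov_comm hc).
Qed.

Lemma nondegenerate_comp : nondegenerate_rep (sigma \o k).
Proof.
have [hk [ndk _]] := cov; apply/total_setP.
suff h x : essential (fun a (h : H) => sigma (k a) h) x.
  move=> x e e0; have /cvg_nrP/(_ _ e0)/filter_ex[u hu] := h x.
  exists (sigma (k u) x); last by rewrite nr_distC.
  by apply: lin_span_incl; exists u, x.
have hsk : star_hom (sigma \o k) by exact: (cov_hom covariant_comp).
have hM := rep_module hsk; have hMs := rep_module hs.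
move: x; apply: (total_ind nd).
- have : essential (fun a (h : H) => sigma (k a) h) (sigma (k 0) 0).
    exact: (essential_act hM).
  by rewrite (bm_0l hM).
- exact: (essentialD hM).
- exact: (essentialZ hM).
- exact: (essential_closed hM).
move=> _ [b [x ->]]; move: b; apply: (total_ind ndk).
- have : essential (fun a (h : H) => sigma (k a) h) (sigma (k 0) 0).
    exact: (essential_act hM).
  by rewrite (bm_0l hM) (bm_0l hMs).
- by move=> b c hb hc; rewrite (star_homD hs); exact: (essentialD hM).
- by move=> c b hb; rewrite (star_homZ hs); exact: (essentialZ hM).
- move=> b hb; apply: (essential_closed hM) => e e0.
  have x0 : 0 < nr x + 1 by rewrite ltr_wpDl ?nr_ge0.
  have [c hc bc] := hb _ (divr_gt0 e0 x0); exists (sigma c x) => //.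
  have -> : sigma b x - sigma c x = sigma (b - c) x.
    by rewrite (star_homB _ _ hs) bop_addE bop_oppE.
  rewrite (le_trans (star_hom_hilbert _ _ hs))//.
  rewrite (@le_trans _ _ (e / (nr x + 1) * (nr x + 1)))//; last by rewrite divfK ?gt_eqF.
  by rewrite ler_pM ?nr_ge0// lerDl.
- move=> _ [a [c ->]]; rewrite (star_homM hs) bop_mulE.
  exact: (essential_act hM).
Qed.

Lemma evm_rep l : sigma (evm l) = ev (sigma \o k) (sigmabar \o w) l.
Proof.
rewrite /evm (star_hom_sum _ _ hs) /ev; apply: eq_bigr => q _.
rewrite -(mult_extension_ml hbar) (star_hom_star hbar.1) -(mult_extension_mr hbar).
by rewrite amulA.
Qed.

End Rep.

(** The formula for V_s V_s^* that [ev_mul] requires has been established on Hilbert spaces, so the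
    product rule is checked in all non-degenerate representations of C. *)
Lemma evm_mul l m : evm (fmul hext l m) = evm l ** evm m.
Proof.
apply: gelfand_naimark_eq => H sigma hs nd; have [sbar hbar] := rep_extension hs nd.
rewrite (star_homM hs) !(evm_rep hs hbar).
have hc := covariant_comp hs hbar.
by apply: (ev_mul halpha hc) => s a; exact: (hilbert_range hext hc (nondegenerate_comp hs nd hbar)).
Qed.

Lemma evm_star l : evm (fstar l) = star (evm l).
Proof.
apply: gelfand_naimark_eq => H sigma hs nd; have [sbar hbar] := rep_extension hs nd.
rewrite (star_hom_star hs) !(evm_rep hs hbar).
exact: (ev_star (covariant_comp hs hbar)).
Qed.

End CovariantIn.

(** * Powers of a sum and the growth of their degrees *)

Lemma bernoulli (R : realType) (d : R) n : 0 <= d -> 1 + n%:R * d <= (1 + d) ^+ n.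
Proof.
move=> d0; elim: n => [|n IH]; first by rewrite expr0 mul0r addr0.
have n0 : 0 <= n%:R :> R by [].
rewrite exprS -natr1; apply: (@le_trans _ _ ((1 + d) * (1 + n%:R * d))); first by nra.
by rewrite ler_wpM2l// addr_ge0.
Qed.

Lemma exp_beats_poly (R : realType) (rho : R) (q : nat) : 1 < rho ->
  exists n, ((2 ^ n).+1%:R : R) ^+ q <= rho ^+ (2 ^ n.+1).
Proof.
move=> rho1; pose d := rho - 1; have d0 : 0 < d by rewrite subr_gt0.
have rhoE : rho = 1 + d by rewrite /d addrC subrK.
have [j hj] : exists j, (q <= 2 ^ j)%N by exists q; apply: ltnW; exact: ltn_expl.
have [i hi] : exists i, 2 ^+ j / d ^+ 2 <= 2 ^+ i :> R.
  exists (Num.Def.archi_bound (2 ^+ j / d ^+ 2)); apply: ltW.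
  have h0 : 0 <= 2 ^+ j / d ^+ 2 by rewrite divr_ge0 ?sqr_ge0// exprn_ge0.
  apply: (lt_trans (archi_boundP h0)).
  by set m := Num.Def.archi_bound _; rewrite -(natrX _ 2 m) ltr_nat ltn_expl.
(* By Bernoulli, rho^(2^i) is at least 1 + 2^i d, and the choice of i makes the square of the latter
   at least 1 + 2^(i+j). The exponent 2^(i+j+1) provides 2^j such squares, at least q of them. *)
exists (i + j)%N.
have -> : (2 ^ (i + j).+1 = 2 ^ i * 2 ^ j.+1)%N by rewrite -addnS expnD.
rewrite exprM; have h1 := bernoulli (2 ^ i) (ltW d0); rewrite -rhoE in h1.
have h0 : 1 <= 1 + (2 ^ i)%:R * d by rewrite lerDl mulr_ge0// ltW.
apply: (@le_trans _ _ ((1 + (2 ^ i)%:R * d) ^+ 2 ^+ (2 ^ j))); last first.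
  rewrite -exprM -expnS lerXn2r ?nnegrE//; first exact: le_trans h0.
  by rewrite exprn_ge0// (le_trans ler01)// ltW.
apply: (@le_trans _ _ ((1 + (2 ^ i)%:R * d) ^+ 2 ^+ q)); last by rewrite ler_weXn2l// exprn_ege1.
rewrite lerXn2r ?nnegrE ?exprn_ge0//; first exact: le_trans h0.
have {}hi : 2 ^+ j <= 2 ^+ i * d ^+ 2 by rewrite -ler_pdivrMr ?exprn_gt0.
rewrite -[leLHS]natr1 expnD natrM !natrX; move: hi.
have : 0 <= 2 ^+ i :> R by rewrite exprn_ge0.
move: (2 ^+ i) (2 ^+ j) => x y x0 hi; rewrite sqrrD expr1n mul1r exprMn.
have : x * y <= x * (x * d ^+ 2) by rewrite ler_wpM2l.
rewrite mulrA -expr2; have : 0 <= x * d by rewrite mulr_ge0// ltW.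
by lra.
Qed.

Lemma bop_sqr_le (R : realType) (H : hilbertType R) (T : bop H) (K : R) : 0 <= K ->
  (forall h, nr ((star T ** T) h) <= K ^+ 2 * nr h) -> forall h, nr (T h) <= K * nr h.
Proof.
move=> K0 hK h.
rewrite -(@ler_pXn2r _ 2) ?nnegrE ?mulr_ge0 ?nr_ge0// exprMn.
have -> : nr (T h) ^+ 2 = complex.Re (hdot ((star T ** T) h) h).
  by rewrite bop_mulE -hdot_star' hdotxxE.
rewrite (le_trans (ler_norm _))// (le_trans (re_hdot_le _ _))//.
by rewrite [nr h ^+ 2]expr2 mulrA ler_wpM2r ?nr_ge0.
Qed.

Section Degrees.
Variables (R : realType) (G : ordGroupType) (A : cstarType R).
Variable alpha : pos_cone G -> A -> A.
Hypothesis hext : forall x : pos_cone G, extendible (alpha x).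
Implicit Types (l m : seq (term G A)).

Lemma degree_tmul p q : degree (tmul hext p q) = degree p + degree q.
Proof.
case: p q => [[s a] t] [[u b] r]; rewrite /degree /tmul.
case: ifP => [ut|/negbT ut] /=.
  by rewrite pc_diffE// opprD opprB [val u - val t]addrC !addrA.
have tu : val t <= val u by case: (pc_leVge t u) => // h; rewrite h in ut.
by rewrite pc_diffE// [_ + val s]addrC [val u - val t]addrC !addrA.
Qed.

(** Repeated squaring of l^* l, so index n carries the power 2^n of l^* l and the power 2^(n+1) of
    the norm of l. Self-adjointness of the start makes each squaring an instance of x^* x. *)
Fixpoint npow l n :=
  if n is n'.+1 then fmul hext (npow l n') (npow l n') else fmul hext (fstar l) l.

(** Degrees add under products, so those of (l^* l)^(2^n) are combinations of the q degrees of l^* l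
    with multiplicities at most 2^n. The group is abelian, so there are at most (2^n + 1)^q of
    them. *)
Lemma degrees_npow l : exists q : nat, forall n,
  (size (undup [seq degree p | p <- npow l n]) <= (2 ^ n).+1 ^ q)%N.
Proof.
pose D := undup [seq degree p | p <- npow l 0]; pose q := size D; exists q => n.
pose val_at (c : {ffun 'I_q -> 'I_(2 ^ n).+1}) : G := \sum_(j < q) D`_j *+ c j.
have key : forall g, g \in [seq degree p | p <- npow l n] ->
    exists c : 'I_q -> nat, (forall j, (c j <= 2 ^ n)%N) /\ g = \sum_(j < q) D`_j *+ c j.
  rewrite {val_at}; elim: n => [|n IH] g.
    rewrite -mem_undup -/D => gD; have gi : (index g D < q)%N by rewrite index_mem.
    exists (fun j => (j == Ordinal gi) : nat); split=> [j|]; first by case: eqP.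
    rewrite (bigD1 (Ordinal gi)) //= eqxx mulr1n nth_index// big1 ?addr0// => j /negbTE ->.
    by rewrite mulr0n.
  move=> /mapP[_ /allpairsP[[p1 p2] /= [h1 h2 ->]] ->].
  have [c1 [b1 e1]] := IH _ (map_f (@degree R G A) h1); have [c2 [b2 e2]] := IH _ (map_f (@degree R G A) h2).
  exists (fun j => (c1 j + c2 j)%N); split=> [j|]; first by rewrite expnS mul2n -addnn leq_add.
  by rewrite degree_tmul e1 e2 -big_split; apply: eq_bigr => j _; rewrite mulrnDr.
have -> : ((2 ^ n).+1 ^ q = size [seq val_at c | c : {ffun 'I_q -> 'I_(2 ^ n).+1}])%N.
  by rewrite size_map -cardE card_ffun !card_ord.
apply: uniq_leq_size; first exact: undup_uniq.
move=> g; rewrite mem_undup => /key[c [bc ->]]; apply/mapP.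
exists [ffun j => inord (c j)]; first by rewrite mem_enum.
by apply: eq_bigr => j _; rewrite ffunE inordK// ltnS.
Qed.

End Degrees.

Section MainEstimate.
Variables (R : realType) (G : ordGroupType) (A : cstarType R).
Variable alpha : pos_cone G -> A -> A.
Hypotheses (halpha : dynamical_system alpha)
  (hext : forall x : pos_cone G, extendible (alpha x)).
Local Notation GP := (pos_cone G).
Variables (C : cstarType R) (k : A -> C) (w : GP -> multiplier C).
Hypotheses (cov : covariant_in alpha k w)
  (hcoef : forall l r t, nr (coef hext l r t) <= nr (evm k w l)).
Implicit Types (l m : seq (term G A)).

Lemma npow_star l n : star (evm k w (npow hext l n)) = evm k w (npow hext l n).
Proof.
elim: n => [|n IH] /=; rewrite (evm_mul halpha hext cov) starM ?IH//.
by rewrite (evm_star cov) starK.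
Qed.

Lemma nr_npow l n : nr (evm k w (npow hext l n)) = nr (evm k w l) ^+ (2 ^ n.+1).
Proof.
elim: n => [|n IH] /=; rewrite (evm_mul halpha hext cov).
  by rewrite (evm_star cov) nr_cstar.
by rewrite -{1}npow_star nr_cstar IH -exprM -expnSr.
Qed.

Variables (H : hilbertType R) (pi : A -> bop H) (V : GP -> bop H).
Hypotheses (covH : covariant alpha pi V) (nd : nondegenerate_rep pi).

Lemma ev_degrees_le l h :
  nr (ev pi V l h) <= (size (undup [seq degree p | p <- l]))%:R * nr (evm k w l) * nr h.
Proof.
set D := undup _.
have -> : ev pi V l = \sum_(g <- D) ev pi V (homogeneous g l).
  rewrite /ev; under [RHS]eq_bigr do rewrite /homogeneous big_filter.
  rewrite (exchange_big_dep predT)//= big_seq [RHS]big_seq; apply: eq_bigr => p pl.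
  rewrite -big_filter; have -> : [seq g <- D | degree p == g] = [:: degree p].
    have pD : degree p \in D by rewrite mem_undup map_f.
    have := filter_pred1_uniq (undup_uniq _) pD.
    by move=> <-; apply: eq_filter => g /=; rewrite eq_sym.
  by rewrite big_seq1.
rewrite bop_sumE (le_trans (nr_sum _ _ _))//.
rewrite -mulrA mulr_natl; set K := _ * _.
apply: (@le_trans _ _ (\sum_(g <- D) K)).
  rewrite /K; apply: ler_sum => g _; apply: (@ev_homogeneous_le _ _ _ _ halpha hext _ _ _ covH nd _ _ g _ (leqnn _)); first exact: nr_ge0.
    by move=> p; rewrite mem_filter => /andP[/eqP].
  move=> p; rewrite mem_filter => /andP[/eqP <- _].
  by rewrite coef_homogeneous.
by rewrite big_const_seq count_predT iter_addr_0.
Qed.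

(** For K above the norm in C, some n makes the number of degrees times the 2^(n+1)-th power of that
    norm at most the same power of K. This bounds [npow l n], and [bop_sqr_le] takes square roots
    back down to l. *)
Lemma ev_le l h : nr (ev pi V l h) <= nr (evm k w l) * nr h.
Proof.
have hev := ev_mul halpha covH (hilbert_range hext covH nd).
have sN (m : nat) : star (ev pi V (npow hext l m)) = ev pi V (npow hext l m).
  by elim: m => [|m IH] /=; rewrite hev starM ?IH// (ev_star covH) starK.
suff key K : nr (evm k w l) < K -> nr (ev pi V l h) <= K * nr h.
  apply/ler_addgt0Pr => e e0; have h0 : 0 < nr h + 1 by rewrite ltr_wpDl ?nr_ge0.
  apply: (@le_trans _ _ ((nr (evm k w l) + e / (nr h + 1)) * nr h)).
    by apply: key; rewrite ltrDl divr_gt0.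
  rewrite mulrDl lerD2l -mulrA ler_piMr ?(ltW e0)// mulrC ler_pdivrMr// mul1r.
  by rewrite lerDl.
move=> lK; have K0 : 0 < K := le_lt_trans (nr_ge0 _) lK.
have [q hq] := degrees_npow hext l.
have [n hn] : exists n, (2 ^ n).+1%:R ^+ q * nr (evm k w l) ^+ (2 ^ n.+1) <= K ^+ (2 ^ n.+1).
  have [->|c0] := eqVneq (nr (evm k w l)) 0.
    by exists 0; rewrite expr0n/= mulr0 exprn_ge0// ltW.
  have {}c0 : 0 < nr (evm k w l) by rewrite lt_neqAle eq_sym c0 nr_ge0.
  have [n hn] : exists n, ((2 ^ n).+1%:R : R) ^+ q <= (K / nr (evm k w l)) ^+ (2 ^ n.+1).
    by apply: exp_beats_poly; rewrite ltr_pdivlMr// mul1r.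
  by exists n; rewrite -ler_pdivlMr ?exprn_gt0// -expr_div_n.
have bound h' : nr (ev pi V (npow hext l n) h') <= K ^+ (2 ^ n.+1) * nr h'.
  rewrite (le_trans (ev_degrees_le _ _))// ler_wpM2r ?nr_ge0// nr_npow.
  rewrite (le_trans _ hn)// ler_wpM2r ?exprn_ge0 ?nr_ge0//.
  by rewrite -natrX ler_nat.
elim: n bound {hn} h => [|n IH] bound h.
  apply: bop_sqr_le; first exact: ltW.
  by move=> h'; have := bound h'; rewrite /= hev (ev_star covH).
apply: IH => h'; apply: bop_sqr_le; first by rewrite exprn_ge0// ltW.
by move=> h''; rewrite sN -hev -exprM -expnSr; exact: bound.
Qed.

End MainEstimate.

(** * The universal property *)

Section DenseExtension.
Variables (R : realType) (V : normedModType R[i]) (I : Type) (f : I -> V).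
Hypothesis dense : forall x e, 0 < e -> exists i, nr (x - f i) < e.

(** The dense set is given as a family, since formal sums index it with repetitions; the Lipschitz
    bound also says that g i depends only on f i. *)
Lemma dense_extension (W : completeNormedModType R[i]) (g : I -> W) (K : R) : 0 <= K ->
  (forall i j, nr (g i - g j) <= K * nr (f i - f j)) ->
  exists F : V -> W, (forall i, F (f i) = g i) /\ forall x y, nr (F x - F y) <= K * nr (x - y).
Proof.
move=> K0 gK; pose L := K + 1; have L0 : 0 < L by rewrite ltr_wpDl.
have gL i j : nr (g i - g j) <= L * nr (f i - f j).
  by rewrite (le_trans (gK i j))// ler_wpM2r ?nr_ge0// lerDl.
have /choice[F hF] : forall x, exists y, forall e, 0 < e ->
    exists2 d, 0 < d & forall i, nr (x - f i) < d -> nr (g i - y) <= e.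
  move=> x; pose Fx : set_system I :=
    filter_from [set d : R | 0 < d] (fun d => [set i | nr (x - f i) < d]).
  have PF : ProperFilter Fx.
    apply: filter_from_proper; last by move=> d d0; have [i hi] := dense x d0; exists i.
    apply: filter_from_filter; first by exists (1 : R) => /=.
    move=> d1 d2 /= h1 h2; exists (Num.min d1 d2); first by rewrite /= lt_min h1.
    by move=> i /=; rewrite lt_min => /andP[].
  have [y hy] : exists y : W, g i @[i --> Fx] --> y.
    apply: nr_complete => e e0.
    exists [set i | nr (x - f i) < e / 2 / L]; first by exists (e / 2 / L) => //=; rewrite !divr_gt0.
    move=> i j /= hi hj; rewrite (le_trans (gL _ _))// mulrC -ler_pdivlMr//.
    rewrite (le_trans (nr_dist_trans x _ _))// nr_distC.
    have -> : e / L = e / 2 / L + e / 2 / L by rewrite -mulrDl -splitr.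
    by rewrite lerD// ltW.
  by exists y => e e0; have /cvg_nrP/(_ _ e0)[d d0 hd] := hy; exists d.
have FK x y : nr (F x - F y) <= K * nr (x - y).
  apply/ler_addgt0Pr => e e0.
  have e4 : 0 < e / 4 by rewrite divr_gt0.
  have [d1 d10 h1] := hF x _ e4; have [d2 d20 h2] := hF y _ e4.
  pose d := Num.min (Num.min d1 d2) (e / 4 / L).
  have d0 : 0 < d by rewrite !lt_min d10 d20 divr_gt0.
  have [i hi] := dense x d0; have [j hj] := dense y d0.
  move: (hi) (hj); rewrite !lt_min => /andP[/andP[hi1 _] hi2] /andP[/andP[_ hj1] hj2].
  have {}h1 := h1 _ hi1; have {}h2 := h2 _ hj1; have h3 := gK i j.
  have h4 : nr (f i - f j) <= e / 4 / L + nr (x - y) + e / 4 / L.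
    rewrite (le_trans (nr_dist_trans y _ _))// lerD ?(ltW hj2)//.
    by rewrite (le_trans (nr_dist_trans x _ _))// lerD// nr_distC ltW.
  have h5 : K * nr (f i - f j) <= e / 2 + K * nr (x - y).
    have h5 : K * (e / 4 / L) <= e / 4.
      by rewrite mulrCA ler_piMr ?(ltW e4)// ler_pdivrMr// mul1r lerDl.
    by rewrite (le_trans (ler_wpM2l K0 h4))// !mulrDr; lra.
  rewrite (le_trans (nr_dist_trans (g i) _ _))// nr_distC.
  have h6 := nr_dist_trans (g j) (g i) (F y); lra.
exists F; split=> // i; apply: nr_small_eq => e e0.
by have [d d0 /(_ i)] := hF (f i) _ e0; rewrite subrr nr0 nr_distC; apply.
Qed.

Definition lipschitz (W : normedModType R[i]) (F : V -> W) :=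
  exists2 K : R, 0 <= K & forall x y, nr (F x - F y) <= K * nr (x - y).

Lemma dense_eq (W : normedModType R[i]) (F G : V -> W) : lipschitz F -> lipschitz G ->
  (forall i, F (f i) = G (f i)) -> forall x, F x = G x.
Proof.
move=> [K K0 hF] [L L0 hG] FG x; apply: nr_small_eq => e e0.
have s0 : 0 < K + L + 1 by rewrite ltr_wpDl ?addr_ge0.
have [i hi] := dense x (divr_gt0 e0 s0).
rewrite (le_trans (nr_dist_trans (F (f i)) _ _))// {2}FG.
have h1 := hF x (f i); have h2 := hG (f i) x.
rewrite (le_trans (lerD h1 h2))//; rewrite [nr (f i - x)]nr_distC -mulrDl.
rewrite (le_trans (ler_wpM2l (addr_ge0 K0 L0) (ltW hi)))// mulrCA ler_piMr ?ltW//.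
by rewrite ltr_pdivrMr// mul1r ltrDl.
Qed.

Lemma linear_lipschitz (W : normedModType R[i]) (F : V -> W) (K : R) : 0 <= K ->
  (forall x y, F (x + y) = F x + F y) -> (forall (c : R[i]) x, F (c *: x) = c *: F x) ->
  (forall x, nr (F x) <= K * nr x) -> lipschitz F.
Proof.
move=> K0 FD FZ FK; exists K => // x y.
by rewrite -[- F y]scaleN1r -FZ -FD scaleN1r.
Qed.

(** Linearity is required at the level of indices only: one index realizes the sum on both sides, as
    concatenation of formal sums does. *)
Lemma dense_linear_extension (W : completeNormedModType R[i]) (g : I -> W) (K : R) :
  0 <= K ->
  (forall i j, exists m, f m = f i + f j /\ g m = g i + g j) ->
  (forall (c : R[i]) i, exists m, f m = c *: f i /\ g m = c *: g i) ->
  (forall i, nr (g i) <= K * nr (f i)) ->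
  exists F : V -> W, [/\ forall i, F (f i) = g i, forall x y, F (x + y) = F x + F y,
    forall (c : R[i]) x, F (c *: x) = c *: F x & forall x, nr (F x) <= K * nr x].
Proof.
move=> K0 gD gZ gK; have [F [Ff FK]] : exists F : V -> W, (forall i, F (f i) = g i) /\
    forall x y, nr (F x - F y) <= K * nr (x - y).
  apply: dense_extension => // i j.
  have [m [fm gm]] := gZ (- 1) j; have [n [fn gn]] := gD i m.
  by rewrite -[- g j]scaleN1r -[- f j]scaleN1r -fm -gm -fn -gn.
have lipF (h : V -> V) (L : R) : 0 <= L -> (forall x y, nr (h x - h y) <= L * nr (x - y)) ->
    lipschitz (F \o h).
  move=> L0 hL; exists (K * L); first exact: mulr_ge0.
  by move=> x y; rewrite (le_trans (FK _ _))// -mulrA ler_wpM2l.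
have FD x y : F (x + y) = F x + F y.
  have tr z : lipschitz (F \o +%R z).
    by apply: (lipF _ 1) => // x' y'; rewrite opprD addrACA subrr add0r mul1r.
  have tr' z : lipschitz (fun x => z + F x).
    by exists K => // x' y'; rewrite opprD addrACA subrr add0r.
  apply: (dense_eq (tr x) (tr' (F x))) => j; rewrite /= addrC [RHS]addrC.
  apply: (dense_eq (tr (f j)) (tr' (F (f j)))) => i; rewrite /= !Ff.
  by have [m [fm gm]] := gD j i; rewrite -fm Ff.
have FZ (c : R[i]) x : F (c *: x) = c *: F x.
  have c0 : 0 <= complex.Re `|c| by rewrite -ler0c RRe_real ?normr_real.
  move: x; apply: dense_eq.
  - by apply: (lipF _ (complex.Re `|c|)) => // x y; rewrite -scalerBr nrZC.
  - exists (complex.Re `|c| * K); first exact: mulr_ge0.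
    by move=> x y; rewrite -scalerBr nrZC -mulrA ler_wpM2l.
  by move=> i; have [m [fm gm]] := gZ c i; rewrite -fm !Ff.
exists F; split=> // x; have := FK x (0 *: x).
by rewrite FZ !scale0r !subr0.
Qed.

End DenseExtension.

(** Replacing x by ix recovers the imaginary parts. *)
Lemma hdot_re_eq (R : realType) (H : hilbertType R) (S T : H -> H) :
  (forall (c : R[i]) x, S (c *: x) = c *: S x) ->
  (forall x y, complex.Re (hdot (S x) y) = complex.Re (hdot x (T y))) ->
  forall x y, hdot (S x) y = hdot x (T y).
Proof.
move=> SZ h x y; have h1 := h x y; have := h ('i *: x) y; rewrite SZ !hdotZl.
case: (hdot (S x) y) (hdot x (T y)) h1 => a b [c d] /= ->.
by rewrite !mul0r !mul1r !add0r => /oppr_inj ->.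
Qed.

Section Universal.
Variables (R : realType) (G : ordGroupType) (A : cstarType R).
Variable alpha : pos_cone G -> A -> A.
Hypotheses (halpha : dynamical_system alpha)
  (hext : forall x : pos_cone G, extendible (alpha x)).
Local Notation GP := (pos_cone G).
Implicit Types (l m : seq (term G A)).

(** V_0 is only given as an idempotent partial isometry; alpha_0 = id and covariance make it act
    trivially on pi(A). *)
Lemma cov_zero_l (W : starAlgType R) (pi : A -> W) (V : GP -> W) a :
  covariant alpha pi V -> star (V (pc0 G)) ** pi a = pi a.
Proof.
move=> cov; have e a' : pi a' = V (pc0 G) ** pi a' ** star (V (pc0 G)).
  by rewrite -(cov_act cov) (ds_id halpha).
have V0 : V (pc0 G) ** V (pc0 G) = V (pc0 G).
  by rewrite (cov_add cov); congr V; apply: pc_inj; rewrite /= addr0.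
have -> : star (V (pc0 G)) ** pi a = pi a ** star (V (pc0 G)).
  by rewrite (cov_piS halpha cov) (ds_id halpha).
by rewrite {1}e -amulA -starM V0 -e.
Qed.

Lemma cov_zero (W : starAlgType R) (pi : A -> W) (V : GP -> W) a :
  covariant alpha pi V -> star (V (pc0 G)) ** pi a ** V (pc0 G) = pi a.
Proof.
move=> cov; rewrite cov_zero_l//; have := cov_zero_l (star a) cov.
move=> /(congr1 (@star R W)); rewrite starM starK -(star_hom_star (cov_hom cov)) starK.
by [].
Qed.

Section Evm.
Variables (C : cstarType R) (k : A -> C) (w : GP -> multiplier C).
Hypothesis cov : covariant_in alpha k w.

Lemma evm_unit a : evm k w [:: (pc0 G, a, pc0 G)] = k a.
Proof.
rewrite /evm big_seq1; have h := cov_zero a cov.2.2; apply: amul_injl => b.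
by rewrite -mlM -ml_mr; have := congr1 (fun T => ml T b) h.
Qed.

(** v_s i_A(a) is a single generator. Maps known on the sums are thereby known on v_s, by
    non-degeneracy. *)
Lemma evm_algebra s a : evm k w [:: (pc0 G, alpha s a, s)] = ml (w s) (k a).
Proof.
have hc := cov.2.2; rewrite /evm big_seq1.
have h1 := cov_zero_l (alpha s a) hc; have h2 := cov_pi hc s a.
have e : mr (w s) (k (alpha s a)) = ml (w s) (k a).
  apply: amul_injl => b.
  by rewrite -ml_mr -mlM; have := congr1 (fun T => ml T b) h2.
rewrite -[RHS]e; apply: amul_injl => b; rewrite -mlM -ml_mr.
by have := congr1 (fun T => ml T (ml (w s) b)) h1.
Qed.

Hypothesis span : total_set
  [set b | exists s a t, b = ml (star (w s)) (mr (w t) (k a))].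

Lemma evm_dense x (e : R) : 0 < e -> exists l, nr (x - evm k w l) < e.
Proof.
move=> e0; have e20 : 0 < e / 2 by rewrite divr_gt0.
move/total_setP : span => /(_ x _ e20)[y hy xy].
suff [l lE] : exists l, y = evm k w l.
  by exists l; rewrite -lE (le_lt_trans xy)// ltr_pdivrMr// ltr_pMr// ltrDl.
have := hy; apply: (@lin_span_ind _ _ _ (fun y => exists l, y = evm k w l)).
- by exists [::]; rewrite /evm big_nil.
- by move=> _ _ [l ->] [m ->]; exists (l ++ m); rewrite evm_cat.
- by move=> c _ [l ->]; exists (fscale c l); rewrite (evm_scale cov).
- by move=> _ [s [a [t ->]]]; exists [:: (s, a, t)]; rewrite /evm big_seq1.
Qed.

End Evm.

Section Representation.
Variables (C : cstarType R) (k : A -> C) (w : GP -> multiplier C).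
Hypotheses (cov : covariant_in alpha k w)
  (span : total_set [set b | exists s a t, b = ml (star (w s)) (mr (w t) (k a))])
  (hcoef : forall l r t, nr (coef hext l r t) <= nr (evm k w l)).

Section OnHilbert.
Variables (H : hilbertType R) (pi : A -> bop H) (V : GP -> bop H).
Hypotheses (nd : nondegenerate_rep pi) (covH : covariant alpha pi V).

Let dense := evm_dense cov span.
Let hpi := cov_hom covH.

(** The extension from sums to C is made for one vector h at a time, with values in H. Linearity in
    h, adjoints and multiplicativity then pass from the sums to C by density. *)
Lemma integrated_rep : exists rho : C -> bop H, star_hom rho /\
  forall l, rho (evm k w l) = ev pi V l.
Proof.
have /choice[Phi hPhi] : forall h, exists F : C -> H,
    [/\ forall l, F (evm k w l) = ev pi V l h, forall x y, F (x + y) = F x + F y,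
    forall (c : R[i]) x, F (c *: x) = c *: F x & forall x, nr (F x) <= nr h * nr x].
  move=> h; apply: (dense_linear_extension dense); first exact: nr_ge0.
  - by move=> l m; exists (l ++ m); rewrite evm_cat ev_cat.
  - by move=> c l; exists (fscale c l); rewrite (evm_scale cov) (ev_scale covH).
  - by move=> l; rewrite mulrC; exact: (ev_le halpha cov hcoef covH nd).
have evE h l : Phi h (evm k w l) = ev pi V l h by case: (hPhi h).
have PhiD h x y : Phi h (x + y) = Phi h x + Phi h y by case: (hPhi h).
have PhiZ h (c : R[i]) x : Phi h (c *: x) = c *: Phi h x by case: (hPhi h).
have Phile h x : nr (Phi h x) <= nr h * nr x by case: (hPhi h).
have PhiB h x y : Phi h (x - y) = Phi h x - Phi h y.
  by rewrite PhiD -scaleN1r PhiZ scaleN1r.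
have lipP h : lipschitz (Phi h) by apply: linear_lipschitz (Phile h) => //; exact: nr_ge0.
have lipP' h (c : R[i]) h' : lipschitz (fun x => c *: Phi h x + Phi h' x).
  have c0 : 0 <= complex.Re `|c| by rewrite -ler0c RRe_real ?normr_real.
  apply: (@linear_lipschitz _ _ _ _ (complex.Re `|c| * nr h + nr h')).
  - by rewrite addr_ge0 ?mulr_ge0 ?nr_ge0.
  - by move=> x y; rewrite !PhiD scalerDr addrACA.
  - by move=> d x; rewrite !PhiZ scalerDr scalerA mulrC -scalerA.
  move=> x; rewrite (le_trans (nrD _ _))// nrZC mulrDl lerD// -mulrA ler_wpM2l//.
have Hlin (c : R[i]) h h' x : Phi (c *: h + h') x = c *: Phi h x + Phi h' x.
  by move: x; apply: (dense_eq dense) => // l; rewrite !evE bopD bopZ.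
have adj x : forall h h', hdot (Phi h x) h' = hdot h (Phi h' (star x)).
  apply: (hdot_re_eq (S := Phi^~ x)) => [c h|h h'].
    by have := Hlin c h 0 x; rewrite addr0 => ->; have := Hlin 1 0 0 x;
      rewrite scaler0 addr0 scale1r => /(congr1 (fun z => z - Phi 0 x));
      rewrite subrr addrK => <-; rewrite addr0.
  apply/eqP; rewrite -subr_eq0; apply/eqP/eqP; rewrite -normr_le0; apply/ler_addgt0Pr => e e0.
  rewrite add0r; have s0 : 0 < 2 * nr h * nr h' + 1.
    by rewrite ltr_wpDl ?mulr_ge0 ?nr_ge0.
  have [l hl] := dense x (divr_gt0 e0 s0).
  have h1 : hdot (ev pi V l h) h' = hdot h (ev pi V (fstar l) h').
    by rewrite (ev_star covH) hdot_star.
  have h2 := re_hdot_le (Phi h (x - evm k w l)) h'.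
  have h3 := re_hdot_le h (Phi h' (star (x - evm k w l))).
  have h4 := Phile h (x - evm k w l); have h5 := Phile h' (star (x - evm k w l)).
  rewrite nr_star in h5.
  have E : complex.Re (hdot (Phi h x) h') - complex.Re (hdot h (Phi h' (star x))) =
    complex.Re (hdot (Phi h (x - evm k w l)) h') -
    complex.Re (hdot h (Phi h' (star (x - evm k w l)))).
    rewrite starB !PhiB -(evm_star cov) // hdotBl hdotBr !evE h1.
    move: (hdot (Phi h x) h') (hdot h (Phi h' (star x))) (hdot h (ev pi V (fstar l) h')).
    by move=> [a a'] [b b'] [c c'] /=; lra.
  rewrite E (le_trans (ler_normB _ _))//.
  set d := nr (x - _) in hl h4 h5.
  have h6 : nr (Phi h (x - evm k w l)) * nr h' <= nr h * nr h' * d.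
    by rewrite mulrAC ler_wpM2r ?nr_ge0.
  have h7 : nr h * nr (Phi h' (star (x - evm k w l))) <= nr h * nr h' * d.
    by rewrite -mulrA ler_wpM2l ?nr_ge0.
  have h8 : (2 * nr h * nr h' + 1) * d <= e by rewrite mulrC -ler_pdivlMr// ltW.
  have d0 : 0 <= d := nr_ge0 _; lra.
have bnd x : exists M : R[i], forall h, `|Phi h x| <= M * `|h| /\ `|Phi h (star x)| <= M * `|h|.
  exists (nr x)%:C => h; rewrite !nrE -realCM !lecR mulrC; split=> //.
  by have := Phile h (star x); rewrite nr_star.
pose rho x := Bop (adj x) (bnd x).
exists rho; split=> [|l]; last by apply: bop_eq => h; exact: evE.
split=> [x y|c x|x y|x]; apply: bop_eq => h //.
- exact: (PhiD h x y).
- exact: (PhiZ h c x).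
have mulK z : lipschitz (fun x => Phi h (x ** z)).
  apply: (@linear_lipschitz _ _ _ _ (nr h * nr z)).
  - by rewrite mulr_ge0 ?nr_ge0.
  - by move=> a b; rewrite amulDl PhiD.
  - by move=> c a; rewrite amulZl PhiZ.
  - by move=> a; rewrite (le_trans (Phile _ _))// mulrAC -mulrA ler_wpM2l ?nr_ge0 ?nrM.
have mulK' z : lipschitz (fun y => Phi h (z ** y)).
  apply: (@linear_lipschitz _ _ _ _ (nr h * nr z)).
  - by rewrite mulr_ge0 ?nr_ge0.
  - by move=> a b; rewrite amulDr PhiD.
  - by move=> c a; rewrite amulZr PhiZ.
  - by move=> a; rewrite (le_trans (Phile _ _))// -mulrA ler_wpM2l ?nr_ge0 ?nrM.
have compK : lipschitz (fun y => Phi (Phi h y) x).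
  apply: (@linear_lipschitz _ _ _ _ (nr h * nr x)).
  - by rewrite mulr_ge0 ?nr_ge0.
  - by move=> a b; rewrite PhiD; exact: (bopD (rho x)).
  - by move=> c a; rewrite PhiZ; exact: (bopZ (rho x)).
  - by move=> a; rewrite (le_trans (Phile _ _))// mulrAC ler_wpM2r ?nr_ge0.
apply: (dense_eq dense (mulK' x) compK) => m.
apply: (dense_eq dense (mulK (evm k w m)) (lipP (Phi h (evm k w m)))) => l.
rewrite -(evm_mul halpha hext cov) !evE (ev_mul halpha covH) //.
exact: (hilbert_range hext covH nd).
Qed.

Lemma universal_rep : exists rho : C -> bop H,
  [/\ star_hom rho, nondegenerate_rep rho, forall a, rho (k a) = pi a &
    exists2 rhobar, mult_extension rho rhobar & forall s, rhobar (w s) = V s].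
Proof.
have [rho [hrho rhoE]] := integrated_rep.
have rk a : rho (k a) = pi a.
  have := rhoE [:: (pc0 G, a, pc0 G)]; rewrite /ev big_seq1 (cov_zero _ covH) => <-.
  by rewrite (evm_unit cov).
have ndr : nondegenerate_rep rho.
  apply: (total_set_trans nd) => _ e [a [h ->]] e0.
  exists (pi a h); last by rewrite subrr nr0 ltW.
  by apply: lin_span_incl; exists (k a), h; rewrite rk.
have [rb hrb] := rep_extension hrho ndr.
(* The equality is tested on the vectors pi(a) h, with a along the approximate unit; there w_s k(a)
   is a generator by [evm_algebra]. *)
exists rho; split=> //; exists rb => // s; apply: bop_eq => h.
have e0 : pi a h @[a --> @au R A] --> h by exact: (@rep_essential _ _ _ _ hpi nd h).
have e (T : bop H) : T (pi a h) @[a --> @au R A] --> T h by exact: bop_cvg.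
have e1 := e (rb (w s)); have e2 := e (V s).
apply: (lim_uniq e1); apply: cvg_ext e2 => a.
rewrite -!bop_mulE -rk (mult_extension_ml hrb) -(evm_algebra cov) rhoE.
rewrite /ev big_seq1 (cov_zero_l _ covH) -(cov_pi covH).
by rewrite rk.
Qed.

End OnHilbert.

Lemma piso_crossed_product_of_coef : piso_crossed_product alpha k w.
Proof. by split=> // H pi V; exact: universal_rep. Qed.

End Representation.
End Universal.

(** * Comparison of two crossed products *)

Lemma mult_of_inj (R : realType) (C : cstarType R) (x y : C) : mult_of x = mult_of y -> x = y.
Proof. by move=> h; apply: amul_injl => z; exact: (congr1 (fun m => ml m z) h). Qed.

Lemma nondegenerate_mult_eq (R : realType) (A C : cstarType R) (k : A -> C)
    (m n : multiplier C) : nondegenerate_hom k ->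
  (forall a, ml m (k a) = ml n (k a)) -> m = n.
Proof.
move=> nd h; apply: multiplier_eq => c; apply: amul_injr => b; rewrite !ml_mr.
apply/eqP; rewrite -subr_eq0 -amulBl; apply/eqP.
apply: (total_ind nd (P := fun c => (mr m b - mr n b) ** c = 0)).
- exact: amul0r.
- by move=> x y hx hy; rewrite amulDr hx hy addr0.
- by move=> d x hx; rewrite amulZr hx scaler0.
- move=> x hx; apply: nr_small => e e0.
  have s0 : 0 < nr (mr m b - mr n b) + 1 by rewrite ltr_wpDl ?nr_ge0.
  have [y hy xy] := hx _ (divr_gt0 e0 s0).
  rewrite -[X in nr X]subr0 -hy -amulBr (le_trans (nrM _ _))//.
  rewrite (le_trans (ler_wpM2l (nr_ge0 _) xy))// mulrCA ler_piMr ?ltW//.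
  by rewrite ltr_pdivrMr// mul1r ltrDl.
by move=> _ [a [x ->]]; rewrite amulA amulBl -!ml_mr h subrr amul0l.
Qed.

Lemma star_hom_lipschitz (R : realType) (B C : cstarType R) (psi : B -> C) :
  star_hom psi -> lipschitz psi.
Proof.
move=> h; apply: (@linear_lipschitz _ _ _ _ 1) => // [x y|c x|x].
- exact: star_homD.
- exact: star_homZ.
- by rewrite mul1r star_hom_contr.
Qed.

Section Comparison.
Variables (R : realType) (G : ordGroupType) (A : cstarType R).
Variable alpha : pos_cone G -> A -> A.
Hypotheses (halpha : dynamical_system alpha)
  (hext : forall x : pos_cone G, extendible (alpha x)).
Local Notation GP := (pos_cone G).
Implicit Types (l m : seq (term G A)).

(** A representation of B that computes the norm of this element restricts to a covariant pair on a
    Hilbert space. By the universal property of C that pair also comes from a representation of C,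
    which is contractive. *)
Lemma pcp_le (B C : cstarType R) (iA : A -> B) (v : GP -> multiplier B)
    (kA : A -> C) (w : GP -> multiplier C) l :
  piso_crossed_product alpha iA v -> piso_crossed_product alpha kA w ->
  nr (evm iA v l) <= nr (evm kA w l).
Proof.
move=> hB hC; have [H [sigma [hs nd]]] := gelfand_naimark (evm iA v l).
apply; first exact: nr_ge0.
move=> h; have [sbar hbar] := rep_extension hs nd; have cB := pcp_covariant hB.
have [rho [hr _ rE [rbar hrbar rbE]]] :=
  pcp_universal hC (nondegenerate_comp cB hs nd hbar) (covariant_comp cB hs hbar).
have -> : sigma (evm iA v l) = rho (evm kA w l).
  rewrite (evm_rep _ _ hs hbar) (evm_rep _ _ hr hrbar); apply: eq_bigr => q _.
  by rewrite /= rE !rbE.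
exact: star_hom_hilbert.
Qed.

Lemma pcp_hom (B C : cstarType R) (iA : A -> B) (v : GP -> multiplier B)
    (kA : A -> C) (w : GP -> multiplier C) :
  piso_crossed_product alpha iA v -> piso_crossed_product alpha kA w ->
  exists psi : B -> C, star_hom psi /\ forall l, psi (evm iA v l) = evm kA w l.
Proof.
move=> hB hC; have cB := pcp_covariant hB; have cC := pcp_covariant hC.
have dense := evm_dense cB (pcp_span hB).
have [psi [pE pD pZ pK]] : exists F : B -> C, [/\ forall l, F (evm iA v l) = evm kA w l,
    forall x y, F (x + y) = F x + F y, forall (c : R[i]) x, F (c *: x) = c *: F x &
    forall x, nr (F x) <= 1 * nr x].
  apply: (dense_linear_extension dense) => //.
  - by move=> l m; exists (l ++ m); rewrite !evm_cat.
  - by move=> c l; exists (fscale c l); rewrite (evm_scale cB) (evm_scale cC).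
  - by move=> l; rewrite mul1r; exact: pcp_le.
have lp : lipschitz psi by exact: (linear_lipschitz ler01).
have lin (f : B -> C) K : 0 <= K -> (forall x y, f (x + y) = f x + f y) ->
    (forall x, nr (f x) <= K * nr x) -> (forall x, f (- x) = - f x) -> lipschitz f.
  by move=> K0 fD fK fN; exists K => // x y; rewrite -fN -fD.
have pN x : psi (- x) = - psi x by rewrite -scaleN1r pZ scaleN1r.
exists psi; split=> //; split=> // [x y|x].
- have lr z : lipschitz (fun x => psi (x ** z)).
    apply: (lin _ (nr z)); first exact: nr_ge0.
    + by move=> a b; rewrite amulDl pD.
    + by move=> a; rewrite (le_trans (pK _))// mul1r mulrC nrM.
    + by move=> a; rewrite amulNl pN.
  have lr' z : lipschitz (fun x => psi x ** z).
    apply: (lin _ (nr z)); first exact: nr_ge0.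
    + by move=> a b; rewrite pD amulDl.
    + by move=> a; rewrite (le_trans (nrM _ _))// mulrC ler_wpM2l ?nr_ge0// -[nr a]mul1r.
    + by move=> a; rewrite pN amulNl.
  have ll z : lipschitz (fun x => psi (z ** x)).
    apply: (lin _ (nr z)); first exact: nr_ge0.
    + by move=> a b; rewrite amulDr pD.
    + by move=> a; rewrite (le_trans (pK _))// mul1r nrM.
    + by move=> a; rewrite amulNr pN.
  have ll' z : lipschitz (fun x => z ** psi x).
    apply: (lin _ (nr z)); first exact: nr_ge0.
    + by move=> a b; rewrite pD amulDr.
    + by move=> a; rewrite (le_trans (nrM _ _))// ler_wpM2l ?nr_ge0// -[nr a]mul1r.
    + by move=> a; rewrite pN amulNr.
  apply: (dense_eq dense (ll x) (ll' (psi x))) => m.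
  apply: (dense_eq dense (lr (evm iA v m)) (lr' (psi (evm iA v m)))) => l.
  by rewrite -(evm_mul halpha hext cB) !pE (evm_mul halpha hext cC).
- apply: (dense_eq dense (F := psi \o @star R B) (G := @star R C \o psi)).
  + apply: (lin _ 1) => // [a b|a|a] /=; first by rewrite starD pD.
      by rewrite (le_trans (pK _))// nr_star.
    by rewrite starN pN.
  + apply: (lin _ 1) => // [a b|a|a] /=; first by rewrite pD starD.
      by rewrite nr_star.
    by rewrite pN starN.
  by move=> l /=; rewrite -(evm_star cB) !pE (evm_star cC).
Qed.

Section Iso.
Variables (B C : cstarType R) (iA : A -> B) (v : GP -> multiplier B).
Variables (kA : A -> C) (w : GP -> multiplier C).
Hypotheses (hB : piso_crossed_product alpha iA v) (hC : piso_crossed_product alpha kA w).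

Let cB := pcp_covariant hB.
Let cC := pcp_covariant hC.
Let denseB := evm_dense cB (pcp_span hB).
Let denseC := evm_dense cC (pcp_span hC).

(** The prescribed values on i_A and v determine psi on the dense set of sums, which gives
    uniqueness. *)
Lemma integrated_form_evm psi l : integrated_form iA v kA w psi ->
  psi (evm iA v l) = evm kA w l.
Proof.
move=> [hp _ pa [pb hpb pw]]; rewrite /evm (star_hom_sum _ _ hp).
apply: eq_bigr => q _; apply: mult_of_inj.
rewrite -(mult_extension_ml hpb) -(mult_extension_mr hpb).
rewrite (star_hom_star hpb.1) !pw pa.
apply: multiplier_eq => x.
rewrite -[LHS]/(ml (star (w q.1.1)) (kA q.1.2 ** ml (w q.2) x)) ml_mr.
exact: mlM.
Qed.

Lemma integrated_form_unique psi psi' : integrated_form iA v kA w psi ->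
  integrated_form iA v kA w psi' -> psi = psi'.
Proof.
move=> h h'; apply/funext; apply: (dense_eq denseB).
- exact: star_hom_lipschitz (if_hom h).
- exact: star_hom_lipschitz (if_hom h').
- by move=> l; rewrite !integrated_form_evm.
Qed.

Lemma integrated_form_exists : exists psi (chi : C -> B),
  [/\ integrated_form iA v kA w psi, star_hom chi, cancel psi chi & cancel chi psi].
Proof.
have [psi [hp pE]] := pcp_hom hB hC; have [chi [hc cE]] := pcp_hom hC hB.
have lc (D E F : cstarType R) (f : D -> E) (g : E -> F) : star_hom f -> star_hom g ->
    lipschitz (g \o f).
  move=> hf hg; apply: star_hom_lipschitz; split=> [x y|c x|x y|x] /=.
  - by rewrite (star_homD hf) (star_homD hg).
  - by rewrite (star_homZ hf) (star_homZ hg).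
  - by rewrite (star_homM hf) (star_homM hg).
  - by rewrite (star_hom_star hf) (star_hom_star hg).
have lid (D : cstarType R) : lipschitz (id : D -> D) by exists 1 => // x y; rewrite mul1r.
have pK : cancel psi chi.
  by apply: (dense_eq denseB (lc _ _ _ _ _ hp hc) (lid B)) => l /=; rewrite pE cE.
have cK : cancel chi psi.
  by apply: (dense_eq denseC (lc _ _ _ _ _ hc hp) (lid C)) => l /=; rewrite cE pE.
have pa a : psi (iA a) = kA a by rewrite -(evm_unit halpha cB) pE (evm_unit halpha cC).
exists psi, chi; split=> //; split=> //.
  apply/total_setP => x e e0.
  have /cvg_nrP/(_ _ e0)/filter_ex[u hu] := @au_l R C x.
  exists (u ** x); last by rewrite nr_distC.
  by apply: lin_span_incl; exists (chi u), x; rewrite cK.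
have mm (m : multiplier B) a b : a ** psi (ml m (chi b)) = psi (mr m (chi a)) ** b.
  by rewrite -{1}[a]cK -{2}[b]cK -!(star_homM hp) ml_mr.
(* An isomorphism extends to multipliers by conjugation. *)
exists (fun m : multiplier B => Multiplier (mm m)).
  split=> [|b]; last first.
    by apply: multiplier_eq => c /=; rewrite (star_homM hp) cK.
  split=> [x y|c x|x y|x]; apply: multiplier_eq => b /=.
  - by rewrite (star_homD hp).
  - by rewrite (star_homZ hp).
  - by rewrite pK.
  - by rewrite (star_hom_star hp) (star_hom_star hc).
move=> x; apply: (nondegenerate_mult_eq cC.2.1) => a /=.
by rewrite -pa pK -(evm_algebra halpha cB) pE (evm_algebra halpha cC) pa.
Qed.

End Iso.
End Comparison.

(** * The imprimitivity bimodule [pT] *)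

Section ProjectionRow.
Variables (R : realType) (T : cstarType R) (p : projection T).

Definition prow_pred : {pred T} := fun x => ml p x == x.

Record prow := Prow { prow_val : T; prow_valP : prow_val \in prow_pred }.

HB.instance Definition _ := [isSub of prow for prow_val].
HB.instance Definition _ := [Choice of prow by <:].

Implicit Types (x y z : prow).

Lemma prow_ml x : ml p (val x) = val x.
Proof. exact/eqP/(valP x). Qed.

Fact prow_submod_closed : submod_closed prow_pred.
Proof.
split; first by apply/eqP; rewrite -(scale0r (0 : T)) mlZ !scale0r.
by move=> c a b /eqP pa /eqP pb; apply/eqP; rewrite mlD mlZ pa pb.
Qed.

HB.instance Definition _ :=
  GRing.isSubmodClosed.Build R[i] T prow_pred prow_submod_closed.
HB.instance Definition _ := [SubChoice_isSubLmodule of prow by <:].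

Fact prow_norm_triangle x y : `|val (x + y)| <= `|val x| + `|val y|.
Proof. exact: ler_normD. Qed.
Fact prow_normZ (c : R[i]) x : `|val (c *: x)| = `|c| * `|val x|.
Proof. exact: normrZ. Qed.
Fact prow_norm_eq0 x : `|val x| = 0 -> x = 0.
Proof. by move=> /normr0_eq0 h; apply: val_inj. Qed.

HB.instance Definition _ := Lmodule_isNormed.Build R[i] prow
  prow_norm_triangle prow_normZ prow_norm_eq0.

Fact prow_complete (F : set_system prow) : ProperFilter F -> cauchy F -> cvg F.
Proof.
move=> FF cF.
have [l hl] : exists l : T, val x @[x --> F] --> l.
  apply: nr_complete => e e0; have e20 : 0 < (e / 2)%:C :> R[i] by rewrite ltcR divr_gt0.
  move/cauchy_ballP : cF => /(_ _ e20) [[P Q] /= [FP FQ] PQ].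
  have [z [Pz Qz]] := filter_ex (filterI FP FQ).
  exists P => // x y Px Py; have hx := PQ (x, z) (conj Px Qz); have hy := PQ (y, z) (conj Py Qz).
  rewrite -!ball_normE /= in hx hy.
  rewrite (le_trans (nr_dist_trans (val z) _ _))// (splitr e) lerD//.
    by rewrite -lecR -nrE ltW.
  by rewrite nr_distC -lecR -nrE ltW.
have lp : l \in prow_pred.
  apply/eqP; apply: nr_small_eq => e e0; have e20 : 0 < e / 2 by rewrite divr_gt0.
  have /cvg_nrP/(_ _ e20)/filter_ex[x hx] := hl.
  rewrite (le_trans (nr_dist_trans (val x) _ _))// (splitr e) lerD//.
  rewrite -{1}[val x]prow_ml nr_distC -[- ml p l]scaleN1r -mlZ -mlD scaleN1r -lecR.
  apply: (le_trans _ (_ : (nr (val x - l))%:C <= _)); last by rewrite lecR.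
  by rewrite -!nrE norm_mlp.
apply/cvg_ex; exists (Prow lp); apply/cvg_nrP => e e0.
by have /cvg_nrP/(_ _ e0) := hl.
Qed.

HB.instance Definition _ := Uniform_isComplete.Build prow prow_complete.

End ProjectionRow.

Section Imprimitivity.
Variables (R : realType) (T B : cstarType R) (p : projection T).
Variables (psi : B -> corner p) (chi : corner p -> B).
Hypotheses (hpsi : star_hom psi) (hchi : star_hom chi).
Hypotheses (psiK : cancel psi chi) (chiK : cancel chi psi).
Hypothesis full : total_set [set t | exists x y : T, t = x ** ml p y].

Local Notation X := (prow p).
Implicit Types (x y z : X) (t : T) (b : B).

Fact prow_lact_mem b x : val (psi b) ** val x \in prow_pred p.
Proof. by apply/eqP; rewrite mlM corner_ml. Qed.
Definition prow_lact b x : X := Prow (prow_lact_mem b x).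

Fact prow_ract_mem x t : val x ** t \in prow_pred p.
Proof. by apply/eqP; rewrite mlM prow_ml. Qed.
Definition prow_ract x t : X := Prow (prow_ract_mem x t).

Fact prow_lip_mem x y : val x ** star (val y) \in corner_pred p.
Proof.
by apply: corner_memP; rewrite ?mlM ?mrM ?prow_ml// -star_mlp prow_ml.
Qed.
Definition prow_lip x y : B := chi (Corner (prow_lip_mem x y)).

Definition prow_rip x y : T := star (val x) ** val y.

(** The inner product has to be a square inside the corner. The root d, taken in T, lies there
    because (1 - p) d d (1 - p) = (1 - p) c (1 - p) = 0. *)
Lemma corner_sqrt (c : corner p) : Pos (val c) -> exists d : corner p, c = star d ** d.
Proof.
move=> hc; have [d [sd pd dd _]] := Pos_sqrt hc.
have ld : ml p d = d.
  apply/eqP; rewrite eq_sym -subr_eq0; apply/eqP.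
  rewrite -[LHS]starK; apply: (etrans _ (@star0 R T)); congr star.
  apply: star_amul_eq0; rewrite starK starB star_mlp sd.
  rewrite amulBr !amulBl -mlM -[d ** mr p d]mrM dd corner_ml.
  by rewrite -mlM -mrM dd corner_mr corner_ml !subrr.
have rd : mr p d = d by rewrite -[LHS]starK star_mrp sd ld sd.
exists (Corner (corner_memP ld rd)); apply: val_inj.
by rewrite /= sd dd.
Qed.

Lemma nr_chi (c : corner p) : nr (chi c) = nr (val c).
Proof.
apply/eqP; rewrite eq_le; apply/andP; split; first exact: (star_hom_contr c hchi).
by have := star_hom_contr (chi c) hpsi; rewrite chiK.
Qed.

Lemma prow_left : left_hilbert_module prow_lact prow_lip.
Proof.
split.
- by move=> a b x; apply: val_inj; rewrite /= (star_homD hpsi) amulDl.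
- by move=> a x y; apply: val_inj; rewrite /= amulDr.
- by move=> c a x; apply: val_inj; rewrite /= (star_homZ hpsi) amulZl.
- by move=> c a x; apply: val_inj; rewrite /= amulZr.
- by move=> a b x; apply: val_inj; rewrite /= (star_homM hpsi) amulA.
- move=> x y z; rewrite /prow_lip -(star_homD hchi); congr chi; apply: val_inj.
  by rewrite /= amulDl.
- move=> c x y; rewrite /prow_lip -(star_homZ hchi); congr chi; apply: val_inj.
  by rewrite /= amulZl.
- move=> a x y; rewrite /prow_lip -[a in RHS]psiK -(star_homM hchi); congr chi.
  by apply: val_inj; rewrite /= amulA.
- move=> x y; rewrite /prow_lip -(star_hom_star hchi); congr chi; apply: val_inj.
  by rewrite /= starM starK.
- move=> x; have [d hd] := @corner_sqrt (Corner (prow_lip_mem x x)) (Pos_mul_star _).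
  by exists (chi d); rewrite /prow_lip hd (star_homM hchi) (star_hom_star hchi).
- by move=> x; rewrite [LHS]nrE nr_chi /= nr_cstar' realCX -nrE.
Qed.

Lemma prow_right : right_hilbert_module prow_ract prow_rip.
Proof.
split.
- by move=> x y a; apply: val_inj; rewrite /= amulDl.
- by move=> x a b; apply: val_inj; rewrite /= amulDr.
- by move=> c x a; apply: val_inj; rewrite /= amulZl.
- by move=> c x a; apply: val_inj; rewrite /= amulZr.
- by move=> x a b; apply: val_inj; rewrite /= amulA.
- by move=> x y z; rewrite /prow_rip /= amulDr.
- by move=> c x y; rewrite /prow_rip /= amulZr.
- by move=> x y a; rewrite /prow_rip /= amulA.
- by move=> x y; rewrite /prow_rip /= starM starK.
- by move=> x; exists (val x).
- by move=> x; rewrite cstar_identity.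
Qed.

(** Left fullness comes from an approximate unit of the corner, right fullness from the density of
    the span of T p T. *)
Theorem morita_corner : morita_equivalent B T.
Proof.
apply: inhabits; apply: (@ImprimitivityBimodule R B T (prow p)
  prow_lact prow_ract prow_lip prow_rip prow_left prow_right).
- by move=> a x b; apply: val_inj; rewrite /= amulA.
- apply/total_setP => b e e0.
  have /cvg_nrP/(_ _ e0)/filter_ex[u hu] := @au_l R (corner p) (psi b).
  have um : val u \in prow_pred p by apply/eqP; exact: corner_ml.
  have bm : star (val (psi b)) \in prow_pred p.
    by apply/eqP; rewrite -star_mrp corner_mr.
  exists (prow_lip (Prow um) (Prow bm)); first by apply: lin_span_incl; exists (Prow um), (Prow bm).
  have -> : prow_lip (Prow um) (Prow bm) = chi (u ** psi b).
    by congr chi; apply: val_inj; rewrite /= starK.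
  by rewrite -{1}[b]psiK -(star_homB _ _ hchi) nr_chi nr_distC.
- apply: (total_set_trans full) => _ e [x [y ->]] e0.
  exists (x ** ml p y); last by rewrite subrr nr0 ltW.
  have xm : ml p (star x) \in prow_pred p by apply/eqP; rewrite mlpp.
  have ym : ml p y \in prow_pred p by apply/eqP; rewrite mlpp.
  apply: lin_span_incl; exists (Prow xm), (Prow ym).
  by rewrite /prow_rip /= star_mlp starK -ml_mr mlpp.
- by move=> a x y; rewrite /prow_rip /= starM (star_hom_star hpsi) /= amulA.
- move=> b x y; rewrite /prow_lip; congr chi; apply: val_inj.
  by rewrite /= starM starK amulA.
- by move=> x y z; apply: val_inj; rewrite /= chiK /= amulA.
Qed.

End Imprimitivity.

(** * The Hilbert module l2 *)

Section FiniteSums.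
Variables (R : realType) (A : cstarType R) (I : Type).
Implicit Types (f g h : I -> A) (s : seq I).

Definition dots s f g : A := \sum_(x <- s) star (f x) ** g x.

(* The norm of the restriction of [f] to [s] in the Hilbert module [A^s]. *)
Definition qn s f : R := Num.sqrt (nr (dots s f f)).

Lemma qn_ge0 s f : 0 <= qn s f. Proof. exact: sqrtr_ge0. Qed.

Lemma qn_sqr s f : qn s f ^+ 2 = nr (dots s f f).
Proof. by rewrite sqr_sqrtr ?nr_ge0. Qed.

Lemma qn_le s f K : 0 <= K -> nr (dots s f f) <= K ^+ 2 -> qn s f <= K.
Proof. by move=> K0; rewrite -qn_sqr ler_pXn2r ?nnegrE ?qn_ge0. Qed.

Lemma dots_pos s f : Pos (dots s f f).
Proof. by apply: Pos_sum => x _; exact: Pos_star_mul. Qed.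

Lemma dotsDl s f g h : dots s (f + g) h = dots s f h + dots s g h.
Proof. by rewrite /dots -big_split; apply: eq_bigr => x _; rewrite starD amulDl. Qed.

Lemma dotsDr s f g h : dots s h (f + g) = dots s h f + dots s h g.
Proof. by rewrite /dots -big_split; apply: eq_bigr => x _; rewrite amulDr. Qed.

Lemma dotsZl s (c : R[i]) f g : dots s (c *: f) g = Num.conj c *: dots s f g.
Proof. by rewrite /dots scaler_sumr; apply: eq_bigr => x _; rewrite starZ amulZl. Qed.

Lemma dotsZr s (c : R[i]) f g : dots s f (c *: g) = c *: dots s f g.
Proof. by rewrite /dots scaler_sumr; apply: eq_bigr => x _; rewrite amulZr. Qed.

Lemma dots_star s f g : star (dots s f g) = dots s g f.
Proof. by rewrite /dots star_sum; apply: eq_bigr => x _; rewrite starM starK. Qed.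

(* [1 - b* b] is the square [(1 - e)^2] for [|b| <= 1]. *)
Lemma ball_defect (b : A) : nr b <= 1 -> exists e : A, forall z : A,
  star z ** z - star (b ** z) ** (b ** z) = star (z - e ** z) ** (z - e ** z).
Proof.
move=> /ball_sqrt[e [se ee _]]; exists e => z.
have ee' : star e ** e = 2%:C *: e - star b ** b by rewrite se ee addrAC subrr add0r.
transitivity (star z ** z - star z ** (star b ** b) ** z); first by rewrite starM !amulA.
have -> : star (z - e ** z) ** (z - e ** z) = star z ** z - star z ** (2%:C *: e) ** z
    + star z ** (star e ** e) ** z.
  have -> : 2%:C *: e = e + star e by rewrite se; staralg R A.
  by staralg R A.
by rewrite ee'; staralg R A.
Qed.

(** After scaling, F = <h, h> has norm at most 1. With z = <h, g> and K = <g, g>, positivity of <g -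
    h z, g - h z> = K - 2 z^* z + z^* F z bounds z^* z by K. The inequality between z^* F z and z^*
    z is supplied by [ball_defect] as an explicit square. *)
Lemma dots_cauchy_schwarz_sqr s f g M : 0 < M -> nr (dots s f f) <= M ->
  nr (dots s f g) ^+ 2 <= M * nr (dots s g g).
Proof.
suff key h : nr (dots s h h) <= 1 -> nr (dots s h g) ^+ 2 <= nr (dots s g g).
  move=> M0 fM; pose t := Num.sqrt M; have tt : t ^+ 2 = M by rewrite sqr_sqrtr// ltW.
  have t0 : 0 < t by rewrite sqrtr_gt0.
  have := key ((t^-1)%:C *: f); rewrite dotsZl dotsZl dotsZr conj_realC scalerA -realCM.
  rewrite nrZp ?mulr_ge0 ?invr_ge0 ?(ltW t0)// -expr2 exprVn tt.
  rewrite nrZp ?invr_ge0 ?(ltW t0)// exprMn exprVn tt.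
  by rewrite ler_pdivrMl ?mulr1 // ler_pdivrMl//; apply.
move=> h1; set F := dots s h h in h1; set z := dots s h g; set K := dots s g g.
have [m [sm Pm mm _]] := Pos_sqrt (dots_pos s h); rewrite -/F in mm.
have [e he] : exists e, forall z : A, star z ** z - star (m ** z) ** (m ** z) =
    star (z - e ** z) ** (z - e ** z).
  apply: ball_defect; rewrite -(@ler_pXn2r _ 2) ?nnegrE ?nr_ge0//.
  by rewrite expr1n -nr_cstar sm mm.
have P1 : Pos (dots s (fun x => g x - h x ** z) (fun x => g x - h x ** z)) by exact: dots_pos.
have E1 : dots s (fun x => g x - h x ** z) (fun x => g x - h x ** z) =
    K - star z ** z - (star z ** z - star (m ** z) ** (m ** z)).
  have -> : star (m ** z) ** (m ** z) = star z ** F ** z by rewrite starM sm -mm !amulA.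
  have -> : K - star z ** z - (star z ** z - star z ** F ** z) =
    K - star z ** z - star z ** z + star z ** F ** z by lmod R[i] A.
  have zs : star z = dots s g h by rewrite dots_star.
  have -> : K - star z ** z - star z ** z = K - dots s g h ** z - star z ** dots s h g.
    by rewrite -zs.
  have amulsl (u v : I -> A) y : dots s u v ** y = \sum_(x <- s) star (u x) ** v x ** y.
    exact: (amul_suml s (fun x => star (u x) ** v x) y).
  have amulsr (u v : I -> A) y : y ** dots s u v = \sum_(x <- s) y ** (star (u x) ** v x).
    exact: (amul_sumr s (fun x => star (u x) ** v x) y).
  have -> : star z ** F ** z = \sum_(x <- s) star z ** (star (h x) ** h x) ** z.
    by rewrite (amulsr h h); exact: (amul_suml s (fun x => star z ** (star (h x) ** h x)) z).
  rewrite (amulsl g h) (amulsr h g) /K /dots -!sumrB -big_split.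
  by apply: eq_bigr => x _ /=; move: (h x) (g x) => a b; clearbody z; staralg R A.
rewrite E1 he in P1.
have := PosD P1 (Pos_star_mul (z - e ** z)); rewrite subrK => P2.
rewrite -nr_cstar; have := Pos_norm_le (Pos_star_mul z) P2.
by rewrite addrC subrK.
Qed.

Lemma dots_cauchy_schwarz s f g : nr (dots s f g) <= qn s f * qn s g.
Proof.
rewrite -(@ler_pXn2r _ 2) ?nnegrE ?mulr_ge0 ?qn_ge0 ?nr_ge0// exprMn !qn_sqr.
apply/ler_addgt0Pr => e e0; have k0 : 0 < nr (dots s g g) + 1 by rewrite ltr_wpDl ?nr_ge0.
rewrite (le_trans (@dots_cauchy_schwarz_sqr s f g (nr (dots s f f) + e / (nr (dots s g g) + 1)) _ _))//.
- by rewrite ltr_wpDl ?nr_ge0 ?divr_gt0.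
- by rewrite lerDl divr_ge0 ?ltW.
rewrite mulrDl lerD2l mulrAC -mulrA ler_piMr ?ltW//.
by rewrite ltr_pdivrMr// mul1r ltrDl.
Qed.

Lemma qnD s f g : qn s (f + g) <= qn s f + qn s g.
Proof.
apply: qn_le; first by rewrite addr_ge0 ?qn_ge0.
rewrite dotsDl !dotsDr sqrrD !qn_sqr.
have h1 := dots_cauchy_schwarz s f g; have h2 := dots_cauchy_schwarz s g f.
have h3 := nrD (dots s f f + dots s f g) (dots s g f + dots s g g).
have h4 := nrD (dots s f f) (dots s f g); have h5 := nrD (dots s g f) (dots s g g).
by rewrite -mulr_natr; lra.
Qed.

Lemma qnZ s (c : R[i]) f : qn s (c *: f) = complex.Re `|c| * qn s f.
Proof.
have c0 : 0 <= complex.Re `|c| by rewrite -ler0c RRe_real ?normr_real.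
rewrite /qn dotsZl dotsZr scalerA nrZC normrM norm_conjC.
have -> : complex.Re (`|c| * `|c|) = complex.Re `|c| ^+ 2.
  have -> : `|c| = (complex.Re `|c|)%:C by rewrite RRe_real ?normr_real.
  by rewrite -realCM expr2.
by rewrite sqrtrM ?sqr_ge0// sqrtr_sqr ger0_norm.
Qed.

Lemma qnN s f : qn s (- f) = qn s f.
Proof. by rewrite -scaleN1r qnZ normrN normr1 mul1r. Qed.

Lemma qnB s f g : qn s (f - g) <= qn s f + qn s g.
Proof. by rewrite (le_trans (qnD _ _ _))// qnN. Qed.

Lemma qn_contr s (b : I -> A) f M : 0 <= M -> (forall x, nr (b x) <= M) ->
  qn s (fun x => b x ** f x) <= M * qn s f.
Proof.
suff key b' : (forall x, nr (b' x) <= 1) -> qn s (fun x => b' x ** f x) <= qn s f.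
  move=> M0 bM; apply/ler_addgt0Pr => e e0.
  have k0 : 0 < qn s f + 1 by rewrite ltr_wpDl ?qn_ge0.
  (* M may vanish; a slightly larger N can be divided by. *)
  pose N := M + e / (qn s f + 1); have N0 : 0 < N by rewrite ltr_wpDl// divr_gt0.
  have := key (fun x => (N^-1)%:C *: b x).
  have -> : (fun x => ((N^-1)%:C *: b x) ** f x) = (N^-1)%:C *: (fun x => b x ** f x).
    by apply/funext => x; rewrite amulZl.
  rewrite qnZ ger0_norm; last by rewrite ler0c invr_ge0 ltW.
  rewrite ler_pdivrMl// => h; apply: (le_trans (h _)).
    move=> x; rewrite nrZp ?invr_ge0 ?(ltW N0)// ler_pdivrMl// mulr1 (le_trans (bM x))//.
    by rewrite lerDl divr_ge0 ?ltW.
  rewrite mulrDl lerD2l mulrAC -mulrA ler_piMr ?ltW//.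
  by rewrite ltr_pdivrMr// mul1r ltrDl.
move=> b1; apply: qn_le; first exact: qn_ge0.
rewrite qn_sqr; have /choice[e he] : forall x, exists e : A, forall z : A,
    star z ** z - star (b' x ** z) ** (b' x ** z) = star (z - e ** z) ** (z - e ** z).
  by move=> x; exact: ball_defect.
have P : Pos (\sum_(x <- s) star (f x - e x ** f x) ** (f x - e x ** f x)).
  by apply: Pos_sum => x _; exact: Pos_star_mul.
have := Pos_norm_le (dots_pos s (fun x => b' x ** f x)) P.
rewrite /dots -big_split /=; under [X in _ <= nr X -> _]eq_bigr do rewrite -he addrC subrK.
by [].
Qed.

End FiniteSums.

#[local] Existing Instance totally_filter.

(** * Unordered sums over finite sets *)

Section FsetSums.
Variables (R : realType) (A : cstarType R) (I : choiceType).
Local Open Scope fset_scope.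
Local Open Scope ring_scope.
Implicit Types (F : I -> A) (J K : {fset I}) (f g : I -> A).

Lemma partial_sumE F J : partial_sum F J = \sum_(x <- J) F x.
Proof. by rewrite /partial_sum big_seq_fsetE. Qed.

Lemma fset_split J K : J `<=` K -> perm_eq K (enum_fset J ++ enum_fset (K `\` J)).
Proof.
move=> JK; apply: uniq_perm; first exact: fset_uniq.
  rewrite cat_uniq !fset_uniq andbT /=; apply/hasPn => x.
  by rewrite in_fsetD => /andP[].
move=> x; rewrite mem_cat in_fsetD; have [xJ|//] := boolP (x \in J).
exact: (fsubsetP JK).
Qed.

Lemma seq_fset_perm_eq (s : seq I) : uniq s -> exists2 J : {fset I}, J =i s & perm_eq J s.
Proof.
move=> us; exists [fset x in s]; first by move=> x; rewrite inE.
by apply: uniq_perm; [exact: fset_uniq|done|move=> x; rewrite inE].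
Qed.

Lemma qn_mono J K f : J `<=` K -> qn J f <= qn K f.
Proof.
move=> JK; apply: qn_le; first exact: qn_ge0.
rewrite qn_sqr /dots (perm_big _ (fset_split JK)) big_cat /=.
by apply: Pos_norm_le; exact: dots_pos.
Qed.

Lemma cvg_totallyP F c : (partial_sum F J @[J --> totally] --> c) <->
  forall e : R, 0 < e -> exists J0 : {fset I}, forall J, J0 `<=` J ->
    nr (\sum_(x <- J) F x - c) <= e.
Proof.
split=> [/cvg_nrP h e e0|h]; last apply/cvg_nrP => e e0.
  by have [J0 _ hJ] := h e e0; exists J0 => J JJ; rewrite -partial_sumE; exact: hJ.
by have [J0 hJ] := h e e0; exists J0 => // J /= JJ; rewrite partial_sumE; exact: hJ.
Qed.

(** The Cauchy criterion in terms of finite sets disjoint from J0, a form that translation of the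
    index set preserves. *)
Lemma cvg_cauchyP F : cvg (partial_sum F J @[J --> totally]) <->
  forall e : R, 0 < e -> exists J0 : {fset I}, forall J, [disjoint J & J0] ->
    nr (\sum_(x <- J) F x) <= e.
Proof.
split=> [hF e e0|h].
  have e20 : 0 < e / 2 by rewrite divr_gt0.
  have [J0 hJ] := (cvg_totallyP _ _).1 hF _ e20; exists J0 => J JJ0.
  have h1 := hJ _ (fsubset_refl _); have h2 := hJ _ (fsubsetUl J0 J).
  have JE : (J0 `|` J) `\` J0 =i J.
    move=> x; rewrite !inE; case: (boolP (x \in J0)) => //= x0.
    by apply/esym/negbTE; rewrite fdisjoint_sym in JJ0; exact: (fdisjointP JJ0).
  rewrite (perm_big _ (fset_split (fsubsetUl J0 J))) big_cat /= in h2.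
  rewrite [X in _ + X - _](perm_big (enum_fset J)) in h2; last first.
    by apply: uniq_perm; rewrite ?fset_uniq.
  set l := lim _ in h1 h2.
  have -> : \sum_(x <- J) F x = (\sum_(x <- J0) F x + \sum_(x <- J) F x - l)
    - (\sum_(x <- J0) F x - l) by rewrite opprB addrA subrK addrC addKr.
  by rewrite (le_trans (nrB _ _))// (splitr e) lerD.
suff /cvg_ex : exists l : A, partial_sum F J @[J --> totally] --> l by [].
apply: nr_complete => e e0; have e20 : 0 < e / 2 by rewrite divr_gt0.
have [J0 hJ] := h _ e20; exists [set J | J0 `<=` J]; first by exists J0.
move=> J K /= JJ JK; rewrite !partial_sumE (perm_big _ (fset_split JJ)).
rewrite [X in _ - X](perm_big _ (fset_split JK)) !big_cat /= opprD addrACA subrr add0r.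
rewrite (le_trans (nrB _ _))// (splitr e) lerD// hJ//; apply/fdisjointP => x;
  by rewrite in_fsetD => /andP[].
Qed.

End FsetSums.

Section L2.
Variables (R : realType) (G : ordGroupType) (A : cstarType R).
Local Notation GP := (pos_cone G).
Local Open Scope fset_scope.
Local Open Scope ring_scope.
Implicit Types (f g h : GP -> A) (J K : {fset GP}).

Lemma l2_memP f : l2_mem f <-> forall e : R, 0 < e ->
  exists J0 : {fset GP}, forall J, [disjoint J & J0] -> qn J f <= e.
Proof.
split=> [/cvg_cauchyP h e e0|h].
  have [J0 hJ] := h _ (exprn_gt0 2 e0); exists J0 => J /hJ hh.
  by apply: qn_le => //; exact: ltW.
apply/cvg_cauchyP => e e0; have [J0 hJ] : exists J0 : {fset GP}, forall J,
    [disjoint J & J0] -> qn J f <= Num.sqrt e by apply: h; rewrite sqrtr_gt0.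
exists J0 => J /hJ; rewrite -(@ler_pXn2r _ 2) ?nnegrE ?qn_ge0 ?sqrtr_ge0//.
by rewrite qn_sqr sqr_sqrtr// ltW.
Qed.

Definition l2n f : R := Num.sqrt (nr (l2_dot f f)).

Lemma l2n_ge0 f : 0 <= l2n f. Proof. exact: sqrtr_ge0. Qed.

Lemma l2_normE f : l2_norm f = (l2n f)%:C.
Proof.
rewrite /l2_norm nrE -[nr _]sqr_sqrtr ?nr_ge0// -/(l2n f) realCX sqrCK//.
by rewrite ler0c l2n_ge0.
Qed.

Lemma l2_dot_eq f g c : (forall e : R, 0 < e -> exists J0 : {fset GP}, forall J, J0 `<=` J ->
    nr (dots J f g - c) <= e) -> l2_dot f g = c.
Proof. by move=> /cvg_totallyP h; apply: cvg_lim. Qed.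

Lemma l2_mem_qnD f g h : (forall J, qn J h <= qn J f + qn J g) ->
  l2_mem f -> l2_mem g -> l2_mem h.
Proof.
move=> hfg /l2_memP hf /l2_memP hg; apply/l2_memP => e e0.
have e20 : 0 < e / 2 by rewrite divr_gt0.
have [J0 hJ] := hf _ e20; have [K0 hK] := hg _ e20.
exists (J0 `|` K0) => J; rewrite fdisjointXU => /andP[jJ jK].
by rewrite (le_trans (hfg J))// (splitr e) lerD ?hJ ?hK.
Qed.

Lemma l2D f g : l2_mem f -> l2_mem g -> l2_mem (f + g).
Proof. by apply: l2_mem_qnD => J; exact: qnD. Qed.

Lemma l2B f g : l2_mem f -> l2_mem g -> l2_mem (f - g).
Proof. by apply: l2_mem_qnD => J; exact: qnB. Qed.

Lemma l2_0 : l2_mem (0 : GP -> A).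
Proof.
apply/l2_memP => e e0; exists fset0 => J _; apply: qn_le; first exact: ltW.
by rewrite /dots big1 ?nr0 ?sqr_ge0// => x _; rewrite amul0r.
Qed.

Lemma l2_mem_le (f h : GP -> A) M : 0 <= M -> (forall J, qn J h <= M * qn J f) -> l2_mem f -> l2_mem h.
Proof.
move=> M0 hf /l2_memP lf; apply/l2_memP => e e0.
have M1 : 0 < M + 1 by rewrite ltr_wpDl.
have [J0 hJ] := lf _ (divr_gt0 e0 M1); exists J0 => J jJ.
rewrite (le_trans (hf J))// (le_trans (ler_wpM2l M0 (hJ _ jJ)))// mulrCA ler_piMr ?ltW//.
by rewrite ltr_pdivrMr// mul1r ltrDl.
Qed.

Lemma l2Z (c : R[i]) f : l2_mem f -> l2_mem (c *: f).
Proof.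
apply: (@l2_mem_le _ _ (complex.Re `|c|)); first by rewrite -ler0c RRe_real ?normr_real.
by move=> J; rewrite qnZ.
Qed.

(** Cauchy-Schwarz on a tail: a small tail of f against a tail of g of norm at most 1. *)
Lemma l2_dotP f g : l2_mem f -> l2_mem g -> forall e : R, 0 < e ->
  exists J0 : {fset GP}, forall J, J0 `<=` J -> nr (dots J f g - l2_dot f g) <= e.
Proof.
move=> /l2_memP hf /l2_memP hg; apply/cvg_totallyP.
suff : cvg (partial_sum (fun x : GP => star (f x) ** g x) J @[J --> totally]) by [].
apply/cvg_cauchyP => e e0; have [J0 hJ] := hf _ e0; have [K0 hK] := hg _ (@ltr01 R).
exists (J0 `|` K0) => J; rewrite fdisjointXU => /andP[jJ jK].
rewrite (le_trans (dots_cauchy_schwarz _ _ _))// -[e]mulr1.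
by rewrite ler_pM ?qn_ge0 ?hJ ?hK.
Qed.

Lemma qn_l2n J f : l2_mem f -> qn J f <= l2n f.
Proof.
move=> lf; rewrite /qn ler_wsqrtr//; apply/ler_addgt0Pr => e e0.
have [J0 hJ] := l2_dotP lf lf e0; have := hJ _ (fsubsetUr J J0).
have : nr (dots J f f) <= nr (dots (J `|` J0) f f).
  by rewrite -!qn_sqr lerXn2r ?nnegrE ?qn_ge0 ?qn_mono ?fsubsetUl.
set D := dots (J `|` J0) f f => h1 h2; rewrite (le_trans h1)//.
have -> : D = l2_dot f f + (D - l2_dot f f) by rewrite addrC subrK.
by rewrite (le_trans (nrD _ _))// lerD.
Qed.

Lemma l2_dot_le f g M : l2_mem f -> l2_mem g -> (forall J, nr (dots J f g) <= M) ->
  nr (l2_dot f g) <= M.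
Proof.
move=> lf lg hM; apply/ler_addgt0Pr => e e0.
have [J hJ] := l2_dotP lf lg e0; have := hJ _ (fsubset_refl _); have := hM J.
set D := dots _ _ _ => h1 h2.
have -> : l2_dot f g = D - (D - l2_dot f g) by rewrite opprB addrC subrK.
by rewrite (le_trans (nrB _ _))// lerD.
Qed.

Lemma l2n_le f M : l2_mem f -> 0 <= M -> (forall J, qn J f <= M) -> l2n f <= M.
Proof.
move=> lf M0 hM; rewrite -[M](ger0_norm M0) -sqrtr_sqr ler_wsqrtr//.
apply: l2_dot_le => // J; rewrite -qn_sqr lerXn2r ?nnegrE ?qn_ge0//.
Qed.

Lemma l2_cauchy_schwarz f g : l2_mem f -> l2_mem g -> nr (l2_dot f g) <= l2n f * l2n g.
Proof.
move=> lf lg; apply: l2_dot_le => // J; rewrite (le_trans (dots_cauchy_schwarz _ _ _))//.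
by rewrite ler_pM ?qn_ge0 ?qn_l2n.
Qed.

Lemma l2n_sqr f : l2n f ^+ 2 = nr (l2_dot f f).
Proof. by rewrite sqr_sqrtr ?nr_ge0. Qed.

Lemma l2nD f g : l2_mem f -> l2_mem g -> l2n (f + g) <= l2n f + l2n g.
Proof.
move=> lf lg; apply: l2n_le; [exact: l2D|by rewrite addr_ge0 ?l2n_ge0|move=> J].
by rewrite (le_trans (qnD _ _ _))// lerD ?qn_l2n.
Qed.

Lemma l2nZ_le (c : R[i]) f : l2_mem f -> l2n (c *: f) <= complex.Re `|c| * l2n f.
Proof.
have c0 : 0 <= complex.Re `|c| by rewrite -ler0c RRe_real ?normr_real.
move=> lf; apply: l2n_le; [exact: l2Z|by rewrite mulr_ge0 ?l2n_ge0|move=> J].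
by rewrite qnZ ler_wpM2l ?qn_l2n.
Qed.

Lemma l2n_distC f g : l2n (f - g) = l2n (g - f).
Proof.
rewrite /l2n; congr (Num.sqrt (nr _)); congr (lim (_ @ totally)).
by apply/funext => J; apply: eq_bigr => x _; rewrite -[f - g]opprB starN amulNl amulNr opprK.
Qed.

Lemma l2n_dist_trans g f h : l2_mem f -> l2_mem g -> l2_mem h ->
  l2n (f - h) <= l2n (f - g) + l2n (g - h).
Proof. by move=> lf lg lh; rewrite -(subrKA g) l2nD//; exact: l2B. Qed.

Lemma nr_le_l2n f x : l2_mem f -> nr (f x) <= l2n f.
Proof.
move=> lf; rewrite (le_trans _ (qn_l2n [fset x] lf))//.
by rewrite /qn /dots big_seq_fset1 nr_cstar sqrtr_sqr ler_norm.
Qed.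

Lemma l2n_eq0 f : l2_mem f -> l2n f <= 0 -> f = 0.
Proof.
move=> lf f0; apply/funext => x; apply: nr_le0.
by rewrite (le_trans (nr_le_l2n x lf)).
Qed.

Lemma l2_dot_star f g : l2_mem f -> l2_mem g -> star (l2_dot f g) = l2_dot g f.
Proof.
move=> lf lg; apply/esym/l2_dot_eq => e e0; have [J0 hJ] := l2_dotP lf lg e0.
by exists J0 => J /hJ h; rewrite -[dots J g f]dots_star -(starB (dots J f g)) nr_star.
Qed.

Lemma l2_dotDr f g h : l2_mem f -> l2_mem g -> l2_mem h ->
  l2_dot f (g + h) = l2_dot f g + l2_dot f h.
Proof.
move=> lf lg lh; apply: l2_dot_eq => e e0; have e20 : 0 < e / 2 by rewrite divr_gt0.
have [J0 hJ] := l2_dotP lf lg e20; have [K0 hK] := l2_dotP lf lh e20.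
exists (J0 `|` K0) => J; rewrite fsubUset => /andP[/hJ h1 /hK h2].
rewrite dotsDr opprD addrACA (le_trans (nrD _ _))// (splitr e) lerD//.
Qed.

Lemma l2_dotZr (c : R[i]) f g : l2_mem f -> l2_mem g ->
  l2_dot f (c *: g) = c *: l2_dot f g.
Proof.
move=> lf lg; apply: l2_dot_eq => e e0; set k := complex.Re `|c|.
have k0 : 0 <= k by rewrite -ler0c RRe_real ?normr_real.
have k1 : 0 < k + 1 by rewrite ltr_wpDl.
have [J0 hJ] := l2_dotP lf lg (divr_gt0 e0 k1); exists J0 => J /hJ h.
rewrite dotsZr -scalerBr nrZC (le_trans (ler_wpM2l k0 h))// mulrCA ler_piMr ?ltW//.
by rewrite ltr_pdivrMr// mul1r ltrDl.
Qed.

Definition delta r (x : A) : GP -> A := fun i => if i == r then x else 0.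

Lemma dots_deltal J r x f : r \in J -> dots J (delta r x) f = star x ** f r.
Proof.
move=> rJ; rewrite /dots (big_fsetD1 r)//= /delta eqxx big_seq big1 ?addr0// => i.
by rewrite in_fsetD1 => /andP[/negbTE -> _]; rewrite star0 amul0l.
Qed.

Lemma l2_delta r x : l2_mem (delta r x).
Proof.
apply/l2_memP => e e0; exists [fset r] => J; rewrite fdisjointX1 => rJ.
apply: qn_le; first exact: ltW.
rewrite /dots big_seq big1 ?nr0 ?sqr_ge0// => i iJ; rewrite /delta ifF ?amul0r//.
by apply/negP => /eqP ir; rewrite -ir iJ in rJ.
Qed.

Lemma l2_dot_deltal r x f : l2_dot (delta r x) f = star x ** f r.
Proof.
apply: l2_dot_eq => e e0; exists [fset r] => J; rewrite fsub1set => rJ.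
by rewrite dots_deltal// subrr nr0 ltW.
Qed.

Lemma l2n_delta r x : l2n (delta r x) = nr x.
Proof. by rewrite /l2n l2_dot_deltal /delta eqxx nr_cstar sqrtr_sqr ger0_norm ?nr_ge0. Qed.

Lemma l2_dot_inj f g : (forall h, l2_mem h -> l2_dot h f = l2_dot h g) -> f = g.
Proof.
move=> h; apply/funext => r; apply: amul_injr => a.
by have := h _ (@l2_delta r (star a)); rewrite !l2_dot_deltal starK.
Qed.

(** Completeness with its estimate: the distance to the limit inherits, without loss, every constant
    valid on a set of the filter. Applied to operators at a vector f, this gives bounds proportional
    to the norm of f. *)
Lemma l2_limit (T : Type) (F : set_system T) {FF : ProperFilter F} (u : T -> GP -> A) :
  (forall t, l2_mem (u t)) ->
  (forall e : R, 0 < e -> exists2 P : set T, F P &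
     forall s t, P s -> P t -> l2n (u s - u t) <= e) ->
  exists2 g : GP -> A, l2_mem g & forall (e : R) (P : set T), F P ->
    (forall s t, P s -> P t -> l2n (u s - u t) <= e) -> forall s, P s -> l2n (u s - g) <= e.
Proof.
move=> lu cu; have /choice[g hg] : forall x, exists y : A, u t x @[t --> F] --> y.
  move=> x; apply: nr_complete => e /cu[P FP hP]; exists P => // s t Ps Pt.
  by rewrite (le_trans _ (hP s t Ps Pt))// -[u s x - _]/((u s - u t) x) nr_le_l2n//; exact: l2B.
have key (e : R) P : F P -> (forall s t, P s -> P t -> l2n (u s - u t) <= e) ->
    forall s, P s -> forall J, qn J (u s - g) <= e.
  move=> FP hP s Ps J; apply/ler_addgt0Pr => d d0.
  have [t [Pt ht]] : exists t, P t /\ qn J (u t - g) <= d.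
    (* Coordinates converge separately, and on J the norm is at most the sum of the coordinate
       norms; each coordinate is granted d / k. *)
    pose k := (size (enum_fset J))%:R + 1 : R; have k0 : 0 < k by rewrite ltr_wpDl.
    have dk : 0 < d / k by rewrite divr_gt0.
    have small (s' : seq GP) : \forall t \near F, qn s' (u t - g) <= (size s')%:R * (d / k).
      elim: s' => [|x s' IH].
        by near=> t; rewrite mul0r /qn /dots big_nil nr0 sqrtr0.
      have /cvg_nrP/(_ _ dk) hx := hg x.
      near=> t; have h1 : nr (u t x - g x) <= d / k by near: t.
      have h2 : qn s' (u t - g) <= (size s')%:R * (d / k) by near: t.
      apply: qn_le; first by rewrite mulr_ge0// ltW.
      rewrite /dots big_cons (le_trans (nrD _ _))// nr_cstar -/(dots s' _ _) -qn_sqr /=.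
      rewrite -natr1 mulrDl mul1r sqrrD.
      have h3 : nr (u t x - g x) ^+ 2 <= (d / k) ^+ 2 by rewrite lerXn2r ?nnegrE ?nr_ge0// ltW.
      have h4 : qn s' (u t - g) ^+ 2 <= ((size s')%:R * (d / k)) ^+ 2.
        by rewrite lerXn2r ?nnegrE ?qn_ge0// mulr_ge0// ltW.
      have h5 : 0 <= (size s')%:R * (d / k) * (d / k).
        exact: mulr_ge0 (mulr_ge0 (ler0n _ _) (ltW dk)) (ltW dk).
      by rewrite addrC; rewrite -mulr_natr; lra.
    have [t [Pt ht]] := filter_ex (filterI FP (small (enum_fset J))).
    exists t; split=> //; rewrite (le_trans ht)// mulrCA ler_piMr ?ltW//.
    by rewrite ltr_pdivrMr// mul1r ltrDl.
  have -> : u s - g = (u s - u t) + (u t - g) by rewrite subrKA.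
  rewrite (le_trans (qnD _ _ _))// lerD// (le_trans (qn_l2n J _)) ?hP//.
  exact: l2B.
have lg : l2_mem g.
  apply/l2_memP => e e0; have e20 : 0 < e / 2 by rewrite divr_gt0.
  have [P FP hP] := cu _ e20; have [s Ps] := filter_ex FP.
  have [J0 hJ] := (l2_memP (u s)).1 (lu s) _ e20; exists J0 => J /hJ h.
  have -> : g = u s - (u s - g) by rewrite opprB addrC subrK.
  rewrite (le_trans (qnB _ _ _))// (splitr e) lerD//; exact: (key _ _ FP hP).
exists g => // e P FP hP s Ps; have [t Pt] := filter_ex FP.
have e0 : 0 <= e by rewrite (le_trans _ (hP _ _ Ps Ps))// l2n_ge0.
by apply: l2n_le => //; [exact: l2B|exact: (key _ _ FP hP)].
Unshelve. all: by end_near. Qed.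

End L2.

(** * The Toeplitz algebra *)

Local Notation shift := Defs.shift.

Section ToeplitzOperators.
Variables (R : realType) (G : ordGroupType) (A : cstarType R).
Variable alpha : pos_cone G -> A -> A.
Hypothesis halpha : dynamical_system alpha.
Local Notation GP := (pos_cone G).
Implicit Types (f g h : GP -> A) (J K : {fset GP}) (x y d i j : GP) (a b : A).
Implicit Types (q : term G A) (l m : seq (term G A)).

Definition coshift y f : GP -> A := fun i => f (pc_add i y).

Lemma shiftE x f i : shift x f i = if val x <= val i then f (pc_diff i x) else 0.
Proof.
rewrite /shift /pc_diff; case: {-}_ / idP => [h|/negP/negbTE ->//]; rewrite h.
by congr f; apply: pc_inj.
Qed.

Lemma shift_add x f i : shift x f (pc_add i x) = f i.
Proof. by rewrite shiftE pc_add_diff pc_addC pc_le_add. Qed.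

Lemma shift_lt x f i : ~ val x <= val i -> shift x f i = 0.
Proof. by rewrite shiftE => /negP/negbTE ->. Qed.

Lemma shiftP x (P : GP -> A -> A -> Prop) f g :
  (forall i, P (pc_add i x) (f i) (g (pc_add i x))) ->
  (forall i, ~ val x <= val i -> P i 0 (g i)) -> forall i, P i (shift x f i) (g i).
Proof.
move=> h1 h2 i; rewrite shiftE; case: ifPn => [xi|/negP]; last exact: h2.
by have := h1 (pc_diff i x); rewrite pc_diffK.
Qed.

Lemma shift_ext x f g : (forall i, g (pc_add i x) = f i) ->
  (forall i, ~ val x <= val i -> g i = 0) -> shift x f = g.
Proof.
move=> h1 h2; apply/funext; apply: (@shiftP x (fun _ u v => u = v)) => i; first by rewrite h1.
by move/h2.
Qed.

Lemma shiftD x f g : shift x (f + g) = shift x f + shift x g.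
Proof.
apply: shift_ext => i; first by rewrite -[LHS]/(shift x f _ + shift x g _) !shift_add.
by move=> xi; rewrite -[LHS]/(shift x f _ + shift x g _) !shift_lt ?addr0.
Qed.

Lemma shiftZ x (c : R[i]) f : shift x (c *: f) = c *: shift x f.
Proof.
apply: shift_ext => i; first by rewrite -[LHS]/(c *: shift x f _) shift_add.
by move=> xi; rewrite -[LHS]/(c *: shift x f _) shift_lt ?scaler0.
Qed.

Lemma shift_shift x d f : shift x (shift d f) = shift (pc_add x d) f.
Proof.
apply/esym/shift_ext => i; first by rewrite [pc_add x d]pc_addC pc_addA !shift_add.
move=> xi; rewrite shiftE; case: ifP => // xi'; rewrite shift_lt// pc_diffE// => h.
by apply: xi; have := leD2l_group _ _ (val x) h; rewrite [val x + (_ - _)]addrC subrK.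
Qed.

Lemma coshift_coshift x d f : coshift x (coshift d f) = coshift (pc_add x d) f.
Proof. by apply/funext => i; rewrite /coshift pc_addA. Qed.

Lemma coshift_shift_ge y u f : val u <= val y ->
  coshift y (shift u f) = coshift (pc_diff y u) f.
Proof.
by move=> uy; apply/funext => i; rewrite /coshift -[in LHS](pc_diffK uy) pc_addA shift_add.
Qed.

Lemma coshift_shift_le y u f : val y <= val u ->
  coshift y (shift u f) = shift (pc_diff u y) f.
Proof.
move=> yu; apply/esym/shift_ext => i; rewrite /coshift.
  by rewrite -pc_addA pc_diffK// shift_add.
move=> h; apply: shift_lt => /= h'; apply: h; rewrite pc_diffE//.
by have := leD2l_group _ _ (- val y) h'; rewrite addrC [- _ + _]addrC addrK.
Qed.

Lemma pi_alphaM a b f : pi_alpha alpha a (pi_alpha alpha b f) = pi_alpha alpha (a ** b) f.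
Proof. by apply/funext => i; rewrite /pi_alpha (star_homM (ds_hom halpha i)) amulA. Qed.

Lemma pi_alpha_shift a d f :
  pi_alpha alpha a (shift d f) = shift d (pi_alpha alpha (alpha d a) f).
Proof.
apply/esym/shift_ext => i; rewrite /pi_alpha.
  by rewrite shift_add -(ds_add halpha).
by move=> h; rewrite shift_lt// amul0r.
Qed.

Lemma coshift_pi_alpha d b f :
  coshift d (pi_alpha alpha b f) = pi_alpha alpha (alpha d b) (coshift d f).
Proof. by apply/funext => i; rewrite /coshift /pi_alpha -(ds_add halpha). Qed.

(** The triple (s, a, t) stands for S_s pi(a) S_t^*, in agreement with [ev], because w_s is the
    compression of S_s^*. *)
Definition gen q f := shift q.1.1 (pi_alpha alpha q.1.2 (coshift q.2 f)).

(** Since the shifts are isometries, S_t^* S_u is a shift or the adjoint of one, and no projection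
    appears, in contrast to [tmul]. *)
Definition gmul (p q : term G A) : term G A :=
  let: (s, a, t) := p in let: (u, b, r) := q in
  if val u <= val t then (s, a ** alpha (pc_diff t u) b, pc_add (pc_diff t u) r)
  else (pc_add s (pc_diff u t), alpha (pc_diff u t) a ** b, r).

Lemma gen_mul p q f : gen p (gen q f) = gen (gmul p q) f.
Proof.
case: p q => [[s a] t] [[u b] r]; rewrite /gmul /gen.
case: ifP => [ut|/negbT ut] /=.
  by rewrite coshift_shift_ge// coshift_pi_alpha coshift_coshift pi_alphaM.
have tu : val t <= val u by case: (pc_leVge t u) => // h; rewrite h in ut.
by rewrite coshift_shift_le// pi_alpha_shift shift_shift pi_alphaM.
Qed.

Lemma genD q f g : gen q (f + g) = gen q f + gen q g.
Proof.
rewrite /gen -shiftD; congr shift; apply/funext => i.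
exact: amulDr.
Qed.

Lemma genZ q (c : R[i]) f : gen q (c *: f) = c *: gen q f.
Proof.
rewrite /gen -shiftZ; congr shift; apply/funext => i.
exact: amulZr.
Qed.

Lemma gen_scale q (c : R[i]) f : gen (q.1.1, c *: q.1.2, q.2) f = c *: gen q f.
Proof.
rewrite /gen -shiftZ /=; congr shift; apply/funext => i.
by rewrite /pi_alpha (star_homZ (ds_hom halpha i)) amulZl.
Qed.

Definition tev l f : GP -> A := \sum_(q <- l) gen q f.

Lemma tev_nil f : tev [::] f = 0.
Proof. by rewrite /tev big_nil. Qed.

Lemma tev1 q f : tev [:: q] f = gen q f.
Proof. by rewrite /tev big_seq1. Qed.

Lemma tev_cons q l f : tev (q :: l) f = gen q f + tev l f.
Proof. by rewrite /tev big_cons. Qed.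

Lemma tev_cat l m f : tev (l ++ m) f = tev l f + tev m f.
Proof. by rewrite /tev big_cat. Qed.

Lemma tev_scale (c : R[i]) l f : tev (fscale c l) f = c *: tev l f.
Proof. by rewrite /tev big_map scaler_sumr; apply: eq_bigr => q _; rewrite gen_scale. Qed.

Lemma tevD l f g : tev l (f + g) = tev l f + tev l g.
Proof. by rewrite /tev -big_split; apply: eq_bigr => q _; rewrite genD. Qed.

Lemma tevZ l (c : R[i]) f : tev l (c *: f) = c *: tev l f.
Proof. by rewrite /tev scaler_sumr; apply: eq_bigr => q _; rewrite genZ. Qed.

Lemma tevB l f g : tev l (f - g) = tev l f - tev l g.
Proof. by rewrite tevD -[- g]scaleN1r tevZ scaleN1r. Qed.

Lemma gen0 q : gen q 0 = 0.
Proof. by rewrite -(scale0r (0 : GP -> A)) genZ !scale0r. Qed.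

Lemma tev_mul l m f : tev l (tev m f) = tev [seq gmul p q | p <- l, q <- m] f.
Proof.
rewrite /tev big_allpairs_dep; apply: eq_bigr => p _.
elim: m => [|q m IH]; first by rewrite !big_nil gen0.
by rewrite !big_cons genD IH gen_mul.
Qed.

Lemma shift_tev x l f : shift x (tev l f) = tev [seq (pc_add x q.1.1, q.1.2, q.2) | q <- l] f.
Proof.
rewrite /tev big_map; elim: l => [|q l IH].
  by rewrite !big_nil -(scale0r (0 : GP -> A)) shiftZ !scale0r.
by rewrite !big_cons shiftD IH /gen shift_shift.
Qed.

(** If x exceeds the right index, the remaining shift by d moves to the left across pi(a) and turns
    a into alpha_d(a). *)
Lemma gen_shift x q : exists q', forall f, gen q (shift x f) = gen q' f.
Proof.
have [xy|yx] := pc_leVge x q.2.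
  by exists (q.1.1, q.1.2, pc_diff q.2 x) => f; rewrite /gen coshift_shift_ge.
exists (pc_add q.1.1 (pc_diff x q.2), alpha (pc_diff x q.2) q.1.2, pc0 G) => f.
rewrite /gen coshift_shift_le// pi_alpha_shift shift_shift /=; congr (shift _ (pi_alpha _ _ _)).
by apply/funext => i; rewrite /coshift; congr f; apply: pc_inj; rewrite /= addr0.
Qed.

Lemma tev_shift x l : exists l', forall f, tev l (shift x f) = tev l' f.
Proof.
elim: l => [|q l [l' hl]]; first by exists [::] => f; rewrite /tev !big_nil.
have [q' hq] := gen_shift x q; exists (q' :: l') => f.
by rewrite !tev_cons hl hq.
Qed.

Local Open Scope fset_scope.
Local Open Scope ring_scope.

Lemma pc_add_inj y : injective (fun i => pc_add i y).
Proof. by move=> i j e; rewrite -(pc_add_diff i y) e pc_add_diff. Qed.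

Lemma fset_push y J : exists2 K : {fset GP}, (forall j, (pc_add j y \in K) = (j \in J)) &
  forall F : GP -> A, \sum_(k <- K) F k = \sum_(j <- J) F (pc_add j y).
Proof.
have us : uniq [seq pc_add j y | j <- enum_fset J].
  by rewrite map_inj_uniq ?fset_uniq//; exact: pc_add_inj.
have [K hK KJ] := seq_fset_perm_eq us.
exists K; last by move=> F; rewrite (perm_big _ KJ) big_map.
by move=> j; rewrite hK; exact: (mem_map (@pc_add_inj y)).
Qed.

Lemma fset_pull x J : exists2 K : {fset GP}, (forall j, (j \in K) = (pc_add j x \in J)) &
  forall F : GP -> A, (forall i, ~ val x <= val i -> F i = 0) ->
    \sum_(i <- J) F i = \sum_(j <- K) F (pc_add j x).
Proof.
pose s := [seq pc_diff i x | i <- enum_fset J & val x <= val i].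
have ms j : (j \in s) = (pc_add j x \in J).
  apply/mapP/idP; first by case=> i; rewrite mem_filter => /andP[xi iJ] ->; rewrite pc_diffK.
  move=> jJ.
  exists (pc_add j x); last by rewrite pc_add_diff.
  by rewrite mem_filter jJ andbT pc_addC pc_le_add.
have us : uniq s.
  rewrite map_inj_in_uniq ?filter_uniq ?fset_uniq// => i j.
  by rewrite !mem_filter => /andP[xi _] /andP[xj _] e; rewrite -(pc_diffK xi) e pc_diffK.
have [K hK Ks] := seq_fset_perm_eq us; exists K; first by move=> j; rewrite hK ms.
move=> F hF; rewrite (perm_big _ Ks) big_map big_filter [RHS]big_mkcond.
by apply: eq_bigr => i _; case: ifPn => [xi|/negP/hF//]; rewrite pc_diffK.
Qed.

Lemma dots_shift x J : exists2 K : {fset GP}, (forall j, (j \in K) = (pc_add j x \in J)) &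
  forall f g, dots J (shift x f) g = dots K f (coshift x g).
Proof.
have [K hK KE] := fset_pull x J; exists K => // f g.
rewrite /dots KE => [|i xi]; last by rewrite shift_lt// star0 amul0l.
by apply: eq_bigr => j _; rewrite shift_add.
Qed.

Lemma qn_shift x J : exists2 K : {fset GP}, (forall j, (j \in K) = (pc_add j x \in J)) &
  forall f, qn J (shift x f) = qn K f.
Proof.
have [K hK KE] := dots_shift x J; exists K => // f; rewrite /qn KE.
by congr (Num.sqrt (nr (dots _ _ _))); apply/funext => i; rewrite /coshift shift_add.
Qed.

Lemma qn_coshift y J : exists2 K : {fset GP}, (forall j, (pc_add j y \in K) = (j \in J)) &
  (forall k, k \in K -> exists2 j, j \in J & k = pc_add j y) /\
  forall f, qn J (coshift y f) = qn K f.
Proof.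
have us : uniq [seq pc_add j y | j <- enum_fset J].
  by rewrite map_inj_uniq ?fset_uniq//; exact: pc_add_inj.
have [K hK KJ] := seq_fset_perm_eq us.
exists K; first by move=> j; rewrite hK; exact: (mem_map (@pc_add_inj y)).
split; first by move=> k; rewrite hK => /mapP.
by move=> f; rewrite /qn /dots (perm_big _ KJ) big_map.
Qed.

Lemma l2_shift x f : l2_mem f -> l2_mem (shift x f).
Proof.
move=> /l2_memP lf; apply/l2_memP => e e0; have [J0 hJ] := lf _ e0.
have [K0 hK0 _] := fset_push x J0; exists K0 => J /fdisjointP JK.
have [K hK ->] := qn_shift x J; apply: hJ; apply/fdisjointP => j.
by rewrite hK => /JK; rewrite hK0.
Qed.

Lemma l2_coshift y f : l2_mem f -> l2_mem (coshift y f).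
Proof.
move=> /l2_memP lf; apply/l2_memP => e e0; have [J0 hJ] := lf _ e0.
have [K0 hK0 _] := fset_pull y J0; exists K0 => J /fdisjointP JK.
have [K _ [hK ->]] := qn_coshift y J; apply: hJ; apply/fdisjointP => k /hK[j /JK + ->].
by rewrite hK0.
Qed.

Lemma l2n_shift_le x f : l2_mem f -> l2n (shift x f) <= l2n f.
Proof.
move=> lf; apply: l2n_le => [||J]; [exact: l2_shift|exact: l2n_ge0|].
by have [K _ ->] := qn_shift x J; exact: qn_l2n.
Qed.

Lemma l2n_coshift_le y f : l2_mem f -> l2n (coshift y f) <= l2n f.
Proof.
move=> lf; apply: l2n_le => [||J]; [exact: l2_coshift|exact: l2n_ge0|].
by have [K _ [_ ->]] := qn_coshift y J; exact: qn_l2n.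
Qed.

Lemma qn_pi_alpha a J f : qn J (pi_alpha alpha a f) <= nr a * qn J f.
Proof.
apply: (qn_contr J f (nr_ge0 a)) => i; apply: star_hom_contr.
exact: ds_hom halpha i.
Qed.

Lemma l2_pi_alpha a f : l2_mem f -> l2_mem (pi_alpha alpha a f).
Proof. by apply: (l2_mem_le (nr_ge0 a)) => J; exact: qn_pi_alpha. Qed.

Lemma l2n_pi_alpha a f : l2_mem f -> l2n (pi_alpha alpha a f) <= nr a * l2n f.
Proof.
move=> lf; apply: l2n_le => [||J]; [exact: l2_pi_alpha|by rewrite mulr_ge0 ?nr_ge0 ?l2n_ge0|].
by rewrite (le_trans (qn_pi_alpha _ _ _))// ler_wpM2l ?nr_ge0 ?qn_l2n.
Qed.

Lemma l2_dot_shift x f g : l2_mem f -> l2_mem g ->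
  l2_dot (shift x f) g = l2_dot f (coshift x g).
Proof.
move=> lf lg; apply: l2_dot_eq => e e0.
have [J0 hJ] := l2_dotP lf (@l2_coshift x _ lg) e0.
have [K0 hK0 _] := fset_push x J0; exists K0 => J /fsubsetP JK.
have [K hK ->] := dots_shift x J; apply: hJ; apply/fsubsetP => j jJ.
by rewrite hK JK// hK0.
Qed.

Lemma l2_dot_coshift y f g : l2_mem f -> l2_mem g ->
  l2_dot (coshift y f) g = l2_dot f (shift y g).
Proof.
move=> lf lg; rewrite -(l2_dot_star lg (@l2_coshift y _ lf)) -(l2_dot_shift y lg lf).
by rewrite l2_dot_star//; exact: l2_shift.
Qed.

Lemma l2_dot_pi_alpha a f g : l2_dot (pi_alpha alpha a f) g = l2_dot f (pi_alpha alpha (star a) g).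
Proof.
congr (lim (_ @ totally)); apply/funext => J; apply: eq_bigr => i _.
by rewrite /pi_alpha starM amulA (star_hom_star (ds_hom halpha _)).
Qed.

Lemma l2_gen q f : l2_mem f -> l2_mem (gen q f).
Proof. by move=> lf; apply/l2_shift/l2_pi_alpha/l2_coshift. Qed.

Lemma l2_tev l f : l2_mem f -> l2_mem (tev l f).
Proof.
move=> lf; elim: l => [|q l IH]; first by rewrite /tev big_nil; exact: l2_0.
by rewrite tev_cons; apply: l2D => //; exact: l2_gen.
Qed.

Lemma l2n0 : l2n (0 : GP -> A) = 0.
Proof.
apply/eqP; rewrite eq_le l2n_ge0 andbT; apply: l2n_le => // [|J]; first exact: l2_0.
by rewrite /qn /dots big1 ?nr0 ?sqrtr0// => x _; rewrite amul0r.
Qed.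

Lemma l2n_tev l : exists2 M : R, 0 <= M & forall f, l2_mem f -> l2n (tev l f) <= M * l2n f.
Proof.
elim: l => [|q l [M M0 hM]]; first by exists 0 => // f _; rewrite /tev big_nil l2n0 mul0r.
exists (nr q.1.2 + M); first by rewrite addr_ge0 ?nr_ge0.
move=> f lf; rewrite tev_cons (le_trans (l2nD (@l2_gen q _ lf) (@l2_tev l _ lf)))// mulrDl.
apply: lerD; last exact: hM.
have lc := @l2_coshift q.2 _ lf; have lp := @l2_pi_alpha q.1.2 _ lc.
rewrite (le_trans (l2n_shift_le _ lp))// (le_trans (l2n_pi_alpha _ lc))//.
by rewrite ler_wpM2l ?nr_ge0 ?l2n_coshift_le.
Qed.

Lemma l2_dot_tev l f g : l2_mem f -> l2_mem g -> l2_dot (tev l f) g = l2_dot f (tev (fstar l) g).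
Proof.
move=> lf lg; elim: l => [|q l IH].
  have l0 : l2_mem (0 : GP -> A) by exact: l2_0.
  rewrite /tev !big_nil -(l2_dot_star lg l0) -(scale0r (0 : GP -> A)) !l2_dotZr//.
  by rewrite !scale0r star0.
have lq : l2_mem (gen q f) by exact: l2_gen.
have ll : l2_mem (tev l f) by exact: l2_tev.
rewrite /= !tev_cons l2_dotDr//; [|exact: l2_gen|exact: l2_tev].
rewrite -(l2_dot_star lg (l2D lq ll)) l2_dotDr// starD !l2_dot_star// IH; congr (_ + _).
have lc := @l2_coshift q.2 _ lf; have lp := @l2_pi_alpha q.1.2 _ lc.
rewrite /gen l2_dot_shift// l2_dot_pi_alpha l2_dot_coshift//.
by apply: l2_pi_alpha; exact: l2_coshift.
Qed.

End ToeplitzOperators.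


Section L2Adjoint.
Variables (R : realType) (G : ordGroupType) (A : cstarType R).
Local Notation GP := (pos_cone G).
Implicit Types (f g h : GP -> A) (S T : (GP -> A) -> GP -> A).

Lemma l2_adjoint_sym S T : l2_adjoint S T -> l2_adjoint T S.
Proof.
move=> [lS lT hST]; split=> // f g lf lg.
by rewrite -(l2_dot_star lg (lT _ lf)) -hST// l2_dot_star//; exact: lS.
Qed.

Lemma l2_adjoint_comp S T S' T' : l2_adjoint S S' -> l2_adjoint T T' ->
  l2_adjoint (S \o T) (T' \o S').
Proof.
move=> [lS lS' hS] [lT lT' hT]; split=> [f lf|f lf|f g lf lg] /=; rewrite ?hS ?hT//.
- exact/lS/lT.
- exact/lT'/lS'.
- exact: lS'.
- exact: lT.
Qed.

Lemma l2_adjointD S T S' T' : l2_adjoint S S' -> l2_adjoint T T' ->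
  l2_adjoint (fun f => S f + T f) (fun f => S' f + T' f).
Proof.
move=> [lS lS' hS] [lT lT' hT]; split=> [f lf|f lf|f g lf lg].
- by apply: l2D; [exact: lS|exact: lT].
- by apply: l2D; [exact: lS'|exact: lT'].
have l1 := lS f lf; have l2 := lT f lf; have l3 := lS' g lg; have l4 := lT' g lg.
rewrite -(l2_dot_star lg (l2D l1 l2)) l2_dotDr// starD !l2_dot_star// hS// hT//.
by rewrite l2_dotDr.
Qed.

Lemma l2_adjointZ (c : R[i]) S S' : l2_adjoint S S' ->
  l2_adjoint (fun f => c *: S f) (fun f => Num.conj c *: S' f).
Proof.
move=> [lS lS' hS]; split=> [f lf|f lf|f g lf lg].
- by apply: l2Z; exact: lS.
- by apply: l2Z; exact: lS'.
have l1 := lS f lf; have l3 := lS' g lg.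
by rewrite -(l2_dot_star lg (@l2Z _ _ _ c _ l1)) l2_dotZr// starZ l2_dot_star// hS// l2_dotZr.
Qed.

(** The squared norm of T g is the norm of <S T g, g>, to which Cauchy-Schwarz applies. *)
Lemma l2_adjoint_bound S T K : l2_adjoint S T -> 0 <= K ->
  (forall f, l2_mem f -> l2n (S f) <= K * l2n f) -> forall g, l2_mem g -> l2n (T g) <= K * l2n g.
Proof.
move=> [lS lT hST] K0 hK g lg; have [T0|T0] := eqVneq (l2n (T g)) 0.
  by rewrite T0 mulr_ge0 ?l2n_ge0.
have {}T0 : 0 < l2n (T g) by rewrite lt_neqAle eq_sym T0 l2n_ge0.
rewrite -(ler_pM2r T0) -expr2 l2n_sqr -hST//; last exact: lT.
have l1 := lT g lg; have l2 := lS _ l1.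
rewrite (le_trans (l2_cauchy_schwarz l2 lg))// mulrAC ler_wpM2r ?l2n_ge0//; exact: hK.
Qed.

Lemma l2_adjoint_unique S T T' : l2_adjoint S T -> l2_adjoint S T' ->
  forall g, l2_mem g -> T g = T' g.
Proof.
move=> [_ _ h] [_ _ h'] g lg; apply: l2_dot_inj => f lf.
by rewrite -h// -h'.
Qed.

Lemma l2_adjoint_linear S T : l2_adjoint S T -> forall (c : R[i]) f g, l2_mem f -> l2_mem g ->
  S (c *: f + g) = c *: S f + S g.
Proof.
move=> /l2_adjoint_sym [lT lS h] c f g lf lg; apply: l2_dot_inj => k lk.
have lcf : l2_mem (c *: f) by exact: l2Z.
have lfg := l2D lcf lg; have l1 := lS _ lf; have l2 := lS _ lg; have l3 := lT _ lk.
have lcS : l2_mem (c *: S f) by exact: l2Z.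
by rewrite -h// !l2_dotDr// !l2_dotZr// !h.
Qed.

Lemma l2_adjoint_shift x : l2_adjoint (@shift R G A x) (@coshift R G A x).
Proof.
by split=> f *; [exact: l2_shift|exact: l2_coshift|exact: l2_dot_shift].
Qed.

End L2Adjoint.

(** * The C*-algebra of approximable operators *)

Section ToeplitzAlgebra.
Variables (R : realType) (G : ordGroupType) (A : cstarType R).
Variable alpha : pos_cone G -> A -> A.
Hypothesis halpha : dynamical_system alpha.
Local Notation GP := (pos_cone G).
Local Notation fn := (GP -> A).
Local Notation tev := (tev alpha).
Implicit Types (f g h : GP -> A) (phi : fn -> fn) (l m : seq (term G A)).

(** Membership in the norm closure of the span, expressed through l2 norms because the operator norm
    is only defined later, on these operators. *)
Definition approximable phi := forall e : R, 0 < e -> exists l, forall f, l2_mem f ->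
  l2n (phi f - tev l f) <= e * l2n f.

(* Operators on l2, extended by zero to all functions. *)
Record tz := Tz {
  tz_fun :> fn -> fn;
  tz_adj : fn -> fn;
  tz_off : forall f, ~ l2_mem f -> tz_fun f = 0 /\ tz_adj f = 0;
  tz_adjoint : l2_adjoint tz_fun tz_adj;
  tz_approx : approximable tz_fun
}.

HB.instance Definition _ := gen_eqMixin tz.
HB.instance Definition _ := gen_choiceMixin tz.

Implicit Types (S T U : tz).

Lemma tz_eq S T : (forall f, l2_mem f -> S f = T f) -> S = T.
Proof.
move=> h.
have h1 f : S f = T f.
  have [/h//|nf] := pselect (l2_mem f).
  by rewrite (tz_off S nf).1 (tz_off T nf).1.
have h2 f : tz_adj S f = tz_adj T f.
  have [lf|nf] := pselect (l2_mem f); last by rewrite (tz_off S nf).2 (tz_off T nf).2.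
  apply: (l2_adjoint_unique (tz_adjoint S)) => //.
  by have [a b c] := tz_adjoint T; split=> // [k /a|k k' lk lk']; rewrite ?h1// c.
case: S T h1 h2 {h} => f f' o a p [g g' o' a' p'] /= /funext h1 /funext h2; subst g g'.
by congr Tz.
Qed.

Definition off phi : fn -> fn := fun f => if `[< l2_mem f >] then phi f else 0.

Lemma offE phi f : l2_mem f -> off phi f = phi f.
Proof. by move=> lf; rewrite /off; case: asboolP. Qed.

Lemma tz_mk phi psi : l2_adjoint phi psi -> approximable phi ->
  {T : tz | forall f, l2_mem f -> T f = phi f /\ tz_adj T f = psi f}.
Proof.
move=> adj app; have o f : ~ l2_mem f -> off phi f = 0 /\ off psi f = 0.
  by move=> nf; rewrite /off; case: asboolP.
have adj' : l2_adjoint (off phi) (off psi).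
  by have [a b c] := adj; split=> [f lf|f lf|f g lf lg]; rewrite !offE//; auto.
have app' : approximable (off phi).
  by move=> e /app[l hl]; exists l => f lf; rewrite offE// hl.
by exists (Tz o adj' app') => f lf /=; rewrite !offE.
Qed.

Lemma tz_l2 T f : l2_mem f -> l2_mem (T f).
Proof. by move=> lf; have [h _ _] := tz_adjoint T; exact: h. Qed.
Arguments tz_l2 T {f} _.

Lemma l2_adjoint_tev l : l2_adjoint (tev l) (tev (fstar l)).
Proof.
by split=> f *; [exact: l2_tev|exact: l2_tev|exact: l2_dot_tev].
Qed.

Lemma approximable_tev l : approximable (tev l).
Proof.
by move=> e e0; exists l => f lf; rewrite subrr l2n0 mulr_ge0 ?l2n_ge0 ?ltW.
Qed.

Definition tz_tev l := sval (tz_mk (l2_adjoint_tev l) (approximable_tev l)).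
Lemma tz_tevE l f : l2_mem f -> tz_tev l f = tev l f.
Proof. by rewrite /tz_tev; case: tz_mk => T /= h /h[]. Qed.

Lemma tz_bound T : exists2 M : R, 0 <= M & forall f, l2_mem f -> l2n (T f) <= M * l2n f.
Proof.
have [l hl] := tz_approx T (@ltr01 R); have [M M0 hM] := l2n_tev halpha l.
exists (1 + M); first by rewrite addr_ge0.
move=> f lf; have lt : l2_mem (tev l f) by exact: l2_tev.
have lT := tz_l2 T lf.
have -> : T f = (T f - tev l f) + tev l f by rewrite subrK.
rewrite mulrDl; apply: (le_trans (l2nD (l2B lT lt) lt)).
exact: lerD (hl f lf) (hM f lf).
Qed.

Fact tz_zero_adjoint : l2_adjoint (fun _ : fn => 0 : fn) (fun _ : fn => 0 : fn).
Proof.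
have l0 : l2_mem (0 : fn) by exact: l2_0.
split=> // f g lf lg; rewrite -(l2_dot_star lg l0) -(scale0r (0 : fn)) !l2_dotZr//.
by rewrite !scale0r star0.
Qed.

Fact tz_zero_approx : approximable (fun _ => 0).
Proof.
by move=> e e0; exists [::] => f lf; rewrite tev_nil subr0 l2n0 mulr_ge0 ?l2n_ge0 ?ltW.
Qed.

Fact tz_add_approx S T : approximable (fun f => S f + T f).
Proof.
move=> e e0; have e20 : 0 < e / 2 by rewrite divr_gt0.
have [l hl] := tz_approx S e20; have [m hm] := tz_approx T e20.
exists (l ++ m) => f lf; rewrite tev_cat opprD addrACA (splitr e) mulrDl.
have h1 : l2_mem (S f - tev l f) by apply: l2B; [exact: tz_l2|exact: l2_tev].
have h2 : l2_mem (T f - tev m f) by apply: l2B; [exact: tz_l2|exact: l2_tev].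
apply: (le_trans (l2nD h1 h2)).
exact: lerD (hl f lf) (hm f lf).
Qed.

Fact tz_scale_approx (c : R[i]) T : approximable (fun f => c *: T f).
Proof.
move=> e e0; set k := complex.Re `|c|.
have k0 : 0 <= k by rewrite -ler0c RRe_real ?normr_real.
have k1 : 0 < k + 1 by rewrite ltr_wpDl.
have [l hl] := tz_approx T (divr_gt0 e0 k1); exists (fscale c l) => f lf.
have lB : l2_mem (T f - tev l f) by apply: l2B; [exact: tz_l2|exact: l2_tev].
rewrite (tev_scale halpha) -scalerBr (le_trans (l2nZ_le c lB))// -/k.
rewrite (le_trans (ler_wpM2l k0 (hl f lf)))// mulrA ler_wpM2r ?l2n_ge0// mulrCA ler_piMr ?ltW//.
by rewrite ltr_pdivrMr// mul1r ltrDl.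
Qed.

Fact tz_mul_approx S T : approximable (S \o T).
Proof.
move=> e e0; have [M M0 hM] := tz_bound T.
have M1 : 0 < M + 1 by rewrite ltr_wpDl.
have [l hl] := tz_approx S (divr_gt0 (divr_gt0 e0 (ltr0Sn R 1)) M1).
have [N N0 hN] := l2n_tev halpha l; have N1 : 0 < N + 1 by rewrite ltr_wpDl.
have [m hm] := tz_approx T (divr_gt0 (divr_gt0 e0 (ltr0Sn R 1)) N1).
exists [seq gmul alpha p q | p <- l, q <- m] => f lf; rewrite -(tev_mul halpha) /=.
have lT := tz_l2 T lf; have lm : l2_mem (tev m f) by exact: l2_tev.
have lS := tz_l2 S lT; have lt : l2_mem (tev l (T f)) by exact: l2_tev.
have ltm : l2_mem (tev l (tev m f)) by exact: l2_tev.
rewrite (le_trans (l2n_dist_trans lS lt ltm))// (splitr e) mulrDl lerD//.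
  rewrite (le_trans (hl _ lT))// (le_trans (ler_wpM2l _ (hM f lf)))//.
    by rewrite !divr_ge0 ?ltW.
  rewrite mulrA ler_wpM2r ?l2n_ge0// mulrAC -mulrA ler_piMr ?divr_ge0 ?(ltW e0)//.
  by rewrite ler_pdivrMr// mul1r lerDl.
rewrite -tevB (le_trans (hN _ (l2B lT lm)))//.
rewrite (le_trans (ler_wpM2l N0 (hm f lf)))// mulrA ler_wpM2r ?l2n_ge0//.
rewrite mulrCA ler_piMr ?divr_ge0 ?(ltW e0)//.
by rewrite ler_pdivrMr// mul1r lerDl.
Qed.

Lemma adjoint_approx phi psi : l2_adjoint phi psi -> approximable phi -> approximable psi.
Proof.
move=> adj app e e0; have [l hl] := app _ e0; exists (fstar l) => f lf.
have h := l2_adjointD adj (l2_adjointZ (- 1) (l2_adjoint_tev l)).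
have hl' g : l2_mem g -> l2n (phi g + -1 *: tev l g) <= e * l2n g.
  by rewrite scaleN1r; exact: hl.
have := l2_adjoint_bound h (ltW e0) hl' lf.
by rewrite rmorphN rmorph1 scaleN1r.
Qed.

Definition tz_zero := sval (tz_mk tz_zero_adjoint tz_zero_approx).
Definition tz_add S T :=
  sval (tz_mk (l2_adjointD (tz_adjoint S) (tz_adjoint T)) (tz_add_approx S T)).
Definition tz_scale (c : R[i]) T :=
  sval (tz_mk (l2_adjointZ c (tz_adjoint T)) (tz_scale_approx c T)).
Definition tz_mul S T :=
  sval (tz_mk (l2_adjoint_comp (tz_adjoint S) (tz_adjoint T)) (tz_mul_approx S T)).
Definition tz_star T : tz :=
  Tz (fun f nf => conj (tz_off T nf).2 (tz_off T nf).1) (l2_adjoint_sym (tz_adjoint T))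
    (adjoint_approx (tz_adjoint T) (@tz_approx T)).

Lemma tz_zeroE f : l2_mem f -> tz_zero f = 0.
Proof. by rewrite /tz_zero; case: tz_mk => T /= h /h[]. Qed.
Lemma tz_addE S T f : l2_mem f -> tz_add S T f = S f + T f.
Proof. by rewrite /tz_add; case: tz_mk => U /= h /h[]. Qed.
Lemma tz_scaleE (c : R[i]) T f : l2_mem f -> tz_scale c T f = c *: T f.
Proof. by rewrite /tz_scale; case: tz_mk => U /= h /h[]. Qed.
Lemma tz_mulE S T f : l2_mem f -> tz_mul S T f = S (T f).
Proof. by rewrite /tz_mul; case: tz_mk => U /= h /h[]. Qed.

Fact tz_addA : associative tz_add.
Proof. by move=> S T U; apply: tz_eq => f lf; rewrite !tz_addE// addrA. Qed.
Fact tz_addC : commutative tz_add.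
Proof. by move=> S T; apply: tz_eq => f lf; rewrite !tz_addE// addrC. Qed.
Fact tz_add0 : left_id tz_zero tz_add.
Proof. by move=> S; apply: tz_eq => f lf; rewrite tz_addE// tz_zeroE// add0r. Qed.
Fact tz_addN : left_inverse tz_zero (tz_scale (-1)) tz_add.
Proof.
by move=> S; apply: tz_eq => f lf; rewrite tz_addE// tz_zeroE// tz_scaleE// scaleN1r addNr.
Qed.
HB.instance Definition _ := GRing.isZmodule.Build tz tz_addA tz_addC tz_add0 tz_addN.

Fact tz_scaleA (a b : R[i]) T : tz_scale a (tz_scale b T) = tz_scale (a * b) T.
Proof. by apply: tz_eq => f lf; rewrite !tz_scaleE// scalerA. Qed.
Fact tz_scale1 : left_id 1 tz_scale.
Proof. by move=> T; apply: tz_eq => f lf; rewrite tz_scaleE// scale1r. Qed.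
Fact tz_scaleDr : right_distributive tz_scale +%R.
Proof. by move=> c S T; apply: tz_eq => f lf; rewrite tz_scaleE// !tz_addE// !tz_scaleE// scalerDr. Qed.
Fact tz_scaleDl T : {morph tz_scale^~ T : a b / a + b}.
Proof. by move=> a b; apply: tz_eq => f lf; rewrite tz_scaleE// tz_addE// !tz_scaleE// scalerDl. Qed.
HB.instance Definition _ := GRing.Zmodule_isLmodule.Build R[i] tz
  tz_scaleA tz_scale1 tz_scaleDr tz_scaleDl.

Lemma tzDE S T f : l2_mem f -> (S + T) f = S f + T f. Proof. exact: tz_addE. Qed.
Lemma tzZE (c : R[i]) T f : l2_mem f -> (c *: T) f = c *: T f. Proof. exact: tz_scaleE. Qed.
Lemma tz0E f : l2_mem f -> (0 : tz) f = 0. Proof. exact: tz_zeroE. Qed.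
Lemma tzBE S T f : l2_mem f -> (S - T) f = S f - T f.
Proof. by move=> lf; rewrite tzDE// -[- T]scaleN1r tzZE// scaleN1r. Qed.

Definition opn T : R :=
  inf [set M : R | 0 <= M /\ forall f, l2_mem f -> l2n (T f) <= M * l2n f].

Let opn_has_inf T :
  has_inf [set M : R | 0 <= M /\ forall f, l2_mem f -> l2n (T f) <= M * l2n f].
Proof.
split; last by exists 0 => M [].
by have [M M0 hM] := tz_bound T; exists M.
Qed.

Lemma opn_min T M : 0 <= M -> (forall f, l2_mem f -> l2n (T f) <= M * l2n f) -> opn T <= M.
Proof. by move=> M0 hM; apply: ge_inf; [exact: (opn_has_inf T).2|]. Qed.

Lemma opn_ge0 T : 0 <= opn T.
Proof. by apply: lb_le_inf; [exact: (opn_has_inf T).1|move=> M []]. Qed.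

Lemma opn_le T f : l2_mem f -> l2n (T f) <= opn T * l2n f.
Proof.
move=> lf; have [f0|f0] := eqVneq (l2n f) 0.
  by have [M M0 hM] := tz_bound T; have := hM f lf; rewrite f0 !mulr0.
have {}f0 : 0 < l2n f by rewrite lt_neqAle eq_sym f0 l2n_ge0.
rewrite -ler_pdivrMr//; apply: lb_le_inf; first exact: (opn_has_inf T).1.
by move=> M [_ hM]; rewrite ler_pdivrMr// hM.
Qed.

Fact tz_normD S T : (opn (S + T))%:C <= (opn S)%:C + (opn T)%:C :> R[i].
Proof.
rewrite -realCD lecR; apply: opn_min; first by rewrite addr_ge0 ?opn_ge0.
move=> f lf; rewrite tzDE// (le_trans (l2nD (tz_l2 S lf) (tz_l2 T lf)))//.
by rewrite mulrDl lerD// opn_le.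
Qed.

Lemma opnZ_le (c : R[i]) T : opn (c *: T) <= complex.Re `|c| * opn T.
Proof.
have c0 : 0 <= complex.Re `|c| by rewrite -ler0c RRe_real ?normr_real.
apply: opn_min; first by rewrite mulr_ge0 ?opn_ge0.
move=> f lf; rewrite tzZE// (le_trans (l2nZ_le c (tz_l2 T lf)))//.
by rewrite -mulrA ler_wpM2l ?opn_le.
Qed.

Fact tz_normZ (c : R[i]) T : (opn (c *: T))%:C = `|c| * (opn T)%:C :> R[i].
Proof.
have cE (d : R[i]) : `|d| = (complex.Re `|d|)%:C by rewrite RRe_real ?normr_real.
rewrite cE -realCM; congr (_%:C); apply/eqP; rewrite eq_le opnZ_le andTb.
have [->|c0] := eqVneq c 0; first by rewrite normr0 mul0r opn_ge0.
have := opnZ_le c^-1 (c *: T); rewrite scalerA mulVf// scale1r normfV.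
have k0 : 0 < complex.Re `|c| by rewrite -ltcR -cE normr_gt0.
have -> : complex.Re `|c|^-1 = (complex.Re `|c|)^-1 by rewrite cE -realCV.
by rewrite ler_pdivlMl.
Qed.

Fact tz_norm_eq0 T : (opn T)%:C = 0 :> R[i] -> T = 0.
Proof.
move=> /complexI T0; apply: tz_eq => f lf; rewrite tz0E//.
by apply: (l2n_eq0 (tz_l2 T lf)); rewrite (le_trans (opn_le T lf))// T0 mul0r.
Qed.

HB.instance Definition _ := Lmodule_isNormed.Build R[i] tz tz_normD tz_normZ tz_norm_eq0.

Lemma nr_tz T : nr T = opn T. Proof. by []. Qed.

Lemma opn_star_le T : opn (tz_star T) <= opn T.
Proof.
apply: opn_min; first exact: opn_ge0.
by move=> f; apply: (l2_adjoint_bound (tz_adjoint T) (opn_ge0 T)); exact: opn_le.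
Qed.

Lemma opn_star T : opn (tz_star T) = opn T.
Proof.
apply/eqP; rewrite eq_le opn_star_le /=; have := opn_star_le (tz_star T).
by congr (opn _ <= _); exact: tz_eq.
Qed.

Fact tz_mulA S T U : tz_mul S (tz_mul T U) = tz_mul (tz_mul S T) U.
Proof. by apply: tz_eq => f lf; rewrite !tz_mulE//; exact: tz_l2. Qed.
Fact tz_mulDl S T U : tz_mul (S + T) U = tz_mul S U + tz_mul T U.
Proof. by apply: tz_eq => f lf; rewrite tzDE// !tz_mulE// tzDE//; exact: tz_l2. Qed.
Fact tz_mulZl (c : R[i]) S T : tz_mul (c *: S) T = c *: tz_mul S T.
Proof. by apply: tz_eq => f lf; rewrite tzZE// !tz_mulE// tzZE//; exact: tz_l2. Qed.

Lemma tz_linear S (c : R[i]) f g : l2_mem f -> l2_mem g -> S (c *: f + g) = c *: S f + S g.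
Proof. exact: (l2_adjoint_linear (tz_adjoint S)). Qed.

Fact tz_mulDr S T U : tz_mul S (T + U) = tz_mul S T + tz_mul S U.
Proof.
apply: tz_eq => f lf; rewrite tzDE// !tz_mulE// tzDE//.
have := tz_linear S 1 (tz_l2 T lf) (tz_l2 U lf).
by rewrite !scale1r.
Qed.

Fact tz_mulZr (c : R[i]) S T : tz_mul S (c *: T) = c *: tz_mul S T.
Proof.
apply: tz_eq => f lf; rewrite tzZE// !tz_mulE// tzZE//.
have l0 : l2_mem (0 : fn) by exact: l2_0.
have S0 : S 0 = 0.
  have := tz_linear S 1 l0 l0; rewrite !scale1r addr0 => h.
  by apply: (addrI (S 0)); rewrite addr0 -h.
by have := tz_linear S c (tz_l2 T lf) l0; rewrite S0 !addr0.
Qed.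

Fact tz_starK T : tz_star (tz_star T) = T. Proof. exact: tz_eq. Qed.

Fact tz_starD S T : tz_star (S + T) = tz_star S + tz_star T.
Proof.
apply: tz_eq => f lf; rewrite tzDE//= /GRing.add /= /tz_add.
by case: tz_mk => U /= h; have [] := h f lf.
Qed.
Fact tz_starZ (c : R[i]) T : tz_star (c *: T) = Num.conj c *: tz_star T.
Proof.
apply: tz_eq => f lf; rewrite tzZE//= /GRing.scale /= /tz_scale.
by case: tz_mk => U /= h; have [] := h f lf.
Qed.
Fact tz_starM S T : tz_star (tz_mul S T) = tz_mul (tz_star T) (tz_star S).
Proof.
apply: tz_eq => f lf; rewrite tz_mulE//= /tz_mul.
by case: tz_mk => U /= h; have [] := h f lf.
Qed.

HB.instance Definition _ := isStarAlgebra.Build R tz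
  tz_mulA tz_mulDl tz_mulDr tz_mulZl tz_mulZr tz_starK tz_starD tz_starZ tz_starM.

Lemma l2_dot_near phi phi' f g (e : R) : 0 <= e -> l2_mem (phi f) -> l2_mem (phi' f) -> l2_mem g ->
  l2n (phi f - phi' f) <= e * l2n f ->
  nr (l2_dot (phi f) g - l2_dot (phi' f) g) <= e * l2n f * l2n g.
Proof.
move=> e0 l1 l2 lg h; have l3 := l2B l1 l2.
have -> : l2_dot (phi f) g - l2_dot (phi' f) g = l2_dot (phi f - phi' f) g.
  rewrite -(l2_dot_star lg l1) -(l2_dot_star lg l2) -(l2_dot_star lg l3) -starB.
  congr star; rewrite -[- phi' f]scaleN1r l2_dotDr//; last exact: l2Z.
  by rewrite l2_dotZr// scaleN1r.
by rewrite (le_trans (l2_cauchy_schwarz l3 lg))// ler_wpM2r ?l2n_ge0.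
Qed.

Fact tz_complete (F : set_system tz) : ProperFilter F -> cauchy F -> cvg F.
Proof.
move=> FF cF.
have cau (e : R) : 0 < e -> exists2 P : set tz, F P & forall S T, P S -> P T -> opn (S - T) <= e.
  move=> e0; have e20 : 0 < (e / 2)%:C :> R[i] by rewrite ltcR divr_gt0.
  move/cauchy_ballP : cF => /(_ _ e20) [[P Q] /= [FP FQ] PQ].
  have [z [Pz Qz]] := filter_ex (filterI FP FQ).
  exists P => // x y Px Py; have hx := PQ (x, z) (conj Px Qz); have hy := PQ (y, z) (conj Py Qz).
  rewrite -!ball_normE /= in hx hy; rewrite -nr_tz.
  rewrite (le_trans (nr_dist_trans z _ _))// (splitr e) lerD//.
    by rewrite -lecR -nrE; exact: ltW hx.
  by rewrite nr_distC -lecR -nrE; exact: ltW hy.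
(* Used with [id] and with [tz_star]: a bounded limit on a Hilbert module need not be adjointable,
   so its adjoint is built as the limit of the adjoints. *)
have lim_ex (u : tz -> tz) : (forall S T, opn (u S - u T) <= opn (S - T)) ->
    exists phi : fn -> fn, forall f, l2_mem f -> l2_mem (phi f) /\ forall (e : R) (P : set tz), 0 <= e -> F P ->
      (forall S T, P S -> P T -> opn (S - T) <= e) -> forall S, P S -> l2n (u S f - phi f) <= e * l2n f.
  move=> hu; suff /choice[phi hphi] : forall f, exists k : fn, l2_mem f -> l2_mem k /\
      forall (e : R) (P : set tz), 0 <= e -> F P ->
      (forall S T, P S -> P T -> opn (S - T) <= e) ->
      forall S, P S -> l2n (u S f - k) <= e * l2n f by exists phi.
  move=> f.
  have [lf|nf] := pselect (l2_mem f); last by exists 0.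
  have key (e : R) S T : opn (S - T) <= e -> l2n (u S f - u T f) <= e * l2n f.
    move=> h; rewrite -(tzBE (u S) (u T) lf); apply: (le_trans (opn_le (u S - u T) lf)).
    apply: ler_wpM2r; first exact: l2n_ge0.
    exact: le_trans (hu S T) h.
  have [S|e e0|k lk hk] := @l2_limit R G A tz F _ (fun S => u S f).
  - exact: tz_l2.
  - have n0 : 0 < l2n f + 1 by rewrite ltr_wpDl ?l2n_ge0.
    have [P FP hP] := cau _ (divr_gt0 e0 n0); exists P => // S T PS PT.
    rewrite (le_trans (key _ _ _ (hP S T PS PT)))// mulrAC -mulrA ler_piMr ?ltW//.
    by rewrite ltr_pdivrMr// mul1r ltrDl.
  exists k => _; split=> // e P e0 FP hP S PS.
  by apply: (hk _ P FP) => // S' T' PS' PT'; apply: key; exact: hP.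
have [phi hphi] := lim_ex id (fun S T => lexx _).
have [psi hpsi] : exists psi : fn -> fn, forall f, l2_mem f -> l2_mem (psi f) /\
    forall (e : R) (P : set tz), 0 <= e -> F P -> (forall S T, P S -> P T -> opn (S - T) <= e) ->
    forall S, P S -> l2n (tz_star S f - psi f) <= e * l2n f.
  apply: (lim_ex tz_star) => S T; rewrite -[leRHS]opn_star.
  by rewrite -[tz_star (S - T)]/(star (S - T)) starD -[- T]scaleN1r starZ rmorphN rmorph1 scaleN1r.
have adj : l2_adjoint phi psi.
  split=> [f /hphi[]//|f /hpsi[]//|f g lf lg]; apply: nr_small_eq => e e0.
  have [lphi hf] := hphi f lf; have [lpsi hg] := hpsi g lg.
  pose k := 2 * (l2n f * l2n g) + 1; have k0 : 0 < k.
    by rewrite ltr_wpDl// !mulr_ge0 ?l2n_ge0.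
  have d0 := divr_gt0 e0 k0; have [P FP hP] := cau _ d0; have [S PS] := filter_ex FP.
  have lS := tz_l2 S lf; have lS' := tz_l2 (tz_star S) lg.
  have h1 := l2_dot_near (ltW d0) lS lphi lg (hf _ _ (ltW d0) FP hP S PS).
  have h2 := l2_dot_near (ltW d0) lS' lpsi lf (hg _ _ (ltW d0) FP hP S PS).
  have [_ _ hS] := tz_adjoint S.
  have h3 : nr (l2_dot (S f) g - l2_dot f (psi g)) <= e / k * l2n g * l2n f.
    rewrite hS// -nr_star starB !l2_dot_star//.
  rewrite (le_trans (nr_dist_trans (l2_dot (S f) g) _ _))// nr_distC.
  rewrite (le_trans (lerD h1 h3))//.
  have -> : e / k * l2n f * l2n g + e / k * l2n g * l2n f = e / k * (2 * (l2n f * l2n g)) by ring.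
  by rewrite mulrAC -mulrA ler_piMr ?ltW// ltr_pdivrMr// mul1r ltrDl.
have app : approximable phi.
  move=> e e0; have e20 : 0 < e / 2 by rewrite divr_gt0.
  have [P FP hP] := cau _ e20; have [S PS] := filter_ex FP.
  have [l hl] := tz_approx S e20; exists l => f lf; have [lphi hf] := hphi f lf.
  rewrite (le_trans (l2n_dist_trans lphi (tz_l2 S lf) (@l2_tev _ _ _ _ halpha l _ lf)))//.
  rewrite [e in _ <= e * _](splitr e) mulrDl; apply: lerD; last exact: hl.
  rewrite l2n_distC; exact: (hf _ _ (ltW e20) FP hP S PS).
have [T hT] := tz_mk adj app.
suff /cvg_ex : exists l : tz, S @[S --> F] --> l by [].
exists T; apply/cvg_nrP => e e0; have [P FP hP] := cau _ e0.
apply: (filterS _ FP) => S PS; rewrite nr_tz; apply: opn_min; first exact: ltW.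
move=> f lf; rewrite tzBE// (hT f lf).1.
exact: ((hphi f lf).2 _ _ (ltW e0) FP hP S PS).
Qed.

HB.instance Definition _ := Uniform_isComplete.Build tz tz_complete.

Lemma opnM S T : opn (S ** T) <= opn S * opn T.
Proof.
apply: opn_min; first by rewrite mulr_ge0 ?opn_ge0.
move=> f lf; rewrite -[(S ** T) f]/(tz_mul S T f) tz_mulE//.
rewrite (le_trans (opn_le S (tz_l2 T lf)))// -mulrA ler_wpM2l ?opn_ge0//; exact: opn_le.
Qed.

Fact tz_norm_amul S T : `|S ** T| <= `|S| * `|T|.
Proof. by rewrite !nrE -realCM lecR; exact: opnM. Qed.

Fact tz_cstar_identity T : `|star T ** T| = `|T| ^+ 2.
Proof.
rewrite !nrE -realCX; congr (_%:C); rewrite !nr_tz; apply/eqP; rewrite eq_le; apply/andP; split.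
  rewrite (le_trans (opnM _ _))// expr2 ler_wpM2r ?opn_ge0//; exact: opn_star_le.
have h : opn T <= Num.sqrt (opn (star T ** T)).
  apply: opn_min; first exact: sqrtr_ge0.
  move=> f lf; rewrite -(@ler_pXn2r _ 2) ?nnegrE ?mulr_ge0 ?sqrtr_ge0 ?l2n_ge0// exprMn.
  rewrite (sqr_sqrtr (opn_ge0 (star T ** T))) l2n_sqr; have lT := tz_l2 T lf; have lTT := tz_l2 (star T) lT.
  have [_ _ hT] := tz_adjoint T; rewrite hT// (le_trans (l2_cauchy_schwarz lf lTT))//.
  rewrite mulrC expr2 mulrA ler_wpM2r ?l2n_ge0//.
  rewrite -[tz_star T (T f)]/(star T (T f)) -(tz_mulE (star T) T lf); exact: opn_le.
rewrite -[leRHS](sqr_sqrtr (opn_ge0 _)) lerXn2r ?nnegrE ?opn_ge0 ?sqrtr_ge0//.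
Qed.

HB.instance Definition _ := isCStar.Build R tz tz_norm_amul tz_cstar_identity.

Fact tz_ml_adjoint x T : l2_adjoint (shift x \o T) (tz_adj T \o coshift x).
Proof. exact: (l2_adjoint_comp (@l2_adjoint_shift R G A x) (tz_adjoint T)). Qed.

Fact tz_mr_adjoint x T : l2_adjoint (T \o shift x) (coshift x \o tz_adj T).
Proof. exact: (l2_adjoint_comp (tz_adjoint T) (@l2_adjoint_shift R G A x)). Qed.

Fact tz_ml_approx x T : approximable (shift x \o T).
Proof.
move=> e e0; have [l hl] := tz_approx T e0.
exists [seq (pc_add x q.1.1, q.1.2, q.2) | q <- l] => f lf.
have lB : l2_mem (T f - tev l f) by apply: l2B; [exact: tz_l2|exact: l2_tev].
rewrite -shift_tev /= -[- shift x _]scaleN1r -shiftZ -shiftD scaleN1r.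
exact: le_trans (l2n_shift_le x lB) (hl f lf).
Qed.

Fact tz_mr_approx x T : approximable (T \o shift x).
Proof.
move=> e e0; have [l hl] := tz_approx T e0; have [l' hl'] := tev_shift halpha x l.
exists l' => f lf; rewrite -hl' /= (le_trans (hl _ (@l2_shift _ _ _ x _ lf)))//.
by rewrite ler_wpM2l ?(ltW e0) ?l2n_shift_le.
Qed.

Definition tz_ml x T := sval (tz_mk (tz_ml_adjoint x T) (tz_ml_approx x T)).
Definition tz_mr x T := sval (tz_mk (tz_mr_adjoint x T) (tz_mr_approx x T)).

Lemma tz_mlE x T f : l2_mem f -> tz_ml x T f = shift x (T f).
Proof. by rewrite /tz_ml; case: tz_mk => U /= h /h[]. Qed.
Lemma tz_mrE x T f : l2_mem f -> tz_mr x T f = T (shift x f).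
Proof. by rewrite /tz_mr; case: tz_mk => U /= h /h[]. Qed.

Fact tz_ml_mr x S T : S ** tz_ml x T = tz_mr x S ** T.
Proof.
apply: tz_eq => f lf; rewrite -[(S ** _) f]/(tz_mul S (tz_ml x T) f).
by rewrite -[(_ ** T) f]/(tz_mul (tz_mr x S) T f) !tz_mulE// tz_mlE// tz_mrE//; exact: tz_l2.
Qed.

Definition tz_shift x : multiplier tz := Multiplier (tz_ml_mr x).

Lemma tz_tev_gen q : toeplitz_generator alpha (tz_tev [:: q]).
Proof.
exists q.1.1, q.1.2, q.2, (@coshift R G A q.2); split; first exact: l2_adjoint_shift.
by move=> f lf; rewrite tz_tevE// tev1.
Qed.

Lemma tz_tev_span l : lin_span [set t : tz | toeplitz_generator alpha t] (tz_tev l).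
Proof.
elim: l => [|q l IH].
  have -> : tz_tev [::] = 0 by apply: tz_eq => f lf; rewrite tz_tevE// tz0E// tev_nil.
  exact: lin_span0.
have -> : tz_tev (q :: l) = tz_tev [:: q] + tz_tev l.
  by apply: tz_eq => f lf; rewrite tzDE// !tz_tevE// -cat1s tev_cat.
by apply: lin_spanD => //; apply: lin_span_incl; exact: tz_tev_gen.
Qed.

Theorem toeplitz_algebra_exists : inhabited (toeplitz_algebra alpha).
Proof.
apply: inhabits; apply: (@ToeplitzAlgebra R G A alpha tz (fun T => T)
  (fun a => tz_tev [:: (pc0 G, a, pc0 G)]) tz_shift).
- by move=> S T f lf; rewrite tzDE.
- by move=> c T f lf; rewrite tzZE.
- by move=> S T f lf; rewrite -[(S ** T) f]/(tz_mul S T f) tz_mulE.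
- by move=> T; exact: tz_adjoint.
- move=> T M M0; have [m m0 ->] : exists2 m : R, 0 <= m & M = m%:C.
    by exists (complex.Re M); rewrite ?RRe_real ?ger0_real// -ler0c RRe_real ?ger0_real.
  rewrite nrE lecR; split=> [Tm f lf|h].
    rewrite !l2_normE -realCM lecR (le_trans (opn_le T lf))//.
    by rewrite ler_wpM2r ?l2n_ge0.
  by apply: opn_min => // f lf; have := h f lf; rewrite !l2_normE -realCM lecR.
- move=> T [x [a [y [Sy' [adj hT]]]]]; exists (tz_tev [:: (x, a, y)]) => f lf.
  rewrite tz_tevE// hT// tev1 /gen /=.
  by rewrite (l2_adjoint_unique adj (@l2_adjoint_shift R G A y) lf).
- apply/total_setP => T e e0; have [l hl] := tz_approx T e0.
  exists (tz_tev l); first exact: tz_tev_span.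
  rewrite nr_tz; apply: opn_min; first exact: ltW.
  by move=> f lf; rewrite tzBE// tz_tevE// hl.
- move=> a f lf; rewrite tz_tevE// tev1 /gen /=.
  apply: shift_ext => i; last by move=> []; exact: (valP i).
  have -> : pc_add i (pc0 G) = i by apply: pc_inj; rewrite /= addr0.
  by rewrite /pi_alpha /coshift; congr (_ ** f _); apply: pc_inj; rewrite /= addr0.
- by move=> x T f lf; exact: tz_mlE.
- by move=> x T f lf; exact: tz_mrE.
Qed.

End ToeplitzAlgebra.

(** * Relations in the Toeplitz algebra *)


Section ToeplitzRelations.
Variables (R : realType) (G : ordGroupType) (A : cstarType R).
Variable alpha : pos_cone G -> A -> A.
Hypotheses (halpha : dynamical_system alpha)
  (hext : forall x : pos_cone G, extendible (alpha x)).
Variable T : toeplitz_algebra alpha.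
Local Notation GP := (pos_cone G).
Local Notation op := (@ta_op R G A alpha T).
Local Notation P := (@ta_pi R G A alpha T).
Local Notation S := (@ta_shift R G A alpha T).
Local Notation one_at := (one_at hext).
Implicit Types (f g h : GP -> A) (s t : T) (x y r i : GP) (a b c : A).

Lemma op_l2 t f : l2_mem f -> l2_mem (op t f).
Proof. by move=> lf; have [h _ _] := ta_op_star t; exact: h. Qed.
Arguments op_l2 t {f} _.

Lemma opB s t f : l2_mem f -> op (s - t) f = op s f - op t f.
Proof. by move=> lf; rewrite ta_opD// -[- t]scaleN1r ta_opZ// scaleN1r. Qed.

(** [ta_op] is isometric, so identities in the abstract algebra can be checked on l2. *)
Lemma op_inj s t : (forall f, l2_mem f -> op s f = op t f) -> s = t.
Proof.
move=> h; apply/eqP; rewrite -subr_eq0 -normr_le0; apply/(ta_op_norm _ (lexx 0)) => f lf.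
by rewrite opB// h// subrr l2_normE l2n0 mul0r.
Qed.

Lemma op_bound t f : l2_mem f -> l2n (op t f) <= nr t * l2n f.
Proof.
move=> lf; have := (ta_op_norm t (normr_ge0 t)).1 (lexx _) f lf.
by rewrite !l2_normE nrE -realCM lecR.
Qed.

Lemma op_star t (Y : (GP -> A) -> GP -> A) f : l2_adjoint (op t) Y -> l2_mem f ->
  op (star t) f = Y f.
Proof. by move=> adj; apply: (l2_adjoint_unique (ta_op_star t) adj). Qed.

Lemma l2_adjoint_pi a : l2_adjoint (pi_alpha alpha a) (pi_alpha alpha (star a)).
Proof.
split=> [f lf|f lf|f g lf lg]; [exact: l2_pi_alpha|exact: l2_pi_alpha|].
exact: l2_dot_pi_alpha.
Qed.

Lemma l2_adjoint_ext X X' Y : (forall f, l2_mem f -> X f = X' f) ->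
  @l2_adjoint R G A X Y -> l2_adjoint X' Y.
Proof.
by move=> h [a b c]; split=> [f lf|//|f g lf lg]; rewrite -h//; [exact: a|exact: c].
Qed.

Lemma op_piM a t f : l2_mem f -> op (P a ** t) f = pi_alpha alpha a (op t f).
Proof. by move=> lf; rewrite ta_opM// ta_op_pi//; exact: op_l2. Qed.

Lemma op_mpi a t f : l2_mem f -> op (t ** P a) f = op t (pi_alpha alpha a f).
Proof. by move=> lf; rewrite ta_opM// ta_op_pi. Qed.

Lemma ta_pi_hom : star_hom P.
Proof.
split=> [a b|c a|a b|a]; apply: op_inj => f lf.
- rewrite ta_opD// !ta_op_pi//; apply/funext => i.
  by rewrite /pi_alpha (star_homD (ds_hom halpha i)) amulDl.
- rewrite ta_opZ// !ta_op_pi//; apply/funext => i.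
  by rewrite /pi_alpha (star_homZ (ds_hom halpha i)) amulZl.
- by rewrite op_piM// !ta_op_pi// pi_alphaM.
rewrite ta_op_pi// (@op_star _ (pi_alpha alpha (star a)))//.
by apply: l2_adjoint_ext (l2_adjoint_pi a) => g lg; rewrite ta_op_pi.
Qed.

Lemma op_Sstar x t f : l2_mem f -> op (ml (star (S x)) t) f = coshift x (op t f).
Proof.
move=> lf; apply: (@op_star _ (coshift x \o op t)) => //.
apply: (@l2_adjoint_ext (op (star t) \o shift x)).
  by move=> g lg; rewrite ta_op_shiftr.
by apply: l2_adjoint_comp; [exact/l2_adjoint_sym/ta_op_star|exact: l2_adjoint_shift].
Qed.

Lemma op_mSstar x t f : l2_mem f -> op (mr (star (S x)) t) f = op t (coshift x f).
Proof.
move=> lf; apply: (@op_star _ (op t \o coshift x)) => //.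
apply: (@l2_adjoint_ext (shift x \o op (star t))).
  by move=> g lg; rewrite ta_op_shiftl.
apply: l2_adjoint_comp; [exact: l2_adjoint_shift|exact/l2_adjoint_sym/ta_op_star].
Qed.

Definition tgen x a y : T := ml (S x) (mr (star (S y)) (P a)).

Lemma op_tgen x a y f : l2_mem f -> op (tgen x a y) f = gen alpha (x, a, y) f.
Proof.
by move=> lf; rewrite ta_op_shiftl// op_mSstar// ta_op_pi//; exact: l2_coshift.
Qed.

Lemma tgenD x a b y : tgen x (a + b) y = tgen x a y + tgen x b y.
Proof. by rewrite /tgen (star_homD ta_pi_hom) mrD mlD. Qed.

Lemma tgenB x a b y : tgen x (a - b) y = tgen x a y - tgen x b y.
Proof. by rewrite tgenD -[- b]scaleN1r /tgen (star_homZ ta_pi_hom) mrZ mlZ scaleN1r. Qed.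

Lemma nr_ml_shift x t : nr (ml (S x) t) <= nr t.
Proof.
rewrite -(@ler_pXn2r _ 2) ?nnegrE ?nr_ge0// -!nr_cstar.
suff -> : star (ml (S x) t) ** ml (S x) t = star t ** t by [].
have -> : star (ml (S x) t) ** ml (S x) t = star t ** ml (star (S x)) (ml (S x) t).
  by rewrite [RHS]ml_mr -[mr (star _) _]/(star (ml (S x) (star (star t)))) starK.
congr (_ ** _); apply: op_inj => f lf.
rewrite op_Sstar// ta_op_shiftl//; apply/funext => i; exact: shift_add.
Qed.

Lemma nr_tgen x a y : nr (tgen x a y) <= nr a.
Proof.
rewrite (le_trans (nr_ml_shift _ _))// -nr_star.
have -> : star (mr (star (S y)) (P a)) = ml (S y) (star (P a)) by exact: starK.
by rewrite (le_trans (nr_ml_shift _ _))// nr_star star_hom_contr//; exact: ta_pi_hom.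
Qed.

Lemma tgen_total : total_set [set t | exists x a y, t = tgen x a y].
Proof.
have := ta_span T; congr (total_set _); apply/seteqP; split=> t /=.
  move=> [x [a [y [Sy' [adj ht]]]]]; exists x, a, y; apply: op_inj => f lf.
  by rewrite op_tgen// ht// /gen /= (l2_adjoint_unique adj (@l2_adjoint_shift R G A y) lf).
move=> [x [a [y ->]]]; exists x, a, y, (@coshift R G A y); split; first exact: l2_adjoint_shift.
by move=> f lf; rewrite op_tgen.
Qed.

Lemma pi_tgen b x a y : P b ** tgen x a y = tgen x (alpha x b ** a) y.
Proof.
apply: op_inj => f lf; rewrite op_piM// !op_tgen// /gen /=.
by rewrite (pi_alpha_shift halpha) (pi_alphaM halpha).
Qed.

Lemma tgen_cvg x y (b : A -> A) a : b u @[u --> @au R A] --> a ->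
  tgen x (b u) y @[u --> @au R A] --> tgen x a y.
Proof.
move=> /cvg_nrP h; apply/cvg_nrP => e e0; apply: filterS (h _ e0) => u hu.
by rewrite -tgenB (le_trans (nr_tgen _ _ _)).
Qed.

Lemma pi_tgen_cvg x a y : P u ** tgen x a y @[u --> @au R A] --> tgen x (ml (one_at x) a) y.
Proof.
have h : tgen x (alpha x u ** a) y @[u --> @au R A] --> tgen x (ml (one_at x) a) y.
  by apply: tgen_cvg; exact: (@one_at_l _ _ _ _ hext x a).
by apply: cvg_ext h => u; rewrite pi_tgen.
Qed.

(** On a generator, pi(u) S_x pi(a) S_y^* = S_x pi(alpha_x(u) a) S_y^*, which converges because
    alpha_x is extendible. Contractivity carries convergence to the closed span. *)
Lemma pi_cvg t : exists s : T, P u ** t @[u --> @au R A] --> s.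
Proof.
have hM := hom_module ta_pi_hom.
move: t; apply: (total_ind tgen_total).
- exists 0; apply/cvg_nrP => e e0; apply: nearW => u.
  by rewrite amul0r subr0 nr0 ltW.
- move=> s t [s' hs] [t' ht]; exists (s' + t').
  have h : P u ** s + P u ** t @[u --> @au R A] --> s' + t' by exact: cvgD.
  by apply: cvg_ext h => u; rewrite amulDr.
- move=> c s [s' hs]; exists (c *: s').
  have h : c *: (P u ** s) @[u --> @au R A] --> c *: s' by exact: cvgZr.
  by apply: cvg_ext h => u; rewrite amulZr.
- move=> t ht; apply: nr_complete => e e0.
  have e4 : 0 < e / 4 by rewrite divr_gt0.
  have [s [s' hs] ts] := ht _ e4.
  have /cvg_nrP/(_ _ e4) hs' := hs.
  exists [set u | nr u <= 1 /\ nr (P u ** s - s') <= e / 4].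
    near=> u; split; last by near: u.
    by have [] : unitlike u by near: u; exact: au_unitlike.
  have small u : nr u <= 1 -> nr (P u ** t - P u ** s) <= e / 4.
    move=> u1; rewrite -amulBr (le_trans (nrM _ _))// (le_trans _ ts)//.
    by rewrite ler_piMl ?nr_ge0// (le_trans (star_hom_contr u ta_pi_hom)).
  move=> u v [u1 hu] [v1 hv]; have hu' := small u u1; have hv' := small v v1.
  have h1 := nr_dist_trans s' (P u ** t) (P v ** t).
  have h2 := nr_dist_trans (P u ** s) (P u ** t) s'.
  have h3 := nr_dist_trans (P v ** s) s' (P v ** t).
  have e1 := nr_distC s' (P v ** s); have e2 := nr_distC (P v ** s) (P v ** t).
  by lra.
by move=> _ [x [a [y ->]]]; exists (tgen x (ml (one_at x) a) y); exact: pi_tgen_cvg.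
Unshelve. all: by end_near. Qed.

Theorem ta_pi_extension : exists pibar, strict_extension P pibar.
Proof. exact: hom_strict_extension ta_pi_hom pi_cvg. Qed.

(** alpha_(x+y)(u) lies in the range of alpha_x, so the projections [one_at] decrease along the
    cone. *)
Lemma one_at_add x y b : ml (one_at x) (ml (one_at (pc_add x y)) b) = ml (one_at (pc_add x y)) b.
Proof.
have h := @one_at_l _ _ _ _ hext (pc_add x y) b.
apply/esym/(lim_uniq h); apply/cvg_nrP => e e0; have /cvg_nrP/(_ _ e0) := h.
apply: filterS => u hu; rewrite (ds_add halpha) in hu *.
rewrite -{1}(one_at_alpha halpha hext x (alpha y u)) -mlM.
rewrite -[- ml (one_at x) _]scaleN1r -mlZ -mlD scaleN1r.
by rewrite (le_trans _ hu)// -lecR -!nrE norm_mlp.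
Qed.

Lemma one_at_alpha_r x b : mr (one_at x) (alpha x b) = alpha x b.
Proof.
rewrite -[LHS]starK star_mrp -(star_hom_star (ds_hom halpha x)).
by rewrite (one_at_alpha halpha) (star_hom_star (ds_hom halpha x)) starK.
Qed.

Section Projection.
Variables (pibar : multiplier A -> multiplier T) (hpi : strict_extension P pibar).
Local Notation p := (unit_image hpi).

Lemma p_cvg t : P u ** t @[u --> @au R A] --> ml p t.
Proof. exact: strict_extension_l. Qed.

(** A coordinate is bounded by the operator norm times the norm of f, so the limit of pi(u) t can be
    read off at i. *)
Lemma op_p t f i : l2_mem f -> op (ml p t) f i = ml (one_at i) (op t f i).
Proof.
move=> lf; have h := @one_at_l _ _ _ _ hext i (op t f i).
apply/esym/(lim_uniq h); apply/cvg_nrP => e e0.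
have k0 : 0 < l2n f + 1 by rewrite ltr_wpDl ?l2n_ge0.
have hp : P u ** t @[u --> @au R A] --> ml p t by exact: p_cvg.
have /cvg_nrP/(_ _ (divr_gt0 e0 k0)) := hp; apply: filterS => u hu.
rewrite -[alpha i u ** _]/(pi_alpha alpha u (op t f) i) -op_piM//.
rewrite -[X in nr X]/((op (P u ** t) f - op (ml p t) f) i) -opB//.
rewrite (le_trans (nr_le_l2n i (op_l2 _ lf)))// (le_trans (op_bound _ lf))//.
rewrite (le_trans (ler_wpM2r (l2n_ge0 f) hu))// mulrAC -mulrA ler_piMr ?ltW//.
by rewrite ltr_pdivrMr// mul1r ltrDl.
Qed.

Lemma op_ext s t : (forall f i, l2_mem f -> op s f i = op t f i) -> s = t.
Proof. by move=> h; apply: op_inj => f lf; apply/funext => i; exact: h. Qed.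

(** At the coordinate i, S_x^* p involves [one_at] at i + x, which lies below [one_at i]. So pT is
    invariant under S_x^*, and w_x acts on it without compression; this is why the compressions
    still form a semigroup. *)
Lemma p_shift_star x t : ml p t = t -> ml p (ml (star (S x)) t) = ml (star (S x)) t.
Proof.
move=> <-; apply: op_ext => f i lf; rewrite op_p// op_Sstar// /coshift op_p//.
exact: one_at_add.
Qed.

Lemma pi_p a t : P a ** ml p t = P a ** t.
Proof.
apply: op_ext => f i lf; rewrite !op_piM// /pi_alpha op_p//.
by rewrite ml_mr one_at_alpha_r.
Qed.

Local Notation kA := (corner_map hpi).
Local Notation w := (fun x : GP => compress p (star (S x))).
Implicit Types (z : corner p).

Lemma val_w x z : val (ml (w x) z) = ml (star (S x)) (val z).
Proof.
rewrite -[LHS]/(ml p (ml (star (S x)) (ml p (val z)))) corner_ml.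
by apply: p_shift_star; exact: corner_ml.
Qed.

Lemma val_wstar x z : val (ml (star (w x)) z) = ml p (ml (S x) (val z)).
Proof.
rewrite -[LHS]/(star (mr p (mr (star (S x)) (mr p (star (val z)))))).
rewrite star_mrp -star_mlp corner_ml; congr (ml p _).
by rewrite -[mr (star (S x)) _]/(star (ml (S x) (star (star (val z))))) !starK.
Qed.

(** On pT, w_x is S_x^* and its adjoint is p S_x. The relations are checked one coordinate at a
    time, where the shifts are translations and p is multiplication by [one_at]. *)
Lemma corner_covariant : covariant_in alpha kA w.
Proof.
have hP := ta_pi_hom; split; last split.
- split=> [a b|c a|a b|a]; apply: val_inj.
  + exact: (star_homD hP).
  + exact: (star_homZ hP).
  + exact: (star_homM hP).
  + exact: (star_hom_star hP).
- apply/total_setP => z e e0.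
  have hp : P u ** val z @[u --> @au R A] --> ml p (val z) by exact: p_cvg.
  have /cvg_nrP/(_ _ e0)/filter_ex[u hu] := hp.
  exists (kA u ** z); first by apply: lin_span_incl; exists u, z.
  have -> : nr (z - kA u ** z) = nr (val z - P u ** val z) by [].
  by rewrite nr_distC -{2}[val z]corner_ml.
split.
- split=> [a b|c a|a b|a]; apply: multiplier_eq => z; apply: val_inj => /=.
  + by rewrite (star_homD hP) amulDl.
  + by rewrite (star_homZ hP) amulZl.
  + by rewrite (star_homM hP) amulA.
  + by rewrite (star_hom_star hP) starM starK.
- split=> [x|x y]; apply: multiplier_eq => z; apply: val_inj.
  + rewrite -[ml _ z]/(ml (w x) (ml (star (w x)) (ml (w x) z))) val_w val_wstar val_w.
    apply: op_ext => f i lf; rewrite !op_Sstar// /coshift op_p// ta_op_shiftl// shift_add.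
    rewrite op_Sstar// /coshift -[val z]corner_ml op_p//.
    by rewrite [pc_add i x]pc_addC mlpp.
  + rewrite -[ml _ z]/(ml (w x) (ml (w y) z)) !val_w.
    apply: op_ext => f i lf; rewrite !op_Sstar// /coshift -pc_addA.
    by [].
- move=> x a; apply: multiplier_eq => z; apply: val_inj.
  rewrite -[ml _ z in RHS]/(ml (w x) (kA a ** ml (star (w x)) z)) val_w.
  have -> : val (kA a ** ml (star (w x)) z : corner p) = P a ** ml (S x) (val z).
    by rewrite -[LHS]/(P a ** val (ml (star (w x)) z)) val_wstar pi_p.
  rewrite -[LHS]/(P (alpha x a) ** val z).
  apply: op_ext => f i lf; rewrite op_piM// op_Sstar// /coshift op_piM// /pi_alpha.
  by rewrite ta_op_shiftl// shift_add (ds_add halpha).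
move=> x a; apply: multiplier_eq => z; apply: val_inj.
rewrite -[ml _ z in LHS]/(ml (star (w x)) (ml (w x) (kA a ** z))) val_wstar val_w.
rewrite -[ml _ z in RHS]/(kA a ** ml (star (w x)) (ml (w x) z)).
rewrite -[RHS]/(P a ** val (ml (star (w x)) (ml (w x) z))) val_wstar val_w pi_p.
have -> : val (kA a ** z : corner p) = P a ** val z by [].
apply: op_ext => f i lf; rewrite op_p// ta_op_shiftl// op_piM// /pi_alpha ta_op_shiftl//.
rewrite !shiftE; case: ifP => xi; last by rewrite amul0r -(scale0r (0 : A)) mlZ !scale0r.
rewrite !op_Sstar// /coshift pc_diffK// op_piM// /pi_alpha mlM.
by rewrite (one_at_alpha halpha).
Qed.

Lemma val_corner_gen x a y :
  val (ml (star (w x)) (mr (w y) (kA a))) = ml p (mr p (tgen x a y)).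
Proof.
rewrite val_wstar -[val (mr (w y) (kA a))]/(mr p (mr (star (S y)) (mr p (P a)))).
have -> : mr p (P a) = P a by exact: (corner_mr (kA a)).
by rewrite [ml (S x) (mr p _)]mlmrC.
Qed.

Lemma corner_total :
  total_set [set b | exists x a y, b = ml (star (w x)) (mr (w y) (kA a))].
Proof.
apply/total_setP => z e e0; have /total_setP/(_ (val z) _ e0)[t ht zt] := tgen_total.
have [z' hz' zE] : exists2 z' : corner p,
    lin_span [set b | exists x a y, b = ml (star (w x)) (mr (w y) (kA a))] z' &
    val z' = ml p (mr p t).
  have := ht; apply: (@lin_span_ind _ _ _ (fun t => exists2 z' : corner p,
    lin_span [set b | exists x a y, b = ml (star (w x)) (mr (w y) (kA a))] z' &
    val z' = ml p (mr p t))).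
  - by exists 0; [exact: lin_span0|rewrite -(scale0r (0 : T)) mrZ mlZ scale0r].
  - move=> s s' [z1 h1 e1] [z2 h2 e2]; exists (z1 + z2); first exact: lin_spanD.
    by rewrite mrD mlD -e1 -e2.
  - move=> c s [z1 h1 e1]; exists (c *: z1); first exact: lin_spanZ.
    by rewrite mrZ mlZ -e1.
  move=> _ [x [a [y ->]]]; exists (ml (star (w x)) (mr (w y) (kA a))).
    by apply: lin_span_incl; exists x, a, y.
  exact: val_corner_gen.
exists z' => //; rewrite -[nr _]/(nr (val z - val z')) zE.
rewrite -{1}[val z]corner_ml -{1}[val z]corner_mr.
rewrite -[- ml p _]scaleN1r -mlZ -mrZ -mlD -mrD scaleN1r (le_trans _ zt)//.
by rewrite -lecR -!nrE (le_trans (norm_mlp _ _))// norm_mrp.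
Qed.

Lemma op_deltaB t r a b i : op t (delta r a) i - op t (delta r b) i = op t (delta r (a - b)) i.
Proof.
have la := @l2_delta R G A r a; have lb := @l2_delta R G A r b.
have := l2_adjoint_linear (ta_op_star t) (- 1) lb la.
have -> : -1 *: delta r b + delta r a = delta r (a - b).
  apply/funext => j; rewrite -[LHS]/(-1 *: delta r b j + delta r a j) /delta.
  by case: ifP => _; rewrite ?scaler0 ?addr0// scaleN1r addrC.
by move=> ->; rewrite -[RHS]/(-1 *: op t (delta r b) i + _) scaleN1r addrC.
Qed.

(** Right multiplication by p is computed on point masses, which is what matrix coefficients
    require. *)
Lemma op_mr_p t r a i : op (mr p t) (delta r a) i = op t (delta r (ml (one_at r) a)) i.
Proof.
have h := @one_at_l _ _ _ _ hext r a.
have h2 := @strict_extension_r _ _ _ _ _ hpi t.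
have pd u : pi_alpha alpha u (delta r a) = delta r (alpha r u ** a).
  by apply/funext => j; rewrite /pi_alpha /delta; case: eqP => [->//|_]; rewrite amul0r.
have h3 : op (t ** P u) (delta r a) i @[u --> @au R A] --> op (mr p t) (delta r a) i.
  apply/cvg_nrP => e e0; have k0 : 0 < nr a + 1 by rewrite ltr_wpDl ?nr_ge0.
  have /cvg_nrP/(_ _ (divr_gt0 e0 k0)) := h2; apply: filterS => u hu.
  have ld := @l2_delta R G A r a.
  rewrite -[X in nr X]/((op (t ** P u) (delta r a) - op (mr p t) (delta r a)) i) -opB//.
  rewrite (le_trans (nr_le_l2n i (op_l2 _ ld)))// (le_trans (op_bound _ ld))// l2n_delta.
  rewrite (le_trans (ler_wpM2r (nr_ge0 a) hu))// mulrAC -mulrA ler_piMr ?ltW//.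
  by rewrite ltr_pdivrMr// mul1r ltrDl.
apply: (lim_uniq h3); apply/cvg_nrP => e e0; have k0 : 0 < nr t + 1 by rewrite ltr_wpDl ?nr_ge0.
have /cvg_nrP/(_ _ (divr_gt0 e0 k0)) := h; apply: filterS => u hu.
rewrite op_mpi ?pd ?op_deltaB; last exact: l2_delta.
rewrite (le_trans (nr_le_l2n i (op_l2 _ (@l2_delta R G A r _))))//.
rewrite (le_trans (op_bound _ (@l2_delta R G A r _)))// l2n_delta.
rewrite (le_trans (ler_wpM2l (nr_ge0 t) hu))// mulrCA ler_piMr ?ltW//.
by rewrite ltr_pdivrMr// mul1r ltrDl.
Qed.

Lemma gen_delta (q : term G A) r a i : gen alpha q (delta r a) i =
  (if [&& val q.2 <= val r, val q.1.1 <= val i & val i - val q.1.1 == val r - val q.2]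
   then alpha (pc_diff r q.2) q.1.2 else 0) ** a.
Proof.
rewrite /gen shiftE; case: (boolP (val q.1.1 <= val i)) => [si|_]; last first.
  by rewrite andbF amul0l.
rewrite /pi_alpha /coshift /delta /=.
case: eqP => [e|ne].
  have ur : val q.2 <= val r by rewrite -e pc_addC pc_le_add.
  have -> : pc_diff r q.2 = pc_diff i q.1.1 by rewrite -e pc_add_diff.
  by rewrite ur -e /= pc_diffE// addrK eqxx.
rewrite ifF ?amul0r ?amul0l//; apply/negP => /andP[ur /eqP h]; apply: ne.
by apply: pc_inj; rewrite /= pc_diffE// h subrK.
Qed.

(** Applied to the point mass a at r and evaluated at i, the sum gives the coefficient C times a.
    Taking a = C^* isolates the norm of C by the C*-identity. *)
Lemma corner_coef l r i : nr (coef hext l r i) <= nr (evm kA w l).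
Proof.
have E a : op (val (evm kA w l)) (delta r a) i = coef hext l r i ** a.
  have ld := @l2_delta R G A r a.
  have -> : val (evm kA w l) = ml p (mr p (\sum_(q <- l) tgen q.1.1 q.1.2 q.2)).
    rewrite /evm; elim: l => [|q l IH].
      by rewrite !big_nil -(scale0r (0 : T)) mrZ mlZ scale0r.
    by rewrite !big_cons mrD mlD -IH -val_corner_gen.
  rewrite op_p// op_mr_p /coef -mlM -ml_mr; congr (ml _ _).
  move: (ml (one_at r) a) => b; rewrite [X in X ** b]big_mkcond /=.
  have lb := @l2_delta R G A r b.
  elim: l => [|q l IH].
    rewrite !big_nil; have -> : (0 : T) = 0 *: 0 by rewrite scale0r.
    by rewrite ta_opZ// -[LHS]/(0 *: _) !scale0r amul0l.
  rewrite !big_cons amulDl -IH ta_opD//.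
  rewrite -[LHS]/(op (tgen q.1.1 q.1.2 q.2) (delta r b) i + _); congr (_ + _).
  by rewrite op_tgen// -gen_delta; case: q => [[]].
set C := coef hext l r i in E *; have h := E (star C).
have [C0|C0] := eqVneq (nr C) 0; first by rewrite C0 nr_ge0.
have {}C0 : 0 < nr C by rewrite lt_neqAle eq_sym C0 nr_ge0.
rewrite -(ler_pM2r C0) -expr2 -nr_cstar' -h.
have ld := @l2_delta R G A r (star C).
rewrite (le_trans (nr_le_l2n i (op_l2 _ ld)))// (le_trans (op_bound _ ld))//.
by rewrite l2n_delta nr_star.
Qed.

(** S_x pi(u a) S_y^* is the product of S_x pi(u), p and pi(a) S_y^*, since p pi(a) = pi(a); and u a
    approximates a. *)
Lemma toeplitz_full : total_set [set t : T | exists s u : T, t = s ** ml p u].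
Proof.
apply: (total_set_trans tgen_total) => _ e [x [a [y ->]]] e0.
have /cvg_nrP/(_ _ e0)/filter_ex[u hu] := @au_l R A a.
exists (tgen x (u ** a) y); last first.
  by rewrite -tgenB (le_trans (nr_tgen _ _ _))// nr_distC.
apply: lin_span_incl; exists (ml (S x) (P u)), (mr (star (S y)) (P a)).
rewrite /tgen (star_homM ta_pi_hom) mrM mlM; congr (_ ** _).
by rewrite mlmrC -[P a]/(val (kA a)) corner_ml.
Qed.

Theorem corner_crossed_product : piso_crossed_product alpha kA w.
Proof.
exact: (piso_crossed_product_of_coef halpha corner_covariant corner_total corner_coef).
Qed.

End Projection.
End ToeplitzRelations.

Theorem proposition3p2 (R : realType) (G : ordGroupType) (A : cstarType R)
    (alpha : pos_cone G -> A -> A)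
    (halpha : dynamical_system alpha)
    (hext : forall x : pos_cone G, extendible (alpha x)) :
  inhabited (toeplitz_algebra alpha) /\
  forall T : toeplitz_algebra alpha,
    (exists pibar : multiplier A -> multiplier T,
       strict_extension (@ta_pi R G A alpha T) pibar) /\
    forall (pibar : multiplier A -> multiplier T)
      (hpi : strict_extension (@ta_pi R G A alpha T) pibar),
      let p := unit_image hpi in
      let kA : A -> corner p := corner_map hpi in
      let w : pos_cone G -> multiplier (corner p) :=
        fun x => compress p (star (ta_shift T x)) in
      piso_crossed_product alpha kA w /\
      forall (B : cstarType R) (iA : A -> B) (v : pos_cone G -> multiplier B),
        piso_crossed_product alpha iA v ->
        (exists! psi : B -> corner p, integrated_form iA v kA w psi) /\
        (forall psi : B -> corner p,
           integrated_form iA v kA w psi -> bijective psi) /\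
        morita_equivalent B T.
Proof.
split; first exact: toeplitz_algebra_exists.
move=> T; split; first exact: ta_pi_extension.
move=> pibar hpi p kA w; have hC : piso_crossed_product alpha kA w.
  exact: corner_crossed_product.
split=> // B iA v hB.
have [psi [chi [hpsi hchi psiK chiK]]] := integrated_form_exists halpha hext hB hC.
have unique psi' : integrated_form iA v kA w psi' -> psi = psi'.
  exact: (integrated_form_unique hB hpsi).
split; first by exists psi.
split; first by move=> psi' /unique <-; exists chi.
apply: (morita_corner (if_hom hpsi) hchi psiK chiK).
exact: toeplitz_full.
Qed.
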